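(* Let $\alpha>0$, $1<p<5$, and $\omega>\frac{\alpha^2}{N^2}$. Let $\mathbf{\Phi}_{\alpha,\delta}=(\varphi_{\alpha,\delta})_{j=1}^N$ be the $N$-bump profile all of whose components equal $$\varphi_{\alpha,\delta}(x)=\Big[\tfrac{(p+1)\omega}{2}\operatorname{sech}^2\Big(\tfrac{(p-1)\sqrt{\omega}}{2}x+\tanh^{-1}\Big(\tfrac{-\alpha}{N\sqrt{\omega}}\Big)\Big)\Big]^{\frac{1}{p-1}},\quad x>0.$$ Consider the NLS-$\delta$ equation $i\partial_t\mathbf{U}-\mathbf{H}_\alpha^\delta\mathbf{U}+|\mathbf{U}|^{p-1}\mathbf{U}=0$ on the star graph $\mathcal{G}$ with $N$ edges. Then: (i) If $1<p\le 3$, then the standing wave $e^{i\omega t}\mathbf{\Phi}_{\alpha,\delta}$ is orbitally unstable in $\mathcal{E}(\mathcal{G})$. (ii) If $3<p<5$, then there exists $\omega_2>\frac{\alpha^2}{N^2}$ such that $e^{i\omega t}\mathbf{\Phi}_{\alpha,\delta}$ is orbitally unstable in $\mathcal{E}(\mathcal{G})$ for $\omega>\omega_2$.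
   Context: $\mathcal{G}$ is the star graph consisting of $N\ge 2$ half-lines $(0,\infty)$ attached to a common vertex $\nu=0$. A function on $\mathcal G$ is a vector $\mathbf V=(v_j)_{j=1}^N$ of functions on $\mathbb{R}_+$. $L^2(\mathcal{G})=\bigoplus_{j=1}^N L^2(\mathbb{R}_+)$, $H^s(\mathcal{G})=\bigoplus_{j=1}^N H^s(\mathbb{R}_+)$ ($s=1,2$), and $\mathcal{E}(\mathcal{G})=\{\mathbf V\in H^1(\mathcal{G}): v_1(0)=\dots=v_N(0)\}$ with the $H^1(\mathcal G)$ norm; $\mathcal E'(\mathcal G)$ is its dual. $\mathbf{H}_\alpha^\delta$ is the self-adjoint operator on $L^2(\mathcal{G})$ acting as $(\mathbf{H}_\alpha^\delta\mathbf V)(x)=(-v_j''(x))_{j=1}^N$ for $x>0$ on the domain $\{\mathbf V\in H^2(\mathcal{G}): v_1(0)=\dots=v_N(0),\ \sum_{j=1}^N v_j'(0)=\alpha v_1(0)\}$. The nonlinearity acts componentwise: $(|\mathbf U|^{p-1}\mathbf U)_j=|u_j|^{p-1}u_j$. Solutions of the Cauchy problem with $\mathbf U(0)=\mathbf U_0\in\mathcal E(\mathcal G)$ are understood in $C([-T,T],\mathcal E(\mathcal G))\cap C^1([-T,T],\mathcal E'(\mathcal G))$. A standing wave $e^{i\omega t}\mathbf\Phi(x)$ is orbitally stable in a Banach space $X$ if for every $\varepsilon>0$ there is $\eta>0$ such that whenever $\mathbf U_0\in X$ satisfies $\|\mathbf U_0-\mathbf\Phi\|_X<\eta$, the solution $\mathbf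 U(t)$ with $\mathbf U(0)=\mathbf U_0$ exists for all $t\in\mathbb R$ and $\sup_{t\in\mathbb R}\inf_{\theta\in\mathbb R}\|\mathbf U(t)-e^{i\theta}\mathbf\Phi\|_X<\varepsilon$. Otherwise it is orbitally unstable in $X$. *)

(* Defs.v *)
From HB Require Import structures.
From mathcomp Require Import all_boot all_order all_algebra.
From mathcomp Require Import complex.
From mathcomp Require Import all_classical all_reals all_analysis.

Set Implicit Arguments.
Unset Strict Implicit.
Unset Printing Implicit Defensive.

Import Order.TTheory GRing.Theory Num.Theory.
Import numFieldNormedType.Exports.

Local Open Scope classical_set_scope.
Local Open Scope complex_scope.
Local Open Scope ring_scope.

(* Complex-valued functions on a half-line are total functions R -> R[i] of
   which only the values on [0, +oo) are ever used. *)

Section half_line.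
Context {R : realType}.
Implicit Types (f v w : R -> R[i]) (phi : R -> R).

Definition modulus (z : R[i]) : R := Normc.normc z.

Definition half_line : set R := `]0, +oo[.

Definition cintegral f : R[i] :=
  (\int[lebesgue_measure]_(x in half_line) complex.Re (f x)) +i*
  (\int[lebesgue_measure]_(x in half_line) complex.Im (f x)).

Definition in_L2 f : Prop :=
  [/\ measurable_fun half_line (fun x => complex.Re (f x)),
      measurable_fun half_line (fun x => complex.Im (f x)) &
      (\int[lebesgue_measure]_(x in half_line) ((modulus (f x)) ^+ 2)%:E
         < +oo)%E].

Definition L2normsq f : R :=
  \int[lebesgue_measure]_(x in half_line) ((modulus (f x)) ^+ 2).

Definition test_function phi : Prop :=
  (forall n x, derivable (derive1n n phi) x 1) /\
  (exists a b, 0 < a /\ forall x, x \notin `[a, b] -> phi x = 0).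

Definition is_weak_deriv v w : Prop :=
  forall phi, test_function phi ->
    cintegral (fun x => v x * (derive1 phi x)%:C) =
    - cintegral (fun x => w x * (phi x)%:C).

(* An element of H^1(R_+) is given by its continuous representative on
   [0, +oo), so that its trace at the vertex is v 0. *)
Definition in_H1 v : Prop :=
  [/\ in_L2 v,
      exists w, in_L2 w /\ is_weak_deriv v w,
      {within `[0, +oo[, continuous (fun x => complex.Re (v x))} &
      {within `[0, +oo[, continuous (fun x => complex.Im (v x))}].

Definition in_H2 v : Prop :=
  in_H1 v /\ exists w, in_H1 w /\ is_weak_deriv v w.

(* The weak derivative in L^2, chosen arbitrarily in its a.e. class. *)
Definition weak_deriv v : R -> R[i] :=
  xget (fun _ => 0) [set w | in_L2 w /\ is_weak_deriv v w].

End half_line.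

Section star_graph.
Context {R : realType} {N : nat}.

Definition graph_fun := 'I_N -> R -> R[i].

Implicit Types (U V W : graph_fun) (F : graph_fun -> R[i]).

Definition continuous_at_vertex V : Prop := forall i j, V i 0 = V j 0.

Definition in_E V : Prop := (forall j, in_H1 (V j)) /\ continuous_at_vertex V.

Definition normE V : R :=
  Num.sqrt (\sum_(j < N) (L2normsq (V j) + L2normsq (weak_deriv (V j)))).

Definition gsub V W : graph_fun := fun j x => V j x - W j x.

Definition gscale (c : R[i]) V : graph_fun := fun j x => c * V j x.

Definition inner_L2 V W : R[i] :=
  \sum_(j < N) cintegral (fun x => V j x * (W j x)^*).

(* The dual E' of E is the space of bounded antilinear functionals, into which
   V in L^2 is embedded as inner_L2 V (Gelfand triple). Functionals are total
   on graph_fun and only matter on E. *)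
Definition in_E' F : Prop :=
  (forall (c : R[i]) V W, in_E V -> in_E W ->
     F (fun j x => c * V j x + W j x) = c^* * F V + F W) /\
  (exists M : R, forall W, in_E W -> modulus (F W) <= M * normE W).

Definition normE' F : \bar R :=
  ereal_sup [set (modulus (F W))%:E | W in [set W | in_E W /\ normE W <= 1]].

(* The one-sided derivatives at the vertex are the traces of the continuous
   representatives V' j of the weak derivatives of V j. *)
Definition dom_Hdelta (alpha : R) V : Prop :=
  [/\ forall j, in_H2 (V j),
      continuous_at_vertex V &
      exists V' : graph_fun,
        (forall j, in_H1 (V' j) /\ is_weak_deriv (V j) (V' j)) /\
        (forall k, \sum_(j < N) V' j 0 = alpha%:C * V k 0)].

Definition Hdelta V : graph_fun :=
  fun j x => - weak_deriv (weak_deriv (V j)) x.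

(* F is the image of U in E under the bounded extension E -> E' of the
   self-adjoint operator Hdelta; F is unique on E because the domain of the
   operator is dense in E. *)
Definition is_Hdelta_ext (alpha : R) U F : Prop :=
  in_E' F /\ forall W, dom_Hdelta alpha W -> F W = inner_L2 U (Hdelta W).

Definition nonlinearity (p : R) U : graph_fun :=
  fun j x => (modulus (U j x) `^ (p - 1))%:C * U j x.

Definition continuous_in_E (T : R) (U : R -> graph_fun) : Prop :=
  forall t, t \in `[- T, T] ->
    normE (gsub (U s) (U t)) @[s --> within `[- T, T] (nbhs t)] --> (0 : R).

Definition continuous_in_E' (T : R) (D : R -> graph_fun -> R[i]) : Prop :=
  forall t, t \in `[- T, T] ->
    normE' (fun W => D s W - D t W) @[s --> within `[- T, T] (nbhs t)]
      --> (0 : \bar R)%E.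

(* D is the time derivative of U on [-T, T] in the norm of E'. *)
Definition has_deriv_in_E' (T : R) (U : R -> graph_fun)
    (D : R -> graph_fun -> R[i]) : Prop :=
  forall t, t \in `[- T, T] ->
    normE' (fun W =>
        ((s - t)^-1)%:C * (inner_L2 (U s) W - inner_L2 (U t) W) - D t W)
      @[s --> within `[- T, T] t^'] --> (0 : \bar R)%E.

Definition NLS_solution (alpha p T : R) (U : R -> graph_fun) : Prop :=
  [/\ forall t, t \in `[- T, T] -> in_E (U t),
      continuous_in_E T U &
      exists D : R -> graph_fun -> R[i],
        [/\ forall t, t \in `[- T, T] -> in_E' (D t),
            continuous_in_E' T D,
            has_deriv_in_E' T U D &
            forall t, t \in `[- T, T] ->
              exists HU, is_Hdelta_ext alpha (U t) HU /\
                forall W, in_E W ->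
                  ('i)%C * D t W - HU W + inner_L2 (nonlinearity p (U t)) W = 0]].

Definition expi (theta : R) : R[i] := cos theta +i* sin theta.

Definition orbital_dist (Phi : graph_fun) (U : R -> graph_fun) : \bar R :=
  ereal_sup (range (fun t : R =>
    ereal_inf (range (fun theta : R =>
      (normE (gsub (U t) (gscale (expi theta) Phi)))%:E)))).

Definition orbitally_stable (alpha p : R) (Phi : graph_fun) : Prop :=
  forall eps : R, 0 < eps ->
    exists eta : R, 0 < eta /\
      forall U0, in_E U0 -> normE (gsub U0 Phi) < eta ->
        exists U : R -> graph_fun,
          [/\ forall j x, 0 <= x -> U 0 j x = U0 j x,
              forall T, 0 < T -> NLS_solution alpha p T U &
              (orbital_dist Phi U < eps%:E)%E].

Definition orbitally_unstable (alpha p : R) (Phi : graph_fun) : Prop :=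
  ~ orbitally_stable alpha p Phi.

End star_graph.

Arguments graph_fun : clear implicits.

Section profile.
Context {R : realType}.

Definition sech (x : R) : R := 2 / (expR x + expR (- x)).

Definition artanh (y : R) : R := ln ((1 + y) / (1 - y)) / 2.

Definition bump_profile (N : nat) (alpha p omega x : R) : R :=
  ((p + 1) * omega / 2 *
   sech ((p - 1) * Num.sqrt omega / 2 * x +
         artanh (- alpha / (N%:R * Num.sqrt omega))) ^+ 2) `^ (p - 1)^-1.

Definition Phi_delta (N : nat) (alpha p omega : R) : graph_fun R N :=
  fun _ x => (bump_profile N alpha p omega x)%:C.

End profile.

Arguments bump_profile {R} N alpha p omega x : assert.
Arguments Phi_delta {R} N alpha p omega _ _ : assert.

(* Main.v *)
(** Write [U = a + i b] near the orbit of the ground state. On graph functions that are opposite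
on two edges and vanish on the others, the linearization has the generators [L1] and [L2], where
the vertex condition becomes a Dirichlet condition. Since the profile increases near the vertex,
[L1] is still negative in some direction there, while [L2] is positive, so the linearized
flow has an exponentially growing solution. The difference of the solution along the two edges,
rotated by the phase of its symmetric part, solves this linear flow up to an error that is
relatively small in [L^2] as long as the solution stays near the orbit; a suitable initial datum
therefore makes it grow without bound, which contradicts orbital stability for all [p > 1]. *)

From HB Require Import structures.
Require Import Defs.
From mathcomp Require Import all_boot all_order all_algebra.
From mathcomp Require Import complex ring lra.
From mathcomp Require Import all_classical all_reals all_analysis measurable_realfun.
Import Order.TTheory GRing.Theory Num.Theory.
Import numFieldNormedType.Exports.
Set Implicit Arguments.
Unset Strict Implicit.
Unset Printing Implicit Defensive.
Local Open Scope classical_set_scope.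
Local Open Scope ring_scope.

(** * Positive semidefinite bilinear forms and their seminorms *)

Section psd_forms.
Context {R : realType} {V : lmodType R}.

(** The error is small only relative to the difference itself and only in [L^2], while the quadratic
    energy conserved by the linear flow is controlled in [H^1]. The system is therefore integrated
    once in time: primitives [A], [B] of [a], [b] lie in the domain of [L2], their energy is bounded
    through the [L^2] size of the forcing, and a second quadratic quantity, corrected by a
    first-order form so that no derivative is lost, leads back to the [L^2] norms of [a] and [b].
    Let [F] be the supremum of these norms divided by [e^(lam t / 2)], where [lam] is the rate of
    the growing mode; it is finite since a solution near the orbit stays bounded. For a small error
    size [tau] the energy bounds [F] independently of [tau], whereas the projection on the growing
    mode, slaved to the forcing yet of fixed size at time 0, forces [F] to be at least of order
    [1 / tau]. The underlying space of continuous functions is not complete, so the growing mode is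
    only an approximate eigenvector, and spectral facts are expressed through the inverse [G] of
    [L2], which is explicit because [phi] itself solves [L2 phi = 0]. *)

Record psd_form (b : V -> V -> R) : Prop := PsdForm {
  psdC : forall u v, b u v = b v u;
  psdDl : forall u v w, b (u + v) w = b u w + b v w;
  psdZl : forall k u v, b (k *: u) v = k * b u v;
  psd_ge0 : forall u, 0 <= b u u }.

Variables (b : V -> V -> R) (hb : psd_form b).

Lemma psdDr u v w : b u (v + w) = b u v + b u w.
Proof. by rewrite (psdC hb) (psdDl hb) !(psdC hb u). Qed.

Lemma psdZr k u v : b u (k *: v) = k * b u v.
Proof. by rewrite (psdC hb) (psdZl hb) (psdC hb u). Qed.

Lemma psdNl u v : b (- u) v = - b u v.
Proof. by rewrite -scaleN1r (psdZl hb) mulN1r. Qed.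

Lemma psdNr u v : b u (- v) = - b u v.
Proof. by rewrite (psdC hb) psdNl (psdC hb u). Qed.

Lemma psdBl u v w : b (u - v) w = b u w - b v w.
Proof. by rewrite (psdDl hb) psdNl. Qed.

Lemma psdBr u v w : b u (v - w) = b u v - b u w.
Proof. by rewrite psdDr psdNr. Qed.

Lemma psd0l v : b 0 v = 0.
Proof. by rewrite -(scale0r (0 : V)) (psdZl hb) mul0r. Qed.

Definition psdE := (psdDl hb, psdDr, psdZl hb, psdZr, psdNl, psdNr).

Lemma psd_CS u v : b u v ^+ 2 <= b u u * b v v.
Proof.
have H k : 0 <= b u u + 2 * k * b u v + k ^+ 2 * b v v.
  have := psd_ge0 hb (u + k *: v).
  by rewrite !psdE (psdC hb v u); congr (0 <= _); ring.
have u0 := psd_ge0 hb u; have v0 := psd_ge0 hb v.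
have [bv|bv] := eqVneq (b v v) 0.
  have [->|buv] := eqVneq (b u v) 0; first by rewrite bv mulr0 expr0n.
  have := H (- (b u u + 1) / (2 * b u v)); rewrite bv mulr0 addr0.
  have -> : 2 * (- (b u u + 1) / (2 * b u v)) * b u v = - (b u u + 1) by field.
  by move=> ?; lra.
have {}v0 : 0 < b v v by rewrite lt_def bv.
have := H (- b u v / b v v).
have -> : b u u + 2 * (- b u v / b v v) * b u v + (- b u v / b v v) ^+ 2 * b v v
   = (b u u * b v v - b u v ^+ 2) / b v v by field.
by rewrite pmulr_lge0 ?invr_gt0// subr_ge0.
Qed.

Definition psd_norm u := Num.sqrt (b u u).
Local Notation nm := psd_norm.

Lemma nm_ge0 u : 0 <= nm u. Proof. exact: sqrtr_ge0. Qed.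

Lemma nm_sqr u : nm u ^+ 2 = b u u.
Proof. by rewrite sqr_sqrtr// (psd_ge0 hb). Qed.

Lemma psd_CS_nm u v : `|b u v| <= nm u * nm v.
Proof.
rewrite -(@ler_pXn2r _ 2)// ?nnegrE ?mulr_ge0 ?nm_ge0//.
by rewrite real_normK ?num_real// exprMn !nm_sqr psd_CS.
Qed.

Lemma nmD u v : nm (u + v) <= nm u + nm v.
Proof.
rewrite -(@ler_pXn2r _ 2)// ?nnegrE ?addr_ge0 ?nm_ge0//.
rewrite sqrrD !nm_sqr !psdE (psdC hb v u).
have := psd_CS_nm u v; have := ler_norm (b u v); lra.
Qed.

Lemma nmZ k u : nm (k *: u) = `|k| * nm u.
Proof. by rewrite /nm !psdE mulrA -expr2 sqrtrM ?sqr_ge0// sqrtr_sqr. Qed.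

Lemma nmN u : nm (- u) = nm u.
Proof. by rewrite -scaleN1r nmZ normrN1 mul1r. Qed.

Lemma nmB u v : nm (u - v) <= nm u + nm v.
Proof. by rewrite -(nmN v) nmD. Qed.

Lemma nm0 : nm 0 = 0.
Proof. by rewrite -(scale0r (0 : V)) nmZ normr0 mul0r. Qed.

Lemma nm_le (c : R) u : 0 <= c -> b u u <= c ^+ 2 -> nm u <= c.
Proof. by move=> c0 h; rewrite -(@ler_pXn2r _ 2)// ?nnegrE ?nm_ge0// nm_sqr. Qed.

Lemma le_nm (c : R) u : nm u <= c -> b u u <= c ^+ 2.
Proof. by move=> h; rewrite -nm_sqr lerXn2r// ?nnegrE ?nm_ge0// (le_trans (nm_ge0 u)). Qed.

End psd_forms.

(** * Derivatives of real functions through first-order expansions *)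

Section scalar_derivative.
Context {R : realType}.
Implicit Types (f g : R -> R) (t l x y k a b c : R).

(** Little-o form of the derivative. It avoids quotients and is the way in which derivatives
    obtained from estimates are established later. *)
Lemma is_derive_eps f t l :
  (forall e, 0 < e -> exists2 d, 0 < d & forall s, `|s - t| < d ->
     `|f s - f t - (s - t) * l| <= e * `|s - t|) -> is_derive t 1 f l.
Proof.
move=> H.
have L : h^-1 *: (f (h *: (1 : R) + t) - f t) @[h --> 0^'] --> l.
  apply/cvgrPdist_le => e e0; have [d d0 {}H] := H e e0.
  near=> h.
  have h0 : h != 0 by near: h; exact: nbhs_dnbhs_neq.
  have hd : `|h| < d by near: h; exact: dnbhs0_lt.
  have := H (h + t); rewrite addrK => /(_ hd) Hh.
  rewrite distrC -(ler_pM2l (x := `|h|)) ?normr_gt0// -normrM (mulrC _ e).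
  apply: le_trans Hh; rewrite le_eqVlt; apply/orP; left; apply/eqP; congr (`|_|).
  by rewrite /GRing.scale /= mulr1 mulrBr mulVKf.
split; first by apply/cvg_ex; exists l.
exact: (cvg_lim _ L).
Unshelve. all: by end_near. Qed.

Lemma is_derive_eps_inv f t l : is_derive t 1 f l ->
  forall e, 0 < e -> exists2 d, 0 < d & forall s, `|s - t| < d ->
     `|f s - f t - (s - t) * l| <= e * `|s - t|.
Proof.
move=> [df Df] e e0.
have : h^-1 *: (f (h *: (1 : R) + t) - f t) @[h --> 0^'] --> l.
  by rewrite -Df; exact: df.
move=> /cvgrPdist_le /(_ e e0)[d /= d0 H].
exists d => // s st; have [->|/negP st0] := eqVneq s t.
  by rewrite !subrr mul0r subr0 normr0 mulr0.
have h0 : s - t != 0 by rewrite subr_eq0; exact/negP.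
have := H (s - t); rewrite /ball_ /= sub0r normrN => /(_ st h0) Hh.
have -> : f s - f t - (s - t) * l = (s - t) * ((s - t)^-1 * (f s - f t) - l).
  by rewrite mulrBr mulVKf.
rewrite normrM mulrC ler_pM2r ?normr_gt0// distrC (le_trans _ Hh)//.
by rewrite /GRing.scale /= mulr1 subrK.
Qed.

Lemma is_derive_continuous f t l : is_derive t 1 f l -> {for t, continuous f}.
Proof. by move=> [df _]; apply/differentiable_continuous/derivable1_diffP. Qed.

(** Mean value theorem for [g - f]. It replaces the integration of differential inequalities
    throughout, so that derivatives need not be integrable or continuous. *)
Lemma increment_le f g f' g' x y : x <= y ->
  (forall t, x <= t <= y -> is_derive t 1 f (f' t)) ->
  (forall t, x <= t <= y -> is_derive t 1 g (g' t)) ->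
  (forall t, x <= t <= y -> f' t <= g' t) -> f y - f x <= g y - g x.
Proof.
move=> xy hf hg h.
have hd t : x <= t <= y -> is_derive t 1 (g - f) (g' t - f' t).
  by move=> txy; have ? := hf _ txy; have ? := hg _ txy; apply: is_deriveB.
have [] := @MVT_segment R (g - f) (fun t => g' t - f' t) x y xy.
- by move=> t; rewrite in_itv/= => /andP[a b]; apply: hd; rewrite !ltW.
- apply: derivable_within_continuous => t; rewrite in_itv/= => txy.
  by case: (hd t txy).
move=> c; rewrite in_itv/= => cxy e.
suff : 0 <= (g' c - f' c) * (y - x).
  by rewrite -e !fctE; lra.
by apply: mulr_ge0; rewrite subr_ge0// h.
Qed.

Lemma derD f g t a b : is_derive t 1 f a -> is_derive t 1 g b ->
  is_derive t 1 (fun s => f s + g s) (a + b).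
Proof. exact: is_deriveD. Qed.

Lemma derN f t a : is_derive t 1 f a -> is_derive t 1 (fun s => - f s) (- a).
Proof. exact: is_deriveN. Qed.

Lemma derB f g t a b : is_derive t 1 f a -> is_derive t 1 g b ->
  is_derive t 1 (fun s => f s - g s) (a - b).
Proof. exact: is_deriveB. Qed.

Lemma derM f g t a b : is_derive t 1 f a -> is_derive t 1 g b ->
  is_derive t 1 (fun s => f s * g s) (a * g t + f t * b).
Proof. by move=> hf hg; rewrite addrC (mulrC a); exact: is_deriveM. Qed.

Lemma derZ k f t a : is_derive t 1 f a -> is_derive t 1 (fun s => k * f s) (k * a).
Proof. exact: is_deriveZ. Qed.

Lemma der_lin k t : is_derive t 1 (fun s => k * s) k.
Proof. by have := derZ k (is_derive_id t 1); rewrite mulr1. Qed.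

Lemma der_eq f t a b : is_derive t 1 f a -> a = b -> is_derive t 1 f b.
Proof. by move=> ? <-. Qed.

Lemma is_derive_expRM c t :
  is_derive t 1 (fun s => expR (c * s)) (c * expR (c * t)).
Proof.
by rewrite mulrC; exact: (is_derive1_comp (is_derive_expR _) (der_lin c t)).
Qed.

End scalar_derivative.

(** * Calculus of curves in a space with a semi-inner product *)

Section vector_calculus.
Context {R : realType} {V : lmodType R} {ip : V -> V -> R} (hb : psd_form ip).
Local Notation nm := (psd_norm ip).
Implicit Types (s t : R).

(** Strong derivative in the seminorm of [ip]; it is spelled out with epsilons because [V] is a bare
    module whose only topology comes from the form. *)
Definition vder (u : R -> V) t (u' : V) : Prop := forall e, 0 < e ->
  exists2 d, 0 < d & forall s, `|s - t| < d ->
    nm (u s - u t - (s - t) *: u') <= e * `|s - t|.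

Definition vcont (u : R -> V) t : Prop := forall e, 0 < e ->
  exists2 d, 0 < d & forall s, `|s - t| < d -> nm (u s - u t) <= e.

Lemma vder_lip u t u' : vder u t u' -> exists2 d, 0 < d &
  forall s, `|s - t| < d -> nm (u s - u t) <= (nm u' + 1) * `|s - t|.
Proof.
move=> /(_ 1 ltr01)[d d0 H]; exists d => // s st.
rewrite -(subrK ((s - t) *: u') (u s - u t)) (le_trans (nmD hb _ _))//.
by rewrite (nmZ hb); have := H s st; lra.
Qed.

Lemma vder_vcont u t u' : vder u t u' -> vcont u t.
Proof.
move=> /vder_lip[d d0 H] e e0.
have n0 : 0 < nm u' + 1 by have := nm_ge0 ip u'; lra.
exists (Num.min d (e / (nm u' + 1))); first by rewrite lt_min d0 divr_gt0.
move=> s; rewrite lt_min => /andP[st se].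
by rewrite (le_trans (H s st))// mulrC -ler_pdivlMr// ltW.
Qed.

Lemma vder_cst (x : V) t : vder (fun=> x) t 0.
Proof.
move=> e e0; exists 1 => // s _.
by rewrite subrr scaler0 subrr (nm0 hb) mulr_ge0// ltW.
Qed.

Lemma vderD u v t u' v' : vder u t u' -> vder v t v' ->
  vder (fun s => u s + v s) t (u' + v').
Proof.
move=> hu hv e e0; have e2 : 0 < e / 2 by rewrite divr_gt0.
have [d d0 {}hu] := hu _ e2; have [d' d'0 {}hv] := hv _ e2.
exists (Num.min d d'); first by rewrite lt_min d0.
move=> s; rewrite lt_min => /andP[/hu h1 /hv h2].
have -> : u s + v s - (u t + v t) - (s - t) *: (u' + v') =
  (u s - u t - (s - t) *: u') + (v s - v t - (s - t) *: v').
  by rewrite scalerDr !opprD (addrACA (u s) (v s)) (addrACA (u s - u t)).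
rewrite (le_trans (nmD hb _ _))//.
have -> : e = e / 2 + e / 2 by field.
by rewrite mulrDl lerD.
Qed.

Lemma vder_map (T : {linear V -> V}) (c : R) u t u' :
  (forall x, nm (T x) <= c * nm x) -> vder u t u' -> vder (fun s => T (u s)) t (T u').
Proof.
move=> hT hu e e0.
have c0 : 0 < `|c| + 1 by have := normr_ge0 c; lra.
have [|d d0 {}hu] := hu (e / (`|c| + 1)); first by rewrite divr_gt0.
exists d => // s /hu h; rewrite -!linearB -linearZ -linearB (le_trans (hT _))//.
apply: (@le_trans _ _ ((`|c| + 1) * (e / (`|c| + 1) * `|s - t|))); last first.
  by rewrite le_eqVlt; apply/orP; left; apply/eqP; field; rewrite gt_eqF.
apply: (@le_trans _ _ ((`|c| + 1) * nm (u s - u t - (s - t) *: u'))).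
  by rewrite ler_wpM2r ?nm_ge0//; have := ler_norm c; lra.
by rewrite ler_wpM2l// ltW.
Qed.

Lemma vderZ (k : R) u t u' : vder u t u' -> vder (fun s => k *: u s) t (k *: u').
Proof.
apply: (vder_map (T := ( *:%R k : {linear V -> V})) (c := `|k|)) => x.
by rewrite (nmZ hb).
Qed.

Lemma vderN u t u' : vder u t u' -> vder (fun s => - u s) t (- u').
Proof.
move=> /(vderZ (-1)); rewrite scaleN1r.
by rewrite (_ : (fun s => -1 *: u s) = (fun s => - u s))//; apply/funext => s; rewrite scaleN1r.
Qed.

Lemma vderB u v t u' v' : vder u t u' -> vder v t v' ->
  vder (fun s => u s - v s) t (u' - v').
Proof. by move=> hu hv; apply: (vderD hu (vderN hv)). Qed.

Lemma vder_shift u t k u' : vder u (t + k) u' -> vder (fun s => u (s + k)) t u'.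
Proof.
move=> H e /H[d d0 {}H]; exists d => // s st.
have := H (s + k); rewrite (_ : s + k - (t + k) = s - t); last by ring.
exact.
Qed.

Lemma vder_line (x : V) t : vder (fun s => s *: x) t x.
Proof.
move=> e e0; exists 1 => // s _.
by rewrite scalerBl subrr (nm0 hb) mulr_ge0// ltW.
Qed.

Lemma vcontD u v t : vcont u t -> vcont v t -> vcont (fun s => u s + v s) t.
Proof.
move=> hu hv e e0; have e2 : 0 < e / 2 by rewrite divr_gt0.
have [d d0 {}hu] := hu _ e2; have [d' d'0 {}hv] := hv _ e2.
exists (Num.min d d'); first by rewrite lt_min d0.
move=> s; rewrite lt_min => /andP[/hu h1 /hv h2].
rewrite opprD addrACA.
rewrite (le_trans (nmD hb _ _))//; lra.
Qed.

Lemma vcont_map (T : {linear V -> V}) (c : R) u t :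
  (forall x, nm (T x) <= c * nm x) -> vcont u t -> vcont (fun s => T (u s)) t.
Proof.
move=> hT hu e e0.
have c0 : 0 < `|c| + 1 by have := normr_ge0 c; lra.
have [|d d0 {}hu] := hu (e / (`|c| + 1)); first by rewrite divr_gt0.
exists d => // s /hu h; rewrite -linearB (le_trans (hT _))//.
apply: (@le_trans _ _ ((`|c| + 1) * nm (u s - u t))).
  by rewrite ler_wpM2r ?nm_ge0//; have := ler_norm c; lra.
by rewrite mulrC -ler_pdivlMr.
Qed.

Lemma vcontZ (k : R) u t : vcont u t -> vcont (fun s => k *: u s) t.
Proof.
apply: (vcont_map (T := ( *:%R k : {linear V -> V})) (c := `|k|)) => x.
by rewrite (nmZ hb).
Qed.

Lemma vcontN u t : vcont u t -> vcont (fun s => - u s) t.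
Proof.
by move=> h e e0; have [d d0 H] := vcontZ (-1) h e0; exists d => // s /H; rewrite !scaleN1r.
Qed.

Lemma vcontB u v t : vcont u t -> vcont v t -> vcont (fun s => u s - v s) t.
Proof. by move=> hu hv; apply: (vcontD hu (vcontN hv)). Qed.

Lemma ip_close (x y : V) e : 0 < e -> exists2 d, 0 < d & forall x' y',
  nm (x' - x) <= d -> nm (y' - y) <= d -> `|ip x' y' - ip x y| <= e.
Proof.
move=> e0; have nx := nm_ge0 ip x; have ny := nm_ge0 ip y.
pose M := nm x + nm y + 1.
have M0 : 0 < M by rewrite /M; lra.
exists (Num.min 1 (e / M)); first by rewrite lt_min ltr01 divr_gt0.
move=> x' y'; rewrite !le_min => /andP[x1 xe] /andP[y1 ye].
have -> : ip x' y' - ip x y = ip (x' - x) (y' - y) + ip (x' - x) y + ip x (y' - y).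
  by rewrite !(psdBl hb) !(psdBr hb); ring.
have h1 := psd_CS_nm hb (x' - x) (y' - y).
have h2 := psd_CS_nm hb (x' - x) y; have h3 := psd_CS_nm hb x (y' - y).
have d1 := nm_ge0 ip (x' - x); have d2 := nm_ge0 ip (y' - y).
have k1 : nm (x' - x) * nm (y' - y) <= e / M * 1 by exact: ler_pM.
have k2 : nm (x' - x) * nm y <= e / M * nm y by rewrite ler_wpM2r.
have k3 : nm x * nm (y' - y) <= nm x * (e / M) by rewrite ler_wpM2l.
have E : e = e / M * 1 + e / M * nm y + nm x * (e / M).
  by rewrite /M; field; rewrite gt_eqF.
have t1 := ler_normD (ip (x' - x) (y' - y) + ip (x' - x) y) (ip x (y' - y)).
have t2 := ler_normD (ip (x' - x) (y' - y)) (ip (x' - x) y).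
lra.
Qed.

Lemma is_derive_ip u v t u' v' : vder u t u' -> vder v t v' ->
  is_derive t 1 (fun s => ip (u s) (v s)) (ip u' (v t) + ip (u t) v').
Proof.
move=> hu hv; apply: is_derive_eps => e e0.
have nu := nm_ge0 ip (u t); have nv := nm_ge0 ip (v t).
have nu' := nm_ge0 ip u'; have nv' := nm_ge0 ip v'.
pose M := nm (u t) + nm (v t) + 1 + nm v'.
have M0 : 0 < M by rewrite /M; lra.
have eM : 0 < e / M by rewrite divr_gt0.
have [d d0 Hu] := hu _ eM; have [d' d'0 Hv] := hv _ eM.
have [d1 d10 Lv] := vder_lip hv; have [d2 d20 Lu] := vder_lip hu.
have k0 : 0 < e / M / (nm u' + 1) by rewrite divr_gt0//; lra.
exists (Num.min (Num.min d d') (Num.min (Num.min d1 d2) (e / M / (nm u' + 1)))).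
  by rewrite !lt_min d0 d'0 d10 d20 k0.
move=> s; rewrite !lt_min => /andP[/andP[/Hu h1 /Hv h2] /andP[/andP[/Lv l1 /Lu l2] sk]].
have -> : ip (u s) (v s) - ip (u t) (v t) - (s - t) * (ip u' (v t) + ip (u t) v') =
  ip (u s - u t - (s - t) *: u') (v t) + ip (u t) (v s - v t - (s - t) *: v')
  + ip (u s - u t) (v s - v t).
  by rewrite !(psdBl hb) !(psdBr hb) (psdZl hb) (psdZr hb); ring.
have c1 := psd_CS_nm hb (u s - u t - (s - t) *: u') (v t).
have c2 := psd_CS_nm hb (u t) (v s - v t - (s - t) *: v').
have c3 := psd_CS_nm hb (u s - u t) (v s - v t).
have st0 := normr_ge0 (s - t).
have e1 : nm (u s - u t - (s - t) *: u') * nm (v t) <= e / M * `|s - t| * nm (v t).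
  by rewrite ler_wpM2r.
have e2 : nm (u t) * nm (v s - v t - (s - t) *: v') <= nm (u t) * (e / M * `|s - t|).
  by rewrite ler_wpM2l.
have e3 : nm (u s - u t) * nm (v s - v t) <= e / M * ((nm v' + 1) * `|s - t|).
  apply: ler_pM; rewrite ?nm_ge0//.
  rewrite (le_trans l2)// mulrC -ler_pdivlMr; last by lra.
  exact: ltW.
have E : e * `|s - t| = e / M * `|s - t| * nm (v t) + nm (u t) * (e / M * `|s - t|)
   + e / M * ((nm v' + 1) * `|s - t|).
  by rewrite /M; field; rewrite gt_eqF.
have t1 := ler_normD (ip (u s - u t - (s - t) *: u') (v t) + ip (u t) (v s - v t - (s - t) *: v'))
   (ip (u s - u t) (v s - v t)).
have t2 := ler_normD (ip (u s - u t - (s - t) *: u') (v t)) (ip (u t) (v s - v t - (s - t) *: v')).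
lra.
Qed.

(* [T s] stands for the image of [u s] under a symmetric, possibly unbounded,
   operator; it only needs to be continuous in time. *)
Lemma is_derive_quad (T u : R -> V) t u' : vder u t u' -> vcont T t ->
  (forall s, ip (T s) (u t) = ip (T t) (u s)) ->
  is_derive t 1 (fun s => ip (T s) (u s)) (2 * ip (T t) u').
Proof.
move=> hu hT sym; apply: is_derive_eps => e e0.
have nT := nm_ge0 ip (T t); have nu' := nm_ge0 ip u'.
have [|d d0 Hu] := hu (e / 2 / (2 * nm (T t) + 1)).
  by rewrite !divr_gt0//; lra.
have [d2 d20 Lu] := vder_lip hu.
have [|d1 d10 HT] := hT (e / 2 / (nm u' + 1)); first by rewrite !divr_gt0//; lra.
exists (Num.min d (Num.min d1 d2)); first by rewrite !lt_min d0 d10 d20.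
move=> s; rewrite !lt_min => /andP[/Hu h1 /andP[/HT h2 /Lu h3]].
(* Symmetry moves the increment of [T] onto [u], which yields the factor 2. The remaining product of
   increments is negligible: [T] is continuous and [u] is Lipschitz at [t]. *)
have -> : ip (T s) (u s) - ip (T t) (u t) - (s - t) * (2 * ip (T t) u') =
  ip (T s - T t) (u s - u t) + 2 * ip (T t) (u s - u t - (s - t) *: u').
  by rewrite !(psdBl hb) !(psdBr hb) (psdZr hb) (sym s); ring.
have c1 := psd_CS_nm hb (T s - T t) (u s - u t).
have c2 := psd_CS_nm hb (T t) (u s - u t - (s - t) *: u').
have e1 : nm (T s - T t) * nm (u s - u t) <=
    e / 2 / (nm u' + 1) * ((nm u' + 1) * `|s - t|).
  by apply: ler_pM; rewrite ?nm_ge0.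
have e2 : nm (T t) * nm (u s - u t - (s - t) *: u') <=
    nm (T t) * (e / 2 / (2 * nm (T t) + 1) * `|s - t|) by rewrite ler_wpM2l.
have E1 : e / 2 / (nm u' + 1) * ((nm u' + 1) * `|s - t|) = e / 2 * `|s - t|.
  by field; rewrite gt_eqF//; lra.
have E2 : 2 * (nm (T t) * (e / 2 / (2 * nm (T t) + 1) * `|s - t|)) <= e / 2 * `|s - t|.
  have -> : 2 * (nm (T t) * (e / 2 / (2 * nm (T t) + 1) * `|s - t|)) =
     (e / 2 * `|s - t|) * (2 * nm (T t) / (2 * nm (T t) + 1)).
    by field; rewrite gt_eqF//; lra.
  rewrite ler_piMr// ?mulr_ge0// ?divr_ge0// ?(ltW e0)//.
  by rewrite ler_pdivrMr ?mul1r; lra.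
have t1 := ler_normD (ip (T s - T t) (u s - u t)) (2 * ip (T t) (u s - u t - (s - t) *: u')).
have t2 : `|2 * ip (T t) (u s - u t - (s - t) *: u')| =
   2 * `|ip (T t) (u s - u t - (s - t) *: u')|.
  by rewrite normrM ger0_norm.
lra.
Qed.

(** Pairing the curve with the fixed vector [v = u y - u x] reduces the inequality to the scalar
    mean value theorem; one factor [nm v] is then cancelled. *)
Lemma vincrement_le (u u' : R -> V) (g g' : R -> R) x y : x <= y ->
  (forall t, x <= t <= y -> vder u t (u' t)) ->
  (forall t, x <= t <= y -> is_derive t 1 g (g' t)) ->
  (forall t, x <= t <= y -> nm (u' t) <= g' t) -> nm (u y - u x) <= g y - g x.
Proof.
move=> xy hu hg h.
have g0 : 0 <= g y - g x.
  have h0 t : x <= t <= y -> 0 <= g' t.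
    by move=> txy; rewrite (le_trans (nm_ge0 ip (u' t)))// h.
  have hc t : x <= t <= y -> is_derive t 1 (cst (0 : R)) 0 by move=> _; exact: is_derive_cst.
  by have := increment_le xy hc hg h0; rewrite /cst subrr.
set v := u y - u x; have [v0|v0] := eqVneq (nm v) 0; first by rewrite v0.
have vp : 0 < nm v by rewrite lt_def v0 nm_ge0.
rewrite -(ler_pM2r vp) -expr2 (nm_sqr hb) [in X in ip X _]/v (psdBl hb).
have := @increment_le R (fun s => ip (u s) v) (fun s => g s * nm v)
  (fun s => ip (u' s) v) (fun s => g' s * nm v) x y xy.
rewrite mulrBl; apply.
- move=> t txy; have := is_derive_ip (hu t txy) (vder_cst v t).
  by rewrite (psdC hb (u t)) (psd0l hb) addr0.
- move=> t txy; have hd := hg t txy.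
  apply: der_eq (derM hd (is_derive_cst (nm v) t 1)) _.
  by rewrite mulr0 addr0.
- move=> t txy; rewrite (le_trans (ler_norm _))// (le_trans (psd_CS_nm hb _ _))//.
  by rewrite ler_wpM2r ?nm_ge0// h.
Qed.

Lemma vdiff_quotient_close (u u' : R -> V) (z : V) x k e : 0 < k ->
  (forall t, x <= t <= x + k -> vder u t (u' t)) ->
  (forall t, x <= t <= x + k -> nm (u' t - z) <= e) ->
  nm (k^-1 *: (u (x + k) - u x) - z) <= e.
Proof.
move=> k0 hu h.
have xk : x <= x + k by lra.
have := @vincrement_le (fun s => u s - s *: z) (fun s => u' s - z)
  (fun s => e * s) (fun=> e) x (x + k) xk.
have -> : u (x + k) - (x + k) *: z - (u x - x *: z) = u (x + k) - u x - k *: z.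
  rewrite scalerDl opprB addrA opprD -(addrA (u (x + k))) (addrC _ (x *: z)).
  by rewrite addNKr addrAC.
have -> : e * (x + k) - e * x = k * e by ring.
move=> H.
have -> : k^-1 *: (u (x + k) - u x) - z = k^-1 *: (u (x + k) - u x - k *: z).
  by rewrite [in RHS]scalerBr scalerA mulVf ?gt_eqF// scale1r.
rewrite (nmZ hb) ger0_norm ?invr_ge0 ?(ltW k0)// ler_pdivrMl//.
apply: H => //.
- by move=> t txk; apply: vderB; [exact: hu|exact: vder_line].
- by move=> t _; exact: der_lin.
Qed.

End vector_calculus.

(** The slopes of every [F k] lie within [e] of [D] on one neighbourhood of [t], so its increments
    do as well, and such a bound survives the pointwise limit [k -> 0]. This differentiates
    quantities that are only limits of difference quotients. *)
Lemma is_derive_limit {R : realType} (f : R -> R) (F n : R -> R -> R) (D t : R) :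
  (forall (s e : R), 0 < e -> exists2 k0, 0 < k0 & forall k, 0 < k < k0 -> `|F k s - f s| <= e) ->
  (forall k s : R, 0 < k -> is_derive s 1 (F k) (n k s)) ->
  (forall e : R, 0 < e -> exists2 d, 0 < d &
     forall k s : R, 0 < k < d -> `|s - t| < d -> `|n k s - D| <= e) ->
  is_derive t 1 f D.
Proof.
move=> hf hF hn; apply: is_derive_eps => e e0; have [d d0 H] := hn e e0.
exists d => // s st.
have key k : 0 < k < d -> `|F k s - F k t - (s - t) * D| <= e * `|s - t|.
  move=> kd; have k0 : 0 < k by case/andP: kd.
  have bnd x : (t <= x <= s) || (s <= x <= t) -> D - e <= n k x <= D + e.
    move=> h; have xd : `|x - t| < d.
      apply: le_lt_trans st; case/orP: h => /andP[h1 h2].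
        by rewrite !ger0_norm; lra.
      by rewrite !ler0_norm; lra.
    by have := H k x kd xd; rewrite ler_norml; lra.
  have [ts|ts] := lerP t s.
    have h1 := increment_le ts (fun x _ => hF k x k0) (fun x _ => der_lin (D + e) x).
    have h2 := increment_le ts (fun x _ => der_lin (D - e) x) (fun x _ => hF k x k0).
    have {}h1 := h1 (fun x hx => proj2 (andP (bnd x (introT orP (or_introl _ hx))))).
    have {}h2 := h2 (fun x hx => proj1 (andP (bnd x (introT orP (or_introl _ hx))))).
    by rewrite ler_norml; lra.
  have h1 := increment_le (ltW ts) (fun x _ => hF k x k0) (fun x _ => der_lin (D + e) x).
  have h2 := increment_le (ltW ts) (fun x _ => der_lin (D - e) x) (fun x _ => hF k x k0).
  have {}h1 := h1 (fun x hx => proj2 (andP (bnd x (introT orP (or_intror _ hx))))).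
  have {}h2 := h2 (fun x hx => proj1 (andP (bnd x (introT orP (or_intror _ hx))))).
  by rewrite ler_norml; lra.
apply/ler_addgt0Pr => e' e'0; have e2 : 0 < e' / 2 by rewrite divr_gt0.
have [k1 k10 h1] := hf s _ e2; have [k2 k20 h2] := hf t _ e2.
pose k := Num.min d (Num.min k1 k2) / 2.
have m0 : 0 < Num.min d (Num.min k1 k2) by rewrite !lt_min d0 k10.
have kd : 0 < k < d.
  have : Num.min d (Num.min k1 k2) <= d by rewrite ge_min lexx.
  by rewrite /k; lra.
have kk1 : 0 < k < k1.
  have : Num.min d (Num.min k1 k2) <= k1 by rewrite !ge_min lexx orbT.
  by rewrite /k; lra.
have kk2 : 0 < k < k2.
  have : Num.min d (Num.min k1 k2) <= k2 by rewrite !ge_min lexx !orbT.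
  by rewrite /k; lra.
have := key k kd; have := h1 k kk1; have := h2 k kk2.
rewrite !ler_norml; lra.
Qed.

(** * Rayleigh quotient and approximate eigenvectors without completeness *)

Lemma le_mean_of_sqr {R : realFieldType} (a b y : R) :
  0 <= a -> 0 <= b -> y ^+ 2 <= a * b -> y <= (a + b) / 2.
Proof.
move=> a0 b0 h; rewrite leNgt; apply/negP => hy.
have : ((a + b) / 2) ^+ 2 < y ^+ 2 by rewrite ltrXn2r// divr_ge0// addr_ge0.
have : 0 <= ((a - b) / 2) ^+ 2 by exact: sqr_ge0.
have -> : ((a - b) / 2) ^+ 2 = ((a + b) / 2) ^+ 2 - a * b by field.
lra.
Qed.

(* [G] is the inverse of a positive operator [L]; the operator [L - W] has at
   most one negative direction, as witnessed by the functional [ell]. Elements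
   of the domain of [L] are written [G v], so that [v = L (G v)]. *)
Section spectral.
Context {R : realType} {V : lmodType R} {ip : V -> V -> R} (hb : psd_form ip).
Context (G W : {linear V -> V}) (ell : {linear V -> R^o}) (c0 w : R).
Hypothesis Gsym : forall u v, ip (G u) v = ip u (G v).
Hypothesis c0_gt0 : 0 < c0.
Hypothesis Gcoer : forall v, c0 * ip (G v) (G v) <= ip (G v) v.
Hypothesis Wsym : forall u v, ip (W u) v = ip u (W v).
Hypothesis w_gt0 : 0 < w.
Hypothesis Wbd : forall v, psd_norm ip (W v) <= w * psd_norm ip v.
Hypothesis ell_pos : forall v, ell (G v) = 0 -> 0 <= ip (v - W (G v)) (G v).
Hypothesis neg_dir : exists v, ip (v - W (G v)) (G v) < 0.

Local Notation nm := (psd_norm ip).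
(** For [a = G u] and [b = G v] the three forms are [(a, L b)], [(L^-1 a, b)] and [((L - W) a, b)].
    The weight [zf] appears because a mode of rate [lam] of [a' = L b], [b' = - (L - W) a] satisfies
    [(L - W) a = - lam^2 L^-1 a]. *)
Definition qf u v := ip (G u) v.
Definition zf u v := ip (G (G u)) (G v).
Definition nf u v := ip (u - W (G u)) (G v).
Let n v := nf v v.
Let q v := qf v v.
Let zeta v := zf v v.

Lemma qf_psd : psd_form qf.
Proof.
rewrite /qf; split=> [u v|u v y|k u v|v].
- by rewrite Gsym (psdC hb).
- by rewrite linearD (psdDl hb).
- by rewrite linearZ (psdZl hb).
- by rewrite (le_trans _ (Gcoer _))// mulr_ge0 ?(psd_ge0 hb)// ltW.
Qed.

Lemma zf_psd : psd_form zf.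
Proof.
rewrite /zf; split=> [u v|u v y|k u v|v].
- by rewrite Gsym (psdC hb).
- by rewrite !linearD (psdDl hb).
- by rewrite !linearZ (psdZl hb).
- exact: (psd_ge0 qf_psd (G v)).
Qed.

Lemma nfC u v : nf u v = nf v u.
Proof.
rewrite /nf !(psdBl hb) -(Gsym u v) (psdC hb (G u) v) (Wsym (G u)).
by rewrite (psdC hb (G u) (W _)).
Qed.

Lemma nfDl u v y : nf (u + v) y = nf u y + nf v y.
Proof. by rewrite /nf (linearD G) (linearD W) opprD addrACA (psdDl hb). Qed.

Lemma nfZl k u v : nf (k *: u) v = k * nf u v.
Proof. by rewrite /nf !linearZZ -scalerDr (psdZl hb). Qed.

Lemma n_def v : n v = q v - ip (W (G v)) (G v).
Proof. by rewrite /n /nf (psdBl hb) (psdC hb v). Qed.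

(** Cauchy-Schwarz for [qf] at the pair [G v], [v]: the norm of [G v] is interpolated between the
    forms of [L^-1] and of [L]. *)
Lemma nm_G_interpolation v : ip (G v) (G v) ^+ 2 <= zeta v * q v.
Proof. by have := psd_CS qf_psd (G v) v; rewrite /qf Gsym. Qed.

Lemma W_form_bound u : `|ip (W u) u| <= w * ip u u.
Proof.
rewrite (le_trans (psd_CS_nm hb _ _))// -(nm_sqr hb) expr2 mulrA.
by rewrite ler_wpM2r ?nm_ge0.
Qed.

(** Interpolation and the arithmetic-geometric mean absorb the bounded perturbation [W] into half of
    [q]. In particular the quotient [n / zeta] is at least [- w^2 / 2]. *)
Lemma n_lower v : q v / 2 - w ^+ 2 / 2 * zeta v <= n v.
Proof.
have q0 : 0 <= q v := psd_ge0 qf_psd v; have z0 : 0 <= zeta v := psd_ge0 zf_psd v.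
have := W_form_bound (G v); rewrite n_def ler_norml => /andP[_ h].
suff : w * ip (G v) (G v) <= (q v + w ^+ 2 * zeta v) / 2 by lra.
apply: le_mean_of_sqr => //; first by rewrite mulr_ge0// sqr_ge0.
rewrite exprMn [leRHS]mulrCA ler_wpM2l ?sqr_ge0// mulrC; exact: nm_G_interpolation.
Qed.

Lemma zeta_le v : c0 ^+ 2 * zeta v <= q v.
Proof.
have q0 : 0 <= q v := psd_ge0 qf_psd v; have z0 : 0 <= zeta v := psd_ge0 zf_psd v.
have h1 := Gcoer v; have h2 := Gcoer (G v).
have h3 := psd_CS hb (G (G v)) (G v); rewrite -!/(zeta v) -/(q v) in h1 h2 h3.
have [z1|z1] := eqVneq (zeta v) 0; first by rewrite z1 mulr0.
have {z1} : 0 < zeta v by rewrite lt_def z1.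
move=> z1; rewrite -(ler_pM2l z1).
have a0 := psd_ge0 hb (G (G v)); have b0 := psd_ge0 hb (G v).
have : c0 * ip (G (G v)) (G (G v)) * (c0 * ip (G v) (G v)) <= zeta v * q v.
  by apply: ler_pM => //; rewrite mulr_ge0// ltW.
apply: le_trans.
have -> : zeta v * (c0 ^+ 2 * zeta v) = c0 ^+ 2 * zeta v ^+ 2 by ring.
have -> : c0 * ip (G (G v)) (G (G v)) * (c0 * ip (G v) (G v)) =
  c0 ^+ 2 * (ip (G (G v)) (G (G v)) * ip (G v) (G v)) by ring.
by rewrite ler_wpM2l// sqr_ge0.
Qed.

Lemma nm_G_le v : c0 * nm (G v) <= nm v.
Proof.
have [e|e] := eqVneq (nm (G v)) 0; first by rewrite e mulr0 nm_ge0.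
have {}e : 0 < nm (G v) by rewrite lt_def e nm_ge0.
rewrite -(ler_pM2r e) -mulrA -expr2 (nm_sqr hb) (le_trans (Gcoer v))//.
by rewrite (le_trans (ler_norm _))// mulrC psd_CS_nm.
Qed.

Lemma nm_G_q v : c0 * nm (G v) ^+ 2 <= q v.
Proof. by rewrite (nm_sqr hb). Qed.

(** [- L0] is the infimum of [n / zeta]: finite by [n_lower], negative by [neg_dir]. The last clause
    only asks that the infimum be approached, since without completeness it need not be attained. *)
Lemma spectral_bottom : exists L0, [/\ 0 < L0, forall v, 0 <= n v + L0 * zeta v &
  forall nu : R, 0 < nu -> exists v, zeta v = 1 /\ n v + L0 * zeta v < nu].
Proof.
have zpos v : zeta v = 0 -> n v = 0.
  move=> z0; have := nm_G_interpolation v; rewrite z0 mul0r => h.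
  have e : nm (G v) = 0.
    have e1 : ip (G v) (G v) = 0.
      by apply/eqP; rewrite -(sqrf_eq0); rewrite eq_le h sqr_ge0.
    by rewrite /psd_norm e1 sqrtr0.
  have := psd_CS_nm hb (v - W (G v)) (G v).
  by rewrite e mulr0 normr_le0 => /eqP.
have scal v : 0 < zeta v -> exists k, 0 < k /\ zeta (k *: v) = 1 /\ k ^+ 2 * zeta v = 1 /\ n (k *: v) = k ^+ 2 * n v.
  move=> z0; exists (Num.sqrt (zeta v))^-1.
  have s0 : 0 < Num.sqrt (zeta v) by rewrite sqrtr_gt0.
  have e : (Num.sqrt (zeta v))^-1 ^+ 2 * zeta v = 1.
    by rewrite exprVn sqr_sqrtr ?ltW// mulVf// gt_eqF.
  split; first by rewrite invr_gt0.
  split; last split => //.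
    by rewrite -{}e /zeta (psdZl zf_psd) (psdZr zf_psd) mulrA -expr2.
  by rewrite /n nfZl nfC nfZl mulrA -expr2.
pose S := [set x | exists v, zeta v = 1 /\ x = - n v].
have [v0 v0neg] := neg_dir; rewrite -/(nf v0 v0) -/(n v0) in v0neg.
have z0 : 0 < zeta v0.
  rewrite lt_def (psd_ge0 zf_psd) andbT; apply/eqP => z0.
  by rewrite (zpos _ z0) ltxx in v0neg.
have [k0 [k00 [zk0 [_ nk0]]]] := scal v0 z0.
have Sk0 : S (- n (k0 *: v0)) by exists (k0 *: v0).
have supS : has_sup S.
  split; first by eexists; exact: Sk0.
  exists (w ^+ 2 / 2) => _ [v [zv ->]].
  have := n_lower v; rewrite zv; have : 0 <= q v := psd_ge0 qf_psd v; lra.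
have ubS := ub_le_sup (proj2 supS).
exists (sup S); split.
- apply: lt_le_trans (ubS _ Sk0).
  by rewrite nk0 oppr_gt0 pmulr_rlt0// exprn_gt0.
- move=> v; have [z|z] := eqVneq (zeta v) 0; first by rewrite z (zpos _ z) mulr0 addr0.
  have {}z : 0 < zeta v by rewrite lt_def z (psd_ge0 zf_psd).
  have [k [k_gt0 [zk [kz nk]]]] := scal v z.
  have : - n (k *: v) <= sup S by apply: ubS; exists (k *: v).
  rewrite nk => h; rewrite -(ler_pM2l (exprn_gt0 2 k_gt0)) mulr0 mulrDr.
  have -> : k ^+ 2 * (sup S * zeta v) = sup S * (k ^+ 2 * zeta v) by ring.
  rewrite kz; lra.
- move=> nu nu0; have [x [v [zv ->]] hx] := sup_adherent nu0 supS.
  by exists v; split=> //; rewrite zv mulr1; lra.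
Qed.


Lemma qs_psd L0 : (forall v, 0 <= n v + L0 * zeta v) ->
  psd_form (fun u v => nf u v + L0 * zf u v).
Proof.
move=> h; split=> [u v|u v y|k u v|v].
- by rewrite nfC (psdC zf_psd).
- by rewrite nfDl (psdDl zf_psd); ring.
- by rewrite nfZl (psdZl zf_psd); ring.
- exact: h.
Qed.

Lemma n_upper v : n v <= (1 + w / c0) * q v.
Proof.
have h1 := Gcoer v; have := W_form_bound (G v).
rewrite n_def ler_norml => /andP[h _].
suff : w * ip (G v) (G v) <= w / c0 * q v by lra.
by rewrite -mulrA ler_wpM2l ?(ltW w_gt0)// mulrC ler_pdivlMr// mulrC.
Qed.

Lemma q_add_le u v : q (u + v) <= 2 * q u + 2 * q v.
Proof.
have := psd_ge0 qf_psd (u - v).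
rewrite /q !(psdDl qf_psd) !(psdDr qf_psd) (psdNl qf_psd) !(psdNr qf_psd) (psdNl qf_psd).
rewrite (psdC qf_psd v u); lra.
Qed.

(** Residual of [(L - W) a + L0 L^-1 a = 0] at [a = G x], the equation of a mode growing at rate the
    square root of [L0]. *)
Definition eig_defect L0 x := x - W (G x) + L0 *: G (G x).

(* The minimisers of the Rayleigh quotient [n / zeta] need not exist in [V]:
   one elliptic regularisation step [x0 |-> x] turns an almost minimiser, which
   solves the eigenvalue equation up to a small error in a dual norm, into a
   vector which solves it up to a small error in the norm [nm]. *)
Lemma approx_eigenvector : exists L0 C1 : R, [/\ 0 < L0, 0 < C1 &
  forall nu : R, 0 < nu -> exists x x0 : V,
    [/\ nm (eig_defect L0 x) <= nu, 1 / 4 <= zeta x, zeta x <= C1, q x <= C1 &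
     nm x <= C1 /\ x - W (G x) = W (G (x0 - x)) + G (- (L0 *: G x0))]].
Proof.
have cp := c0_gt0; have wp := w_gt0.
have [L0 [L00 Qs_ge0 near_min]] := spectral_bottom.
have hQ := qs_psd Qs_ge0.
pose Cq := 1 + w / c0 + L0 / c0 ^+ 2.
have wc0 : 0 < w / c0 by rewrite divr_gt0.
have Lc : 0 < L0 / c0 ^+ 2 by rewrite divr_gt0// exprn_gt0.
have Lc1 : 0 < L0 / c0 by rewrite divr_gt0.
have Cq1 : 1 <= Cq by rewrite /Cq; lra.
have QsCq v : n v + L0 * zeta v <= Cq * q v.
  have h1 := n_upper v; have h2 := zeta_le v.
  have : L0 * zeta v <= L0 / c0 ^+ 2 * q v.
    by rewrite -mulrA ler_wpM2l ?(ltW L00)// mulrC ler_pdivlMr ?exprn_gt0// mulrC.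
  rewrite /Cq; lra.
pose B := (w ^+ 2 + c0 / 2) / c0.
have w20 : 0 < w ^+ 2 by rewrite exprn_gt0.
have B0 : 0 < B by rewrite divr_gt0//; lra.
pose E := 2 * w ^+ 2 + 2 * c0.
have E0 : 0 < E by rewrite /E; lra.
exists L0, (E + E / c0 ^+ 2 + (w + L0 / c0) * (B + 1)); split => //.
  have := divr_gt0 E0 (exprn_gt0 2 c0_gt0).
  have : 0 < (w + L0 / c0) * (B + 1) by rewrite mulr_gt0//; lra.
  lra.
move=> nu nu0.
(* The first entry makes the final residual at most [nu]; the others keep [x] so close to [x0] that
   its weight stays above 1/4. *)
pose tau := Num.min (nu / (w + L0 / c0)) (Num.min 1 c0 / 2).
have tau0 : 0 < tau by rewrite !lt_min divr_gt0//= ?divr_gt0// ?lt_min ?ltr01//; lra.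
have tau1 : tau <= nu / (w + L0 / c0) by rewrite ge_min lexx.
have tauh : tau <= 1 / 2.
  have : Num.min 1 c0 <= 1 by rewrite ge_min lexx.
  have : tau <= Num.min 1 c0 / 2 by rewrite ge_min lexx orbT.
  lra.
have tauc : tau <= c0 / 2.
  have : Num.min 1 c0 <= c0 by rewrite ge_min lexx orbT.
  have : tau <= Num.min 1 c0 / 2 by rewrite ge_min lexx orbT.
  lra.
have tau2 : tau ^+ 2 <= 1 / 4.
  have : tau ^+ 2 <= (1 / 2) ^+ 2 by rewrite lerXn2r ?nnegrE//; lra.
  by have -> : ((1 : R) / 2) ^+ 2 = 1 / 4 by field.
have tau2c : tau ^+ 2 <= c0 / 4.
  have : tau * tau <= 1 / 2 * (c0 / 2) by rewrite ler_pM// ltW.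
  rewrite expr2; lra.
have nu'0 : 0 < c0 * tau ^+ 2 / Cq by rewrite divr_gt0 ?mulr_gt0 ?exprn_gt0//; lra.
have [x0 [zx0 nx0]] := near_min _ nu'0.
have nu'1 : c0 * tau ^+ 2 / Cq <= c0 / 4.
  rewrite ler_pdivrMr; last by lra.
  have : c0 * tau ^+ 2 <= c0 * (1 / 4) by rewrite ler_wpM2l// ltW.
  have : c0 / 4 * 1 <= c0 / 4 * Cq by rewrite ler_wpM2l//; lra.
  lra.
have qx0 : q x0 <= w ^+ 2 + c0 / 2.
  have := n_lower x0; rewrite zx0 in nx0 *; lra.
(* Elliptic regularisation: with [a0 = G x0], the vector [G x] solves [L a = W a0 - L0 L^-1 a0]. *)
pose x := W (G x0) - L0 *: G (G x0).
pose d := x - x0.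
have xd : x = x0 + d by rewrite /d addrC subrK.
have e0d v : nf x0 v + L0 * zf x0 v = - qf d v.
  rewrite /nf /zf /qf (Gsym d) -(psdZl hb) -(psdDl hb) -(psdNl hb); congr (ip _ _).
  by rewrite /d /x !opprB addrA addrAC.
(* By [e0d] the residual of [x0] is represented by [- d] in the form [qf]. Cauchy-Schwarz for the
   nonnegative form [n + L0 zeta], almost zero at [x0], therefore bounds [q d]. *)
have qd : q d <= c0 * tau ^+ 2.
  have qd0 : 0 <= q d := psd_ge0 qf_psd d.
  have := psd_CS hQ x0 d; rewrite e0d sqrrN -/(q d) -!/(n _) -!/(zeta _) => h.
  have [e|e] := eqVneq (q d) 0; first by rewrite e mulr_ge0 ?sqr_ge0// ltW.
  have {e} e : 0 < q d by rewrite lt_def e.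
  rewrite -(ler_pM2r e) -expr2 (le_trans h)//.
  have -> : c0 * tau ^+ 2 * q d = (c0 * tau ^+ 2 / Cq) * (Cq * q d).
    by field; rewrite gt_eqF//; lra.
  apply: ler_pM; rewrite ?Qs_ge0 ?QsCq//; exact: ltW.
have sd : nm (G d) <= tau.
  rewrite -(@ler_pXn2r _ 2)// ?nnegrE ?nm_ge0 ?(ltW tau0)//.
  by rewrite -(ler_pM2l c0_gt0) (le_trans (nm_G_q d)).
have zd : zeta d <= 1 / 4.
  have := zeta_le d => h.
  rewrite -(@ler_pM2l _ (c0 ^+ 2)) ?exprn_gt0//.
  have : c0 * tau ^+ 2 <= c0 * (c0 / 4) by rewrite ler_wpM2l// ltW.
  have -> : c0 ^+ 2 * (1 / 4) = c0 * (c0 / 4) by field.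
  lra.
(* The residual of [x] sees [d] only through [G d], which is small in the norm even though [d]
   itself need not be. *)
have def : eig_defect L0 x = L0 *: G (G d) - W (G d).
  have Wx : W (G x) = W (G x0) + W (G d) by rewrite {1}xd !linearD.
  have GGx : G (G x) = G (G x0) + G (G d) by rewrite {1}xd !linearD.
  rewrite /eig_defect Wx GGx scalerDr /x opprD addrACA subrK -addrA addNKr.
  by rewrite addrC.
have wL : 0 < w + L0 / c0 by lra.
have qd4 : q d <= c0 / 4.
  by rewrite (le_trans qd)//; have := ler_wpM2l (ltW cp) tau2; lra.
exists x, x0; split.
- rewrite def (le_trans (nmB hb _ _))// (nmZ hb) (ger0_norm (ltW L00)).
  have h1 := Wbd (G d); have h2 := nm_G_le (G d).
  have h3 : L0 * nm (G (G d)) <= L0 / c0 * nm (G d).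
    by rewrite -mulrA ler_wpM2l ?(ltW L00)// mulrC ler_pdivlMr// mulrC.
  have : (w + L0 / c0) * nm (G d) <= nu.
    by rewrite mulrC -ler_pdivlMr// (le_trans sd).
  lra.
- have h1 := nmD zf_psd (x0 + d) (- d); rewrite addrK (nmN zf_psd) -xd in h1.
  have h2 : psd_norm zf x0 = 1 by rewrite /psd_norm -/(zeta x0) zx0 sqrtr1.
  have h3 : psd_norm zf d <= 1 / 2.
    apply: (nm_le zf_psd); first by lra.
    by have -> : ((1 : R) / 2) ^+ 2 = 1 / 4 by field.
  have h4 : 1 / 2 <= psd_norm zf x by lra.
  have -> : 1 / 4 = ((1 : R) / 2) ^+ 2 by field.
  by rewrite /zeta -(nm_sqr zf_psd) lerXn2r ?nnegrE ?nm_ge0//; lra.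
- have qx : q x <= E by have := q_add_le x0 d; rewrite -xd /E; lra.
  have : zeta x <= E / c0 ^+ 2.
    by rewrite ler_pdivlMr ?exprn_gt0// mulrC (le_trans (zeta_le x)).
  have : 0 < (w + L0 / c0) * (B + 1) by rewrite mulr_gt0//; lra.
  lra.
- have qx : q x <= E by have := q_add_le x0 d; rewrite -xd /E; lra.
  have := divr_gt0 E0 (exprn_gt0 2 c0_gt0).
  have : 0 < (w + L0 / c0) * (B + 1) by rewrite mulr_gt0//; lra.
  lra.
- split.
    have g : nm (G x0) <= B + 1.
      have : nm (G x0) ^+ 2 <= B.
        by rewrite /B ler_pdivlMr// mulrC (le_trans (nm_G_q x0)).
      have : 0 <= (nm (G x0) - 1) ^+ 2 by exact: sqr_ge0.
      have := nm_ge0 ip (G x0); rewrite sqrrB expr1n; lra.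
    have h0 : nm x <= w * nm (G x0) + L0 * nm (G (G x0)).
      rewrite (le_trans (nmB hb _ _))// (nmZ hb) (ger0_norm (ltW L00)).
      by rewrite lerD2r.
    have h2 := nm_G_le (G x0).
    have h3 : L0 * nm (G (G x0)) <= L0 / c0 * nm (G x0).
      by rewrite -mulrA ler_wpM2l ?(ltW L00)// mulrC ler_pdivlMr// mulrC.
    have : (w + L0 / c0) * nm (G x0) <= (w + L0 / c0) * (B + 1).
      by rewrite ler_wpM2l// ltW.
    have := divr_gt0 E0 (exprn_gt0 2 c0_gt0).
    lra.
  have e1 y : W (G (x0 - y)) = W (G x0) - W (G y) by rewrite (linearB G) (linearB W).
  have e2 : G (- (L0 *: G x0)) = - (L0 *: G (G x0)) by rewrite (linearN G) linearZZ.
  by rewrite e1 e2 {1}/x addrAC.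
Qed.

(** The form is strictly negative at the approximate mode [x], so [x] is transversal to the kernel
    of [ell]. In [v = y + s x] the part [y] lies in that kernel, where the form plus a little [zeta]
    is coercive, and the near eigenvalue equation turns the cross term into a multiple of [zf x v]:
    coercivity fails only in the direction of the mode. *)
Lemma coercivity L0 C1 : 0 < L0 -> 0 < C1 -> exists c3 C3 nu0 : R,
  [/\ 0 < c3, 0 < C3, 0 < nu0 & forall x, nm (eig_defect L0 x) <= nu0 ->
    1 / 4 <= zeta x -> q x <= C1 ->
    forall v, c3 * q v - C3 * (zf x v) ^+ 2 <= n v + L0 / 16 * zeta v].
Proof.
have cp := c0_gt0; have wp := w_gt0.
move=> L00 C10; pose m : R := L0 / 16; have m0 : 0 < m by rewrite /m; lra.
(* Share of [n y] that is traded for [q y] through [n_lower]; it is small enough for the resulting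
   loss in [zeta] to be covered by [m]. *)
pose th : R := 2 * m / (2 * m + w ^+ 2).
have w20 : 0 < w ^+ 2 by rewrite exprn_gt0.
have th0 : 0 < th by rewrite divr_gt0//; lra.
have th1 : th <= 1 by rewrite ler_pdivrMr; lra.
have thm : th * (w ^+ 2 / 2) <= m.
  rewrite /th mulrAC ler_pdivrMr; last by lra.
  have : 0 < m * m by rewrite mulr_gt0.
  lra.
pose k : R := L0 / 8; have k0 : 0 < k by rewrite /k; lra.
pose c1 := Num.min (th / 2) (k / (4 * C1)).
have c10 : 0 < c1 by rewrite lt_min !divr_gt0//; lra.
have c1th : c1 <= th / 2 by rewrite ge_min lexx.
have c1k : c1 * C1 <= k / 4.
  have : c1 <= k / (4 * C1) by rewrite ge_min lexx orbT.
  move=> h; apply: (@le_trans _ _ (k / (4 * C1) * C1)); first by rewrite ler_wpM2r// ltW.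
  by rewrite le_eqVlt; apply/orP; left; apply/eqP; field; rewrite gt_eqF.
pose B : R := C1 / c0 + 1; have B1 : 1 < B.
  by rewrite /B; have := divr_gt0 C10 c0_gt0; lra.
pose nu0 := Num.min (L0 / 16 / B) (Num.min (k / 4) (c1 * c0 / 4)).
have nu00 : 0 < nu0.
  by rewrite !lt_min; apply/and3P; split; rewrite ?divr_gt0// ?mulr_gt0//; lra.
exists (c1 / 4), (4 * L0 ^+ 2 / k), nu0; split => //; first by lra.
  by rewrite divr_gt0// mulr_gt0// exprn_gt0.
move=> x rx zx qx v.
have nuB : nu0 * B <= L0 / 16.
  by rewrite -ler_pdivlMr ?ge_min ?lexx//; lra.
have nuk : nu0 <= k / 4 by rewrite !ge_min lexx orbT.
have nuc : nu0 <= c1 * c0 / 4 by rewrite !ge_min lexx !orbT.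
pose r := eig_defect L0 x.
have defx u : nf x u = ip r (G u) - L0 * zf x u.
  by rewrite /r /eig_defect (psdDl hb) (psdZl hb) /zf /nf; ring.
have gB : nm (G x) <= B.
  have : nm (G x) ^+ 2 <= C1 / c0.
    by rewrite ler_pdivlMr// mulrC (le_trans (nm_G_q x)).
  have : 0 <= (nm (G x) - 1) ^+ 2 by exact: sqr_ge0.
  have := nm_ge0 ip (G x); rewrite /B sqrrB expr1n; lra.
have rGx : ip r (G x) <= L0 / 16.
  rewrite (le_trans (ler_norm _))// (le_trans (psd_CS_nm hb _ _))//.
  by rewrite (le_trans _ nuB)// ler_pM// nm_ge0.
have nx : n x + m * zeta x <= - k.
  rewrite /n defx -/(zeta x) /m /k; nra.
have ell0 : ell (G x) != 0.
  apply/eqP => /ell_pos; rewrite -/(nf x x) -/(n x).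
  have := psd_ge0 zf_psd x; rewrite -/(zeta x) => z0.
  have := mulr_ge0 (ltW m0) z0; lra.
pose s : R := ell (G v) / ell (G x); pose y := v - s *: x.
have elly : ell (G y) = 0.
  have -> : ell (G y) = ell (G v) - s * ell (G x).
    by rewrite /y (linearB G) (linearB ell) 2!linearZZ.
  by rewrite /s divfK// subrr.
have vy : v = y + s *: x by rewrite /y subrK.
have hy : th / 2 * q y <= n y + m * zeta y.
  have ny : 0 <= n y := ell_pos elly.
  have z0 : 0 <= zeta y := psd_ge0 zf_psd y.
  have h1 : th * n y <= n y by rewrite ler_piMl.
  have h2 : th * (q y / 2 - w ^+ 2 / 2 * zeta y) <= th * n y.
    by rewrite ler_wpM2l ?(ltW th0)// n_lower.
  have h3 : th * (w ^+ 2 / 2) * zeta y <= m * zeta y by rewrite ler_wpM2r.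
  lra.
(* Pairing [x] with [v] instead of [y] in the cross term flips the sign of the square, so that the
   negativity of the form at [x] becomes a gain. *)
have expand : n v + m * zeta v =
   (n y + m * zeta y) + 2 * s * (nf x v + m * zf x v) - s ^+ 2 * (n x + m * zeta x).
  have e u : nf u v = nf u y + s * nf u x by rewrite nfC {1}vy nfDl nfZl !(nfC u).
  have e' u : zf u v = zf u y + s * zf u x.
    by rewrite {1}vy (psdDr zf_psd) (psdZr zf_psd).
  have f u : nf v u = nf y u + s * nf x u by rewrite {1}vy nfDl nfZl.
  have f' u : zf v u = zf y u + s * zf x u.
    by rewrite {1}vy (psdDl zf_psd) (psdZl zf_psd).
  rewrite /n /zeta !f !f' !e !e' (nfC y x) (psdC zf_psd y x); ring.
have qv : q v <= 2 * q y + 2 * (s ^+ 2 * C1).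
  rewrite {1}vy (le_trans (q_add_le _ _))// lerD2l ler_pM2l//.
  rewrite /q (psdZl qf_psd) (psdZr qf_psd) mulrA -expr2.
  by rewrite ler_wpM2l ?sqr_ge0.
have cross : - (2 * s * (nf x v + m * zf x v)) <=
    nu0 * s ^+ 2 + c1 / 4 * q v + k / 4 * s ^+ 2 + 4 * L0 ^+ 2 / k * zf x v ^+ 2.
  rewrite defx.
  have h1 : - (2 * s * ip r (G v)) <= nu0 * s ^+ 2 + c1 / 4 * q v.
    have cs := psd_CS_nm hb r (G v); have gq := nm_G_q v.
    have : - (2 * s * ip r (G v)) <= 2 * (`|s| * (nu0 * nm (G v))).
      rewrite (le_trans (ler_norm _))// normrN !normrM (ger0_norm (ler0n _ 2)) -mulrA.
      rewrite ler_wpM2l// ler_wpM2l// (le_trans cs)// ler_wpM2r ?nm_ge0//.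
    have : 0 <= nu0 * (`|s| - nm (G v)) ^+ 2 by rewrite mulr_ge0 ?sqr_ge0 ?ltW.
    rewrite sqrrB real_normK ?num_real//.
    have : nu0 * nm (G v) ^+ 2 <= c1 * c0 / 4 * nm (G v) ^+ 2.
      by rewrite ler_wpM2r ?sqr_ge0.
    have : c1 / 4 * (c0 * nm (G v) ^+ 2) <= c1 / 4 * q v.
      by rewrite ler_wpM2l//; lra.
    lra.
  have h2 : 2 * s * ((L0 - m) * zf x v) <= k / 4 * s ^+ 2 + 4 * L0 ^+ 2 / k * zf x v ^+ 2.
    have : 0 <= k / 4 * (s - 4 * (L0 - m) / k * zf x v) ^+ 2.
      by rewrite mulr_ge0 ?sqr_ge0//; lra.
    have -> : k / 4 * (s - 4 * (L0 - m) / k * zf x v) ^+ 2 =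
      k / 4 * s ^+ 2 - 2 * s * ((L0 - m) * zf x v) + 4 * (L0 - m) ^+ 2 / k * zf x v ^+ 2.
      by field; rewrite gt_eqF.
    have : 4 * (L0 - m) ^+ 2 / k * zf x v ^+ 2 <= 4 * L0 ^+ 2 / k * zf x v ^+ 2.
      rewrite ler_wpM2r ?sqr_ge0// ler_wpM2r ?invr_ge0 ?(ltW k0)// ler_wpM2l//.
      by rewrite lerXn2r ?nnegrE /m; lra.
    lra.
  lra.
have s20 : 0 <= s ^+ 2 by exact: sqr_ge0.
have qy0 : 0 <= q y := psd_ge0 qf_psd y.
have h1 : c1 * q y <= th / 2 * q y by rewrite ler_wpM2r.
have h2 : c1 * q v <= c1 * (2 * q y + 2 * (s ^+ 2 * C1)) by rewrite ler_wpM2l// ltW.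
have h3 : s ^+ 2 * (c1 * C1) <= s ^+ 2 * (k / 4) by rewrite ler_wpM2l.
have h4 : s ^+ 2 * (n x + m * zeta x) <= s ^+ 2 * (- k) by rewrite ler_wpM2l.
have h5 : nu0 * s ^+ 2 <= k / 4 * s ^+ 2 by rewrite ler_wpM2r.
have h6 : 0 <= k * s ^+ 2 by rewrite mulr_ge0// ltW.
rewrite -/m expand; move: cross hy h1 h2 h3 h4 h5 h6; clear; lra.
Qed.

End spectral.

(** * Comparison principles for scalar linear inequalities *)

Section scalar_comparison.
Context {R : realType}.
Implicit Types (y z : R -> R) (t k r s K : R).

(** Integrating factor [expR (- k * t)]: since the forcing rate [s] exceeds [k], the solution grows
    no faster than the forcing. *)
Lemma growth_upper_bound y y' k r s : k < s -> 0 <= r ->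
  (forall t, 0 <= t -> is_derive t 1 y (y' t)) ->
  (forall t, 0 <= t -> y' t <= k * y t + r * expR (s * t)) ->
  forall t, 0 <= t -> y t <= (`|y 0| + r / (s - k)) * expR (s * t).
Proof.
move=> ks r0 hy hle t t0.
pose c := r / (s - k).
have sk : 0 < s - k by lra.
have c0 : 0 <= c by rewrite divr_ge0// ltW.
have := @increment_le R (fun u => y u * expR (- k * u)) (fun u => c * expR ((s - k) * u))
  (fun u => (y' u - k * y u) * expR (- k * u)) (fun u => r * expR ((s - k) * u)) 0 t t0.
rewrite !mulr0 !expR0 !mulr1 => H.
have {}H : y t * expR (- k * t) - y 0 <= c * expR ((s - k) * t) - c.
  apply: H => [u /andP[u0 _]|u _|u /andP[u0 _]].
  - by apply: der_eq (derM (hy u u0) (is_derive_expRM (- k) u)) _; ring.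
  - apply: der_eq (derZ c (is_derive_expRM (s - k) u)) _.
    by rewrite /c; field; rewrite gt_eqF.
  - have -> : r * expR ((s - k) * u) = (r * expR (s * u)) * expR (- k * u).
      by rewrite -mulrA -expRD; congr (_ * expR _); ring.
    by rewrite ler_wpM2r ?expR_ge0//; have := hle u u0; lra.
have e : y t = (y t * expR (- k * t)) * expR (k * t).
  by rewrite -mulrA -expRD (_ : - k * t + k * t = 0) ?expR0 ?mulr1//; ring.
have e2 : expR ((s - k) * t) * expR (k * t) = expR (s * t).
  by rewrite -expRD; congr expR; ring.
rewrite e (@le_trans _ _ ((`|y 0| + c * expR ((s - k) * t)) * expR (k * t)))//.
  by rewrite ler_wpM2r ?expR_ge0//; have := ler_norm (y 0); lra.
rewrite mulrDl -mulrA e2 mulrDl lerD2r ler_wpM2l// ler_expR ler_wpM2r//.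
exact: ltW.
Qed.

Lemma expR_decay k : k < 0 -> forall e, 0 < e -> exists2 T, 0 <= T & expR (k * T) <= e.
Proof.
move=> k0 e e0; exists (`|ln e| / - k); first by rewrite divr_ge0//; lra.
have -> : k * (`|ln e| / - k) = - `|ln e| by field; rewrite lt_eqF.
rewrite -[leRHS](lnK e0) ler_expR.
by rewrite lerNl -normrN ler_norm.
Qed.

(* A solution of an expanding equation which grows slower than the expansion
   rate is slaved to the forcing term. *)
Lemma slow_growth_bound y y' k r s K : 0 < s -> s < k -> 0 <= r ->
  (forall t, 0 <= t -> is_derive t 1 y (y' t)) ->
  (forall t, 0 <= t -> k * y t - r * expR (s * t) <= y' t) ->
  (forall t, 0 <= t -> y t <= K * expR (s * t)) ->
  forall t, 0 <= t -> y t <= r / (k - s) * expR (s * t).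
Proof.
move=> s0 sk r0 hy hle hK t t0.
pose c := r / (k - s).
have ks : 0 < k - s by lra.
have c0 : 0 <= c by rewrite divr_ge0// ltW.
have main T : t <= T -> y t * expR (- k * t) <=
    c * expR ((s - k) * t) + `|K| * expR ((s - k) * T).
  move=> tT.
  have := @increment_le R (fun u => c * expR ((s - k) * u)) (fun u => y u * expR (- k * u))
    (fun u => - r * expR ((s - k) * u)) (fun u => (y' u - k * y u) * expR (- k * u)) t T tT.
  move=> H.
  have {}H : c * expR ((s - k) * T) - c * expR ((s - k) * t) <=
      y T * expR (- k * T) - y t * expR (- k * t).
    apply: H => [u _|u /andP[u0 _]|u /andP[u0 _]].
    - apply: der_eq (derZ c (is_derive_expRM (s - k) u)) _.
      by rewrite /c; field; rewrite gt_eqF.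
    - by apply: der_eq (derM (hy u (le_trans t0 u0)) (is_derive_expRM (- k) u)) _; ring.
    - have -> : - r * expR ((s - k) * u) = (- r * expR (s * u)) * expR (- k * u).
        by rewrite -mulrA -expRD; congr (_ * expR _); ring.
      by rewrite ler_wpM2r ?expR_ge0//; have := hle u (le_trans t0 u0); lra.
  have : y T * expR (- k * T) <= `|K| * expR ((s - k) * T).
    have -> : `|K| * expR ((s - k) * T) = (`|K| * expR (s * T)) * expR (- k * T).
      by rewrite -mulrA -expRD; congr (_ * expR _); ring.
    rewrite ler_wpM2r ?expR_ge0// (le_trans (hK _ (le_trans t0 tT)))//.
    by rewrite ler_wpM2r ?expR_ge0// ler_norm.
  have : 0 <= c * expR ((s - k) * T) by rewrite mulr_ge0 ?expR_ge0.
  lra.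
(* Letting [T] go to infinity removes the a priori constant [K], because [s < k]: only the future
   forcing remains. *)
have main2 : y t * expR (- k * t) <= c * expR ((s - k) * t).
  apply/ler_addgt0Pr => e e0.
  have K1 : 0 < `|K| + 1 by have := normr_ge0 K; lra.
  have sk0 : s - k < 0 by lra.
  have [T T0 hT] := expR_decay sk0 (divr_gt0 e0 K1).
  have := main (Num.max t T); rewrite le_max lexx => /(_ isT) h.
  have : `|K| * expR ((s - k) * Num.max t T) <= e.
    apply: (@le_trans _ _ (`|K| * (e / (`|K| + 1)))).
      rewrite ler_wpM2l// (le_trans _ hT)// ler_expR.
      by rewrite ler_wnM2l ?(ltW sk0)// le_max lexx orbT.
    rewrite mulrCA ler_piMr// ?(ltW e0)// ler_pdivrMr// mul1r; lra.
  lra.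
have e : y t = (y t * expR (- k * t)) * expR (k * t).
  by rewrite -mulrA -expRD (_ : - k * t + k * t = 0) ?expR0 ?mulr1//; ring.
have -> : c * expR (s * t) = c * expR ((s - k) * t) * expR (k * t).
  by rewrite -mulrA -expRD; congr (_ * expR _); ring.
by rewrite e ler_wpM2r ?expR_ge0.
Qed.

End scalar_comparison.

(** * Estimates for the time-integrated perturbed flow *)

Section dynamics.
Context {R : realType} {V : lmodType R} {ip : V -> V -> R} (hb : psd_form ip).
Context (G W X : {linear V -> V}) (c0 w CX : R).
Hypothesis Gsym : forall u v, ip (G u) v = ip u (G v).
Hypothesis c0_gt0 : 0 < c0.
Hypothesis Gcoer : forall v, c0 * ip (G v) (G v) <= ip (G v) v.
Hypothesis Wsym : forall u v, ip (W u) v = ip u (W v).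
Hypothesis w_gt0 : 0 < w.
Hypothesis Wbd : forall v, psd_norm ip (W v) <= w * psd_norm ip v.
Hypothesis CX_gt0 : 0 < CX.
(** [X] is the first-order term whose subtraction makes [W (L - W)] symmetric on the domain of [L].
    For a Schrödinger operator and multiplication by [W] it is [a |-> W' a'] at [a = G v], and the
    difference starts with [- (W a')']. *)
Hypothesis Xbd : forall v, psd_norm ip (X v) ^+ 2 <= CX * ip (G v) v.
Hypothesis Msym : forall u v, ip (W (u - W (G u)) - X u) (G v) =
  ip (G u) (W (v - W (G v)) - X v).
Hypothesis Mbd : forall v, `|ip (W (v - W (G v)) - X v) (G v)| <= CX * ip (G v) v.

Local Notation nm := (psd_norm ip).
Local Notation vder := (@vder R V ip).
Local Notation vcont := (@vcont R V ip).
Local Notation qf := (@qf R V ip G).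
Local Notation zf := (@zf R V ip G).
Local Notation nf := (@nf R V ip G W).
Let qf_psd : psd_form qf := qf_psd hb Gsym c0_gt0 Gcoer.
Let zf_psd : psd_form zf := zf_psd hb Gsym c0_gt0 Gcoer.

(** The system [a' = L b + ea], [b' = - (L - W) a + eb] is used in integrated form: with [A = G p]
    and [B = G s] primitives of [a] and [b], it reads [a = L B + al] and [b = be - (L - W) A]. No
    derivative of [a] or [b] is assumed. *)
Variables (a b ea eb p s al be : R -> V).
Implicit Types (t : R).
Let A t := G (p t).
Let B t := G (s t).
Hypothesis hA : forall t, vder A t (a t).
Hypothesis hB : forall t, vder B t (b t).
Hypothesis hal : forall t, vder al t (ea t).
Hypothesis hbe : forall t, vder be t (eb t).
Hypothesis ca : forall t, vcont a t.
Hypothesis cb : forall t, vcont b t.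
Hypothesis cea : forall t, vcont ea t.
Hypothesis ceb : forall t, vcont eb t.
Hypothesis hs : forall t, s t = a t - al t.
Hypothesis hp : forall t, p t - W (G (p t)) = be t - b t.

Let cal t : vcont al t := vder_vcont hb (hal t).
Let cbe t : vcont be t := vder_vcont hb (hbe t).
Let cA t : vcont A t := vder_vcont hb (hA t).

Lemma vcont_eq (u v : R -> V) t : u =1 v -> vcont u t -> vcont v t.
Proof. by move=> /funext ->. Qed.

Lemma s_cont t : vcont s t.
Proof. by apply: (@vcont_eq (fun t => a t - al t)) => [u|]; [rewrite hs|exact: vcontB]. Qed.

Lemma hp' t : p t = be t - b t + W (A t).
Proof. by rewrite -hp subrK. Qed.

Lemma p_cont t : vcont p t.
Proof.
apply: (@vcont_eq (fun t => be t - b t + W (A t))) => [u|]; first by rewrite -hp'.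
by apply: (vcontD hb); [exact: vcontB|exact: (vcont_map Wbd (cA t))].
Qed.

Lemma X_lipschitz v : nm (X v) <= Num.sqrt (CX / c0) * nm v.
Proof.
rewrite -(@ler_pXn2r _ 2)// ?nnegrE ?mulr_ge0 ?sqrtr_ge0 ?nm_ge0//.
have c00 : 0 <= CX / c0 by rewrite divr_ge0 ?(ltW CX_gt0) ?(ltW c0_gt0).
rewrite exprMn (sqr_sqrtr c00) (le_trans (Xbd v))// -mulrA ler_wpM2l ?(ltW CX_gt0)//.
rewrite (le_trans (ler_norm _))// (le_trans (psd_CS_nm hb _ _))//.
rewrite expr2 mulrA ler_wpM2r ?nm_ge0// mulrC ler_pdivlMr// mulrC.
exact: (nm_G_le hb).
Qed.

Lemma der_n t : is_derive t 1 (fun t => nf (p t) (p t)) (2 * ip (be t - b t) (a t)).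
Proof.
rewrite -hp; apply: (is_derive_quad hb (T := fun t => p t - W (G (p t))) (hA t)).
  apply: (@vcont_eq (fun t => be t - b t)) => [u|]; first by rewrite hp.
  exact: vcontB.
by move=> u; rewrite -/(nf (p u) (p t)) (nfC hb Gsym Wsym).
Qed.

Lemma der_q t : is_derive t 1 (fun t => qf (s t) (s t)) (2 * ip (a t - al t) (b t)).
Proof.
have e : (fun t => qf (s t) (s t)) = (fun t => ip (s t) (B t)).
  by apply/funext => u; rewrite /qf (psdC hb).
rewrite e -hs; apply: (is_derive_quad hb (hB t)); first exact: s_cont.
by move=> u; rewrite /B -Gsym (psdC hb).
Qed.

Lemma der_zeta t : is_derive t 1 (fun t => zf (p t) (p t)) (2 * ip (G (A t)) (a t)).
Proof.
apply: (is_derive_quad hb (T := fun t => G (A t)) (hA t)).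
  have Gl v : nm (G v) <= c0^-1 * nm v.
    by rewrite mulrC ler_pdivlMr// mulrC; exact: nm_G_le.
  exact: (vcont_map Gl (cA t)).
by move=> u; rewrite Gsym (psdC hb).
Qed.

(** This is the symmetric operator [W (L - W) - X] applied to [A]; the equation is used to express
    it by quantities that are visibly continuous in time. *)
Let T t := W (be t - b t) - X (p t).

Lemma T_E t : T t = W (p t - W (G (p t))) - X (p t).
Proof. by rewrite hp. Qed.

Lemma der_M t : is_derive t 1 (fun t => ip (T t) (A t)) (2 * ip (T t) (a t)).
Proof.
apply: (is_derive_quad hb (hA t)).
  apply: (vcontB hb); first exact: (vcont_map Wbd (vcontB hb (cbe t) (cb t))).
  exact: (vcont_map X_lipschitz (p_cont t)).
by move=> u; rewrite !T_E Msym (psdC hb).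
Qed.

(** Uniformity in the base point [x], which [is_derive_limit] requires, comes from the continuity of
    the derivative around [t]. *)
Lemma quotient_near (u u' : R -> V) t e : 0 < e ->
  (forall t, vder u t (u' t)) -> (forall t, vcont u' t) ->
  exists2 d, 0 < d & forall k x, 0 < k < d -> `|x - t| < d ->
    nm (k^-1 *: (u (x + k) - u x) - u' t) <= e.
Proof.
move=> e0 hu cu; have [d d0 H] := cu t e e0.
exists (d / 2) => [|k x /andP[k0 kd] xd]; first by rewrite divr_gt0.
apply: (vdiff_quotient_close hb k0) => [y _|y yxk]; first exact: hu.
apply: H; move: xd yxk; rewrite !ltr_norml; lra.
Qed.

(* [a] and [b] are not regular enough to pair [L b] with [a]: the identity is
   obtained for the difference quotients of their primitives. *)
Lemma der_normsq t : is_derive t 1 (fun t => ip (a t) (a t) + ip (b t) (b t))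
  (2 * (ip (W (a t)) (b t) + ip (a t) (ea t) + ip (b t) (eb t))).
Proof.
pose D (u : R -> V) k x := k^-1 *: (u (x + k) - u x).
apply: (@is_derive_limit R _
  (fun k x => ip (D A k x) (D A k x) + ip (D B k x) (D B k x))
  (fun k x => 2 * (ip (W (D A k x)) (D B k x) + ip (D A k x) (D al k x)
      + ip (D B k x) (D be k x)))).
- move=> x e e0; have e2 : 0 < e / 2 by rewrite divr_gt0.
  have [d1 d10 h1] := ip_close hb (a x) (a x) e2.
  have [d2 d20 h2] := ip_close hb (b x) (b x) e2.
  have [r1 r10 k1] := quotient_near x d10 hA ca.
  have [r2 r20 k2] := quotient_near x d20 hB cb.
  exists (Num.min r1 r2); first by rewrite lt_min r10.
  move=> k; rewrite lt_min => /andP[k0 /andP[kr1 kr2]].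
  have x0 (r : R) : 0 < r -> `|x - x| < r by rewrite subrr normr0.
  have := k1 k x; rewrite k0 kr1 => /(_ isT (x0 _ r10)) q1.
  have := k2 k x; rewrite k0 kr2 => /(_ isT (x0 _ r20)) q2.
  have := h1 _ _ q1 q1; have := h2 _ _ q2 q2; rewrite !ler_norml /D; lra.
- move=> k x k0.
  have sh (u u' : R -> V) : (forall t, vder u t (u' t)) ->
      vder (D u k) x (k^-1 *: (u' (x + k) - u' x)).
    move=> hu; apply: vderZ => //; apply: vderB => //.
    exact: (vder_shift (hu _)).
  have dA := sh _ _ hA; have dB := sh _ _ hB.
  apply: der_eq (derD (is_derive_ip hb dA dA) (is_derive_ip hb dB dB)) _.
  rewrite -/(D a k x) -/(D b k x).
  (* The difference quotients satisfy the integrated system with [D A = G P] and [D B = G (D s)], so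
     the two occurrences of [ip P (D B)] cancel by symmetry of [G]. *)
  have Da : D a k x = D s k x + D al k x.
    by rewrite /D !hs -scalerDr opprB addrACA subrK addrAC subrr add0r.
  pose P := k^-1 *: (p (x + k) - p x).
  have DA : D A k x = G P by rewrite /D /A /P (linearZZ G) (linearB G).
  have DB : D B k x = G (D s k x) by rewrite /D /B (linearZZ G) (linearB G).
  have Db : D b k x = D be k x - (P - W (G P)).
    have bE y : b y = be y - (p y - W (G (p y))) by rewrite hp opprB addrC subrK.
    have -> : P - W (G P) = k^-1 *: ((p (x + k) - W (G (p (x + k)))) - (p x - W (G (p x)))).
      rewrite /P (linearZZ G) (linearZZ W) -scalerBr (linearB G) (linearB W).
      by rewrite !opprB addrACA [in RHS]addrACA (addrC (- p x)).
    rewrite /D !bE -scalerBr; congr (_ *: _).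
    by rewrite !opprD !opprK [in RHS]addrACA.
  have h1 : ip (D a k x) (D A k x) = ip P (D B k x) + ip (D al k x) (D A k x).
    by rewrite Da (psdDl hb) DA DB -Gsym (psdC hb).
  have h2 : ip (D b k x) (D B k x) = ip (D be k x) (D B k x) - ip P (D B k x)
      + ip (W (D A k x)) (D B k x).
    by rewrite Db (psdBl hb) (psdBl hb) -DA; ring.
  rewrite (psdC hb (D A k x) (D a k x)) (psdC hb (D B k x) (D b k x)) h1 h2.
  rewrite (psdC hb (D A k x) (D al k x)) (psdC hb (D B k x) (D be k x)); ring.
- move=> e e0; have e6 : 0 < e / 6 by rewrite divr_gt0.
  have [d1 d10 h1] := ip_close hb (W (a t)) (b t) e6.
  have [d2 d20 h2] := ip_close hb (a t) (ea t) e6.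
  have [d3 d30 h3] := ip_close hb (b t) (eb t) e6.
  pose d := Num.min d1 (Num.min d2 d3).
  have d0 : 0 < d by rewrite !lt_min d10 d20 d30.
  have d_gt0 : 0 < Num.min d (d / w) by rewrite lt_min d0 divr_gt0.
  have le_d (r : R) : r <= Num.min d (d / w) -> [/\ r <= d1, r <= d2, r <= d3 & w * r <= d1].
    rewrite !le_min -!andbA => /and4P[-> -> -> h]; split => //.
    have : r <= d / w by apply: le_trans h _; rewrite /d.
    rewrite ler_pdivlMr// mulrC => /le_trans; apply.
    by rewrite /d ge_min lexx.
  have [r1 r10 k1] := quotient_near t d_gt0 hA ca.
  have [r2 r20 k2] := quotient_near t d_gt0 hB cb.
  have [r3 r30 k3] := quotient_near t d_gt0 hal cea.
  have [r4 r40 k4] := quotient_near t d_gt0 hbe ceb.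
  exists (Num.min (Num.min r1 r2) (Num.min r3 r4)); first by rewrite !lt_min r10 r20 r30.
  move=> k x; rewrite !lt_min => /andP[k0 /andP[/andP[q1 q2] /andP[q3 q4]]].
  move=> /andP[/andP[x1 x2] /andP[x3 x4]].
  have := k1 k x; rewrite k0 q1 => /(_ isT x1)/le_d[] A1 A2 A3 A4.
  have := k2 k x; rewrite k0 q2 => /(_ isT x2)/le_d[] B1 B2 B3 B4.
  have := k3 k x; rewrite k0 q3 => /(_ isT x3)/le_d[] C1 C2 C3 C4.
  have := k4 k x; rewrite k0 q4 => /(_ isT x4)/le_d[] E1 E2 E3 E4.
  have A5 : nm (W (D A k x) - W (a t)) <= d1.
    by rewrite -linearB (le_trans (Wbd _)).
  have := h1 _ _ A5 B1; have := h2 _ _ A2 C2; have := h3 _ _ B3 E3.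
  rewrite !ler_norml -/(D A k x) -/(D B k x) -/(D al k x) -/(D be k x).
  by lra.
Qed.


(** [tau] bounds both the residual of the approximate mode [x] and the relative size of the error,
    [K] bounds the initial quantities, and [F] is the best constant in
    [|(a, b)| <= F e^(lam t / 2)], as [hF] and [Fsup] express together. *)
Variables (lam tau F K c3 C3 : R) (x : V).
Hypothesis lam_gt0 : 0 < lam.
Hypothesis tau01 : 0 <= tau <= 1.
Hypothesis F_ge0 : 0 <= F.
Hypothesis K_ge0 : 0 <= K.
Hypothesis c3_gt0 : 0 < c3.
Hypothesis C3_gt0 : 0 < C3.
Let L0 := lam ^+ 2.
Hypothesis p0 : p 0 = x.
Hypothesis s0 : s 0 = lam *: G x.
Hypothesis al0 : al 0 = 0.
Hypothesis be0 : be 0 = 0.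
Hypothesis defect : nm (eig_defect G W L0 x) <= tau.
Hypothesis zx : 1 / 4 <= zf x x.
Hypothesis coer : forall v, c3 * qf v v - C3 * (zf x v) ^+ 2 <= nf v v + L0 / 16 * zf v v.
Hypothesis Kx : [/\ nm (G x) <= K, nm (G (G x)) <= K & qf x x <= K].
Hypothesis KP : `|nf x x + qf (s 0) (s 0) + 2 * (L0 / 16) * zf x x| <= K.
Hypothesis K0 : ip (a 0) (a 0) + ip (b 0) (b 0) <= K.
Hypothesis err : forall t, ip (ea t) (ea t) + ip (eb t) (eb t) <=
  tau ^+ 2 * (ip (a t) (a t) + ip (b t) (b t)).
(** The reference rate lies strictly between [lam / 4], at which the modified energy may grow, and
    the rate [lam] of the mode. Both gaps are needed to integrate the forcing. *)
Let sg := lam / 2.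
Let ex t := expR (sg * t).
Hypothesis hF : forall t, 0 <= t -> ip (a t) (a t) + ip (b t) (b t) <= (F * ex t) ^+ 2.
Hypothesis Fsup : forall M : R, (forall t, 0 <= t ->
  ip (a t) (a t) + ip (b t) (b t) <= M * ex t ^+ 2) -> F ^+ 2 <= M.

Let sg_gt0 : 0 < sg. Proof. by rewrite divr_gt0. Qed.
Let tau_ge0 : 0 <= tau. Proof. by case/andP: tau01. Qed.
Let tau_le1 : tau <= 1. Proof. by case/andP: tau01. Qed.
Let L0_gt0 : 0 < L0. Proof. by rewrite exprn_gt0. Qed.
Let ex_ge0 t : 0 <= ex t. Proof. exact: expR_ge0. Qed.
Let ex_ge1 t : 0 <= t -> 1 <= ex t.
Proof. by move=> t0; rewrite -[leLHS]expR0 ler_expR mulr_ge0// ltW. Qed.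
Let ex0 : ex 0 = 1. Proof. by rewrite /ex mulr0 expR0. Qed.
Let ex_sqr t : ex t ^+ 2 = expR (2 * sg * t).
Proof. by rewrite expr2 -expRD; congr expR; ring. Qed.
Let der_ex t (c : R) : is_derive t 1 (fun t => c / sg * ex t) (c * ex t).
Proof.
by apply: der_eq (derZ (c / sg) (is_derive_expRM sg t)) _; rewrite mulrA divfK// gt_eqF.
Qed.

Let bnd_ab t : 0 <= t -> nm (a t) <= F * ex t /\ nm (b t) <= F * ex t.
Proof.
move=> t0; have Fe : 0 <= F * ex t by rewrite mulr_ge0.
have := hF t0; have := psd_ge0 hb (a t); have := psd_ge0 hb (b t) => b0 a0 h.
by split; apply: (nm_le hb Fe); lra.
Qed.

Let bnd_e t : 0 <= t -> nm (ea t) <= tau * F * ex t /\ nm (eb t) <= tau * F * ex t.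
Proof.
move=> t0; have Fe : 0 <= tau * F * ex t by rewrite !mulr_ge0.
have := err t; have := psd_ge0 hb (ea t); have := psd_ge0 hb (eb t) => b0 a0 h.
have h2 : tau ^+ 2 * (ip (a t) (a t) + ip (b t) (b t)) <= (tau * F * ex t) ^+ 2.
  by rewrite -mulrA [leRHS]exprMn ler_wpM2l ?sqr_ge0// hF.
by split; apply: (nm_le hb Fe); lra.
Qed.

(** Integrating a quantity of size [e^(sg t)] costs only the factor [1 / sg], with no loss in the
    rate. *)
Let bnd_int (u u' : R -> V) (c : R) t : 0 <= c -> 0 <= t -> (forall t, vder u t (u' t)) ->
  (forall t, 0 <= t -> nm (u' t) <= c * ex t) -> nm (u t - u 0) <= c / sg * ex t.
Proof.
move=> c_ge0 t0 hu h.
have := @vincrement_le _ _ _ hb u u' (fun t => c / sg * ex t) (fun t => c * ex t) 0 t t0.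
move=> /(_ (fun y _ => hu y) (fun y _ => der_ex y c)) H.
have {}H := H (fun y hy => h y (proj1 (andP hy))).
have cs : 0 <= c / sg by rewrite divr_ge0// ltW.
by rewrite (le_trans H)// ex0 mulr1 lerBlDr lerDl.
Qed.

Let bnd_al t : 0 <= t -> nm (al t) <= tau * F / sg * ex t /\ nm (be t) <= tau * F / sg * ex t.
Proof.
move=> t0; have c0' : 0 <= tau * F by rewrite mulr_ge0.
have := bnd_int c0' t0 hal (fun y hy => proj1 (bnd_e hy)).
have := bnd_int c0' t0 hbe (fun y hy => proj2 (bnd_e hy)).
by rewrite al0 be0 !subr0.
Qed.

Let bnd_A t : 0 <= t -> nm (A t) <= (K + F / sg) * ex t.
Proof.
move=> t0; have := bnd_int F_ge0 t0 hA (fun y hy => proj1 (bnd_ab hy)).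
have := nmD hb (A t - A 0) (A 0); rewrite subrK {2 4}/A p0 => h1 h2.
have [h3 _ _] := Kx; have h4 : K * 1 <= K * ex t by rewrite ler_wpM2l// ex_ge1.
lra.
Qed.

Definition Crho := (lam + 1) * (K / sg) + K + sg^-1.
Let rho := tau * (1 + F) * Crho.
(** Components of [A] and [B] along the approximate mode. Up to [e1] and [e2] they solve [za' = zb],
    [zb' = lam^2 za], which [lam za + zb] and [lam za - zb] diagonalise. *)
Let za t := ip (A t) (G (G x)).
Let zb t := ip (B t) (G x).
Let e1 t := ip (al t) (G (G x)).
Let e2 t := ip (be t) (G x) - ip (eig_defect G W L0 x) (A t).

Let isg_gt0 : 0 < sg^-1. Proof. by rewrite invr_gt0. Qed.
Let Crho_ge0 : 0 <= Crho.
Proof.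
by rewrite /Crho !addr_ge0// ?mulr_ge0 ?invr_ge0 ?(ltW sg_gt0)// ?addr_ge0 ?(ltW lam_gt0).
Qed.
Let rho_ge0 : 0 <= rho.
Proof. by rewrite /rho mulr_ge0// mulr_ge0// addr_ge0. Qed.

Let der_za t : is_derive t 1 za (zb t + e1 t).
Proof.
apply: der_eq (is_derive_ip hb (hA t) (vder_cst hb (G (G x)) t)) _.
rewrite (psdC hb (A t)) (psd0l hb) addr0 (_ : a t = s t + al t); last by rewrite hs subrK.
by rewrite (psdDl hb) -Gsym.
Qed.

Let der_zb t : is_derive t 1 zb (L0 * za t + e2 t).
Proof.
apply: der_eq (is_derive_ip hb (hB t) (vder_cst hb (G x) t)) _.
rewrite (psdC hb (B t)) (psd0l hb) addr0.
rewrite (_ : b t = be t - (p t - W (G (p t)))); last by rewrite hp opprB addrC subrK.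
rewrite (psdBl hb) -/(nf (p t) x) (nfC hb Gsym Wsym) /e2 /eig_defect (psdDl hb) (psdZl hb).
by rewrite -/(nf x (p t)) /za (psdC hb (A t)); ring.
Qed.

(** Every term carries a factor [tau]: [al] and [be] are primitives of the errors, and the last part
    of [e2] is the residual of [x] paired with [A]. *)
Let bnd_e12 t : 0 <= t -> lam * `|e1 t| + `|e2 t| <= rho * ex t.
Proof.
move=> t0; have [k1 k2 _] := Kx; have [l1 l2] := bnd_al t0; have l3 := bnd_A t0.
have c1 := psd_CS_nm hb (al t) (G (G x)); have c2 := psd_CS_nm hb (be t) (G x).
have c4 := psd_CS_nm hb (eig_defect G W L0 x) (A t).
have m1 : nm (al t) * nm (G (G x)) <= tau * F / sg * ex t * K by rewrite ler_pM// nm_ge0.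
have m2 : nm (be t) * nm (G x) <= tau * F / sg * ex t * K by rewrite ler_pM// nm_ge0.
have m3 : nm (eig_defect G W L0 x) * nm (A t) <= tau * ((K + F / sg) * ex t).
  by rewrite ler_pM// nm_ge0.
have d : `|e2 t| <= tau * F / sg * ex t * K + tau * ((K + F / sg) * ex t).
  by rewrite (le_trans (ler_normB _ _))// lerD// ?(le_trans c2)// (le_trans c4).
have d1 : lam * `|e1 t| <= lam * (tau * F / sg * ex t * K).
  by rewrite ler_wpM2l ?(ltW lam_gt0)// (le_trans c1).
have -> : rho * ex t = lam * (tau * F / sg * ex t * K) +
   (tau * F / sg * ex t * K + tau * ((K + F / sg) * ex t)) +
   tau * ex t * ((lam + 1) * (K / sg) + F * K + sg^-1).
  by rewrite /rho /Crho; ring.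
have : 0 <= tau * ex t * ((lam + 1) * (K / sg) + F * K + sg^-1).
  apply: mulr_ge0; first exact: mulr_ge0.
  by rewrite !addr_ge0// ?mulr_ge0 ?invr_ge0 ?(ltW sg_gt0)// ?addr_ge0 ?(ltW lam_gt0).
lra.
Qed.


(** Crude bound without a factor [tau]. Only its growth rate matters: it is the a priori information
    consumed by [slow_growth_bound]. *)
Let bnd_zab t : 0 <= t -> `|lam * za t + zb t| <= (lam * K + K) * (K + lam * K + F / sg) * ex t.
Proof.
move=> t0; have [k1 k2 _] := Kx; have l3 := bnd_A t0.
have l4 : nm (B t) <= (lam * K + F / sg) * ex t.
  have := bnd_int F_ge0 t0 hB (fun y hy => proj2 (bnd_ab hy)).
  have := nmD hb (B t - B 0) (B 0); rewrite subrK {2 4}/B s0 (linearZZ G) (nmZ hb).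
  rewrite (ger0_norm (ltW lam_gt0)) => h1 h2.
  have h3 : lam * nm (G (G x)) <= lam * K by rewrite ler_wpM2l// ltW.
  have h4 : lam * K * 1 <= lam * K * ex t.
    by rewrite ler_wpM2l ?ex_ge1// mulr_ge0// ltW.
  lra.
have c1 := psd_CS_nm hb (A t) (G (G x)).
have c2 := psd_CS_nm hb (B t) (G x).
have Fs : 0 <= F / sg by rewrite divr_ge0// ltW.
have lK : 0 <= lam * K by rewrite mulr_ge0// ltW.
have Kp := K_ge0.
have m1 : nm (A t) * nm (G (G x)) <= (K + lam * K + F / sg) * ex t * K.
  apply: ler_pM; rewrite ?nm_ge0// (le_trans l3)// ler_wpM2r//; lra.
have m2 : nm (B t) * nm (G x) <= (K + lam * K + F / sg) * ex t * K.
  apply: ler_pM; rewrite ?nm_ge0// (le_trans l4)// ler_wpM2r//; lra.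
have m3 : lam * `|za t| <= lam * ((K + lam * K + F / sg) * ex t * K).
  by rewrite ler_wpM2l ?(ltW lam_gt0)// (le_trans c1).
have m4 : `|lam * za t + zb t| <= lam * `|za t| + `|zb t|.
  by rewrite (le_trans (ler_normD _ _))// normrM (ger0_norm (ltW lam_gt0)).
rewrite (le_trans m4)// (le_trans (lerD m3 (le_trans c2 m2)))//.
by rewrite le_eqVlt; apply/orP; left; apply/eqP; ring.
Qed.

(** The combination expands at rate [lam] but is known to grow at most at rate [lam / 2], hence it
    is determined by the forcing alone. The sign [c] takes care of the absolute value. *)
Let bnd_zp t : 0 <= t -> `|lam * za t + zb t| <= 2 * rho / lam * ex t.
Proof.
move=> t0.
suff key (c : R) : `|c| = 1 -> c * (lam * za t + zb t) <= 2 * rho / lam * ex t.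
  rewrite ler_norml; apply/andP; split.
    by have := key (-1); rewrite normrN1 => /(_ erefl); lra.
  by have := key 1; rewrite normr1 => /(_ erefl); lra.
move=> c1; have e : 2 * rho / lam = rho / (lam - sg).
  have -> : lam - sg = lam / 2 by rewrite /sg; field.
  by field; rewrite gt_eqF.
rewrite e; move: t t0.
apply: (@slow_growth_bound _ (fun t => c * (lam * za t + zb t))
  (fun t => c * (lam * (zb t + e1 t) + (L0 * za t + e2 t))) lam rho sg
  ((lam * K + K) * (K + lam * K + F / sg))) => //.
- by have := lam_gt0; rewrite /sg; lra.
- by move=> t _; apply: derZ; apply: derD; [exact: derZ|].
- move=> t t0; have := bnd_e12 t0.
  have -> : lam * (zb t + e1 t) + (L0 * za t + e2 t) =
    lam * (lam * za t + zb t) + (lam * e1 t + e2 t) by rewrite /L0; ring.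
  have n : `|c * (lam * e1 t + e2 t)| <= lam * `|e1 t| + `|e2 t|.
    rewrite normrM c1 mul1r (le_trans (ler_normD _ _))// normrM.
    by rewrite (ger0_norm (ltW lam_gt0)).
  by have := ler_norm (- (c * (lam * e1 t + e2 t))); rewrite normrN /ex; lra.
- move=> t t0; rewrite (le_trans (ler_norm _))// normrM c1 mul1r; exact: bnd_zab.
Qed.

(** The contracting combination starts from 0, by the choice [s 0 = lam *: G x], and only
    accumulates forcing. *)
Let bnd_zm t : 0 <= t -> `|lam * za t - zb t| <= 2 * rho / lam * ex t.
Proof.
move=> t0.
have rl : rho / (sg - - lam) <= 2 * rho / lam.
  rewrite ler_pdivrMr; last by have := lam_gt0; have := sg_gt0; lra.
  have -> : 2 * rho / lam * (sg - - lam) = 3 * rho.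
    by rewrite /sg; field; rewrite gt_eqF.
  by have := rho_ge0; lra.
have z0 : lam * za 0 - zb 0 = 0.
  by rewrite /za /zb /A /B p0 s0 (linearZZ G) (psdZl hb) (psdC hb (G x)) subrr.
suff key (c : R) : `|c| = 1 -> c * (lam * za t - zb t) <= rho / (sg - - lam) * ex t.
  have h0 : rho / (sg - - lam) * ex t <= 2 * rho / lam * ex t by rewrite ler_wpM2r.
  rewrite ler_norml; apply/andP; split.
    by have := key (-1); rewrite normrN1 => /(_ erefl); lra.
  by have := key 1; rewrite normr1 => /(_ erefl); lra.
move=> c1.
have := @growth_upper_bound _ (fun t => c * (lam * za t - zb t))
  (fun t => c * (lam * (zb t + e1 t) - (L0 * za t + e2 t))) (- lam) rho sg.
rewrite z0 mulr0 normr0 add0r; apply=> //.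
- by have := lam_gt0; have := sg_gt0; lra.
- by move=> u _; apply: derZ; apply: derB; [exact: derZ|].
- move=> u u0; have := bnd_e12 u0.
  have -> : lam * (zb u + e1 u) - (L0 * za u + e2 u) =
    - lam * (lam * za u - zb u) + (lam * e1 u - e2 u) by rewrite /L0; ring.
  have n : `|c * (lam * e1 u - e2 u)| <= lam * `|e1 u| + `|e2 u|.
    rewrite normrM c1 mul1r (le_trans (ler_normB _ _))// normrM.
    by rewrite (ger0_norm (ltW lam_gt0)).
  by have := ler_norm (c * (lam * e1 u - e2 u)); rewrite /ex; lra.
Qed.

Let zr := 2 * rho / L0.

Let bnd_za t : 0 <= t -> `|za t| <= zr * ex t.
Proof.
move=> t0; have h1 := bnd_zp t0; have h2 := bnd_zm t0.
have e : lam * `|za t| = `|(lam * za t + zb t + (lam * za t - zb t)) / 2|.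
  by rewrite -[in LHS](ger0_norm (ltW lam_gt0)) -normrM; congr (`|_|); field.
rewrite -(ler_pM2l lam_gt0) e normrM (ger0_norm (x := 2^-1)) ?invr_ge0//.
have := ler_normD (lam * za t + zb t) (lam * za t - zb t).
have -> : lam * (zr * ex t) = 2 * rho / lam * ex t.
  by rewrite /zr /L0; field; rewrite gt_eqF.
lra.
Qed.

(** At time 0 the expanding combination is [2 lam zf x x], which is bounded below, although [bnd_zp]
    makes it at most of the order of the forcing. Hence [F] has to be of order [1 / tau]. *)
Lemma rho_lower : L0 <= 4 * rho.
Proof.
have := bnd_zp (lexx 0); rewrite ex0 mulr1 => /(le_trans (ler_norm _)).
have -> : lam * za 0 + zb 0 = 2 * lam * zf x x.
  by rewrite /za /zb /zf /A /B p0 s0 (linearZZ G) (psdZl hb) (psdC hb (G x)); ring.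
rewrite ler_pdivlMr//.
have -> : 2 * lam * zf x x * lam = 2 * L0 * zf x x by rewrite /L0; ring.
have : L0 * (1 / 4) <= L0 * zf x x by rewrite ler_wpM2l// ltW.
lra.
Qed.

(** The first two terms form the conserved energy of the unperturbed flow. The added multiple of
    [zf] makes the coercivity estimate applicable, at the price of a growth rate [2 mu], where
    [mu^2 = m]. *)
Let P t := nf (p t) (p t) + qf (s t) (s t) + 2 * (L0 / 16) * zf (p t) (p t).
Let m := L0 / 16.
Let mu := lam / 4.
Let Rr := 2 * mu * (C3 * zr ^+ 2) + 4 * (tau * F / sg * F) +
  4 * m * (c0^-1 * (K + F / sg) * (tau * F / sg)).

Let m_gt0 : 0 < m. Proof. by rewrite divr_gt0. Qed.
Let mu_gt0 : 0 < mu. Proof. by rewrite divr_gt0. Qed.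
Let zr_ge0 : 0 <= zr. Proof. by rewrite /zr divr_ge0 ?(ltW L0_gt0)// mulr_ge0. Qed.
Let tF_ge0 : 0 <= tau * F / sg. Proof. by rewrite divr_ge0 ?(ltW sg_gt0)// mulr_ge0. Qed.
Let KF_ge0 : 0 <= K + F / sg. Proof. by rewrite addr_ge0// divr_ge0// ltW. Qed.
Let Rr_ge0 : 0 <= Rr.
Proof.
have ? := ltW mu_gt0; have ? := ltW m_gt0; have ? := ltW C3_gt0.
have ? : 0 <= c0^-1 by rewrite invr_ge0 ltW.
apply: addr_ge0; first apply: addr_ge0.
- by apply: mulr_ge0; [exact: mulr_ge0|rewrite mulr_ge0// sqr_ge0].
- by apply: mulr_ge0 => //; exact: mulr_ge0.
- by apply: mulr_ge0; [exact: mulr_ge0|apply: mulr_ge0 => //; exact: mulr_ge0].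
Qed.

(** Coercivity at [p t]: the bad direction enters through [zf x (p t) = za t], which [bnd_za] has
    already bounded by the forcing. *)
Let coerP t : 0 <= t -> m * zf (p t) (p t) + qf (s t) (s t) + c3 * qf (p t) (p t) <=
   P t + C3 * zr ^+ 2 * ex t ^+ 2.
Proof.
move=> t0; have := coer (p t); rewrite -/m.
have -> : zf x (p t) = za t by rewrite /zf /za (psdC hb).
have : C3 * za t ^+ 2 <= C3 * (zr ^+ 2 * ex t ^+ 2).
  rewrite ler_wpM2l ?(ltW C3_gt0)// -exprMn -[leLHS]real_normK ?num_real//.
  have h := bnd_za t0; apply: lerXn2r => //; rewrite nnegrE//.
  exact: mulr_ge0.
by rewrite /P -/m; lra.
Qed.

Let der_P t : is_derive t 1 P (2 * ip (be t) (a t) - 2 * ip (al t) (b t)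
  + 4 * m * qf (G (p t)) (s t) + 4 * m * ip (G (A t)) (al t)).
Proof.
apply: der_eq (derD (derD (der_n t) (der_q t)) (derZ (2 * (L0 / 16)) (der_zeta t))) _.
have -> : ip (G (A t)) (a t) = qf (G (p t)) (s t) + ip (G (A t)) (al t).
  by rewrite /qf -/(A t) hs (psdBr hb) subrK.
by rewrite !(psdBl hb) (psdC hb (b t)) /m; ring.
Qed.

Let bnd_P t : 0 <= t -> P t <= (K + Rr / (2 * sg - 2 * mu)) * ex t ^+ 2.
Proof.
move=> t0; have := @growth_upper_bound _ P (fun t => 2 * ip (be t) (a t) - 2 * ip (al t) (b t)
  + 4 * m * qf (G (p t)) (s t) + 4 * m * ip (G (A t)) (al t)) (2 * mu) Rr (2 * sg).
move=> H; have {}H : P t <= (`|P 0| + Rr / (2 * sg - 2 * mu)) * expR (2 * sg * t).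
  apply: H => //; first by have := lam_gt0; rewrite /mu /sg; lra.
  move=> u u0; have := coerP u0; rewrite -ex_sqr.
  have q0 : 0 <= qf (p u) (p u) := psd_ge0 qf_psd _.
  have q1 : 0 <= qf (s u) (s u) := psd_ge0 qf_psd _.
  have z1 : 0 <= zf (p u) (p u) := psd_ge0 zf_psd _.
  have [a1 b1] := bnd_ab u0; have [al1 be1] := bnd_al u0; have A1 := bnd_A u0.
  have h1 : ip (be u) (a u) <= tau * F / sg * F * ex u ^+ 2.
    rewrite (le_trans (ler_norm _))// (le_trans (psd_CS_nm hb _ _))//.
    have -> : tau * F / sg * F * ex u ^+ 2 = tau * F / sg * ex u * (F * ex u) by ring.
    by rewrite ler_pM ?nm_ge0.
  have h2 : - ip (al u) (b u) <= tau * F / sg * F * ex u ^+ 2.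
    rewrite (le_trans (ler_norm _))// normrN (le_trans (psd_CS_nm hb _ _))//.
    have -> : tau * F / sg * F * ex u ^+ 2 = tau * F / sg * ex u * (F * ex u) by ring.
    by rewrite ler_pM ?nm_ge0.
  have h3 : 4 * m * ip (G (A u)) (al u) <=
     4 * m * (c0^-1 * (K + F / sg) * (tau * F / sg)) * ex u ^+ 2.
    rewrite -[leRHS]mulrA ler_wpM2l//; first by rewrite mulr_ge0// ltW.
    rewrite (le_trans (ler_norm _))// (le_trans (psd_CS_nm hb _ _))//.
    have -> : c0^-1 * (K + F / sg) * (tau * F / sg) * ex u ^+ 2 =
      (c0^-1 * ((K + F / sg) * ex u)) * (tau * F / sg * ex u) by ring.
    rewrite ler_pM ?nm_ge0//.
    have Gl v : nm (G v) <= c0^-1 * nm v.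
      by rewrite mulrC ler_pdivlMr// mulrC; exact: (nm_G_le hb).
    by rewrite (le_trans (Gl _))// ler_wpM2l// invr_ge0 ltW.
  (* The only term of the derivative without a small factor. Cauchy-Schwarz for [qf], balanced by
     [mu^2 = m], bounds it by [2 mu] times the coercive part of the energy. *)
  have h4 : 4 * m * qf (G (p u)) (s u) <=
     2 * mu * (m * zf (p u) (p u) + qf (s u) (s u)).
    have -> : 4 * m * qf (G (p u)) (s u) = 4 * mu * (mu * qf (G (p u)) (s u)).
      by rewrite /m /mu /L0; field.
    have : mu * qf (G (p u)) (s u) <= (m * zf (p u) (p u) + qf (s u) (s u)) / 2.
      apply: le_mean_of_sqr => //; first by rewrite mulr_ge0// ltW.
      have -> : m = mu ^+ 2 by rewrite /m /mu /L0; field.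
      rewrite exprMn -[leRHS]mulrA ler_wpM2l ?sqr_ge0//.
      by have := psd_CS qf_psd (G (p u)) (s u).
    by move=> /(ler_wpM2l (ltW mu_gt0)); lra.
  move=> h5; have h6 := ler_wpM2l (ltW mu_gt0) h5.
  have h7 : 0 <= mu * (c3 * qf (p u) (p u)) by rewrite !mulr_ge0// ltW.
  rewrite /Rr; lra.
rewrite (le_trans H)// ex_sqr ler_wpM2r ?expR_ge0// lerD2r.
by move: KP; rewrite /P p0.
Qed.

Let Gam := (K + Rr / (2 * sg - 2 * mu) + C3 * zr ^+ 2) / c3.

Let bnd_q t : 0 <= t -> qf (p t) (p t) <= Gam * ex t ^+ 2.
Proof.
move=> t0; have h1 := coerP t0; have h2 := bnd_P t0.
have q1 : 0 <= qf (s t) (s t) := psd_ge0 qf_psd _.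
have z1 : 0 <= m * zf (p t) (p t) by rewrite mulr_ge0 ?(ltW m_gt0)// (psd_ge0 zf_psd).
rewrite /Gam [leRHS]mulrAC ler_pdivlMr// mulrC; lra.
Qed.

Let Gam_ge0 : 0 <= Gam.
Proof.
have : 0 <= 2 * sg - 2 * mu by have := lam_gt0; rewrite /mu /sg; lra.
move=> h; rewrite /Gam divr_ge0 ?(ltW c3_gt0)// !addr_ge0// ?divr_ge0//.
by rewrite mulr_ge0 ?sqr_ge0 ?(ltW C3_gt0).
Qed.

(** The correction [ip T A] cancels the term [2 (W a, b)] in the derivative of the squared norms.
    What is left contains an error or [X p], and the latter is controlled by the energy through
    [Xbd]. *)
Let S t := ip (a t) (a t) + ip (b t) (b t) + ip (T t) (A t).
Let Q := 4 * (tau * F * F) + 2 * w * (tau * F / sg * F) + 2 * (Num.sqrt (CX * Gam) * F).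

Let der_S t : is_derive t 1 S (2 * ip (a t) (ea t) + 2 * ip (b t) (eb t) +
  2 * ip (W (be t)) (a t) - 2 * ip (X (p t)) (a t)).
Proof.
apply: der_eq (derD (der_normsq t) (der_M t)) _.
rewrite /T (linearB W) !(psdBl hb) (Wsym (b t)) (psdC hb (b t) (W _)); ring.
Qed.

Let bnd_S t : 0 <= t -> S t <= (`|S 0| + Q / (2 * sg)) * ex t ^+ 2.
Proof.
move=> t0; rewrite ex_sqr (_ : Q / (2 * sg) = Q / (2 * sg - 0)); last by rewrite subr0.
have CG : 0 <= CX * Gam by rewrite mulr_ge0// ltW.
apply: (@growth_upper_bound _ S (fun t => 2 * ip (a t) (ea t) + 2 * ip (b t) (eb t) +
  2 * ip (W (be t)) (a t) - 2 * ip (X (p t)) (a t))) => //.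
- by rewrite mulr_gt0.
- rewrite /Q !addr_ge0// ?mulr_ge0// ?sqrtr_ge0//; exact: ltW.
move=> u u0; rewrite -ex_sqr mul0r add0r.
have [a1 b1] := bnd_ab u0; have [al1 be1] := bnd_al u0; have [ea1 eb1] := bnd_e u0.
have prod (y z : V) (c d : R) : nm y <= c * ex u -> nm z <= d * ex u ->
    `|ip y z| <= c * d * ex u ^+ 2.
  move=> hy hz; rewrite (le_trans (psd_CS_nm hb _ _))//.
  have -> : c * d * ex u ^+ 2 = c * ex u * (d * ex u) by ring.
  by rewrite ler_pM ?nm_ge0.
have h1 := prod _ _ _ _ a1 ea1; have h2 := prod _ _ _ _ b1 eb1.
have h3 : `|ip (W (be u)) (a u)| <= w * (tau * F / sg) * F * ex u ^+ 2.
  by apply: prod => //; rewrite (le_trans (Wbd _))// -mulrA ler_wpM2l// ltW.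
have h4 : `|ip (X (p u)) (a u)| <= Num.sqrt (CX * Gam) * F * ex u ^+ 2.
  apply: prod => //.
  rewrite -(@ler_pXn2r _ 2)// ?nnegrE ?mulr_ge0 ?sqrtr_ge0 ?nm_ge0//.
  rewrite (le_trans (Xbd _))// exprMn (sqr_sqrtr CG) -mulrA ler_wpM2l ?(ltW CX_gt0)//.
  exact: bnd_q.
have := ler_norm (ip (a u) (ea u)); have := ler_norm (ip (b u) (eb u)).
have := ler_norm (ip (W (be u)) (a u)); have := ler_norm (- ip (X (p u)) (a u)).
rewrite normrN /Q; lra.
Qed.

(** By [Mbd] the correction is of the size of [qf p p], so [bnd_S] and [bnd_q] bound the squared
    norms; the minimality of [F] turns this into an inequality on [F]. *)
Lemma F_sqr_le : F ^+ 2 <= K + CX * K + Q / (2 * sg) + CX * Gam.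
Proof.
apply: Fsup => t t0.
have Tb u : `|ip (T u) (A u)| <= CX * qf (p u) (p u) by rewrite T_E; exact: Mbd.
have := bnd_S t0; have h1 := ler_normlP _ _ (Tb t).
have h2 : CX * qf (p t) (p t) <= CX * (Gam * ex t ^+ 2).
  by rewrite ler_wpM2l ?(ltW CX_gt0)// bnd_q.
have h3 : `|S 0| <= K + CX * K.
  rewrite (le_trans (ler_normD _ _))// lerD//.
    by rewrite ger0_norm// addr_ge0// (psd_ge0 hb).
  rewrite (le_trans (Tb 0))// ler_wpM2l ?(ltW CX_gt0)// p0.
  by case: Kx.
have h4 : `|S 0| * ex t ^+ 2 <= (K + CX * K) * ex t ^+ 2 by rewrite ler_wpM2r// sqr_ge0.
case: h1 => h1 h1'; rewrite /S; lra.
Qed.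

End dynamics.

(** * Incompatibility of the two inequalities on [F] *)

Section closing.
Context {R : realType}.
Implicit Types (lam tau F K : R).

(** In terms of [y = tau (1 + F)^2] all the error terms are at most a constant times [y], so the
    energy chain reads [F^2 <= C (1 + y)]. For small [tau] this bounds [F] independently of [tau],
    which contradicts [lam^2 <= 4 tau (1 + F) C]. *)
Lemma bootstrap_contradiction lam K c0 w CX c3 C3 : 0 < lam -> 0 <= K -> 0 < c0 -> 0 < w ->
  0 < CX -> 0 < c3 -> 0 < C3 -> exists2 tau0 : R, 0 < tau0 &
  forall tau F, 0 <= tau <= 1 -> tau <= tau0 -> 0 <= F ->
  let rho := tau * (1 + F) * Crho lam K in
  let zr := 2 * rho / lam ^+ 2 in
  let Rr := 2 * (lam / 4) * (C3 * zr ^+ 2) + 4 * (tau * F / (lam / 2) * F) +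
    4 * (lam ^+ 2 / 16) * (c0^-1 * (K + F / (lam / 2)) * (tau * F / (lam / 2))) in
  let Gam := (K + Rr / (2 * (lam / 2) - 2 * (lam / 4)) + C3 * zr ^+ 2) / c3 in
  let Q := 4 * (tau * F * F) + 2 * w * (tau * F / (lam / 2) * F) + 2 * (Num.sqrt (CX * Gam) * F) in
  lam ^+ 2 <= 4 * rho -> F ^+ 2 <= K + CX * K + Q / (2 * (lam / 2)) + CX * Gam -> False.
Proof.
move=> lam0 K0 c00 w0 CX0 c30 C30.
pose sg := lam / 2; have sg0 : 0 < sg by rewrite divr_gt0.
pose Cr := Crho lam K.
have Cr0 : 0 < Cr.
  have : 0 < sg^-1 by rewrite invr_gt0.
  have : 0 <= (lam + 1) * (K / sg) by rewrite mulr_ge0 ?divr_ge0//; lra.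
  rewrite /Cr /Crho -/sg; lra.
pose cz := 2 * Cr / lam ^+ 2.
have l20 : 0 < lam ^+ 2 by rewrite exprn_gt0.
have cz0 : 0 < cz by rewrite divr_gt0// mulr_gt0.
pose cR := 2 * (lam / 4) * (C3 * cz ^+ 2) + 4 / sg +
  4 * (lam ^+ 2 / 16) * (c0^-1 * (K + sg^-1) / sg).
have isg : 0 < sg^-1 by rewrite invr_gt0.
have ic0 : 0 < c0^-1 by rewrite invr_gt0.
have l4 : 0 < lam / 4 by rewrite divr_gt0.
have l16 : 0 < lam ^+ 2 / 16 by rewrite divr_gt0.
have Kisg : 0 < K + sg^-1 by lra.
have cR0 : 0 < cR.
  apply: addr_gt0; first apply: addr_gt0.
  - by apply: mulr_gt0; apply: mulr_gt0 => //; rewrite exprn_gt0.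
  - by rewrite divr_gt0.
  - by apply: mulr_gt0; [exact: mulr_gt0|apply: mulr_gt0 => //; exact: mulr_gt0].
pose cG := (K + 2 * cR / lam + C3 * cz ^+ 2) / c3.
have cG0 : 0 < cG.
  rewrite divr_gt0//.
  have : 0 < 2 * cR / lam by rewrite divr_gt0// mulr_gt0.
  have : 0 < C3 * cz ^+ 2 by rewrite mulr_gt0// exprn_gt0.
  lra.
pose cQ := (4 + 2 * w / sg) / lam + 4 / lam ^+ 2 * (CX * cG) + CX * cG.
have CG0 : 0 < CX * cG by rewrite mulr_gt0.
have cQ0 : 0 < cQ.
  have : 0 < 2 * w / sg by rewrite divr_gt0// mulr_gt0.
  have : 0 < 4 / lam ^+ 2 * (CX * cG) by rewrite mulr_gt0// divr_gt0.
  move=> h1 h2; have : 0 < (4 + 2 * w / sg) / lam by rewrite divr_gt0//; lra.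
  by rewrite /cQ; lra.
pose cF := K + CX * K + cQ.
have cF0 : 0 < cF.
  have : 0 <= CX * K by rewrite mulr_ge0// ltW.
  by rewrite /cF; lra.
pose D := 8 * (6 * cF + 2) * (Cr + 1).
have D0 : 0 < D by rewrite !mulr_gt0//; lra.
(* The first bound allows [cF * y] to be absorbed and gives [F^2 <= 6 cF]; the second then makes
   [4 * rho] at most half of [lam^2]. *)
exists (Num.min (1 / (8 * cF)) (lam ^+ 2 / D)).
  by rewrite lt_min !divr_gt0// mulr_gt0.
move=> tau F /andP[tau0 tau1]; rewrite le_min => /andP[tauF tauD] F0.
rewrite -/sg => rho zr Rr Gam Q.
pose y := tau * (1 + F) ^+ 2.
have F10 : 0 <= 1 + F by lra.
have y0 : 0 <= y by rewrite mulr_ge0// sqr_ge0.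
have zr2 : zr ^+ 2 <= cz ^+ 2 * y.
  have -> : zr = cz * (tau * (1 + F)) by rewrite /zr /rho /cz -/Cr; field; rewrite gt_eqF.
  rewrite exprMn ler_wpM2l ?sqr_ge0// exprMn /y ler_wpM2r ?sqr_ge0//.
  by rewrite expr2 ler_piMr.
have tFF : tau * F * F <= y.
  have -> : y = tau * F * F + tau * (1 + 2 * F) by rewrite /y; ring.
  have : 0 <= tau * (1 + 2 * F) by rewrite mulr_ge0//; lra.
  lra.
have t3 : c0^-1 * (K + F / sg) * (tau * F / sg) <= c0^-1 * (K + sg^-1) / sg * y.
  have e1 : (K + F / sg) <= (K + sg^-1) * (1 + F).
    have -> : (K + sg^-1) * (1 + F) = K + F / sg + (K * F + sg^-1) by ring.
    have : 0 <= K * F by rewrite mulr_ge0.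
    lra.
  have e2 : tau * F / sg <= tau * (1 + F) / sg.
    by rewrite ler_wpM2r ?(ltW isg)// ler_wpM2l//; lra.
  have -> : c0^-1 * (K + sg^-1) / sg * y =
     c0^-1 * (((K + sg^-1) * (1 + F)) * (tau * (1 + F) / sg)) by rewrite /y; ring.
  rewrite -mulrA ler_wpM2l ?(ltW ic0)// ler_pM//.
    by rewrite addr_ge0// divr_ge0// ltW.
  by rewrite divr_ge0 ?(ltW sg0)// mulr_ge0.
have RrB : Rr <= cR * y.
  have h1 : 2 * (lam / 4) * (C3 * zr ^+ 2) <= 2 * (lam / 4) * (C3 * cz ^+ 2) * y.
    have -> : 2 * (lam / 4) * (C3 * cz ^+ 2) * y = 2 * (lam / 4) * (C3 * (cz ^+ 2 * y)).
      by ring.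
    by rewrite ler_wpM2l ?ler_wpM2l ?(ltW C30)// mulr_ge0 ?(ltW l4).
  have h2 : 4 * (tau * F / sg * F) <= 4 / sg * y.
    have -> : 4 * (tau * F / sg * F) = 4 / sg * (tau * F * F) by ring.
    by rewrite ler_wpM2l// divr_ge0// ltW.
  have h3 : 4 * (lam ^+ 2 / 16) * (c0^-1 * (K + F / sg) * (tau * F / sg)) <=
     4 * (lam ^+ 2 / 16) * (c0^-1 * (K + sg^-1) / sg) * y.
    rewrite -[leRHS]mulrA ler_wpM2l//; exact: mulr_ge0 (ltW l16).
  rewrite /Rr /cR; lra.
have GamB : Gam <= cG * (1 + y).
  have -> : cG * (1 + y) = (K + 2 * cR / lam + C3 * cz ^+ 2) * (1 + y) / c3.
    by rewrite /cG; ring.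
  rewrite /Gam ler_wpM2r ?invr_ge0 ?(ltW c30)//.
  have -> : Rr / (2 * sg - 2 * (lam / 4)) = 2 * Rr / lam.
    have -> : 2 * sg - 2 * (lam / 4) = lam / 2 by rewrite /sg; field.
    by field; rewrite gt_eqF.
  have h1 : 2 * Rr / lam <= 2 * cR / lam * y.
    by rewrite [leRHS]mulrAC ler_wpM2r ?invr_ge0 ?(ltW lam0)// -[leRHS]mulrA ler_wpM2l.
  have h2 : C3 * zr ^+ 2 <= C3 * cz ^+ 2 * y by rewrite -[leRHS]mulrA ler_wpM2l ?(ltW C30).
  have h3 : 0 <= K * y by rewrite mulr_ge0.
  have h4 : 0 <= 2 * cR / lam by rewrite divr_ge0 ?(ltW lam0)// mulr_ge0 ?(ltW cR0).
  have h5 : 0 <= C3 * cz ^+ 2 by rewrite mulr_ge0 ?sqr_ge0 ?(ltW C30).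
  lra.
have CGB : CX * Gam <= CX * cG * (1 + y) by rewrite -[leRHS]mulrA ler_wpM2l ?(ltW CX0).
(* Young's inequality with weight [lam / 4], so that after division by [2 sg = lam] only [F^2 / 4]
   is left to absorb. *)
have sqB : 2 * (Num.sqrt (CX * Gam) * F) <= lam / 4 * F ^+ 2 + 4 / lam * (CX * cG * (1 + y)).
  have sq : Num.sqrt (CX * Gam) ^+ 2 <= CX * cG * (1 + y).
    have [h|h] := lerP 0 (CX * Gam); first by rewrite sqr_sqrtr.
    by rewrite ler0_sqrtr ?(ltW h)// expr0n mulr_ge0 ?(ltW CG0)//; lra.
  have : 0 <= 4 / lam * (Num.sqrt (CX * Gam) - lam / 4 * F) ^+ 2.
    by rewrite mulr_ge0 ?sqr_ge0// divr_ge0// ltW.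
  have -> : 4 / lam * (Num.sqrt (CX * Gam) - lam / 4 * F) ^+ 2 =
    4 / lam * Num.sqrt (CX * Gam) ^+ 2 - 2 * (Num.sqrt (CX * Gam) * F) + lam / 4 * F ^+ 2.
    by field; rewrite gt_eqF.
  have : 4 / lam * Num.sqrt (CX * Gam) ^+ 2 <= 4 / lam * (CX * cG * (1 + y)).
    by rewrite ler_wpM2l// divr_ge0// ltW.
  lra.
have QB : Q / (2 * sg) <= (4 + 2 * w / sg) / lam * y + F ^+ 2 / 4
    + 4 / lam ^+ 2 * (CX * cG) * (1 + y).
  have -> : 2 * sg = lam by rewrite /sg; field.
  have -> : (4 + 2 * w / sg) / lam * y + F ^+ 2 / 4 + 4 / lam ^+ 2 * (CX * cG) * (1 + y) =
    (4 * y + 2 * w / sg * y + (lam / 4 * F ^+ 2 + 4 / lam * (CX * cG * (1 + y)))) / lam.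
    by field; rewrite !gt_eqF.
  rewrite ler_wpM2r ?invr_ge0 ?(ltW lam0)// /Q !lerD//; first by rewrite ler_wpM2l.
  have -> : 2 * w * (tau * F / sg * F) = 2 * w / sg * (tau * F * F) by ring.
  by rewrite ler_wpM2l// divr_ge0 ?(ltW sg0)// mulr_ge0// ltW.
move=> hL hF.
have F2 : 3 / 4 * F ^+ 2 <= cF * (1 + y).
  have : 0 <= CX * K by rewrite mulr_ge0// ltW.
  move=> /(mulr_ge0 y0) h1; have h2 : 0 <= K * y by rewrite mulr_ge0.
  have h3 : 0 <= (4 + 2 * w / sg) / lam.
    rewrite divr_ge0 ?(ltW lam0)// addr_ge0// divr_ge0 ?(ltW sg0)// mulr_ge0//.
    exact: ltW.
  rewrite /cF /cQ; lra.
have y2 : y <= 2 * tau + 2 * tau * F ^+ 2.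
  have : 0 <= tau * (1 - F) ^+ 2 by rewrite mulr_ge0// sqr_ge0.
  rewrite /y sqrrB sqrrD !mul1r expr1n; lra.
have tcF : 8 * (tau * cF) <= 1.
  by move: tauF; rewrite ler_pdivlMr ?mulr_gt0//; lra.
have F6 : F ^+ 2 <= 6 * cF.
  have h1 : cF * y <= cF * (2 * tau + 2 * tau * F ^+ 2) by rewrite ler_wpM2l// ltW.
  have h2 : 8 * (tau * cF) * F ^+ 2 <= 1 * F ^+ 2 by rewrite ler_wpM2r// sqr_ge0.
  have h3 : cF * tau <= cF * 1 by rewrite ler_wpM2l// ltW.
  lra.
have F7 : 1 + F <= 6 * cF + 2.
  have : 0 <= (F - 1) ^+ 2 by exact: sqr_ge0.
  rewrite sqrrB expr1n; lra.
have : tau * D <= lam ^+ 2 by rewrite -ler_pdivlMr.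
have h1 : tau * (1 + F) * Cr <= tau * (6 * cF + 2) * (Cr + 1).
  rewrite ler_pM// ?mulr_ge0// ?(ltW Cr0)//; last by lra.
  by rewrite ler_wpM2l.
move: hL; rewrite /rho -/Cr /D; lra.
Qed.
End closing.

(** * No bounded solution of the perturbed flow starts from the growing mode *)

Lemma der0_const {R : realType} (f : R -> R) :
  (forall t : R, is_derive t 1 f 0) -> forall t, f t = f 0.
Proof.
move=> h.
have main x y : x <= y -> f x = f y.
  move=> xy.
  have h1 := increment_le xy (fun u _ => h u) (fun u _ => is_derive_cst (0 : R) u 1)
    (fun _ _ => lexx _).
  have h2 := increment_le xy (fun u _ => is_derive_cst (0 : R) u 1) (fun u _ => h u)
    (fun _ _ => lexx _).
  by apply/eqP; rewrite eq_le; move: h1 h2; rewrite /cst => *; apply/andP; split; lra.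
by move=> t; have [/main|/ltW/main] := lerP 0 t.
Qed.

Section instability.
Context {R : realType} {V : lmodType R} {ip : V -> V -> R} (hb : psd_form ip).
Hypothesis ip_definite : forall v, ip v v = 0 -> v = 0.
Context (G W X : {linear V -> V}) (ell : {linear V -> R^o}) (c0 w CX : R).
Hypothesis Gsym : forall u v, ip (G u) v = ip u (G v).
Hypothesis c0_gt0 : 0 < c0.
Hypothesis Gcoer : forall v, c0 * ip (G v) (G v) <= ip (G v) v.
Hypothesis Wsym : forall u v, ip (W u) v = ip u (W v).
Hypothesis w_gt0 : 0 < w.
Hypothesis Wbd : forall v, psd_norm ip (W v) <= w * psd_norm ip v.
Hypothesis ell_pos : forall v, ell (G v) = 0 -> 0 <= ip (v - W (G v)) (G v).
Hypothesis neg_dir : exists v, ip (v - W (G v)) (G v) < 0.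
Hypothesis CX_gt0 : 0 < CX.
Hypothesis Xbd : forall v, psd_norm ip (X v) ^+ 2 <= CX * ip (G v) v.
Hypothesis Msym : forall u v, ip (W (u - W (G u)) - X u) (G v) =
  ip (G u) (W (v - W (G v)) - X v).
Hypothesis Mbd : forall v, `|ip (W (v - W (G v)) - X v) (G v)| <= CX * ip (G v) v.
Local Notation nm := (psd_norm ip).
Local Notation vder := (@vder R V ip).
Local Notation vcont := (@vcont R V ip).

(* The linear system [a' = L b + ea], [b' = - (L - W) a + eb] in weak form, with
   [A], [B], [al], [be] time primitives of [a], [b], [ea], [eb]. *)
Record perturbed_flow (delta : R) (a b ea eb A B al be : R -> V) : Prop := {
  pf_A : forall t, vder A t (a t);
  pf_B : forall t, vder B t (b t);
  pf_al : forall t, vder al t (ea t);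
  pf_be : forall t, vder be t (eb t);
  pf_0 : [/\ A 0 = 0, B 0 = 0, al 0 = 0 & be 0 = 0];
  pf_a : forall t, vcont a t;
  pf_b : forall t, vcont b t;
  pf_ea : forall t, vcont ea t;
  pf_eb : forall t, vcont eb t;
  pf_weak_a : forall (t : R) y, is_derive t 1 (fun s => ip (a s) (G y))
    (ip (b t) y + ip (ea t) (G y));
  pf_weak_b : forall (t : R) y, is_derive t 1 (fun s => ip (b s) (G y))
    (- ip (a t) y + ip (W (a t)) (G y) + ip (eb t) (G y));
  pf_bounded : exists M : R, forall t, ip (a t) (a t) + ip (b t) (b t) <= M;
  pf_err : forall t, ip (ea t) (ea t) + ip (eb t) (eb t) <=
    delta ^+ 2 * (ip (a t) (a t) + ip (b t) (b t)) }.

Lemma ip_ext u v : (forall y, ip u y = ip v y) -> u = v.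
Proof.
move=> h; apply/eqP; rewrite -subr_eq0; apply/eqP/ip_definite.
by rewrite (psdBl hb) h subrr.
Qed.

(** The initial vectors are given through [G] so that they vanish at the vertex and are regular
    enough to come from a datum in the energy space. [delta] and the vectors depend on the operators
    alone, hence they may be fixed before any solution is considered. *)
Theorem perturbed_flow_unbounded : exists y1 y2 y3 : V, exists2 delta : R, 0 < delta &
  forall a b ea eb A B al be : R -> V, perturbed_flow delta a b ea eb A B al be ->
    a 0 = G y1 -> b 0 = W (G y2) + G y3 -> False.
Proof.
have [L0 [C1 [L00 C10 approx]]] := approx_eigenvector hb Gsym c0_gt0 Gcoer Wsym w_gt0 Wbd neg_dir.
have [c3 [C3 [nu0 [c30 C30 nu00 coer]]]] :=
  coercivity hb Gsym c0_gt0 Gcoer Wsym w_gt0 Wbd ell_pos L00 C10.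
pose lam := Num.sqrt L0.
have lam0 : 0 < lam by rewrite sqrtr_gt0.
have lam2 : lam ^+ 2 = L0 by rewrite sqr_sqrtr// ltW.
have [cp wp] := (c0_gt0, w_gt0).
pose c1 := C1 / c0; pose c2 := c1 / c0.
have c1p : 0 < c1 by rewrite divr_gt0.
have c2p : 0 < c2 by rewrite divr_gt0.
pose KP := (1 + w / c0) * C1 + w ^+ 2 / 2 * C1 + 2 * L0 * C1.
pose K0 := L0 * c1 ^+ 2 + (C1 + w * c1) ^+ 2.
have KP0 : 0 <= KP.
  rewrite !addr_ge0// ?mulr_ge0// ?divr_ge0// ?addr_ge0// ?divr_ge0// ?sqr_ge0//;
  exact: ltW.
have K00 : 0 <= K0 by rewrite addr_ge0 ?sqr_ge0// mulr_ge0 ?sqr_ge0// ltW.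
pose K := C1 + c1 + c2 + KP + K0.
have K_ge0 : 0 <= K by rewrite /K; lra.
have [tau0 tau00 boot] :=
  @bootstrap_contradiction R lam K c0 w CX c3 C3 lam0 K_ge0 cp wp CX_gt0 c30 C30.
pose tau := Num.min 1 (Num.min tau0 nu0).
have tau_gt0 : 0 < tau by rewrite !lt_min ltr01 tau00.
have tau1 : 0 <= tau <= 1 by rewrite ltW//= ge_min lexx.
have tautau0 : tau <= tau0 by rewrite !ge_min lexx orbT.
have taunu0 : tau <= nu0 by rewrite !ge_min lexx !orbT.
have [x [x0 [dx zx zC1 qC1 [nx Lx]]]] := approx tau tau_gt0.
(* By the regularised expression of [x - W (G x)] these choices mean [a 0 = lam *: G x] and
   [b 0 = - (x - W (G x))], the initial values of a growing mode. *)
exists (lam *: x), (- (x0 - x)), (L0 *: G x0), tau => //.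
move=> a b ea eb A B al be fl a0 b0.
have {Lx} b0 : b 0 = - (x - W (G x)).
  have e1 : W (G (- (x0 - x))) = - W (G (x0 - x)) by rewrite (linearN G) (linearN W).
  have e2 : G (- (L0 *: G x0)) = - G (L0 *: G x0) by rewrite (linearN G).
  by rewrite b0 Lx e1 e2 opprD opprK.
have {}a0 : a 0 = lam *: G x by rewrite a0 (linearZZ G).
have [A0 B0 al0 be0] := pf_0 fl.
pose A' t := G x + A t; pose B' t := lam *: G (G x) + B t.
(* The values that the integrated system prescribes for [L B'] and [L A']. That [G] maps them back
   to [B'] and [A'] is verified weakly: against every [y], the difference has zero derivative and
   vanishes at time 0. *)
pose s t := a t - al t; pose p t := W (A' t) - b t + be t.
have dA' t : vder A' t (a t).
  have := vderD hb (vder_cst hb (G x) t) (pf_A fl t).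
  by rewrite add0r.
have dB' t : vder B' t (b t).
  have := vderD hb (vder_cst hb (lam *: G (G x)) t) (pf_B fl t).
  by rewrite add0r.
have der_l (u : R -> V) u' (t : R) y : vder u t u' -> is_derive t 1 (fun r => ip (u r) y) (ip u' y).
  move=> hu; apply: der_eq (is_derive_ip hb hu (vder_cst hb y t)) _.
  by rewrite (psdC hb (u t)) (psd0l hb) addr0.
have GB t : G (s t) = B' t.
  apply: ip_ext => y; rewrite Gsym.
  have key : forall r : R, is_derive r 1 (fun r => ip (s r) (G y) - ip (B' r) y) 0.
    move=> r; rewrite (_ : (fun r => _) = (fun r => ip (a r) (G y) - ip (al r) (G y) - ip (B' r) y)).
      apply: der_eq (derB (derB (pf_weak_a fl r y) (der_l _ _ _ (G y) (pf_al fl r)))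
        (der_l _ _ _ y (dB' r))) _; ring.
    by apply/funext => r'; rewrite /s (psdBl hb).
  have E0 : ip (s 0) (G y) - ip (B' 0) y = 0.
    by rewrite /s /B' B0 al0 a0 subr0 addr0 !(psdZl hb) -(Gsym (G x)) subrr.
  by have := der0_const key t; rewrite E0 => /eqP; rewrite subr_eq0 => /eqP.
have p0 : p 0 = x.
  by rewrite /p /A' A0 be0 b0 !addr0 opprK addrC subrK.
have GA t : G (p t) = A' t.
  apply: ip_ext => y; rewrite Gsym.
  have key : forall r : R, is_derive r 1 (fun r => ip (p r) (G y) - ip (A' r) y) 0.
    move=> r; rewrite (_ : (fun r => _) = (fun r => ip (A' r) (W (G y)) - ip (b r) (G y)
        + ip (be r) (G y) - ip (A' r) y)).
      apply: der_eq (derB (derD (derB (der_l _ _ _ _ (dA' r)) (pf_weak_b fl r y))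
        (der_l _ _ _ (G y) (pf_be fl r))) (der_l _ _ _ y (dA' r))) _.
      rewrite Wsym; ring.
    by apply/funext => r'; rewrite /p (psdDl hb) (psdBl hb) Wsym.
  have E0 : ip (p 0) (G y) - ip (A' 0) y = 0 by rewrite p0 /A' A0 addr0 Gsym subrr.
  by have := der0_const key t; rewrite E0 => /eqP; rewrite subr_eq0 => /eqP.
have hA t : vder (fun t => G (p t)) t (a t).
  by rewrite (_ : (fun t => _) = A')//; apply/funext => r; rewrite GA.
have hB t : vder (fun t => G (s t)) t (b t).
  by rewrite (_ : (fun t => _) = B')//; apply/funext => r; rewrite GB.
have hp t : p t - W (G (p t)) = be t - b t.
  by rewrite GA /p addrAC (addrAC (W _)) subrr add0r addrC.
have s0 : s 0 = lam *: G x by rewrite /s al0 subr0.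
have gx : nm (G x) <= c1.
  have := nm_G_le hb Gcoer x; rewrite -ler_pdivlMl// mulrC => h.
  by rewrite (le_trans h)// ler_wpM2r// invr_ge0 ltW.
have ggx : nm (G (G x)) <= c2.
  have := nm_G_le hb Gcoer (G x); rewrite -ler_pdivlMl// mulrC => h.
  by rewrite (le_trans h)// ler_wpM2r// invr_ge0 ltW.
have Kx : [/\ nm (G x) <= K, nm (G (G x)) <= K & qf (ip := ip) G x x <= K].
  by split; rewrite /K; [move: gx|move: ggx|move: qC1]; lra.
have z_ge0 : 0 <= zf (ip := ip) G x x := psd_ge0 (zf_psd hb Gsym c0_gt0 Gcoer) x.
have q_ge0 : 0 <= qf (ip := ip) G x x := psd_ge0 (qf_psd hb Gsym c0_gt0 Gcoer) x.
have KPx : `|nf (ip := ip) G W x x + qf (ip := ip) G (s 0) (s 0)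
    + 2 * (lam ^+ 2 / 16) * zf (ip := ip) G x x| <= K.
  have -> : qf (ip := ip) G (s 0) (s 0) = L0 * zf (ip := ip) G x x.
    by rewrite s0 /qf (linearZZ G) (psdZl hb) (psdZr hb) mulrA -expr2 lam2.
  rewrite lam2.
  have h1 := n_upper hb c0_gt0 Gcoer w_gt0 Wbd x.
  have h2 := n_lower hb Gsym c0_gt0 Gcoer Wbd x.
  have h3 : (1 + w / c0) * qf (ip := ip) G x x <= (1 + w / c0) * C1.
    by rewrite ler_wpM2l// addr_ge0// divr_ge0// ltW.
  have h4 : w ^+ 2 / 2 * zf (ip := ip) G x x <= w ^+ 2 / 2 * C1.
    by rewrite ler_wpM2l// divr_ge0// sqr_ge0.
  have h5 : L0 * zf (ip := ip) G x x <= L0 * C1 by rewrite ler_wpM2l// ltW.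
  have h6 : 0 <= L0 * zf (ip := ip) G x x by rewrite mulr_ge0// ltW.
  have h7 : 0 <= (1 + w / c0) * C1.
    by rewrite mulr_ge0 ?(ltW C10)// addr_ge0// divr_ge0// ltW.
  have h8 : 0 <= w ^+ 2 / 2 * C1 by rewrite mulr_ge0 ?(ltW C10)// divr_ge0// sqr_ge0.
  rewrite ler_norml /K /KP.
  set nn := nf _ _ _ _ in h1 h2 *; set zz := zf _ _ _ in h2 h4 h5 h6 *.
  set qq := qf _ _ _ in h1 h2 h3 q_ge0.
  move: h1 h2 h3 h4 h5 h6 h7 h8 q_ge0 K00 c1p c2p C10; rewrite -!/nn -!/qq -!/zz.
  by move=> *; lra.
have K0x : ip (a 0) (a 0) + ip (b 0) (b 0) <= K.
  rewrite a0 b0 (psdZl hb) (psdZr hb) mulrA -expr2 lam2 (psdNl hb) (psdNr hb) opprK.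
  have h1 : ip (G x) (G x) <= c1 ^+ 2 := le_nm hb gx.
  have h2 : ip (x - W (G x)) (x - W (G x)) <= (C1 + w * c1) ^+ 2.
    apply: (le_nm hb); rewrite (le_trans (nmB hb _ _))// lerD//.
    by rewrite (le_trans (Wbd _))// ler_wpM2l// ltW.
  have h3 : L0 * ip (G x) (G x) <= L0 * c1 ^+ 2 by rewrite ler_wpM2l// ltW.
  by rewrite /K /K0; lra.
pose ex t := expR (lam / 2 * t).
pose f2 t := ip (a t) (a t) + ip (b t) (b t).
have f2_ge0 t : 0 <= f2 t by rewrite addr_ge0// (psd_ge0 hb).
(* The only use of stability: boundedness of the solution makes this set bounded, so that its
   supremum [F] is a real number. *)
pose S := [set Num.sqrt (f2 t) / ex t | t in [set t | 0 <= t]].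
have ex0 t : 0 < ex t by exact: expR_gt0.
have ex1 t : 0 <= t -> 1 <= ex t.
  by move=> t0; rewrite -[leLHS]expR0 ler_expR mulr_ge0// divr_ge0// ltW.
have [M fM] := pf_bounded fl.
have hS : has_sup S.
  split; first by exists (Num.sqrt (f2 0) / ex 0); exists 0 => //=.
  exists (Num.sqrt M) => _ [t /= t0 <-].
  rewrite ler_pdivrMr// (@le_trans _ _ (Num.sqrt M * 1))//.
    by rewrite mulr1 ler_wsqrtr //; exact: fM.
  by rewrite ler_wpM2l ?sqrtr_ge0// ex1.
pose F := sup S.
have hF t : 0 <= t -> f2 t <= (F * ex t) ^+ 2.
  move=> t0; have h : Num.sqrt (f2 t) / ex t <= F.
    by apply: (ub_le_sup (proj2 hS)); exists t.
  rewrite ler_pdivrMr// in h.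
  by rewrite -[leLHS]sqr_sqrtr// lerXn2r ?nnegrE ?sqrtr_ge0// (le_trans (sqrtr_ge0 _) h).
have F0 : 0 <= F.
  apply: le_trans (ub_le_sup (proj2 hS) _); last by exists 0 => //=.
  by rewrite divr_ge0 ?sqrtr_ge0// ltW.
have Fsup (N : R) : (forall t, 0 <= t -> f2 t <= N * ex t ^+ 2) -> F ^+ 2 <= N.
  move=> h; have N0 : 0 <= N.
    have := h 0 (lexx _); rewrite /ex mulr0 expR0 expr1n mulr1; exact: le_trans.
  suff : F <= Num.sqrt N.
    by move=> FN; rewrite -[leRHS]sqr_sqrtr// lerXn2r ?nnegrE ?sqrtr_ge0.
  apply: ge_sup; first exact: (proj1 hS).
  move=> _ [t /= t0 <-]; rewrite ler_pdivrMr//.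
  rewrite -[leRHS](ger0_norm) ?mulr_ge0 ?sqrtr_ge0 ?(ltW (ex0 t))//.
  by rewrite -sqrtr_sqr ler_wsqrtr// exprMn sqr_sqrtr// h.
have coer' v : c3 * qf (ip := ip) G v v - C3 * zf (ip := ip) G x v ^+ 2 <=
    nf (ip := ip) G W v v + lam ^+ 2 / 16 * zf (ip := ip) G v v.
  by rewrite lam2; apply: coer => //; rewrite (le_trans dx).
have dx' : nm (eig_defect G W (lam ^+ 2) x) <= tau by rewrite lam2.
apply: (boot tau F tau1 tautau0 F0).
- exact: (@rho_lower _ _ _ hb G W Gsym Wsym a b ea eb p s al be hA hB
   (pf_al fl) (pf_be fl) (fun=> erefl) hp lam tau F K x lam0 tau1 F0 K_ge0
   p0 s0 al0 be0 dx' zx Kx (pf_err fl) hF).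
- exact: (@F_sqr_le _ _ _ hb G W X c0 w CX Gsym c0_gt0 Gcoer Wsym w_gt0 Wbd CX_gt0
   Xbd Msym Mbd a b ea eb p s al be hA hB (pf_al fl) (pf_be fl) (pf_a fl) (pf_b fl)
   (pf_ea fl) (pf_eb fl) (fun=> erefl) hp lam tau F K c3 C3 x lam0 tau1 F0 K_ge0
   c30 C30 p0 s0 al0 be0 dx' coer' Kx KPx K0x (pf_err fl) hF Fsup).
Qed.

End instability.

(** * Integration on the half-line *)

Section half_line_integrals.
Context {R : realType}.
Local Notation mu := (@lebesgue_measure R).
Local Notation D := (@half_line R).
Implicit Types (f g : R -> R) (k r : R).

Definition intD f : Prop := mu.-integrable D (EFin \o f).
Definition I f : R := \int[mu]_(x in D) f x.
Definition J r f : R := \int[mu]_(x in `[0, r]) f x.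

Lemma measurable_D : measurable (D : set (measurableTypeR R)).
Proof. exact: measurable_itv. Qed.
Hint Resolve measurable_D : core.

Lemma inD x : (D x) = (0 < x) :> Prop.
Proof. by rewrite /half_line /= in_itv /= andbT. Qed.

Lemma continuous_mD f : continuous f -> measurable_fun D f.
Proof. by move=> cf; apply: measurable_funTS; exact: continuous_measurable_fun. Qed.

Lemma intD_measurable f : intD f -> measurable_fun D f.
Proof. by move=> /integrableP[/measurable_EFinP]. Qed.

Lemma intD_eq f g : (forall x, 0 < x -> f x = g x) -> intD f -> intD g.
Proof.
move=> fg; apply: eq_integrable => // x; rewrite inE inD => x0.
by rewrite /= fg.
Qed.

Lemma I_eq f g : (forall x, 0 < x -> f x = g x) -> I f = I g.
Proof. by move=> fg; apply: eq_Rintegral => x; rewrite inE inD => /fg. Qed.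

Lemma intD_le f g : measurable_fun D f -> (forall x, 0 < x -> `|f x| <= g x) ->
  intD g -> intD f.
Proof.
move=> mf fg ig; apply: le_integrable ig => //; first exact/measurable_EFinP.
by move=> x; rewrite inD => x0 /=; rewrite lee_fin (le_trans (fg _ x0))// ler_norm.
Qed.

Lemma intDD f g : intD f -> intD g -> intD (fun x => f x + g x).
Proof.
move=> i1 i2; have := integrableD measurable_D i1 i2.
by apply: eq_integrable => // x _; rewrite /= EFinD.
Qed.

Lemma intDZ k f : intD f -> intD (fun x => k * f x).
Proof.
move=> i1; have := integrableZl measurable_D k i1.
by apply: eq_integrable => // x _; rewrite /= EFinM.
Qed.

Lemma intDN f : intD f -> intD (fun x => - f x).
Proof. by move=> /(intDZ (-1)); apply: intD_eq => x _; rewrite mulN1r. Qed.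

Lemma intDB f g : intD f -> intD g -> intD (fun x => f x - g x).
Proof. by move=> i1 i2; apply: intDD => //; exact: intDN. Qed.

Lemma intD0 : intD (fun=> 0).
Proof. exact: integrable0. Qed.


Lemma ID f g : intD f -> intD g -> I (fun x => f x + g x) = I f + I g.
Proof. by move=> *; rewrite /I RintegralD. Qed.

Lemma IB f g : intD f -> intD g -> I (fun x => f x - g x) = I f - I g.
Proof. by move=> *; rewrite /I RintegralB. Qed.

Lemma IZ k f : intD f -> I (fun x => k * f x) = k * I f.
Proof. by move=> *; rewrite /I RintegralZl. Qed.

Lemma IN f : intD f -> I (fun x => - f x) = - I f.
Proof.
by move=> h; rewrite -mulN1r -IZ//; apply: I_eq => x _; rewrite mulN1r.
Qed.

Lemma I_le f g : intD f -> intD g -> (forall x, 0 < x -> f x <= g x) -> I f <= I g.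
Proof. by move=> i1 i2 fg; apply: le_Rintegral => // x; rewrite inD => /fg. Qed.

Lemma I_ge0 f : (forall x, 0 < x -> 0 <= f x) -> 0 <= I f.
Proof. by move=> h; apply: Rintegral_ge0 => x; rewrite inD => /h. Qed.

Lemma intD_mul f g : measurable_fun D f -> measurable_fun D g ->
  intD (fun x => f x ^+ 2) -> intD (fun x => g x ^+ 2) -> intD (fun x => f x * g x).
Proof.
move=> mf mg i1 i2; apply: (intD_le (g := fun x => f x ^+ 2 + g x ^+ 2)).
- exact: measurable_funM.
- move=> x _; rewrite normrM -(real_normK (num_real (f x))) -(real_normK (num_real (g x))).
  have := sqr_ge0 (`|f x| - `|g x|); have := normr_ge0 (f x); have := normr_ge0 (g x).
  rewrite sqrrB => *; have : 0 <= `|f x| * `|g x| by exact: mulr_ge0.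
  by lra.
- exact: intDD.
Qed.

Lemma J_int r f : continuous f -> mu.-integrable `[0, r] (EFin \o f).
Proof.
move=> cf; apply: continuous_compact_integrable; first exact: segment_compact.
exact: continuous_subspaceT.
Qed.

Lemma FTC_J r (F f : R -> R) : 0 < r -> continuous f -> continuous F ->
  (forall x : R, 0 < x -> is_derive x 1 F (f x)) -> J r f = F r - F 0.
Proof.
move=> r0 cf cF dF; rewrite /J /Rintegral (@continuous_FTC2 _ f F 0 r)//.
- exact: continuous_subspaceT.
- split => [x||].
  + by rewrite in_itv/= => /andP[x0 _]; case: (dF x x0).
  + by apply: cvg_at_right_filter; exact: cF.
  + by apply: cvg_at_left_filter; exact: cF.
- move=> x; rewrite in_itv/= => /andP[x0 _].
  by rewrite derive1E; case: (dF x x0).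
Qed.

Lemma J_cvg f : continuous f -> intD f -> J r f @[r --> +oo] --> I f.
Proof.
move=> cf h; apply/cvg_pinftyP => u uoo.
pose fn n x := if x <= u n then f x else 0.
have e n : J (u n) f = \int[mu]_(x in D) fn n x.
  rewrite /J -Rintegral_itv_obnd_cbnd; last first.
    by apply: integrableS (J_int (u n) cf) => //; exact: subset_itv_oc_cc.
  rewrite (_ : [set` `]0, u n]] = D `&` [set x | x <= u n]); last first.
    by apply/seteqP; split => x /=; rewrite /half_line /= !in_itv /= andbT => /andP.
  rewrite Rintegral_mkcondr; apply: eq_Rintegral => x _.
  rewrite /fn patchE; case: ifPn => [|]; first by rewrite inE /= => ->.
  by move=> /negP h1; case: ifPn => // h2; exfalso; apply: h1; rewrite inE.
have := @dominated_convergence _ _ R mu D measurable_D (fun n x => (fn n x)%:E)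
  (fun x => (f x)%:E) (fun x => `|f x|%:E).
move=> H; have {}H : (\int[mu]_(x in D) (fn n x)%:E)%E @[n --> \oo] --> (\int[mu]_(x in D) (f x)%:E)%E.
  case: H => //.
  - move=> n; apply/measurable_EFinP; apply: measurable_funTS.
    apply: measurable_fun_if => //.
      by apply: measurable_fun_ler => //; exact: measurable_cst.
    by apply: measurable_funTS; exact: continuous_measurable_fun.
  - apply/measurable_EFinP; exact: continuous_mD.
  - apply/aeW => x Dx; apply: cvg_EFin; first exact: nearW.
    apply: cvg_near_cst; near=> n; rewrite /= /fn.
    suff -> : x <= u n by [].
    by near: n; move/cvgryPge : uoo; apply.
  - exact: (integrable_abse h).
  - apply/aeW => x n _ /=; rewrite lee_fin /fn.
    by case: ifP => // _; rewrite normr0.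
rewrite (_ : (fun n => J (u n) f) = (fun n => fine (\int[mu]_(x in D) (fn n x)%:E))%E); last first.
  by apply/funext => n; rewrite e.
apply: fine_cvg; rewrite /I /Rintegral fineK//.
exact: integrable_fin_num.
Unshelve. all: by end_near. Qed.

(** Monotone convergence along the intervals []0, n]]. It converts differential inequalities, which
    bound integrals over finite intervals, into integrability on the half-line. *)
Lemma intD_exhaust M f : continuous f -> (forall x, 0 < x -> 0 <= f x) ->
  (forall r, 0 < r -> J r f <= M) -> intD f /\ I f <= M.
Proof.
move=> cf f0 fM.
pose F (n : nat) : set R := [set` `]0, (n%:R : R)]].
have DF : D = \bigcup_n F n.
  by rewrite /half_line itv_bndy_bigcup_BRight; under eq_bigcupr do rewrite add0r.
have ndF : nondecreasing_seq F.
  move=> m n mn; apply/subsetPset/subset_itvl; rewrite bnd_simp ler_nat//.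
have M0 : 0 <= M.
  apply: le_trans (fM 1 ltr01); rewrite /J -Rintegral_itv_obnd_cbnd.
    by apply: Rintegral_ge0 => x /=; rewrite in_itv/= => /andP[x0 _]; exact: f0.
  by apply: integrableS (J_int (1) cf) => //; exact: subset_itv_oc_cc.
have mF (n : nat) : measurable (F n : set (measurableTypeR R)) by exact: measurable_itv.
have FM n : (\int[mu]_(x in F n) (f x)%:E <= M%:E)%E.
  have ii : mu.-integrable (F n) (EFin \o f).
    by rewrite /F; apply: integrableS (J_int n%:R cf) => //; exact: subset_itv_oc_cc.
  rewrite -[leLHS]fineK; last exact: integrable_fin_num.
  rewrite lee_fin; case: n ii => [|n] ii.
    by rewrite /F set_itv_ge ?bnd_simp// integral_set0.
  have := fM n.+1%:R (ltr0Sn _ _).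
  by rewrite /J -Rintegral_itv_obnd_cbnd.
have lim : (\int[mu]_(x in F i) (EFin \o f) x)%E @[i --> \oo] -->
   (\int[mu]_(x in \bigcup_i F i) (EFin \o f) x)%E.
  apply: ge0_nondecreasing_set_cvg_integral => [//|i|i|i x].
  - exact: measurable_itv.
  - by apply/measurable_EFinP/measurable_funTS; exact: continuous_measurable_fun.
  - by rewrite /F /= in_itv /= => /andP[x0 _]; rewrite lee_fin f0.
rewrite -DF in lim.
have le : (\int[mu]_(x in D) (f x)%:E <= M%:E)%E.
  rewrite -(cvg_lim _ lim)//; apply: lime_le; first by apply/cvg_ex; eexists; exact: lim.
  by apply: nearW => n; exact: FM.
have f0' : (0 <= \int[mu]_(x in D) (f x)%:E)%E.
  by apply: integral_ge0 => x; rewrite inD => x0; rewrite lee_fin f0.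
split; last by rewrite /I /Rintegral -lee_fin fineK// ge0_fin_numE// (le_lt_trans le)// ltry.
apply/integrableP; split.
  by apply/measurable_EFinP; exact: continuous_mD.
have -> : (\int[mu]_(x in D) `|(EFin \o f) x| = \int[mu]_(x in D) (f x)%:E)%E.
  by apply: eq_integral => x; rewrite inE inD => x0 /=; rewrite ger0_norm// f0.
by rewrite (le_lt_trans le)// ltry.
Qed.

End half_line_integrals.
#[export] Hint Resolve measurable_D : core.

(** * Primitives and integration by parts up to infinity *)

Section primitives.
Context {R : realType}.
Local Notation mu := (@lebesgue_measure R).
Local Notation D := (@half_line R).
Implicit Types (f g F : R -> R) (x r : R).

Lemma J_derive f x : continuous f -> 0 < x -> is_derive x 1 (fun r => J r f) (f x).
Proof.
move=> cf x0; have x1 : x < x + 1 by rewrite ltrDl.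
have [d <-] := continuous_FTC1_closed x1 (J_int (x + 1) cf) x0 (cf x).
by split; [exact: d|rewrite derive1E].
Qed.

Lemma J_neg f x : x < 0 -> J x f = 0.
Proof. by move=> x0; rewrite /J set_itv_ge ?bnd_simp -?ltNge// Rintegral_set0. Qed.

Lemma J0 f : J 0 f = 0.
Proof. by rewrite /J set_itv1 Rintegral_set1. Qed.

Lemma J_continuous f : continuous f -> continuous (fun r => J r f).
Proof.
move=> cf x; have [x0|x0|->] := ltgtP x 0.
- rewrite /continuous_at J_neg//; apply: cvg_near_cst; near=> y.
  by apply: J_neg; near: y; exact: lt_nbhsl.
- exact: is_derive_continuous (J_derive cf x0).
- rewrite /continuous_at J0.
  exact: (parameterized_integral_cvg_left ltr01 (J_int 1 cf)).
Unshelve. all: by end_near. Qed.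

Lemma J_le_I f x : continuous f -> (forall y, 0 < y -> 0 <= f y) -> intD f -> J x f <= I f.
Proof.
move=> cf f0 fi; rewrite leNgt; apply/negP => h.
have x0 : 0 < x.
  rewrite ltNge; apply/negP; rewrite le_eqVlt => /orP[/eqP e|/J_neg e].
    by move: h; rewrite e J0 ltNge I_ge0.
  by move: h; rewrite e ltNge I_ge0.
have := J_cvg cf fi; move/cvgrPdist_lt => /(_ (J x f - I f)).
rewrite subr_gt0 => /(_ h) [M [_ hM]].
pose y := Num.max x (M + 1).
have xy : x <= y by rewrite le_max lexx.
have My : M < y by rewrite lt_max ltrDl ltr01 orbT.
have := hM y My.
have inc : J x f <= J y f.
  have p t : x <= t <= y -> 0 < t by case/andP => xt _; exact: lt_le_trans xt.
  have dJ t (ht : x <= t <= y) := J_derive cf (p t ht).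
  have := increment_le xy (fun t _ => is_derive_cst (0 : R) t 1) dJ (fun t ht => f0 t (p t ht)).
  by rewrite /cst subrr subr_ge0.
by rewrite ltr_norml; lra.
Qed.

(** Derivatives are available only at positive points, so the interval is started at [a > 0] and
    continuity lets [a] tend to 0. *)
Lemma increment_le0 f g (df dg : R -> R) r : 0 <= r -> continuous f -> continuous g ->
  (forall x, 0 < x -> is_derive x 1 f (df x)) ->
  (forall x, 0 < x -> is_derive x 1 g (dg x)) ->
  (forall x, 0 < x -> df x <= dg x) -> f r - f 0 <= g r - g 0.
Proof.
move=> r0 cf cg hf hg h; move: r0; rewrite le_eqVlt => /orP[/eqP <-|r0].
  by rewrite !subrr.
have lim (k : R -> R) : continuous k -> k r - k a @[a --> 0^'+] --> k r - k 0.
  move=> ck; apply: cvgB; first exact: cvg_cst.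
  by apply: cvg_at_right_filter; exact: ck.
apply: (ler_cvg_to (lim _ cf) (lim _ cg)); near=> a.
have a0 : 0 < a by near: a; exact: nbhs_right_gt.
have ar : a <= r by near: a; exact: nbhs_right_le.
have pos x : a <= x <= r -> 0 < x by case/andP => ax _; exact: lt_le_trans ax.
by apply: (increment_le ar (fun x hx => hf x (pos x hx)) (fun x hx => hg x (pos x hx)));
  move=> x hx; exact: h (pos x hx).
Unshelve. all: by end_near. Qed.

(** Otherwise [f] would exceed [e] on a whole half-line and its integral over a long interval would
    be larger than [I f]. *)
Lemma intD_small f e r : continuous f -> (forall y, 0 < y -> 0 <= f y) -> intD f ->
  0 < e -> exists x, [/\ r <= x, 0 < x & f x <= e].
Proof.
move=> cf f0 fi e0; apply: contrapT => /forallNP h.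
pose r0 := Num.max 1 r.
have r01 : 1 <= r0 by rewrite le_max lexx.
have r0r : r <= r0 by rewrite le_max lexx orbT.
have big x : r0 <= x -> e <= f x.
  move=> xr; rewrite leNgt; apply/negP => fe; apply: (h x); split; last exact: ltW.
    exact: le_trans r0r xr.
  by apply: lt_le_trans xr; exact: lt_le_trans r01.
have If0 := I_ge0 f0.
pose x := r0 + (I f + 1) / e.
have r0x : r0 <= x by rewrite lerDl divr_ge0 ?(ltW e0)//; lra.
have le1 := J_le_I x cf f0 fi.
have J0r : 0 <= J r0 f.
  have c0 : continuous (fun _ : R => (0 : R)) by move=> y; exact: cvg_cst.
  have := increment_le0 (le_trans ler01 r01) c0 (J_continuous cf) (fun y _ => is_derive_cst (0 : R) y 1) (fun y y0 => J_derive cf y0) f0.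
  by rewrite J0 !subr0.
have : e * x - e * r0 <= J x f - J r0 f.
  apply: (@increment_le R (fun x => e * x) (fun r => J r f) (fun=> e) f r0 x r0x)
    => y /andP[ry _]; [exact: der_lin| |exact: big].
  exact: J_derive (lt_le_trans ltr01 (le_trans r01 ry)).
have -> : e * x - e * r0 = I f + 1 by rewrite /x; field; rewrite gt_eqF.
by lra.
Qed.

(** No decay of [F] is prescribed: its integrability provides arbitrarily distant points where it is
    small, and the boundary term disappears along them. *)
Lemma I_FTC F f : continuous F -> continuous f ->
  (forall x, 0 < x -> is_derive x 1 F (f x)) -> intD F -> intD f -> I f = - F 0.
Proof.
move=> cF cf dF iF i_f; pose l := I f + F 0.
suff : l = 0 by rewrite /l; lra.
apply/eqP/negPn/negP => l0; have {}l0 : 0 < `|l| by rewrite normr_gt0.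
have := J_cvg cf i_f; move/cvgrPdist_lt => /(_ (`|l| / 2)).
rewrite divr_gt0// => /(_ isT) [M [_ hM]].
have cA : continuous (fun x => `|F x|) by move=> x; apply: cvg_norm; exact: cF.
have iA : intD (fun x => `|F x|).
  by have := integrable_abse iF; apply: eq_integrable => // x _; exact: erefl.
have l4 : 0 < `|l| / 4 by rewrite divr_gt0.
have [r [Mr r0 Fr]] := intD_small (M + 1) cA (fun y _ => normr_ge0 (F y)) iA l4.
have := hM r (lt_le_trans (ltr_pwDr ltr01 (lexx M)) Mr).
rewrite (FTC_J r0 cf cF dF).
have -> : I f - (F r - F 0) = l - F r by rewrite /l; ring.
have := ler_normD (l - F r) (F r); rewrite subrK; lra.
Qed.

Lemma I_eq0 f x : continuous f -> (forall y, 0 < y -> 0 <= f y) -> intD f ->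
  I f = 0 -> 0 < x -> f x = 0.
Proof.
move=> cf f0 fi I0 x0.
have Jz y : 0 < y -> J y f = 0.
  move=> y0; apply/eqP; rewrite eq_le; apply/andP; split.
    by rewrite -I0 J_le_I.
  rewrite /J -Rintegral_itv_obnd_cbnd.
    by apply: Rintegral_ge0 => z /=; rewrite in_itv/= => /andP[z0 _]; exact: f0.
  by apply: integrableS (J_int y cf) => //; exact: subset_itv_oc_cc.
have [_ <-] := J_derive cf x0.
suff : is_derive x 1 (fun r => J r f) 0 by case.
apply: is_derive_eps => e e0; exists x => // s sx.
have s0 : 0 < s by move: sx; rewrite ltr_norml; lra.
by rewrite !Jz// subrr mulr0 subr0 normr0 mulr_ge0// ltW.
Qed.

End primitives.

(** * The pre-Hilbert space of continuous square-integrable functions *)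

Section L2_space.
Context {R : realType}.
Local Notation D := (@half_line R).

(* Functions on the half-line are represented by their even extensions, which
   makes the L2 inner product definite on continuous functions. *)
Definition evenL2 : {pred R -> R} := mem [set f : R -> R |
  [/\ continuous f, forall x, f (- x) = f x & intD (fun x => f x ^+ 2)]].

Record L2fun := MkL2fun { L2val : R -> R; _ : L2val \in evenL2 }.
HB.instance Definition _ := [isSub for L2val].
HB.instance Definition _ := [Choice of L2fun by <:].

Lemma evenL2_submod : submod_closed evenL2.
Proof.
split; first rewrite inE; first split.
- by move=> x; exact: cvg_cst.
- by [].
- by apply: intD_eq intD0 => x _; rewrite expr0n.
move=> k f g; rewrite !inE => -[cf ef fi] [cg eg gi]; split.
- move=> x; apply: cvgD; last exact: cg.
  by apply: cvgZr; exact: cf.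
- by move=> x; rewrite !fctE ef eg.
- have ifg := intD_mul (continuous_mD cf) (continuous_mD cg) fi gi.
  have := intDD (intDD (intDZ (k ^+ 2) fi) (intDZ (2 * k) ifg)) gi.
  by apply: intD_eq => x _; rewrite !fctE /GRing.scale /=; ring.
Qed.

HB.instance Definition _ := GRing.isSubmodClosed.Build _ _ evenL2 evenL2_submod.
HB.instance Definition _ := [SubChoice_isSubLmodule of L2fun by <:].

Implicit Types (u v : L2fun) (x : R).

Lemma L2_prop u : [/\ continuous (L2val u), forall x, L2val u (- x) = L2val u x &
  intD (fun x => L2val u x ^+ 2)].
Proof. by have := valP u; rewrite inE. Qed.

Lemma L2_cont u : continuous (L2val u). Proof. by case: (L2_prop u). Qed.
Arguments L2_cont : clear implicits.
Lemma L2_even u x : L2val u (- x) = L2val u x. Proof. by case: (L2_prop u). Qed.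
Lemma L2_int u : intD (fun x => L2val u x ^+ 2). Proof. by case: (L2_prop u). Qed.
Lemma L2_mD u : measurable_fun D (L2val u). Proof. exact: continuous_mD (L2_cont u). Qed.

Lemma L2_intM u v : intD (fun x => L2val u x * L2val v x).
Proof. by apply: intD_mul; [exact: L2_mD|exact: L2_mD|exact: L2_int|exact: L2_int]. Qed.

Lemma L2_eq u v : (forall x, 0 < x -> L2val u x = L2val v x) -> u = v.
Proof.
move=> h; apply/val_inj/funext => x /=.
have pos y : 0 <= y -> L2val u y = L2val v y.
  rewrite le_eqVlt => /orP[/eqP <-|/h//].
  have cu : L2val u y @[y --> 0^'+] --> L2val u 0 by apply: cvg_at_right_filter; exact: L2_cont.
  have cv : L2val v y @[y --> 0^'+] --> L2val v 0 by apply: cvg_at_right_filter; exact: L2_cont.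
  have cv' : L2val u y @[y --> 0^'+] --> L2val v 0.
    apply: cvg_trans cv; apply: near_eq_cvg; near=> z.
    by rewrite h//; near: z; exact: nbhs_right_gt.
  exact: (cvg_unique _ cu cv').
have [x0|/ltW x0] := lerP 0 x; first exact: pos.
by rewrite -(L2_even u) -(L2_even v) pos// oppr_ge0.
Unshelve. all: by end_near. Qed.

Definition ip u v : R := I (fun x => L2val u x * L2val v x).

Lemma L2valD u v x : L2val (u + v) x = L2val u x + L2val v x. Proof. by []. Qed.
Lemma L2valZ (k : R) u x : L2val (k *: u) x = k * L2val u x. Proof. by []. Qed.
Lemma L2valN u x : L2val (- u) x = - L2val u x. Proof. by []. Qed.
Lemma L2valB u v x : L2val (u - v) x = L2val u x - L2val v x. Proof. by []. Qed.

Lemma ip_psd : psd_form ip.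
Proof.
split=> [u v|u v y|k u v|v].
- by apply: I_eq => x _; rewrite mulrC.
- rewrite /ip -ID; [|exact: L2_intM|exact: L2_intM].
  by apply: I_eq => x _; rewrite L2valD mulrDl.
- rewrite /ip -IZ; last exact: L2_intM.
  by apply: I_eq => x _; rewrite L2valZ mulrA.
- by apply: I_ge0 => x _; rewrite -expr2 sqr_ge0.
Qed.

Lemma ip_definite v : ip v v = 0 -> v = 0.
Proof.
move=> h; apply: L2_eq => x x0; apply/eqP; rewrite -sqrf_eq0 expr2; apply/eqP.
apply: (I_eq0 (f := fun x => L2val v x * L2val v x)) => //.
- by move=> y; apply: cvgM; exact: L2_cont.
- by move=> y _; rewrite -expr2 sqr_ge0.
- exact: L2_intM.
Qed.

Lemma evenL2P (f : R -> R) : continuous f -> (forall x, f (- x) = f x) ->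
  intD (fun x => f x ^+ 2) -> f \in evenL2.
Proof. by move=> *; rewrite inE. Qed.

End L2_space.
Arguments L2_cont {R} u.

(** * Time primitives of curves in the function space *)

Section time_primitive.
Context {R : realType}.
Local Notation mu := (@lebesgue_measure R).
Local Notation D := (@half_line R).
Local Notation ip := (@ip R).
Local Notation nm := (psd_norm ip).
Local Notation V := (@L2fun R).
Let hb : psd_form ip := ip_psd.
Implicit Types (f g : R -> R) (x y r s t e c : R).

Lemma JB s f g : continuous f -> continuous g ->
  J s (fun y => f y - g y) = J s f - J s g.
Proof. by move=> cf cg; rewrite /J RintegralB//; exact: J_int. Qed.

Lemma J_cst s c : 0 <= s -> J s (fun=> c) = c * s.
Proof.
move=> s0; rewrite /J Rintegral_cst//= lebesgue_measure_itv/= lte_fin.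
move: s0; rewrite le_eqVlt => /orP[/eqP <-|->]; first by rewrite ltxx.
by rewrite -EFinB subr0.
Qed.

Lemma J_bound s c f : 0 <= s -> continuous f ->
  (forall y, 0 <= y <= s -> `|f y| <= c) -> `|J s f| <= c * s.
Proof.
move=> s0 cf fc; rewrite (le_trans (le_normr_Rintegral _ (J_int s cf)))//.
rewrite -(J_cst c s0); apply: le_Rintegral => //.
- have := integrable_abse (J_int s cf); apply: eq_integrable => // y _; exact: erefl.
- exact: (J_int s ((fun y => cvg_cst c) : continuous (fun _ : R => c))).
Qed.

(** Signed primitive: [J] vanishes for a negative end point, so negative times are reached by
    reflection and exactly one term is active. *)
Definition prim f t := J t f - J (- t) (fun s => f (- s)).

Lemma prim0 f : prim f 0 = 0.
Proof. by rewrite /prim oppr0 !J0 subrr. Qed.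

Lemma J_near0 f e : continuous f -> 0 < e -> exists2 d, 0 < d &
  forall s, 0 <= s < d -> `|J s f - s * f 0| <= e * s.
Proof.
move=> cf e0; have /cvgrPdist_le /(_ e e0) [d /= d0 hd] := cf 0.
exists d => // s /andP[s0 sd].
have cc : continuous (fun _ : R => f 0) by move=> y; exact: cvg_cst.
rewrite mulrC -(J_cst (f 0) s0) -JB//; apply: J_bound => //.
  by move=> y; apply: cvgB; [exact: cf|exact: cvg_cst].
move=> y /andP[y0 ys]; rewrite distrC; apply: hd.
by rewrite /ball_ /= sub0r normrN ger0_norm// (le_lt_trans ys).
Qed.

Lemma prim_derive f t : continuous f -> is_derive t 1 (prim f) (f t).
Proof.
move=> cf; have cg : continuous (fun s => f (- s)).
  by move=> y; apply: continuous_comp; [exact: opp_continuous|exact: cf].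
have [t0|t0|->] := ltgtP t 0.
- have h1 : is_derive t 1 (fun r => J r f) 0.
    apply: is_derive_eps => e e0; exists (- t); first by rewrite oppr_gt0.
    move=> s st; have s0 : s < 0 by move: st; rewrite ltr_norml; lra.
    by rewrite !J_neg// mulr0 !subr0 normr0 mulr_ge0// ltW.
  have nt0 : 0 < - t by rewrite oppr_gt0.
  have h2 := is_derive1_comp (J_derive cg nt0) (derN (is_derive_id t 1)).
  by apply: der_eq (derB h1 h2) _; rewrite opprK; ring.
- have h1 : is_derive t 1 (fun r => J (- r) (fun s => f (- s))) 0.
    apply: is_derive_eps => e e0; exists t => //.
    move=> s st; have s0 : - s < 0 by move: st; rewrite ltr_norml; lra.
    have nt0 : - t < 0 by rewrite oppr_lt0.
    by rewrite (J_neg _ s0) (J_neg _ nt0) mulr0 !subr0 normr0 mulr_ge0// ltW.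
  by apply: der_eq (derB (J_derive cf t0) h1) _; rewrite subr0.
- apply: is_derive_eps => e e0; have [d d0 h1] := J_near0 cf e0.
  have [d' d'0 h2] := J_near0 cg e0; rewrite oppr0 in h2.
  exists (Num.min d d'); first by rewrite lt_min d0.
  move=> s; rewrite subr0 lt_min => /andP[sd sd']; rewrite prim0 subr0.
  have [s0|s0] := lerP 0 s.
    rewrite /prim; have -> : J (- s) (fun s => f (- s)) = 0.
      move: s0; rewrite le_eqVlt => /orP[/eqP <-|s0]; first by rewrite oppr0 J0.
      by rewrite J_neg// oppr_lt0.
    by move: sd; rewrite subr0 (ger0_norm s0) => sd; apply: h1; rewrite s0.
  move: sd'; rewrite (ltr0_norm s0) => sd'; rewrite /prim J_neg// sub0r -opprD normrN.
  by rewrite -[s * f 0]opprK -mulNr; apply: h2; rewrite sd' oppr_ge0 (ltW s0).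
Qed.

Lemma intD_supp f r : continuous f -> (forall x, r < x -> f x = 0) -> intD f.
Proof.
move=> cf f0.
have : mu.-integrable D ((EFin \o f) \_ `[0, r]).
  apply: (integrableS measurableT) => //; apply/(integrable_mkcond _ _).1 => //.
  exact: J_int.
apply: eq_integrable => // x; rewrite inE inD => x0; rewrite patchE.
case: ifPn => // /negP h; rewrite /= f0// ltNge; apply/negP => xr.
by apply: h; rewrite inE /= in_itv /= xr ltW.
Qed.

(** Uniform estimates in [x] become [L^2] estimates only on bounded sets; the cutoff confines them
    to such a set before [r] tends to infinity. *)
Definition cutoff r x := Num.max 0 (Num.min 1 (r + 1 - `|x|)).

Lemma cutoff_cont r : continuous (cutoff r).
Proof.
move=> x; apply: (@continuous_max R R (fun=> 0) (fun y => Num.min 1 (r + 1 - `|y|))).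
  exact: cvg_cst.
apply: (@continuous_min R R (fun=> 1) (fun y => r + 1 - `|y|)); first exact: cvg_cst.
by apply: cvgB; [exact: cvg_cst|exact: norm_continuous].
Qed.

Lemma cutoff_ge0 r x : 0 <= cutoff r x. Proof. by rewrite le_max lexx. Qed.

Lemma cutoff_le1 r x : cutoff r x <= 1.
Proof. by rewrite ge_max ler01 ge_min lexx. Qed.

Lemma cutoff_1 r x : 0 <= x <= r -> cutoff r x = 1.
Proof.
move=> /andP[x0 xr]; rewrite /cutoff ger0_norm// min_l; last by lra.
by rewrite max_r// ler01.
Qed.

Lemma cutoff_0 r x : 0 < r + 1 -> r + 1 < x -> cutoff r x = 0.
Proof.
move=> r0 rx; rewrite /cutoff max_l// ge_min ger0_norm; first by apply/orP; right; lra.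
by lra.
Qed.

Lemma cut_evenL2 r f : 0 < r -> continuous f -> (forall x, f (- x) = f x) ->
  (fun x => cutoff r x * f x) \in evenL2.
Proof.
move=> r0 cf ef; apply: evenL2P => [x|x|].
- by apply: cvgM; [exact: cutoff_cont|exact: cf].
- by rewrite ef /cutoff normrN.
- apply: (@intD_supp _ (r + 1)) => [x|x rx]; last first.
    by rewrite cutoff_0 ?mul0r ?expr0n//; lra.
  apply: (@cvg_comp _ _ _ _ (fun y => y ^+ 2)); last exact: exprn_continuous.
  by apply: cvgM; [exact: cutoff_cont|exact: cf].
Qed.

Variables (h : R -> V) (M : R).
Hypothesis h_vcont : forall t, @vcont R V ip h t.
Hypothesis h_ucont : forall t e, 0 < e -> exists2 d, 0 < d &
  forall s, `|s - t| < d -> forall x, `|L2val (h s) x - L2val (h t) x| <= e.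
Hypothesis h_bound : forall t x, `|L2val (h t) x| <= M.
Hypothesis h_nm : forall t, nm (h t) <= M.

Let K t x := prim (fun s => L2val (h s) x) t.

Lemma h_tcont x : continuous (fun s => L2val (h s) x).
Proof.
move=> t; apply/cvgrPdist_le => e e0; have [d d0 hd] := h_ucont t e0.
exists d => //= s; rewrite /ball_ /= distrC => /hd; rewrite distrC; exact.
Qed.

Let J_xcont (k : R -> V) t : (forall x, continuous (fun s => L2val (k s) x)) ->
  (forall t x, `|L2val (k t) x| <= M) -> continuous (fun x => J t (fun s => L2val (k s) x)).
Proof.
move=> kc kM y.
have := @continuity_under_integral R _ _ mu (fun x s => L2val (k s) x) `[0, t]
  (measurable_itv _) (y - 1) (y + 1).
move=> H; apply: (H _ _ (fun=> M)).
- by move=> x _; exact: J_int (kc x).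
- by apply/aeW => s _ x _; exact: L2_cont.
- exact: (J_int t ((fun y => cvg_cst M) : continuous (fun _ : R => M))).
- by move=> x _; apply/aeW => s _; exact: kM.
- by rewrite inE /= in_itv /=; lra.
Qed.

Lemma K_xcont t : continuous (K t).
Proof.
move=> y; apply: cvgB; first exact: (J_xcont (k := h) h_tcont h_bound).
apply: (J_xcont (k := fun s => h (- s)) (t := - t)) => [x s|//].
by apply: (@continuous_comp _ _ _ -%R (fun s => L2val (h s) x));
  [exact: opp_continuous|exact: h_tcont].
Qed.

Lemma K_even t x : K t (- x) = K t x.
Proof. by rewrite /K; congr prim; apply/funext => s; rewrite L2_even. Qed.

Lemma K_unif t e : 0 < e -> exists2 d, 0 < d & forall s, `|s - t| < d ->
  forall x, `|K s x - K t x - (s - t) * L2val (h t) x| <= e * `|s - t|.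
Proof.
move=> e0; have [d d0 hd] := h_ucont t e0; exists d => // s st x.
have cK := fun u => prim_derive u (@h_tcont x).
have key a b : `|a - t| < d -> `|b - t| < d -> a <= b ->
    `|K b x - K a x - (b - a) * L2val (h t) x| <= e * (b - a).
  move=> ad bd ab.
  have near u : a <= u <= b -> L2val (h t) x - e <= L2val (h u) x <= L2val (h t) x + e.
    move=> aub; have : `|u - t| < d by move: ad bd; rewrite !ltr_norml; lra.
    by move=> /hd /(_ x); rewrite ler_norml; lra.
  have h1 := increment_le ab (fun u _ => cK u) (fun u _ => der_lin (L2val (h t) x + e) u)
    (fun u hu => proj2 (andP (near u hu))).
  have h2 := increment_le ab (fun u _ => der_lin (L2val (h t) x - e) u) (fun u _ => cK u)
    (fun u hu => proj1 (andP (near u hu))).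
  by rewrite ler_norml /K; lra.
have tt : `|t - t| < d by rewrite subrr normr0.
have [ts|/ltW ts] := leP t s.
  by rewrite (ger0_norm (x := s - t)) ?subr_ge0//; exact: key.
have := key s t st tt ts.
rewrite -normrN (ler0_norm (x := s - t)) ?subr_le0// opprB.
by congr (`|_| <= _); ring.
Qed.

Let Kcut r t (r0 : 0 < r) : V := MkL2fun (cut_evenL2 r0 (@K_xcont t) (K_even t)).
Let hcut r (u : V) (r0 : 0 < r) : V := MkL2fun (cut_evenL2 r0 (@L2_cont _ u) (L2_even u)).
Let one_cut r (r0 : 0 < r) : V :=
  MkL2fun (cut_evenL2 r0 ((fun y => cvg_cst (1 : R)) : continuous (fun _ : R => (1 : R)))
    (fun x => erefl)).

Lemma nm_le_pointwise (u v : V) c : 0 <= c ->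
  (forall x, 0 < x -> `|L2val u x| <= c * `|L2val v x|) -> nm u <= c * nm v.
Proof.
move=> c0 h'; apply: (nm_le hb); first by rewrite mulr_ge0 ?nm_ge0.
rewrite exprMn (nm_sqr hb) /ip -IZ; last exact: L2_intM.
apply: I_le => [||x x0]; [exact: L2_intM|exact/intDZ/L2_intM|].
rewrite -!expr2 -exprMn -[leLHS]real_normK ?num_real// -[leRHS]real_normK ?num_real//.
by rewrite lerXn2r ?nnegrE// normrM (ger0_norm c0) h'.
Qed.

(** The truncated primitive is differentiable in [L^2], since uniform expansions in time may be
    multiplied by a compactly supported function. The vector mean value inequality then bounds its
    increment by [c (s - t)] whatever the truncation radius, and exhaustion removes the cutoff. *)
Lemma K_increment (z : V) c s t : t <= s -> 0 <= c ->
  (forall y, t <= y <= s -> nm (h y - z) <= c) ->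
  let k := fun x => K s x - K t x - (s - t) * L2val z x in
  intD (fun x => k x ^+ 2) /\ I (fun x => k x ^+ 2) <= (c * (s - t)) ^+ 2.
Proof.
move=> ts c0 hz k.
have ck : continuous k.
  move=> x; apply: cvgB; first by apply: cvgB; exact: K_xcont.
  by apply: cvgZr; exact: L2_cont.
have ck2 : continuous (fun x => k x ^+ 2).
  move=> x; apply: (@cvg_comp _ _ _ _ (fun y => y ^+ 2)); last exact: exprn_continuous.
  exact: ck.
apply: intD_exhaust => // [x _|r r0]; first exact: sqr_ge0.
pose u y : V := Kcut y r0 - y *: hcut z r0.
have du y : @vder R V ip u y (hcut (h y) r0 - hcut z r0).
  apply: (vderB hb); last exact: vder_line.
  move=> e e0.
  have n0 : 0 < nm (one_cut r0) + 1 by have := nm_ge0 ip (one_cut r0); lra.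
  have [d d0 hd] := K_unif y (divr_gt0 e0 n0).
  exists d => // s' s'y; have H := hd s' s'y.
  apply: (@le_trans _ _ (e / (nm (one_cut r0) + 1) * `|s' - y| * nm (one_cut r0))).
    apply: nm_le_pointwise => [|x _].
      by rewrite mulr_ge0// divr_ge0// ltW.
    rewrite !L2valB !L2valZ /= mulr1.
    have -> : cutoff r x * K s' x - cutoff r x * K y x - (s' - y) * (cutoff r x * L2val (h y) x)
      = (K s' x - K y x - (s' - y) * L2val (h y) x) * cutoff r x by ring.
    by rewrite normrM ler_wpM2r.
  rewrite mulrAC ler_wpM2r// -mulrA ler_piMr ?(ltW e0)//.
  by rewrite mulrC ler_pdivrMr// mul1r; lra.
have := @vincrement_le _ _ _ hb u (fun y => hcut (h y) r0 - hcut z r0) (fun y => c * y)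
  (fun=> c) t s ts (fun y _ => du y) (fun y _ => der_lin c y).
move=> H; have {}H : nm (u s - u t) <= c * s - c * t.
  apply: H => y /hz; apply: le_trans; rewrite -[leRHS]mul1r.
  apply: nm_le_pointwise => // x _; rewrite !L2valB /= mul1r -mulrBr normrM.
  by rewrite ler_piMl// ger0_norm ?cutoff_le1 ?cutoff_ge0.
rewrite -mulrBr in H; have := le_nm hb H; apply: le_trans.
rewrite /ip (@le_trans _ _ (J r (fun x => L2val (u s - u t) x * L2val (u s - u t) x)))//.
  rewrite /J le_eqVlt; apply/orP; left; apply/eqP/eq_Rintegral => x.
  rewrite inE => xr; have {}xr : 0 <= x <= r by move: xr; rewrite /= in_itv.
  by rewrite !L2valB !L2valZ /= cutoff_1// !mul1r /k; ring.
apply: J_le_I => [x|y _|]; last exact: L2_intM.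
- by apply: cvgM; exact: L2_cont.
- by rewrite -expr2 sqr_ge0.
Qed.

Let M_ge0 : 0 <= M. Proof. exact: le_trans (normr_ge0 _) (h_bound 0 0). Qed.

Let K_evenL2 t : K t \in evenL2.
Proof.
have K0 x : K 0 x = 0 by rewrite /K prim0.
have hM y : nm (h y - 0) <= M by rewrite subr0.
apply: evenL2P; [exact: K_xcont|exact: K_even|].
have [t0|/ltW t0] := leP 0 t.
  have [i _] := K_increment t0 M_ge0 (fun y _ => hM y).
  by apply: intD_eq i => x _; rewrite K0 mulr0 !subr0.
have [i _] := K_increment t0 M_ge0 (fun y _ => hM y).
by apply: intD_eq i => x _; rewrite K0 mulr0 subr0 sub0r sqrrN.
Qed.

(** Without completeness the integral of a curve need not exist in [V]. It is formed pointwise in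
    [x]; the uniform bounds keep it continuous, and [K_increment] gives square integrability and the
    derivative. *)
Lemma time_primitive : exists k : R -> V, k 0 = 0 /\ forall t, @vder R V ip k t (h t).
Proof.
exists (fun t => MkL2fun (K_evenL2 t)); split.
  by apply: L2_eq => x _; rewrite /= /K prim0.
move=> t e e0; have [d d0 hd] := h_vcont t e0; exists d => // s st.
have main a b : a <= b -> `|a - t| < d -> `|b - t| < d ->
    nm (MkL2fun (K_evenL2 b) - MkL2fun (K_evenL2 a) - (b - a) *: h t) <= e * (b - a).
  move=> ab ad bd.
  have hy y : a <= y <= b -> nm (h y - h t) <= e.
    by move=> ayb; apply: hd; move: ad bd; rewrite !ltr_norml; lra.
  have [_ i] := K_increment ab (ltW e0) hy.
  apply: (nm_le hb); first by rewrite mulr_ge0 ?subr_ge0// ltW.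
  apply: le_trans i; rewrite /ip le_eqVlt; apply/orP; left; apply/eqP/I_eq => x _.
  by rewrite expr2.
have tt : `|t - t| < d by rewrite subrr normr0.
have [ts|/ltW ts] := leP t s.
  by rewrite (ger0_norm (x := s - t)) ?subr_ge0//; exact: main.
rewrite (ler0_norm (x := s - t)) ?subr_le0// opprB -(nmN hb).
have := main s t ts st tt; congr (nm _ <= _).
by apply: L2_eq => x _; rewrite !(L2valB, L2valN, L2valZ); ring.
Qed.

End time_primitive.

(** * Rules for continuous functions and the data of a ground state *)

Section continuity.
Context {R : realType}.
Implicit Types (f g : R -> R) (k : R).

Lemma cnt_cst k : continuous (fun _ : R => k).
Proof. by move=> x; exact: cvg_cst. Qed.

Lemma cntD f g : continuous f -> continuous g -> continuous (fun x => f x + g x).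
Proof. by move=> cf cg x; apply: cvgD; [exact: cf|exact: cg]. Qed.

Lemma cntN f : continuous f -> continuous (fun x => - f x).
Proof. by move=> cf x; apply: cvgN; exact: cf. Qed.

Lemma cntB f g : continuous f -> continuous g -> continuous (fun x => f x - g x).
Proof. by move=> cf cg x; apply: cvgB; [exact: cf|exact: cg]. Qed.

Lemma cntM f g : continuous f -> continuous g -> continuous (fun x => f x * g x).
Proof. by move=> cf cg x; apply: cvgM; [exact: cf|exact: cg]. Qed.

Lemma cntX f n : continuous f -> continuous (fun x => f x ^+ n).
Proof.
move=> cf x; apply: (@cvg_comp _ _ _ _ (fun y => y ^+ n)); first exact: cf.
exact: exprn_continuous.
Qed.

Lemma cntV f : (forall x, f x != 0) -> continuous f -> continuous (fun x => (f x)^-1).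
Proof. by move=> f0 cf x; apply: cvgV; [exact: f0|exact: cf]. Qed.

Lemma cnt_norm f : continuous f -> continuous (fun x : R => f `|x|).
Proof.
move=> cf x; apply: (@continuous_comp R R R (fun x => `|x|) f x); last exact: cf.
exact: (@norm_continuous R R^o).
Qed.

Lemma derV f (a t : R) : f t != 0 -> is_derive t 1 f a ->
  is_derive t 1 (fun x => (f x)^-1) (- (f t ^- 2) * a).
Proof. by move=> f0 df; exact: (is_deriveV f0 df). Qed.

Lemma derX n f (a t : R) : is_derive t 1 f a ->
  is_derive t 1 (fun x => f x ^+ n.+1) (n.+1%:R * f t ^+ n * a).
Proof.
move=> df; have := is_deriveX n.+1 df.
by have -> : f ^+ n.+1 = (fun x => f x ^+ n.+1) by apply/funext => x; rewrite fctE.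
Qed.

Lemma is_derive_cnt f (df : R -> R) : (forall x : R, is_derive x 1 f (df x)) -> continuous f.
Proof. by move=> h x; exact: is_derive_continuous (h x). Qed.

End continuity.

Ltac cnt := repeat first [assumption | exact: cnt_cst | apply: cntD | apply: cntB
  | apply: cntN | apply: cntM | apply: cntX | exact: L2_cont ].

(* [phi] is the soliton profile, [sig = phi'/phi], [Q = phi^(p-1)]; the
   linearized operators are [L2 = - d^2 + omega - Q], [L1 = L2 - (p - 1) Q]. *)
Record ground_state {R : realType} (phi sig Q : R -> R)
    (omega p gam c0 C0 Qb xm : R) : Prop := GroundState {
  gs_p : 1 < p;
  gs_gam : 0 < gam;
  gs_c0 : 0 < c0;
  gs_C0 : 0 < C0;
  gs_phi : forall x, 0 < phi x;
  gs_lo : forall x : R, 0 < x -> c0 * expR (- gam * x) <= phi x;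
  gs_hi : forall x : R, 0 < x -> phi x <= C0 * expR (- gam * x);
  gs_dphi : forall x : R, is_derive x 1 phi (sig x * phi x);
  gs_dsig : forall x : R, is_derive x 1 sig (omega - Q x - sig x ^+ 2);
  gs_dQ : forall x : R, is_derive x 1 Q ((p - 1) * (sig x * Q x));
  gs_Q0 : forall x, 0 < Q x;
  gs_Qb : forall x, Q x <= Qb;
  gs_sigb : forall x, `|sig x| <= gam;
  gs_xm : 0 < xm;
  gs_sig_eq0 : forall x, (sig x == 0) = (x == xm);
  gs_Qxm : Q xm != omega;
  gs_sig0 : 0 < sig 0;
  gs_far : exists M : R, forall x, M < x -> sig x <= - (gam / 2)
}.

(** * Explicit Green function of [L2] with the Dirichlet condition *)

Section ground_state_green.
Context {R : realType}.
Local Notation D := (@half_line R).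
Local Notation V := (@L2fun R).
Local Notation ip := (@ip R).
Local Notation nm := (psd_norm ip).
Variables (phi sig Q : R -> R) (omega p gam c0 C0 Qb xm : R).
Hypothesis gs : ground_state phi sig Q omega p gam c0 C0 Qb xm.
Let gam_gt0 := gs_gam gs.
Let c0_gt0 := gs_c0 gs.
Let C0_gt0 := gs_C0 gs.
Let phi_gt0 := gs_phi gs.
Let phi_lo := gs_lo gs.
Let phi_hi := gs_hi gs.
Let dphi := gs_dphi gs.
Let dsig := gs_dsig gs.
Let hb : psd_form ip := ip_psd.
Implicit Types (u v y z : V) (x r s : R).

Let phi_neq0 x : phi x != 0. Proof. by rewrite gt_eqF. Qed.
Let phi_cnt : continuous phi. Proof. exact: is_derive_cnt dphi. Qed.
Let sig_cnt : continuous sig. Proof. exact: is_derive_cnt dsig. Qed.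
Let Vphi_cnt : continuous (fun x => (phi x)^-1). Proof. exact: cntV. Qed.

Lemma intD_expN a : 0 < a -> intD (fun x => expR (- a * x)).
Proof.
move=> a0; have c : continuous (fun x => expR (- a * x)).
  by apply: is_derive_cnt => x; exact: is_derive_expRM.
apply: (proj1 (intD_exhaust (M := a^-1) c _ _)) => [x _|r r0]; first exact: expR_ge0.
have d x : 0 < x -> is_derive x 1 (fun x => - a^-1 * expR (- a * x)) (expR (- a * x)).
  move=> _; apply: der_eq (derZ _ (is_derive_expRM (- a) x)) _.
  by rewrite mulrA mulrNN mulVf ?mul1r// gt_eqF.
rewrite (FTC_J r0 c _ d); last by apply: cntM => //; exact: cnt_cst.
by rewrite mulr0 expR0 mulr1 opprK mulNr gerDr oppr_le0 mulr_ge0 ?expR_ge0// invr_ge0 ltW.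
Qed.

Lemma intD_phi2 : intD (fun x => phi x ^+ 2).
Proof.
have h : intD (fun x => C0 ^+ 2 * expR (- (2 * gam) * x)).
  by apply/intDZ/intD_expN; rewrite mulr_gt0.
apply: intD_le h; first by apply: continuous_mD; exact: cntX.
move=> x x0; rewrite ger0_norm ?sqr_ge0// (_ : expR _ = expR (- gam * x) ^+ 2).
  by rewrite -exprMn lerXn2r ?nnegrE ?(ltW (phi_gt0 x)) ?phi_hi// mulr_ge0 ?expR_ge0 ?ltW.
by rewrite expr2 -expRD; congr expR; ring.
Qed.

Lemma intD_phiM v : intD (fun x => phi x * L2val v x).
Proof. by apply: intD_mul; [exact: continuous_mD|exact: L2_mD|exact: intD_phi2|exact: L2_int]. Qed.

Let pv_cnt v : continuous (fun x => phi x * L2val v x). Proof. by cnt. Qed.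

(** Since [L2 phi = 0] and [phi > 0], [L2 u = - phi^-1 (phi^2 (u / phi)')']. Integrating [L2 u = v]
    from infinity and then from 0 gives [u = green_sol v], with [u 0 = 0]; [green_dsol v] is its
    derivative. *)
Definition green_tail v x := I (fun s => phi s * L2val v s) - J x (fun s => phi s * L2val v s).
Definition green_quo v x := J x (fun s => green_tail v s * (phi s ^+ 2)^-1).
Definition green_sol v x := phi x * green_quo v x.
Definition green_dsol v x := sig x * green_sol v x + green_tail v x / phi x.

Lemma tail_cnt v : continuous (green_tail v).
Proof. by apply: cntB; [exact: cnt_cst|exact: J_continuous]. Qed.

Let quo'_cnt v : continuous (fun s => green_tail v s * (phi s ^+ 2)^-1).
Proof.
apply: cntM; first exact: tail_cnt.
by apply: cntV => [x|]; [rewrite expf_neq0|exact: cntX].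
Qed.

Lemma quo_cnt v : continuous (green_quo v). Proof. exact: J_continuous. Qed.
Lemma sol_cnt v : continuous (green_sol v). Proof. by apply: cntM => //; exact: quo_cnt. Qed.
Lemma tphi_cnt v : continuous (fun x => green_tail v x / phi x).
Proof. by apply: cntM => //; exact: tail_cnt. Qed.
Lemma sol'_cnt v : continuous (green_dsol v).
Proof. by apply: cntD; [apply: cntM => //; exact: sol_cnt|exact: tphi_cnt]. Qed.

Lemma dtail v x : 0 < x -> is_derive x 1 (green_tail v) (- (phi x * L2val v x)).
Proof.
move=> x0; apply: der_eq (derB (is_derive_cst _ x 1) (J_derive _ x0)) _ => //.
by rewrite sub0r.
Qed.

Lemma dquo v x : 0 < x -> is_derive x 1 (green_quo v) (green_tail v x * (phi x ^+ 2)^-1).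
Proof. by move=> x0; exact: (J_derive (f := fun s => green_tail v s * (phi s ^+ 2)^-1)). Qed.

Lemma dsol v x : 0 < x -> is_derive x 1 (green_sol v) (green_dsol v x).
Proof.
move=> x0; apply: der_eq (derM (dphi x) (dquo v x0)) _.
by rewrite /green_dsol /green_sol; field; rewrite phi_neq0.
Qed.

Lemma dsol' v x : 0 < x ->
  is_derive x 1 (green_dsol v) ((omega - Q x) * green_sol v x - L2val v x).
Proof.
move=> x0.
have h1 := derM (dsig x) (dsol v x0).
have h2 := derM (dtail v x0) (derV (phi_neq0 x) (dphi x)).
by apply: der_eq (derD h1 h2) _; rewrite /green_dsol; field; rewrite phi_neq0.
Qed.

Lemma sol0 v : green_sol v 0 = 0. Proof. by rewrite /green_sol /green_quo J0 mulr0. Qed.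

Lemma tail_lin k u v x : green_tail (k *: u + v) x = k * green_tail u x + green_tail v x.
Proof.
have -> : green_tail (k *: u + v) x = I (fun s => k * (phi s * L2val u s) + phi s * L2val v s)
    - J x (fun s => k * (phi s * L2val u s) + phi s * L2val v s).
  by congr (_ - _); [apply: I_eq => s _|apply: eq_Rintegral => s _];
    rewrite L2valD L2valZ; ring.
rewrite ID ?IZ//; [|exact: intD_phiM|exact/intDZ/intD_phiM|exact: intD_phiM].
rewrite /green_tail /J RintegralD//; [|by apply: J_int; apply: cntM => //; exact: cnt_cst|exact: J_int].
by rewrite RintegralZl//; [ring|exact: J_int].
Qed.

Lemma quo_lin k u v x : green_quo (k *: u + v) x = k * green_quo u x + green_quo v x.
Proof.
rewrite /green_quo (_ : J x _ = J x (fun s => k * (green_tail u s * (phi s ^+ 2)^-1)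
  + green_tail v s * (phi s ^+ 2)^-1)); last first.
  by apply: eq_Rintegral => s _; rewrite tail_lin; ring.
rewrite /J RintegralD//; [|by apply: J_int; apply: cntM => //; exact: cnt_cst|exact: J_int].
by rewrite RintegralZl//; exact: J_int.
Qed.

Lemma sol_lin k u v x : green_sol (k *: u + v) x = k * green_sol u x + green_sol v x.
Proof. by rewrite /green_sol quo_lin; ring. Qed.

Lemma sol'_lin k u v x : green_dsol (k *: u + v) x = k * green_dsol u x + green_dsol v x.
Proof. by rewrite /green_dsol sol_lin tail_lin; ring. Qed.

(** Young's inequality for [phi * v] beyond [r], weighted by [e = e^(- gam r)], makes both halves of
    order [e]. [F] is the explicit primitive of the resulting majorant [f]. *)
Lemma tail_bound v : exists2 K, 0 <= K & forall r, 0 <= r -> `|green_tail v r| <= K * expR (- gam * r).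
Proof.
pose A := C0 ^+ 2 / (4 * gam); pose B := I (fun x => L2val v x ^+ 2) / 2.
have A0 : 0 <= A by rewrite divr_ge0 ?sqr_ge0// mulr_ge0 ?ltW.
have B0 : 0 <= B by rewrite divr_ge0// I_ge0// => x _; exact: sqr_ge0.
exists (A + B) => [|r r0]; first exact: addr_ge0.
pose g s := phi s * L2val v s.
pose e := expR (- gam * r); have e0 : 0 < e by exact: expR_gt0.
have v2c : continuous (fun x => L2val v x ^+ 2) by apply: cntX; exact: L2_cont.
pose F s := - (A / e) * expR (- (2 * gam) * s) + e / 2 * J s (fun x => L2val v x ^+ 2).
pose f s := C0 ^+ 2 / 2 / e * expR (- (2 * gam) * s) + e / 2 * L2val v s ^+ 2.
have dF s : 0 < s -> is_derive s 1 F (f s).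
  move=> s0; apply: der_eq (derD (derZ _ (is_derive_expRM _ _)) (derZ _ (J_derive v2c s0))) _.
  by rewrite /f /A; field; rewrite !gt_eqF.
have gf s : 0 < s -> `|g s| <= f s.
  move=> s0; rewrite normrM (ger0_norm (ltW (phi_gt0 s))).
  apply: (@le_trans _ _ (C0 * expR (- gam * s) * `|L2val v s|)).
    by rewrite ler_wpM2r// phi_hi.
  rewrite /f -[L2val v s ^+ 2]real_normK ?num_real//.
  have -> : expR (- (2 * gam) * s) = expR (- gam * s) ^+ 2.
    by rewrite expr2 -expRD; congr expR; ring.
  set a := expR _; set b := `|_|.
  have := sqr_ge0 (C0 * a - e * b); rewrite -(pmulr_rge0 _ (x := e^-1 / 2)) ?divr_gt0 ?invr_gt0//.
  have -> : e^-1 / 2 * (C0 * a - e * b) ^+ 2 =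
    (C0 ^+ 2 / 2 / e * a ^+ 2 + e / 2 * b ^+ 2) - C0 * a * b by field; rewrite gt_eqF.
  by rewrite subr_ge0.
have gc : continuous g by exact: pv_cnt.
have Fr : F r = - A * e + e / 2 * J r (fun x => L2val v x ^+ 2).
  rewrite /F (_ : expR _ = e ^+ 2); last by rewrite /e expr2 -expRD; congr expR; ring.
  by field; rewrite gt_eqF.
have FI s : F s <= e * B.
  have h1 : 0 <= A / e * expR (- (2 * gam) * s).
    by rewrite mulr_ge0 ?expR_ge0// divr_ge0// ltW.
  have h2 : e / 2 * J s (fun x => L2val v x ^+ 2) <= e / 2 * I (fun x => L2val v x ^+ 2).
    rewrite ler_wpM2l ?divr_ge0 ?(ltW e0)// J_le_I//; [|exact: L2_int].
    by move=> *; exact: sqr_ge0.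
  rewrite /F mulNr (_ : e * B = e / 2 * I (fun x => L2val v x ^+ 2)); last by rewrite /B; ring.
  by lra.
have J0r : 0 <= J r (fun x => L2val v x ^+ 2).
  by apply: Rintegral_ge0 => x _; exact: sqr_ge0.
have bnd s : r < s -> `|J s g - J r g| <= (A + B) * e.
  move=> rs.
  have main : F s - F r <= (A + B) * e.
    have := FI s; have : 0 <= e / 2 * J r (fun x => L2val v x ^+ 2).
      by rewrite mulr_ge0// divr_ge0// ltW.
    by rewrite Fr; lra.
  have cF : continuous F.
    apply: cntD; apply: cntM; [exact: cnt_cst| |exact: cnt_cst|exact: J_continuous].
    by apply: is_derive_cnt => x; exact: is_derive_expRM.
  have shift (h k : R -> R) dh dk : continuous h -> continuous k ->
     (forall x, 0 < x -> is_derive x 1 h (dh x)) -> (forall x, 0 < x -> is_derive x 1 k (dk x)) ->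
     (forall x, 0 < x -> dh x <= dk x) -> h s - h r <= k s - k r.
    move=> ch ck hh hk hhk.
    move: r0 rs; rewrite le_eqVlt => /orP[/eqP <- rs|r0 rs].
      exact: (increment_le0 (ltW rs) ch ck hh hk hhk).
    have pos x : r <= x <= s -> 0 < x by case/andP => rx _; exact: lt_le_trans rx.
    exact: (increment_le (ltW rs) (fun x hx => hh x (pos x hx)) (fun x hx => hk x (pos x hx))
      (fun x hx => hhk x (pos x hx))).
  have dJ x (x0 : 0 < x) := J_derive gc x0.
  have h1 : J s g - J r g <= F s - F r.
    apply: (shift (J ^~ g) F g f (J_continuous gc) cF dJ dF) => x x0.
    exact: le_trans (ler_norm _) (gf x x0).
  have h2 : - F s - - F r <= J s g - J r g.
    have dN x (x0 : 0 < x) := derN (dF x x0).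
    apply: (shift (\- F) (J ^~ g) (\- f) g (cntN cF) (J_continuous gc) dN dJ) => x x0 /=.
    by rewrite lerNl (le_trans _ (gf x x0))// -normrN ler_norm.
  by rewrite ler_norml; lra.
have lim : `|J s g - J r g| @[s --> +oo] --> `|green_tail v r|.
  by apply: cvg_norm; apply: cvgB; [exact: J_cvg (intD_phiM v)|exact: cvg_cst].
apply: (cvgr_to_le lim); near=> s; apply: bnd; near: s.
by apply: nbhs_pinfty_gt; rewrite num_real.
Unshelve. all: by end_near. Qed.

(** The function [z = e^(gam x) green_tail] is bounded and satisfies
    [(z^2)' >= gam z^2 - (C0^2 / gam) v^2], so integration puts it in [L^2]; the lower bound of
    [phi] compares [1 / phi] with [e^(gam x)]. *)
Lemma tphi_int v : intD (fun x => (green_tail v x / phi x) ^+ 2).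
Proof.
have [K K0 hK] := tail_bound v.
pose z x := expR (gam * x) * green_tail v x.
have zK r : 0 <= r -> `|z r| <= K.
  move=> r0; rewrite /z normrM (ger0_norm (expR_ge0 _)).
  have := hK r r0; rewrite mulNr expRN -(ler_pM2l (expR_gt0 (gam * r))).
  by rewrite [leRHS]mulrC -mulrA mulVf ?mulr1// gt_eqF// expR_gt0.
have dz x : 0 < x -> is_derive x 1 z
    (gam * expR (gam * x) * green_tail v x - expR (gam * x) * (phi x * L2val v x)).
  by move=> x0; apply: der_eq (derM (is_derive_expRM _ _) (dtail v x0)) _; ring.
have zc : continuous z.
  apply: cntM; last exact: tail_cnt.
  by apply: is_derive_cnt => x; exact: is_derive_expRM.
have z2c : continuous (fun x => z x ^+ 2) by exact: cntX.
have v2c : continuous (fun x => L2val v x ^+ 2) by apply: cntX; exact: L2_cont.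
pose B := K ^+ 2 + C0 ^+ 2 / gam * I (fun x => L2val v x ^+ 2).
have zint r : 0 < r -> gam * J r (fun x => z x ^+ 2) <= B.
  move=> r0.
  have main := @increment_le0 R
    (fun r => gam * J r (fun x => z x ^+ 2) - C0 ^+ 2 / gam * J r (fun x => L2val v x ^+ 2))
    (fun r => z r ^+ 2) (fun x => gam * z x ^+ 2 - C0 ^+ 2 / gam * L2val v x ^+ 2)
    (fun x => 2 * z x * (gam * expR (gam * x) * green_tail v x - expR (gam * x) * (phi x * L2val v x)))
    r (ltW r0).
  have Jv : J r (fun x => L2val v x ^+ 2) <= I (fun x => L2val v x ^+ 2).
    by apply: J_le_I; [|move=> *; exact: sqr_ge0|exact: L2_int].
  have K2 : z r ^+ 2 <= K ^+ 2.
    by rewrite -[leLHS]real_normK ?num_real// lerXn2r ?nnegrE// zK// ltW.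
  have z00 := sqr_ge0 (z 0).
  have Cg : 0 <= C0 ^+ 2 / gam by rewrite divr_ge0 ?sqr_ge0// ltW.
  have := ler_wpM2l Cg Jv.
  rewrite /B => h5; move: main; rewrite !J0 !mulr0 subrr subr0 => main.
  suff : gam * J r (fun x => z x ^+ 2) - C0 ^+ 2 / gam * J r (fun x => L2val v x ^+ 2) <=
    z r ^+ 2 - z 0 ^+ 2 by lra.
  apply: main => //.
  - by apply: cntB; apply: cntM; (exact: cnt_cst || exact: J_continuous).
  - by move=> x x0; apply: derB; apply: derZ; exact: J_derive.
  - by move=> x x0; exact: (derX 1 (dz x x0)).
  move=> x x0.
  have hz : gam * expR (gam * x) * green_tail v x = gam * z x by rewrite /z; ring.
  have ep0 : 0 <= expR (gam * x) * phi x by rewrite mulr_ge0 ?expR_ge0// ltW.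
  have ep : expR (gam * x) * phi x <= C0.
    have := ler_wpM2l (expR_ge0 (gam * x)) (phi_hi x0).
    by rewrite mulNr expRN mulrCA mulfV ?mulr1// gt_eqF// expR_gt0.
  rewrite hz mulrA.
  set q := expR _ * phi x in ep0 ep *; set w := L2val v x.
  have h1 : z x * q * w <= gam / 2 * z x ^+ 2 + C0 ^+ 2 / gam / 2 * w ^+ 2.
    have := sqr_ge0 (gam * z x - q * w).
    rewrite -(pmulr_rge0 _ (x := gam^-1 / 2)) ?divr_gt0 ?invr_gt0//.
    have -> : gam^-1 / 2 * (gam * z x - q * w) ^+ 2 =
      gam / 2 * z x ^+ 2 + q ^+ 2 / gam / 2 * w ^+ 2 - z x * q * w.
      by field; rewrite gt_eqF.
    have : q ^+ 2 / gam / 2 * w ^+ 2 <= C0 ^+ 2 / gam / 2 * w ^+ 2.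
      rewrite ler_wpM2r ?sqr_ge0// !ler_pM2r ?invr_gt0//.
      by rewrite lerXn2r ?nnegrE// ltW.
    by lra.
  have -> : 2 * z x * (gam * z x - q * w) = 2 * gam * z x ^+ 2 - 2 * (z x * q * w) by ring.
  by lra.
have [i1 _] : intD (fun x => z x ^+ 2) /\ I (fun x => z x ^+ 2) <= B / gam.
  apply: intD_exhaust => // [x _|r r0]; first exact: sqr_ge0.
  by rewrite ler_pdivlMr// mulrC zint.
apply: intD_le (intDZ (c0 ^- 2) i1).
  by apply: continuous_mD; apply: cntX; exact: tphi_cnt.
move=> x x0; rewrite ger0_norm ?sqr_ge0// -exprVn -exprMn -[leLHS]real_normK ?num_real//.
rewrite -[leRHS]real_normK ?num_real// lerXn2r ?nnegrE// /z !normrM.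
rewrite [leLHS]mulrC mulrA ler_wpM2r// !ger0_norm ?invr_ge0 ?expR_ge0 ?(ltW (phi_gt0 x)) ?(ltW c0_gt0)//.
rewrite -[leRHS]invrK lef_pV2 ?posrE ?invr_gt0 ?mulr_gt0 ?invr_gt0 ?expR_gt0//.
by rewrite invfM invrK -expRN -mulNr phi_lo.
Qed.

(* Hardy's inequality with the weight e^(- 2 gam x), obtained by expanding the
   square of quo' - gam * green_quo. *)
Lemma sol_int v : intD (fun x => green_sol v x ^+ 2) /\ 
  (gam * c0 / C0) ^+ 2 * I (fun x => green_sol v x ^+ 2) <= I (fun x => (green_tail v x / phi x) ^+ 2).
Proof.
pose m x := expR (- (2 * gam) * x).
have mE x : m x = expR (- gam * x) ^+ 2 by rewrite /m expr2 -expRD; congr expR; ring.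
have m0 x : 0 < m x by exact: expR_gt0.
have mc : continuous m by apply: is_derive_cnt => x; exact: is_derive_expRM.
have qc := @quo_cnt v.
have key r : 0 < r -> (gam * c0 / C0) ^+ 2 * J r (fun x => green_sol v x ^+ 2) <=
    J r (fun x => (green_tail v x / phi x) ^+ 2).
  move=> r0.
  have main := @increment_le0 R
    (fun x => (gam * c0 / C0) ^+ 2 * J x (fun x => green_sol v x ^+ 2) + c0 ^+ 2 * (gam * (m x * green_quo v x ^+ 2)))
    (fun r => J r (fun x => (green_tail v x / phi x) ^+ 2))
    (fun x => (gam * c0 / C0) ^+ 2 * green_sol v x ^+ 2 + c0 ^+ 2 * (gam *
      (- (2 * gam) * m x * green_quo v x ^+ 2 + m x * (2 * green_quo v x * (green_tail v x * (phi x ^+ 2)^-1)))))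
    (fun x => (green_tail v x / phi x) ^+ 2) r (ltW r0).
  (* Boundary term of the integration by parts: it has a favourable sign at [r] and vanishes at 0
     together with [green_quo]. *)
  have mq : 0 <= c0 ^+ 2 * (gam * (m r * green_quo v r ^+ 2)).
    apply: mulr_ge0; first exact: sqr_ge0.
    apply: mulr_ge0; first exact: ltW.
    by apply: mulr_ge0; [exact: ltW (m0 r)|exact: sqr_ge0].
  have q0 : green_quo v 0 = 0 by rewrite /green_quo J0.
  move: main; rewrite !J0 q0 expr0n !mulr0 addr0 !subr0 => main.
  suff : (gam * c0 / C0) ^+ 2 * J r (fun x => green_sol v x ^+ 2) + c0 ^+ 2 * (gam * (m r * green_quo v r ^+ 2))
    <= J r (fun x => (green_tail v x / phi x) ^+ 2) by lra.
  apply: main.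
  - apply: cntD; apply: cntM; [exact: cnt_cst| |exact: cnt_cst|].
      by apply: J_continuous; apply: cntX; exact: sol_cnt.
    by apply: cntM; [exact: cnt_cst|apply: cntM => //; exact: cntX].
  - by apply: J_continuous; apply: cntX; exact: tphi_cnt.
  - move=> x x0; apply: derD.
      by apply: derZ; apply: J_derive x0; apply: cntX; exact: sol_cnt.
    apply: derZ; apply: derZ; apply: derM; first exact: is_derive_expRM.
    exact: (derX 1 (dquo v x0)).
  - by move=> x x0; apply: J_derive x0; apply: cntX; exact: tphi_cnt.
  move=> x x0.
  have lo := phi_lo x0; have hi := phi_hi x0; have p0 := phi_gt0 x.
  set e := expR (- gam * x) in lo hi.
  have e0 : 0 < e by exact: expR_gt0.
  have cp := c0_gt0; have Cp := C0_gt0; have gp := gam_gt0.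
  rewrite /green_sol mE -/e; set q := green_quo v x; set T := green_tail v x; set P := phi x in lo hi p0 *.
  have h1 : (gam * c0 / C0) ^+ 2 * (P * q) ^+ 2 <= c0 ^+ 2 * gam ^+ 2 * e ^+ 2 * q ^+ 2.
    have -> : (gam * c0 / C0) ^+ 2 * (P * q) ^+ 2 =
      c0 ^+ 2 * gam ^+ 2 * q ^+ 2 * (P / C0) ^+ 2 by field; rewrite gt_eqF.
    have A0 : 0 <= c0 ^+ 2 * gam ^+ 2 * q ^+ 2 by rewrite -!exprMn sqr_ge0.
    rewrite [leRHS]mulrAC ler_wpM2l//.
    rewrite lerXn2r ?nnegrE ?(ltW e0)//; first by rewrite divr_ge0// ltW.
    by rewrite ler_pdivrMr// mulrC.
  have h2 : c0 ^+ 2 * e ^+ 2 * (T / P ^+ 2) ^+ 2 <= (T / P) ^+ 2.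
    have -> : c0 ^+ 2 * e ^+ 2 * (T / P ^+ 2) ^+ 2 = (T / P) ^+ 2 * (c0 * e / P) ^+ 2.
      by field; rewrite gt_eqF.
    rewrite ler_piMr ?sqr_ge0// exprn_ile1//; first by rewrite divr_ge0 ?mulr_ge0// ltW.
    by rewrite ler_pdivrMr// mul1r.
  have h3 : 0 <= c0 ^+ 2 * e ^+ 2 * (T / P ^+ 2 - gam * q) ^+ 2.
    by rewrite -!exprMn sqr_ge0.
  have h4 : c0 ^+ 2 * e ^+ 2 * (T / P ^+ 2 - gam * q) ^+ 2 =
     c0 ^+ 2 * e ^+ 2 * (T / P ^+ 2) ^+ 2 - c0 ^+ 2 * (gam * (e ^+ 2 * (2 * q * (T / P ^+ 2))))
       + c0 ^+ 2 * gam ^+ 2 * e ^+ 2 * q ^+ 2 by ring.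
  have h5 : c0 ^+ 2 * (gam * (- (2 * gam) * e ^+ 2 * q ^+ 2 + e ^+ 2 * (2 * q * (T / P ^+ 2)))) =
    - 2 * (c0 ^+ 2 * gam ^+ 2 * e ^+ 2 * q ^+ 2) + c0 ^+ 2 * (gam * (e ^+ 2 * (2 * q * (T / P ^+ 2)))).
    by ring.
  by rewrite h5; lra.
have k0 : 0 < (gam * c0 / C0) ^+ 2 by rewrite exprn_gt0// divr_gt0// mulr_gt0.
have [i1 i2] : intD (fun x => green_sol v x ^+ 2) /\ I (fun x => green_sol v x ^+ 2) <=
    I (fun x => (green_tail v x / phi x) ^+ 2) / (gam * c0 / C0) ^+ 2.
  apply: intD_exhaust => [|x _|r r0]; [by apply: cntX; exact: sol_cnt|exact: sqr_ge0|].
  rewrite ler_pdivlMr// mulrC (le_trans (key r r0))//.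
  apply: J_le_I; [by apply: cntX; exact: tphi_cnt|by move=> *; exact: sqr_ge0|exact: tphi_int].
by split=> //; rewrite mulrC -ler_pdivlMr.
Qed.

End ground_state_green.

(** * The operators [G], [W], [X] on the function space *)

Section green_operator.
Context {R : realType}.
Local Notation D := (@half_line R).
Local Notation V := (@L2fun R).
Local Notation ip := (@ip R).
Local Notation nm := (psd_norm ip).
Variables (phi sig Q : R -> R) (omega p gam c0 C0 Qb xm : R).
Hypothesis gs : ground_state phi sig Q omega p gam c0 C0 Qb xm.
Let hb : psd_form ip := ip_psd.
Let p_gt1 := gs_p gs.
Let gam_gt0 := gs_gam gs.
Let phi_gt0 := gs_phi gs.
Let dphi := gs_dphi gs.
Let dsig := gs_dsig gs.
Let dQ := gs_dQ gs.
Let Q_gt0 := gs_Q0 gs.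
Let sig_bd := gs_sigb gs.
Let phi_neq0 x : phi x != 0. Proof. by rewrite gt_eqF. Qed.
Let phi_cnt : continuous phi. Proof. exact: is_derive_cnt dphi. Qed.
Let sig_cnt : continuous sig. Proof. exact: is_derive_cnt dsig. Qed.
Let Q_cnt : continuous Q. Proof. exact: is_derive_cnt dQ. Qed.
Let p_gt0 : 0 < p. Proof. exact: lt_trans ltr01 p_gt1. Qed.
Let p1_gt0 : 0 < p - 1. Proof. by rewrite subr_gt0. Qed.
Implicit Types (u v y z : V) (x r s : R).
Local Notation sol := (green_sol phi).
Local Notation sol' := (green_dsol phi sig).
Local Notation tail := (green_tail phi).
Local Notation quo := (green_quo phi).

Lemma evn_L2 (f : R -> R) : continuous f -> intD (fun x => f x ^+ 2) ->
  (fun x : R => f `|x|) \in evenL2.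
Proof.
move=> cf fi; apply: evenL2P => [|x|]; [exact: cnt_norm|by rewrite normrN|].
by apply: intD_eq fi => x x_gt0; rewrite gtr0_norm.
Qed.

Lemma intD_bounded (f g : R -> R) B : continuous f -> measurable_fun D g ->
  (forall x, 0 < x -> `|f x| <= B) -> intD g -> intD (fun x => f x * g x).
Proof.
move=> cf mg fB /integrable_abse/(intDZ B) h.
apply: (intD_le (g := fun x => B * `|g x|)); last exact: h.
  by apply: measurable_funM => //; exact: continuous_mD.
by move=> x x_gt0; rewrite normrM ler_wpM2r// fB.
Qed.

Lemma intD_bounded2 (f g : R -> R) B : continuous f -> measurable_fun D g ->
  (forall x, 0 < x -> `|f x| <= B) -> intD (fun x => g x ^+ 2) ->
  intD (fun x => (f x * g x) ^+ 2).
Proof.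
move=> cf mg fB gi.
have h : intD (fun x => f x ^+ 2 * g x ^+ 2).
  apply: (intD_bounded (B := B ^+ 2)) => //; first exact: cntX.
    exact: measurable_funX.
  by move=> x x_gt0; rewrite normrX lerXn2r ?nnegrE ?fB// (le_trans _ (fB x x_gt0)).
by apply: intD_eq h => x _; rewrite exprMn.
Qed.

Let sol_i v := (sol_int gs v).1.
Let sol_mD v : measurable_fun D (sol v).
Proof. by apply: continuous_mD; exact: (sol_cnt gs). Qed.
Let tphi_mD v : measurable_fun D (fun x => tail v x / phi x).
Proof. by apply: continuous_mD; exact: (tphi_cnt gs). Qed.
Let sol'_mD v : measurable_fun D (sol' v).
Proof. by apply: continuous_mD; exact: (sol'_cnt gs). Qed.

Lemma sol'_int v : intD (fun x => sol' v x ^+ 2) /\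
  I (fun x => sol' v x ^+ 2) <=
    2 * gam ^+ 2 * I (fun x => sol v x ^+ 2) + 2 * I (fun x => (tail v x / phi x) ^+ 2).
Proof.
have i1 := intDZ (2 * gam ^+ 2) (sol_i v); have i2 := intDZ 2 (tphi_int gs v).
have le x : 0 < x -> sol' v x ^+ 2 <= 2 * gam ^+ 2 * sol v x ^+ 2 + 2 * (tail v x / phi x) ^+ 2.
  move=> _; rewrite /green_dsol.
  have := sqr_ge0 (sig x * sol v x - tail v x / phi x).
  have : (sig x * sol v x) ^+ 2 <= gam ^+ 2 * sol v x ^+ 2.
    rewrite exprMn ler_wpM2r ?sqr_ge0// -[leLHS]real_normK ?num_real//.
    by rewrite lerXn2r ?nnegrE ?sig_bd// ltW.
  by rewrite sqrrB sqrrD; lra.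
have i : intD (fun x => sol' v x ^+ 2).
  apply: (intD_le _ _ (intDD i1 i2)); first exact: measurable_funX.
  by move=> x x_gt0; rewrite ger0_norm ?sqr_ge0// le.
split=> //; rewrite -IZ// -IZ; last exact: (tphi_int gs).
rewrite -ID//; apply: I_le => //; exact: intDD.
Qed.

Let sol'_i v := (sol'_int v).1.

Definition Gop v : V := MkL2fun (evn_L2 (@sol_cnt _ _ _ _ _ _ _ _ _ _ _ gs v) (sol_i v)).

Lemma GopE v x : 0 <= x -> L2val (Gop v) x = sol v x.
Proof. by move=> x_ge0; rewrite /= ger0_norm. Qed.

Lemma Gop_linear : linear Gop.
Proof.
move=> k u v; apply: L2_eq => x x_gt0.
by rewrite L2valD L2valZ !GopE ?(ltW x_gt0)// (sol_lin gs).
Qed.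
HB.instance Definition _ := GRing.isLinear.Build R V V *:%R Gop Gop_linear.

Lemma mul_L2 (f : R -> R) B v : continuous f -> (forall x, 0 < x -> `|f x| <= B) ->
  (fun x : R => f `|x| * L2val v x) \in evenL2.
Proof.
move=> cf fB; apply: evenL2P => [|x|].
- by apply: cntM; [exact: cnt_norm|exact: L2_cont].
- by rewrite normrN L2_even.
- have := intD_bounded2 cf (L2_mD v) fB (L2_int v).
  by apply: intD_eq => x x_gt0; rewrite gtr0_norm.
Qed.

Let W x := (p - 1) * Q x.
Let W' x := (p - 1) * ((p - 1) * (sig x * Q x)).
Let W_cnt : continuous W. Proof. by apply: cntM => //; exact: cnt_cst. Qed.
Let W'_cnt : continuous W'.
Proof. by do 2 (apply: cntM; first exact: cnt_cst); exact: cntM. Qed.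
Let dW x : is_derive x 1 W (W' x). Proof. by apply: derZ; exact: dQ. Qed.
Let W_gt0 x : 0 < W x. Proof. by rewrite mulr_gt0. Qed.
Let Qb_gt0 : 0 < Qb. Proof. exact: lt_le_trans (Q_gt0 0) (gs_Qb gs 0). Qed.
Let w := (p - 1) * Qb.
Let w_gt0 : 0 < w. Proof. by rewrite mulr_gt0. Qed.
Let W_bd x : 0 < x -> `|W x| <= w.
Proof. by move=> _; rewrite gtr0_norm// ler_pM2l// (gs_Qb gs). Qed.
Let w' := (p - 1) * ((p - 1) * (gam * Qb)).
Let w'_ge0 : 0 <= w'.
Proof. by rewrite !mulr_ge0// ltW. Qed.
Let W'_bd x : 0 < x -> `|W' x| <= w'.
Proof.
move=> _; rewrite !normrM (gtr0_norm p1_gt0) (gtr0_norm (Q_gt0 x)) !ler_pM2l//.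
by rewrite ler_pM ?sig_bd// ?(gs_Qb gs)// ltW.
Qed.

Definition Wop v : V := MkL2fun (mul_L2 v W_cnt W_bd).

Lemma WopE v x : 0 <= x -> L2val (Wop v) x = W x * L2val v x.
Proof. by move=> x_ge0; rewrite /= ger0_norm. Qed.

Lemma Wop_linear : linear Wop.
Proof.
move=> k u v; apply: L2_eq => x x_gt0.
by rewrite L2valD L2valZ !WopE ?(ltW x_gt0)// L2valD L2valZ; ring.
Qed.
HB.instance Definition _ := GRing.isLinear.Build R V V *:%R Wop Wop_linear.

(** The commutator term [W' a'] for [a = G v]; it is a bounded operator of [v] because [green_dsol]
    is controlled in [L^2]. *)
Definition Xop v : V := MkL2fun (evn_L2 (cntM W'_cnt (@sol'_cnt _ _ _ _ _ _ _ _ _ _ _ gs v))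
  (intD_bounded2 W'_cnt (@sol'_mD v) W'_bd (sol'_i v))).

Lemma XopE v x : 0 <= x -> L2val (Xop v) x = W' x * sol' v x.
Proof. by move=> x_ge0; rewrite /= ger0_norm. Qed.

Lemma Xop_linear : linear Xop.
Proof.
move=> k u v; apply: L2_eq => x x_gt0.
by rewrite L2valD L2valZ !XopE ?(ltW x_gt0)// (sol'_lin gs); ring.
Qed.
HB.instance Definition _ := GRing.isLinear.Build R V V *:%R Xop Xop_linear.

(** Evaluation at the zero of [phi']. As [phi'] solves the equation of [L1], it serves as a
    comparison function on both sides of this point. *)
Definition ell v : R^o := L2val v xm.
Lemma ell_linear : linear ell. Proof. by []. Qed.
HB.instance Definition _ := GRing.isLinear.Build R V R^o *:%R ell ell_linear.

Lemma ipE u v (f : R -> R) : (forall x, 0 < x -> L2val u x * L2val v x = f x) ->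
  ip u v = I f.
Proof. exact: I_eq. Qed.

(** [tail v / phi] is [(d - sig) (G v)], so this is the factorisation of [L2] as a product of an
    operator and its adjoint, obtained by integrating the derivative of [quo u * tail v]. Symmetry
    and positivity of [G] are read off at once. *)
Lemma ip_GE u v : ip (Gop u) v = I (fun x => tail u x / phi x * (tail v x / phi x)).
Proof.
pose F x := quo u x * tail v x.
pose f x := tail u x * (phi x ^+ 2)^-1 * tail v x + quo u x * (- (phi x * L2val v x)).
have cq : continuous (fun x => (phi x ^+ 2)^-1).
  by apply: cntV => [x|]; [rewrite expf_neq0|exact: cntX].
have ct u' : continuous (tail u') by exact: (tail_cnt gs).
have cqu u' : continuous (quo u') by exact: (quo_cnt gs).
have cf : continuous f.
  by apply: cntD; apply: cntM => //; [exact: cntM|apply: cntN; apply: cntM => //; exact: L2_cont].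
have i1 : intD (fun x => tail u x / phi x * (tail v x / phi x)).
  by apply: intD_mul => //; exact: (tphi_int gs).
have i2 : intD (fun x => sol u x * L2val v x).
  by apply: intD_mul => //; [exact: L2_mD|exact: L2_int].
have fE x : 0 < x -> tail u x / phi x * (tail v x / phi x) - sol u x * L2val v x = f x.
  by move=> _; rewrite /f /green_sol; field.
have i_f : intD f by apply: intD_eq fE _; exact: intDB.
have iF : intD F.
  have : intD (fun x => sol u x * (tail v x / phi x)) by apply: intD_mul => //; exact: (tphi_int gs).
  by apply: intD_eq => x _; rewrite /F /green_sol; field.
have dF x : 0 < x -> is_derive x 1 F (f x).
  by move=> x_gt0; exact: derM (dquo gs u x_gt0) (dtail gs v x_gt0).
have := I_FTC (cntM (cqu u) (ct v)) cf dF iF i_f.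
rewrite /F /green_quo J0 mul0r oppr0 -(I_eq fE) IB// => /eqP; rewrite subr_eq0 => /eqP ->.
by apply: ipE => x x_gt0; rewrite GopE// ltW.
Qed.

Lemma Gop_sym u v : ip (Gop u) v = ip u (Gop v).
Proof. by rewrite (psdC hb u) !ip_GE; apply: I_eq => x _; rewrite mulrC. Qed.

Lemma ip_Gdiag v : ip (Gop v) v = I (fun x => (tail v x / phi x) ^+ 2).
Proof. by rewrite ip_GE; apply: I_eq => x _; rewrite expr2. Qed.

Lemma ip_GG v : ip (Gop v) (Gop v) = I (fun x => sol v x ^+ 2).
Proof. by apply: ipE => x x_gt0; rewrite !GopE ?ltW// expr2. Qed.

Definition coer := (gam * c0 / C0) ^+ 2.
Lemma coer_gt0 : 0 < coer.
Proof. by rewrite exprn_gt0// divr_gt0 ?(gs_C0 gs)// mulr_gt0// (gs_c0 gs). Qed.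

Lemma Gop_coer v : coer * ip (Gop v) (Gop v) <= ip (Gop v) v.
Proof. by rewrite ip_Gdiag ip_GG; exact: (sol_int gs v).2. Qed.

Let Gvv_ge0 v : 0 <= ip (Gop v) v.
Proof. by rewrite ip_Gdiag I_ge0// => x _; exact: sqr_ge0. Qed.

Definition K' := 2 * gam ^+ 2 / coer + 2.
Let K'_ge0 : 0 <= K'.
Proof.
have k0 := coer_gt0; rewrite addr_ge0// divr_ge0 ?(ltW k0)//.
by rewrite mulr_ge0 ?sqr_ge0.
Qed.

Lemma sol'_le v : I (fun x => sol' v x ^+ 2) <= K' * ip (Gop v) v.
Proof.
apply: le_trans (sol'_int v).2 _; rewrite -ip_GG -ip_Gdiag /K' [leRHS]mulrDl lerD2r.
have k0 := coer_gt0; have h : 0 <= 2 * gam ^+ 2 / coer.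
  by rewrite divr_ge0 ?(ltW k0)// mulr_ge0// sqr_ge0.
by have := ler_wpM2l h (Gop_coer v); rewrite mulrA divfK ?gt_eqF.
Qed.

(** [L2val u - (omega - Q) * sol u] is minus the second derivative of [sol u]; an integration by
    parts with weight [m] has no boundary term because [sol v] vanishes at 0. *)
Lemma energy_identity (m m' : R -> R) B u v : continuous m -> continuous m' ->
  (forall x : R, is_derive x 1 m (m' x)) -> (forall x, 0 < x -> `|m x| <= B) ->
  (forall x, 0 < x -> `|m' x| <= B) ->
  I (fun x => m x * (L2val u x - (omega - Q x) * sol u x) * sol v x) =
  I (fun x => m' x * (sol' u x * sol v x) + m x * (sol' u x * sol' v x)).
Proof.
move=> cm cm' dm mB m'B.
have cs u' : continuous (sol u') by exact: (sol_cnt gs).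
have cs' u' : continuous (sol' u') by exact: (sol'_cnt gs).
have isv : intD (fun x => sol' u x * sol v x).
  by apply: intD_mul.
have is'v' : intD (fun x => sol' u x * sol' v x) by apply: intD_mul.
have iuv : intD (fun x => L2val u x * sol v x).
  by apply: intD_mul => //; [exact: L2_mD|exact: L2_int].
have iss : intD (fun x => sol u x * sol v x) by apply: intD_mul.
have ibd (k g : R -> R) b : continuous k -> (forall x, 0 < x -> `|k x| <= b) -> continuous g ->
    intD g -> intD (fun x => k x * g x).
  by move=> ck kb cg; apply: intD_bounded kb => //; exact: continuous_mD.
have i1 := ibd _ _ _ cm' m'B (cntM (cs' u) (cs v)) isv.
have i2 := ibd _ _ _ cm mB (cntM (cs' u) (cs' v)) is'v'.
have i3 : intD (fun x => m x * (L2val u x - (omega - Q x) * sol u x) * sol v x).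
  have h1 := ibd _ _ _ cm mB (cntM (@L2_cont _ u) (cs v)) iuv.
  have cq : continuous (fun x => m x * (omega - Q x)).
    by apply: cntM => //; apply: cntB => //; exact: cnt_cst.
  have qb x : 0 < x -> `|m x * (omega - Q x)| <= B * (`|omega| + Qb).
    move=> x_gt0; rewrite normrM ler_pM ?mB// (le_trans (ler_normB _ _))// lerD2l.
    by rewrite gtr0_norm// (gs_Qb gs).
  have h2 := ibd _ _ _ cq qb (cntM (cs u) (cs v)) iss.
  by apply: intD_eq (intDB h1 h2) => x _; ring.
pose F x := m x * (sol' u x * sol v x).
pose f x := m' x * (sol' u x * sol v x) + m x * (sol' u x * sol' v x)
   - m x * (L2val u x - (omega - Q x) * sol u x) * sol v x.
have dF x : 0 < x -> is_derive x 1 F (f x).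
  move=> x_gt0.
  apply: der_eq (derM (dm x) (derM (dsol' gs u x_gt0) (dsol gs v x_gt0))) _.
  by rewrite /f; ring.
have cF : continuous F by do 2 apply: cntM => //.
have cf : continuous f.
  apply: cntB; first by apply: cntD; do 2 apply: cntM => //.
  apply: cntM => //; apply: cntM => //; apply: cntB; first exact: L2_cont.
  by apply: cntM => //; apply: cntB => //; exact: cnt_cst.
have := I_FTC cF cf dF (ibd _ _ _ cm mB (cntM (cs' u) (cs v)) isv) (intDB (intDD i1 i2) i3).
rewrite /F sol0 !mulr0 oppr0 IB//; last exact: intDD.
by move=> /eqP; rewrite subr_eq0 => /eqP ->.
Qed.

Let Mop v := Wop (v - Wop (Gop v)) - Xop v.

Let q x := omega - p * Q x.

(** The weighted integration by parts produces [W' * sol' u * sol v], exactly the term that [Xop]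
    subtracts. The remaining form is visibly symmetric and of first order. *)
Lemma ip_Mop u v : ip (Mop u) (Gop v) =
  I (fun x => W x * (sol' u x * sol' v x) + W x * q x * (sol u x * sol v x)).
Proof.
pose B := w + w'.
have WB x : 0 < x -> `|W x| <= B by move=> x_gt0; rewrite /B ler_wpDr// W_bd.
have W'B x : 0 < x -> `|W' x| <= B.
  by move=> x_gt0; rewrite /B ler_wpDl ?W'_bd// ltW.
have e := energy_identity u v W_cnt W'_cnt dW WB W'B.
have cs u' : continuous (sol u') by exact: (sol_cnt gs).
have cs' u' : continuous (sol' u') by exact: (sol'_cnt gs).
have isv : intD (fun x => W' x * (sol' u x * sol v x)).
  by apply: (intD_bounded (B := w')) => //; [exact: measurable_funM|apply: intD_mul].
have is'v' : intD (fun x => W x * (sol' u x * sol' v x)).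
  by apply: (intD_bounded (B := w)) => //; [exact: measurable_funM|apply: intD_mul].
have iss : intD (fun x => W x * q x * (sol u x * sol v x)).
  apply: (intD_bounded (B := w * (`|omega| + p * Qb))) => //.
  - by apply: cntM => //; apply: cntB; [exact: cnt_cst|apply: cntM => //; exact: cnt_cst].
  - exact: measurable_funM.
  - move=> x x_gt0; rewrite normrM ler_pM ?W_bd// (le_trans (ler_normB _ _))// lerD2l.
    by rewrite normrM !gtr0_norm// ler_pM2l// (gs_Qb gs).
  - by apply: intD_mul.
have i3 : intD (fun x => W x * (L2val u x - (omega - Q x) * sol u x) * sol v x).
  have h1 : intD (fun x => W x * (L2val u x * sol v x)).
    apply: (intD_bounded (B := w)) => //; first by apply: measurable_funM => //; exact: L2_mD.
    by apply: intD_mul => //; [exact: L2_mD|exact: L2_int].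
  have h2 : intD (fun x => (W x * (omega - Q x)) * (sol u x * sol v x)).
    apply: (intD_bounded (B := w * (`|omega| + Qb))) => //.
    - by apply: cntM => //; apply: cntB => //; exact: cnt_cst.
    - exact: measurable_funM.
    - move=> x x_gt0; rewrite normrM ler_pM ?W_bd// (le_trans (ler_normB _ _))// lerD2l.
      by rewrite gtr0_norm// (gs_Qb gs).
    - by apply: intD_mul.
  by apply: intD_eq (intDB h1 h2) => x _; ring.
rewrite (@ipE _ _ (fun x => W x * (L2val u x - (omega - Q x) * sol u x) * sol v x
   + (W x * q x * (sol u x * sol v x) - W' x * (sol' u x * sol v x)))); last first.
  move=> x x_gt0; have x_ge0 := ltW x_gt0.
  rewrite GopE// L2valB WopE// L2valB WopE// XopE// GopE//.
  by rewrite /q /W; ring.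
rewrite ID//; last exact: intDB.
rewrite e ID// IB// ID//; ring.
Qed.

Lemma Mop_sym u v : ip (Mop u) (Gop v) = ip (Gop u) (Mop v).
Proof. by rewrite (psdC hb (Gop u)) !ip_Mop; apply: I_eq => x _; ring. Qed.

(** One constant for two bounds: the first summand serves [Xop_bd], the two middle ones serve
    [Mop_bd], and the last makes it positive. *)
Definition CX := w' ^+ 2 * K' + w * K' + w * (`|omega| + p * Qb) / coer + 1.

Let b_ge0 : 0 <= `|omega| + p * Qb.
Proof. by rewrite addr_ge0// mulr_ge0// ltW. Qed.

Lemma CX_gt0 : 0 < CX.
Proof.
have k0 := coer_gt0; have w0 := ltW w_gt0.
have h1 := mulr_ge0 (sqr_ge0 w') K'_ge0; have h2 := mulr_ge0 w0 K'_ge0.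
have h3 := divr_ge0 (mulr_ge0 w0 b_ge0) (ltW k0).
by rewrite /CX; lra.
Qed.

Lemma Xop_bd v : nm (Xop v) ^+ 2 <= CX * ip (Gop v) v.
Proof.
rewrite (nm_sqr hb) (@ipE _ _ (fun x => (W' x * sol' v x) ^+ 2)); last first.
  by move=> x x_gt0; rewrite XopE ?ltW// expr2.
apply: (@le_trans _ _ (w' ^+ 2 * K' * ip (Gop v) v)).
  apply: (@le_trans _ _ (w' ^+ 2 * I (fun x => sol' v x ^+ 2))).
    rewrite -IZ//; apply: I_le => [||x x_gt0]; [|exact: intDZ|].
      exact: (intD_bounded2 W'_cnt (@sol'_mD v) W'_bd).
    rewrite exprMn ler_wpM2r ?sqr_ge0// -[leLHS]real_normK ?num_real//.
    by rewrite lerXn2r ?nnegrE ?W'_bd.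
  by rewrite -mulrA ler_wpM2l ?sqr_ge0// sol'_le.
rewrite ler_wpM2r// /CX.
have k0 := coer_gt0; have w0 := ltW w_gt0; have h2 := mulr_ge0 w0 K'_ge0.
have h3 := divr_ge0 (mulr_ge0 w0 b_ge0) (ltW k0).
by lra.
Qed.

Lemma Mop_bd v : `|ip (Mop v) (Gop v)| <= CX * ip (Gop v) v.
Proof.
rewrite ip_Mop.
have iss : intD (fun x => w * sol' v x ^+ 2 + w * (`|omega| + p * Qb) * sol v x ^+ 2).
  by apply: intDD; apply: intDZ.
have le x : 0 < x -> `|W x * (sol' v x * sol' v x) + W x * q x * (sol v x * sol v x)| <=
   w * sol' v x ^+ 2 + w * (`|omega| + p * Qb) * sol v x ^+ 2.
  have ab (k a c : R) : `|k| <= c -> `|k * (a * a)| <= c * a ^+ 2.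
    by move=> kc; rewrite normrM -expr2 (ger0_norm (sqr_ge0 a)) ler_wpM2r ?sqr_ge0.
  move=> x_gt0; rewrite (le_trans (ler_normD _ _))// lerD// ab ?W_bd//.
  rewrite normrM ler_pM ?W_bd// (le_trans (ler_normB _ _))// lerD2l.
  by rewrite normrM !gtr0_norm// ler_pM2l// (gs_Qb gs).
have i : intD (fun x => W x * (sol' v x * sol' v x) + W x * q x * (sol v x * sol v x)).
  apply: (intD_le _ le iss); apply: measurable_funD; apply: measurable_funM;
    (try exact: measurable_funM); apply: continuous_mD => //.
  by apply: cntM => //; apply: cntB; [exact: cnt_cst|apply: cntM => //; exact: cnt_cst].
apply: le_trans (le_normr_Rintegral _ i) _ => //.
apply: (@le_trans _ _ (w * I (fun x => sol' v x ^+ 2)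
   + w * (`|omega| + p * Qb) * I (fun x => sol v x ^+ 2))).
  rewrite -!IZ// -ID; [|exact: intDZ|exact: intDZ].
  apply: I_le => //; exact: integrable_abse i.
have h1 := sol'_le v; have h2 := Gop_coer v; rewrite ip_GG mulrC -ler_pdivlMr ?coer_gt0// in h2.
have := ler_wpM2l (ltW w_gt0) h1.
have := ler_wpM2l (mulr_ge0 (ltW w_gt0) b_ge0) h2.
rewrite /CX => h3 h4.
have h5 : 0 <= w' ^+ 2 * K' * ip (Gop v) v.
  by do 2 apply: mulr_ge0 => //; exact: sqr_ge0.
have := Gvv_ge0 v.
have -> : (w' ^+ 2 * K' + w * K' + w * (`|omega| + p * Qb) / coer + 1) * ip (Gop v) v =
  w' ^+ 2 * K' * ip (Gop v) v + w * (K' * ip (Gop v) v) +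
  w * (`|omega| + p * Qb) * (ip (Gop v) v / coer) + ip (Gop v) v by ring.
by lra.
Qed.

Lemma Wop_sym u v : ip (Wop u) v = ip u (Wop v).
Proof. by apply: I_eq => x x_gt0; rewrite !WopE ?(ltW x_gt0)//; ring. Qed.

Lemma Wop_bd v : nm (Wop v) <= w * nm v.
Proof.
apply: nm_le_pointwise => [|x x_gt0]; first exact: ltW.
by rewrite WopE ?(ltW x_gt0)// normrM ler_wpM2r// W_bd.
Qed.

Lemma ip_L1 v : intD (fun x => sol' v x ^+ 2 + q x * sol v x ^+ 2) /\
  ip (v - Wop (Gop v)) (Gop v) = I (fun x => sol' v x ^+ 2 + q x * sol v x ^+ 2).
Proof.
have c1 := @cnt_cst R 1; have c0' := @cnt_cst R 0.
have e : I (fun x => 1 * (L2val v x - (omega - Q x) * sol v x) * sol v x) =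
  I (fun x => 0 * (sol' v x * sol v x) + 1 * (sol' v x * sol' v x)).
  apply: (@energy_identity (fun=> 1) (fun=> 0) 1) => //.
    by move=> *; rewrite normr1.
  by move=> *; rewrite normr0.
have iss (f : R -> R) b : continuous f -> (forall x, 0 < x -> `|f x| <= b) ->
    intD (fun x => f x * sol v x ^+ 2).
  by move=> cf fb; apply: intD_bounded fb _ => //; exact: measurable_funX.
have iq : intD (fun x => q x * sol v x ^+ 2).
  apply: (iss _ (`|omega| + p * Qb)).
    by apply: cntB; [exact: cnt_cst|apply: cntM => //; exact: cnt_cst].
  move=> x x_gt0; rewrite (le_trans (ler_normB _ _))// lerD2l.
  by rewrite normrM !gtr0_norm// ler_pM2l// (gs_Qb gs).
split; first exact: intDD.
have iw : intD (fun x => (omega - Q x) * sol v x ^+ 2).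
  apply: (iss _ (`|omega| + Qb)); first by apply: cntB => //; exact: cnt_cst.
  move=> x x_gt0; rewrite (le_trans (ler_normB _ _))// lerD2l.
  by rewrite gtr0_norm// (gs_Qb gs).
have ivv : intD (fun x => L2val v x * sol v x).
  by apply: intD_mul => //; [exact: L2_mD|exact: L2_int].
rewrite (@ipE _ _ (fun x => 1 * (L2val v x - (omega - Q x) * sol v x) * sol v x + q x * sol v x ^+ 2)).
  rewrite ID//; last by apply: intD_eq (intDB ivv iw) => x _; ring.
  by rewrite e [RHS]ID//; congr (_ + _); apply: I_eq => x _; ring.
move=> x x_gt0; have x_ge0 := ltW x_gt0.
by rewrite L2valB WopE// !GopE// /q /W; ring.
Qed.

End green_operator.

(** * One negative direction of [L1] *)

Section linearized_spectrum.
Context {R : realType}.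
Local Notation D := (@half_line R).
Local Notation V := (@L2fun R).
Local Notation ip := (@ip R).
Variables (phi sig Q : R -> R) (omega p gam c0 C0 Qb xm : R).
Hypothesis gs : ground_state phi sig Q omega p gam c0 C0 Qb xm.
Let hb : psd_form ip := ip_psd.
Let p_gt1 := gs_p gs.
Let gam_gt0 := gs_gam gs.
Let phi_gt0 := gs_phi gs.
Let dphi := gs_dphi gs.
Let dsig := gs_dsig gs.
Let dQ := gs_dQ gs.
Let Q_gt0 := gs_Q0 gs.
Let sig_bd := gs_sigb gs.
Let phi_neq0 x : phi x != 0. Proof. by rewrite gt_eqF. Qed.
Let phi_cnt : continuous phi. Proof. exact: is_derive_cnt dphi. Qed.
Let sig_cnt : continuous sig. Proof. exact: is_derive_cnt dsig. Qed.
Let Q_cnt : continuous Q. Proof. exact: is_derive_cnt dQ. Qed.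
Let p_gt0 : 0 < p. Proof. exact: lt_trans ltr01 p_gt1. Qed.
Let p1_gt0 : 0 < p - 1. Proof. by rewrite subr_gt0. Qed.
Implicit Types (u v y z : V) (x r s : R).
Local Notation sol := (green_sol phi).
Local Notation sol' := (green_dsol phi sig).
Local Notation tail := (green_tail phi).
Local Notation quo := (green_quo phi).
Local Notation G := (Gop gs).
Local Notation W := (Wop gs).

Lemma is_derive_quotientP (f : R -> R) (t l : R) :
  (f (h + t) - f t) / h @[h --> 0^'] --> l <-> is_derive t 1 f l.
Proof.
have e : (fun h : R => (f (h + t) - f t) / h) = (fun h => h^-1 *: (f (h *: (1 : R) + t) - f t)).
  by apply/funext => h; rewrite /GRing.scale /= mulr1 mulrC.
rewrite e; split=> [L|[df Df]].
  split; first by apply/cvg_ex; exists l.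
  exact: (cvg_lim _ L).
by rewrite -Df; exact: df.
Qed.

Let sig_neq0 x : x != xm -> sig x != 0.
Proof. by rewrite -(gs_sig_eq0 gs). Qed.
Let sig_xm : sig xm = 0.
Proof. by apply/eqP; rewrite (gs_sig_eq0 gs). Qed.
Let q x := omega - p * Q x.

(* [phi'' / phi'] is a singular Riccati solution for [L1] with its pole at
   [xm]; the boundary term is harmless when [sol v] vanishes there. *)
Let F v x := (omega - Q x) / sig x * sol v x ^+ 2.

Lemma riccati_derive v x : x != xm -> 0 < x -> is_derive x 1 (F v)
  ((q x - ((omega - Q x) / sig x) ^+ 2) * sol v x ^+ 2
    + (omega - Q x) / sig x * (2 * sol v x * sol' v x)).
Proof.
move=> xxm x_gt0; have s0 := sig_neq0 xxm.
have h1 := derB (is_derive_cst omega x 1) (dQ x).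
have h2 := derM (derM h1 (derV s0 (dsig x))) (derX 1 (dsol gs v x_gt0)).
by apply: der_eq h2 _; rewrite /q /cst expr1; field.
Qed.

(** The zero of [sig] at [xm] is simple, with slope [omega - Q xm], while [sol v ^+ 2] vanishes to
    second order. The quotient of [F] is thus the square of the quotient of [sol v] times a factor
    tending to 1. *)
Lemma riccati_derive_pole v : sol v xm = 0 -> is_derive xm 1 (F v) (sol' v xm ^+ 2).
Proof.
move=> v0; have xm_gt0 := gs_xm gs.
have /is_derive_quotientP hu := dsol gs v xm_gt0.
have /is_derive_quotientP hs := dsig xm.
rewrite sig_xm expr0n subr0 in hs.
have w0 : omega - Q xm != 0 by rewrite subr_eq0 eq_sym (gs_Qxm gs).
apply/is_derive_quotientP.
have hq : omega - Q (h + xm) @[h --> 0^'] --> omega - Q xm.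
  have c : {for 0, continuous (fun h : R => omega - Q (h + xm))}.
    apply: cvgB; first exact: cvg_cst.
    apply: (@continuous_comp _ _ _ (fun h : R => h + xm) Q); last exact: Q_cnt.
    by apply: cvgD; [exact: cvg_id|exact: cvg_cst].
  by move/continuous_withinNx : c; rewrite add0r.
have H : (omega - Q (h + xm)) * ((sig (h + xm) - 0) / h)^-1 *
    ((sol v (h + xm) - sol v xm) / h * ((sol v (h + xm) - sol v xm) / h)) @[h --> 0^'] -->
    (omega - Q xm) * (omega - Q xm)^-1 * (sol' v xm * sol' v xm).
  by apply: cvgM; [apply: cvgM => //; exact: cvgV|exact: cvgM].
rewrite mulfV// mul1r -expr2 in H; apply: (cvg_trans _ H); apply: near_eq_cvg; near=> h.
have h0 : h != 0 by near: h; exact: nbhs_dnbhs_neq.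
have s0 : sig (h + xm) != 0 by apply: sig_neq0; rewrite -subr_eq0 addrK.
by rewrite /F v0 expr0n mulr0 !subr0; field; rewrite h0 s0.
Unshelve. all: by end_near. Qed.

(** The integrand minus the derivative of [F v] is the square of [sol' - (phi'' / phi') sol], so the
    integral over [[0, r]] dominates [F v r]. Far away [sig <= - gam / 2] bounds the Riccati
    coefficient, and [F v r] becomes negligible at points [r] where [sol v] is small. *)
Lemma L1_ge0 v : ell xm (G v) = 0 -> 0 <= ip (v - W (G v)) (G v).
Proof.
have xm_gt0 := gs_xm gs.
rewrite /ell GopE ?(ltW xm_gt0)// => v0.
have [i ->] := ip_L1 gs v.
pose f x := sol' v x ^+ 2 + q x * sol v x ^+ 2.
have cs : continuous (sol v) by exact: (sol_cnt gs).
have cs' : continuous (sol' v) by exact: (sol'_cnt gs).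
have cf : continuous f.
  apply: cntD; [exact: cntX|apply: cntM; last exact: cntX].
  by apply: cntB; [exact: cnt_cst|apply: cntM => //; exact: cnt_cst].
have cF : continuous (F v).
  move=> x; have [->|xxm] := eqVneq x xm.
    exact: is_derive_continuous (riccati_derive_pole v0).
  apply: cvgM; last exact: (cntX (n := 2) cs).
  apply: cvgM; first by apply: (cntB _ Q_cnt); exact: cnt_cst.
  by apply: cvgV; [exact: sig_neq0|exact: sig_cnt].
pose f0 x := if x == xm then sol' v xm ^+ 2 else
  (q x - ((omega - Q x) / sig x) ^+ 2) * sol v x ^+ 2
    + (omega - Q x) / sig x * (2 * sol v x * sol' v x).
have le r : 0 <= r -> F v r <= J r f.
  move=> r_ge0; have := @increment_le0 R (F v) (fun r => J r f) f0 f r r_ge0 cF (J_continuous cf).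
  have F0 : F v 0 = 0 by rewrite /F sol0 expr0n mulr0.
  rewrite J0 F0 !subr0; apply => [x x_gt0|x x_gt0|x _].
  - rewrite /f0; case: eqVneq => [->|xxm]; first exact: riccati_derive_pole.
    exact: riccati_derive.
  - exact: J_derive.
  - rewrite /f0 /f; case: eqVneq => [->|xxm]; first by rewrite v0 expr0n mulr0 addr0.
    have := sqr_ge0 (sol' v x - (omega - Q x) / sig x * sol v x).
    by rewrite sqrrB; lra.
rewrite leNgt; apply/negP => If0.
have [M hM] := gs_far gs.
pose B := (`|omega| + Qb) / (gam / 2).
have bb : 0 <= `|omega| + Qb.
  by rewrite addr_ge0// (le_trans (ltW (Q_gt0 0)) (gs_Qb gs 0)).
have B0 : 0 <= B by rewrite divr_ge0// divr_ge0// ltW.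
have Fb r : M < r -> - (B * sol v r ^+ 2) <= F v r.
  move=> Mr; rewrite /F -mulNr ler_wpM2r ?sqr_ge0// lerNl.
  have g2 : 0 < gam / 2 by rewrite divr_gt0.
  have sr : gam / 2 <= - sig r by rewrite lerNr hM.
  have sr0 : 0 < - sig r by exact: lt_le_trans sr.
  rewrite -mulrN -invrN /B ler_pdivrMr// mulrAC ler_pdivlMr//.
  apply: (@le_trans _ _ ((`|omega| + Qb) * (gam / 2))).
    rewrite ler_wpM2r ?(ltW g2)// (le_trans (ler_norm _))// (le_trans (ler_normB _ _))//.
    by rewrite lerD2l gtr0_norm// (gs_Qb gs).
  by rewrite ler_wpM2l.
have := J_cvg cf i; move/cvgrPdist_lt => /(_ (- I f / 2)).
have IfN : 0 < - I f / 2 by rewrite divr_gt0// oppr_gt0.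
move=> /(_ IfN) [M' [_ hM']].
have e0 : 0 < - I f / 2 / (B + 1) by rewrite divr_gt0// ltr_wpDl.
have [r [Mr r_gt0 ur]] := intD_small (Num.max M M' + 1) (cntX (n := 2) cs)
  (fun x _ => sqr_ge0 _) (sol_int gs v).1 e0.
have MM : Num.max M M' < r by apply: lt_le_trans Mr; rewrite ltrDl.
move: MM; rewrite gt_max => /andP[Mr1 Mr2].
have := hM' r Mr2; have := Fb r Mr1; have := le r (ltW r_gt0).
have : B * sol v r ^+ 2 <= - I f / 2.
  rewrite ler_pdivlMr ?ltr_wpDl// in ur; have := sqr_ge0 (sol v r).
  by have := ur; rewrite mulrDr mulr1 mulrC; lra.
by rewrite /= ltr_norml -/f; lra.
Qed.

(** [phi' - sig 0 phi]: the solution [phi'] of the equation of [L1], corrected by a multiple of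
    [phi] so as to satisfy the Dirichlet condition. *)
Let psi x := (sig x - sig 0) * phi x.
Let W0 x := (p - 1) * Q x.
Let v0f x := W0 x * sig x * phi x.

Lemma phi_mul_L2 (f : R -> R) B : continuous f -> (forall x, 0 < x -> `|f x| <= B) ->
  (fun x : R => f `|x| * phi `|x|) \in evenL2.
Proof.
move=> cf fB; apply: (evn_L2 (f := fun x => f x * phi x)); first exact: cntM.
by apply: (intD_bounded2 cf _ fB); [exact: continuous_mD|exact: (intD_phi2 gs)].
Qed.

Let cW : continuous W0. Proof. by apply: cntM => //; exact: cnt_cst. Qed.
Let W0_bd x : 0 < x -> `|W0 x| <= (p - 1) * Qb.
Proof. by move=> _; rewrite normrM !gtr0_norm// ler_pM2l// (gs_Qb gs). Qed.
Let Ws_bd x : 0 < x -> `|W0 x * sig x| <= (p - 1) * Qb * gam.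
Proof. by move=> x_gt0; rewrite normrM ler_pM// W0_bd. Qed.

(** The image of [psi] under [L2]: as [L2 phi = 0] and [L1 phi' = 0], it equals [W phi']. *)
Definition psi_src : V := MkL2fun (phi_mul_L2 (cntM cW sig_cnt) Ws_bd).

Let tail_psi x : 0 <= x -> tail psi_src x = phi x ^+ 2 * (omega - Q x - sig x ^+ 2).
Proof.
pose H x := - (phi x ^+ 2 * (omega - Q x - sig x ^+ 2)).
pose h x := phi x * (W0 x * sig x * phi x).
have ch : continuous h by do ! (apply: cntM => //).
have cH : continuous H.
  apply/cntN/cntM; first exact: cntX.
  by apply: cntB; [apply: cntB => //; exact: cnt_cst|exact: cntX].
have dH x' : is_derive x' 1 H (h x').
  have h1 := derB (derB (is_derive_cst omega x' 1) (dQ x')) (derX 1 (dsig x')).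
  by apply: der_eq (derN (derM (derX 1 (dphi x')) h1)) _; rewrite /h /W0 /cst !expr1; ring.
have i2 := intD_phi2 gs.
have iH : intD H.
  have : intD (fun x => - (omega - Q x - sig x ^+ 2) * phi x ^+ 2).
    apply: (intD_bounded (B := `|omega| + Qb + gam ^+ 2)) => //.
    - apply: cntN; apply: cntB; [apply: cntB => //; exact: cnt_cst|exact: cntX].
    - exact: continuous_mD (cntX (n := 2) phi_cnt).
    - move=> x' _; rewrite normrN (le_trans (ler_normB _ _))// lerD//.
        by rewrite (le_trans (ler_normB _ _))// lerD2l gtr0_norm// (gs_Qb gs).
      by rewrite normrX lerXn2r ?nnegrE// ltW.
  by apply: intD_eq => x' _; rewrite /H; ring.
have ih : intD h.
  have : intD (fun x => W0 x * sig x * phi x ^+ 2).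
    apply: intD_bounded Ws_bd i2; first exact: cntM.
    exact: continuous_mD (cntX (n := 2) phi_cnt).
  by apply: intD_eq => x' _; rewrite /h; ring.
move=> x_ge0; rewrite /green_tail.
have -> : I (fun s => phi s * L2val psi_src s) = I h.
  by apply: I_eq => s s_gt0; rewrite /= gtr0_norm.
have -> : J x (fun s => phi s * L2val psi_src s) = J x h.
  by apply: eq_Rintegral => s; rewrite inE /= in_itv/= => /andP[s_ge0 _]; rewrite ger0_norm.
rewrite (I_FTC cH ch (fun x _ => dH x) iH ih).
move: x_ge0; rewrite le_eqVlt => /orP[/eqP <-|x_gt0]; first by rewrite J0 subr0 /H opprK.
by rewrite (FTC_J x_gt0 ch cH (fun x _ => dH x)) /H; ring.
Qed.

Lemma sol_psi x : 0 <= x -> sol psi_src x = psi x.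
Proof.
move=> x_ge0; rewrite /green_sol /psi mulrC; congr (_ * _); rewrite /green_quo.
have -> : J x (fun s => tail psi_src s * (phi s ^+ 2)^-1) =
    J x (fun s => omega - Q s - sig s ^+ 2).
  apply: eq_Rintegral => s; rewrite inE /= in_itv/= => /andP[s_ge0 _].
  by rewrite tail_psi// mulrAC mulfV ?mul1r// expf_neq0.
move: x_ge0; rewrite le_eqVlt => /orP[/eqP <-|x_gt0]; first by rewrite J0 subrr.
have c : continuous (fun s => omega - Q s - sig s ^+ 2).
  by apply: cntB; [apply: cntB => //; exact: cnt_cst|exact: cntX].
exact: (FTC_J x_gt0 c sig_cnt (fun s _ => dsig s)).
Qed.

(** Here [L1 psi = sig 0 (p - 1) Q phi]. Its pairing with [psi] is negative because [sig 0 > 0] and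
    because the integral of [Q phi phi'] is [- Q 0 phi(0)^2 / (p + 1)]. *)
Lemma L1_negative : exists v, ip (v - W (G v)) (G v) < 0.
Proof.
exists psi_src.
have i2 := intD_phi2 gs.
have m2 : measurable_fun D (fun x => phi x ^+ 2) by exact: continuous_mD (cntX (n := 2) phi_cnt).
have i1 : intD (fun x => Q x * phi x ^+ 2).
  by apply: (intD_bounded (B := Qb)) => // x _; rewrite gtr0_norm// (gs_Qb gs).
have i3 : intD (fun x => (sig x * Q x) * phi x ^+ 2).
  apply: (intD_bounded (B := gam * Qb)) => //; first exact: cntM.
  by move=> x _; rewrite normrM ler_pM// gtr0_norm// (gs_Qb gs).
have e1 : I (fun x => (p + 1) * ((sig x * Q x) * phi x ^+ 2)) = - (Q 0 * phi 0 ^+ 2).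
  apply: (I_FTC (F := fun x => Q x * phi x ^+ 2)) => //.
  - by apply: cntM => //; exact: cntX.
  - by apply: cntM; [exact: cnt_cst|apply: cntM; [exact: cntM|exact: cntX]].
  - by move=> x _; apply: der_eq (derM (dQ x) (derX 1 (dphi x))) _; ring.
  - exact: intDZ.
rewrite IZ// in e1.
have -> : ip (psi_src - W (G psi_src)) (G psi_src) =
    sig 0 * (p - 1) * (I (fun x => (sig x * Q x) * phi x ^+ 2)
       - sig 0 * I (fun x => Q x * phi x ^+ 2)).
  rewrite -IZ// -IB//; last exact: intDZ.
  rewrite -IZ; last by apply: intDB => //; exact: intDZ.
  apply: ipE => x x_gt0; have x_ge0 := ltW x_gt0.
  rewrite L2valB WopE// !GopE// sol_psi// /= gtr0_norm// /psi /W0; ring.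
rewrite pmulr_rlt0 ?mulr_gt0 ?(gs_sig0 gs)//.
have : 0 <= sig 0 * I (fun x => Q x * phi x ^+ 2).
  rewrite mulr_ge0 ?(ltW (gs_sig0 gs))// I_ge0// => x _.
  by rewrite mulr_ge0 ?sqr_ge0// ltW.
have : I (fun x => sig x * Q x * phi x ^+ 2) < 0.
  rewrite -(pmulr_rlt0 _ (x := p + 1)) ?addr_gt0// e1 oppr_lt0.
  by rewrite mulr_gt0// exprn_gt0.
by lra.
Qed.

End linearized_spectrum.

(** * The bump profile satisfies the ground state hypotheses *)

Section profile_ground_state.
Context {R : realType}.
Variables (N : nat) (alpha p omega : R).
Hypothesis N_gt1 : (2 <= N)%N.
Hypothesis alpha_gt0 : 0 < alpha.
Hypothesis p_gt1 : 1 < p.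
Hypothesis omega_gt : alpha ^+ 2 / N%:R ^+ 2 < omega.
Implicit Types x y : R.

Let gam := Num.sqrt omega.
Let k := (p - 1) * Num.sqrt omega / 2.
Let y0 := artanh (- alpha / (N%:R * Num.sqrt omega)).
Let A := (p + 1) * omega / 2.
Let Q x := A * sech (k * x + y0) ^+ 2.
Let th y := (expR y - expR (- y)) / (expR y + expR (- y)).
Let sig x := - (gam * th (k * x + y0)).

Let N_gt0 : 0 < N%:R :> R.
Proof. by rewrite ltr0n; exact: leq_trans N_gt1. Qed.
Let omega_gt0 : 0 < omega.
Proof. by apply: le_lt_trans omega_gt; rewrite divr_ge0 ?sqr_ge0. Qed.
Let gam_gt0 : 0 < gam. Proof. by rewrite sqrtr_gt0. Qed.
Let gam2 : gam ^+ 2 = omega. Proof. by rewrite sqr_sqrtr// ltW. Qed.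
Let p1_gt0 : 0 < p - 1. Proof. by rewrite subr_gt0. Qed.
Let k_gt0 : 0 < k. Proof. by rewrite divr_gt0// mulr_gt0. Qed.
Let A_gt0 : 0 < A.
Proof. by rewrite divr_gt0// mulr_gt0// addr_gt0// (lt_trans ltr01). Qed.
Let a := - alpha / (N%:R * gam).
(** The lower bound is the condition [omega > alpha^2 / N^2]; it puts [a] in the range where
    [artanh] inverts [th]. *)
Let a_bd : -1 < a < 0.
Proof.
have d0 : 0 < N%:R * gam by rewrite mulr_gt0.
apply/andP; split; last by rewrite /a mulNr oppr_lt0 divr_gt0.
rewrite /a mulNr ltrN2 ltr_pdivrMr// mul1r.
rewrite -(@ltr_pXn2r _ 2)// ?nnegrE ?ltW// exprMn gam2.
by move: omega_gt; rewrite ltr_pdivrMr ?exprn_gt0// mulrC.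
Qed.

Let E_gt0 y : 0 < expR y + expR (- y). Proof. by rewrite addr_gt0// expR_gt0. Qed.

Let sech_gt0 y : 0 < sech y :> R. Proof. by rewrite divr_gt0. Qed.

Let expNV y : expR (- y) = (expR y)^-1. Proof. by rewrite expRN. Qed.

Let sech_le1 y : sech y <= 1 :> R.
Proof.
rewrite /sech ler_pdivrMr// mul1r expNV; have e0 := expR_gt0 y.
rewrite -(ler_pM2r e0) [leRHS]mulrDl mulVf ?gt_eqF//.
by have := sqr_ge0 (expR y - 1); rewrite sqrrB; lra.
Qed.

Let sech_le y : sech y <= 2 * expR (- y) :> R.
Proof.
rewrite /sech ler_pM2l// expNV lef_pV2 ?posrE ?addr_gt0 ?invr_gt0 ?expR_gt0//.
by rewrite lerDl invr_ge0 expR_ge0.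
Qed.

Let th2 y : th y ^+ 2 = 1 - sech y ^+ 2.
Proof.
have e0 : expR y * expR (- y) = 1 by rewrite expNV mulfV// gt_eqF// expR_gt0.
rewrite /th /sech !expr_div_n; apply/eqP; rewrite -subr_eq0; apply/eqP.
have h : (expR y + expR (- y)) ^+ 2 != 0 by rewrite expf_neq0// gt_eqF.
apply: (mulIf h); rewrite mul0r !(mulrBl, mulrDl, mulNr) !divfK// mul1r.
rewrite sqrrB sqrrD e0; ring.
Qed.

Let th_bd y : `|th y| <= 1.
Proof.
rewrite -(@ler_pXn2r _ 2)// ?nnegrE// expr1n real_normK ?num_real// th2.
by rewrite lerBlDr lerDl sqr_ge0.
Qed.

Let dE y : is_derive y 1 (fun z : R => expR (- z)) (- expR (- y)).
Proof.
by have := is_derive_expRM (- 1) y; rewrite !mulN1r; under [X in is_derive _ _ X _]eq_fun do rewrite mulN1r.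
Qed.

Let dth y : is_derive y 1 th (sech y ^+ 2).
Proof.
have h1 := derB (is_derive_expR y) (dE y).
have h2 := derD (is_derive_expR y) (dE y).
have nz : expR y + expR (- y) != 0 by rewrite gt_eqF.
have h := derM h1 (derV (f := fun z : R => expR z + expR (- z)) nz h2); apply: (der_eq h).
have e0 : expR y * expR (- y) = 1 by rewrite expNV mulfV// gt_eqF// expR_gt0.
rewrite /sech expr_div_n (_ : 2 ^+ 2 = 4 * (expR y * expR (- y))); last by rewrite e0; ring.
by field.
Qed.

Let dsech y : is_derive y 1 sech (- (th y * sech y)).
Proof.
have h2 := derD (is_derive_expR y) (dE y).
have nz : expR y + expR (- y) != 0 by rewrite gt_eqF.
by have h := derZ 2 (derV (f := fun z : R => expR z + expR (- z)) nz h2); apply: (der_eq h); rewrite /th /sech; field.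
Qed.

Let dy x : is_derive x 1 (fun z : R => k * z + y0) k.
Proof. by apply: der_eq (derD (der_lin k x) (is_derive_cst y0 x 1)) _; rewrite addr0. Qed.

Let dQ x : is_derive x 1 Q ((p - 1) * (sig x * Q x)).
Proof.
have h := is_derive1_comp (g := fun z : R => k * z + y0) (dsech (k * x + y0)) (dy x).
apply: der_eq (derZ A (derX 1 h)) _; rewrite /Q /sig /k /gam expr1 /=.
set g := Num.sqrt _; set t := th _; set s := sech _; by field.
Qed.

Let dsig x : is_derive x 1 sig (omega - Q x - sig x ^+ 2).
Proof.
have h := is_derive1_comp (g := fun z : R => k * z + y0) (dth (k * x + y0)) (dy x).
apply: der_eq (derN (derZ gam h)) _.
have -> : sig x ^+ 2 = gam ^+ 2 * (1 - sech (k * x + y0) ^+ 2).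
  by rewrite /sig sqrrN -th2; ring.
rewrite /Q; set s := sech _; rewrite /A -gam2 /k -/gam.
by field.
Qed.

Let Q_gt0 x : 0 < Q x. Proof. by rewrite mulr_gt0// exprn_gt0. Qed.

Let phi := bump_profile N alpha p omega.

Let phiE x : phi x = expR ((p - 1)^-1 * ln (Q x)).
Proof. by rewrite /phi /bump_profile /powR gt_eqF ?Q_gt0//; exact: Q_gt0. Qed.

Let phi_gt0 x : 0 < phi x. Proof. by rewrite phiE expR_gt0. Qed.

Let dphi x : is_derive x 1 phi (sig x * phi x).
Proof.
have h := is_derive1_comp (g := Q) (is_derive1_ln (Q_gt0 x)) (dQ x).
have {}h := is_derive1_comp (g := fun z => (p - 1)^-1 * ln (Q z))
  (is_derive_expR ((p - 1)^-1 * ln (Q x))) (derZ (p - 1)^-1 h).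
have -> : phi = expR \o (fun z => (p - 1)^-1 * ln (Q z)) by apply/funext => z; exact: phiE.
apply: der_eq h _; rewrite /= -phiE; field.
by rewrite !gt_eqF.
Qed.

Let phi_hi x : phi x <= expR ((p - 1)^-1 * (ln (4 * A) - 2 * y0)) * expR (- gam * x).
Proof.
rewrite phiE -expRD ler_expR.
have -> : (p - 1)^-1 * (ln (4 * A) - 2 * y0) + - gam * x =
  (p - 1)^-1 * (ln (4 * A) - 2 * (k * x + y0)).
  by rewrite /k -/gam; field; rewrite gt_eqF.
rewrite ler_pM2l ?invr_gt0//.
have h : Q x <= 4 * A * expR (- (2 * (k * x + y0))).
  rewrite /Q; set y := k * x + y0.
  have -> : 4 * A * expR (- (2 * y)) = A * (2 * expR (- y)) ^+ 2.
    by rewrite (_ : - (2 * y) = - y + - y) ?expRD; ring.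
  by rewrite ler_pM2l// lerXn2r ?nnegrE ?(ltW (sech_gt0 y)) ?sech_le// mulr_ge0// expR_ge0.
have h4 : 0 < 4 * A by rewrite mulr_gt0.
have := h; rewrite -ler_ln ?posrE ?(Q_gt0 x) ?(mulr_gt0 h4 (expR_gt0 _))//.
by rewrite lnM ?posrE ?expR_gt0// expRK.
Qed.

(** [phi * e^(gam x)] is nondecreasing, its logarithmic derivative being [sig + gam >= 0]. *)
Let phi_lo x : 0 < x -> phi 0 * expR (- gam * x) <= phi x.
Proof.
move=> x_gt0.
have h : phi 0 <= phi x * expR (gam * x).
  have := @increment_le0 R (fun _ => phi 0) (fun x => phi x * expR (gam * x)) (fun=> 0)
    (fun x => (sig x + gam) * (phi x * expR (gam * x))) x (ltW x_gt0).
  rewrite subrr mulr0 expR0 mulr1 subr_ge0; apply.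
  - exact: cnt_cst.
  - apply: cntM; first exact: is_derive_cnt dphi.
    by apply: is_derive_cnt => z; exact: is_derive_expRM.
  - by move=> z _; apply: der_eq (derM (dphi z) (is_derive_expRM gam z)) _; ring.
  - move=> z _; rewrite mulr_ge0// ?mulr_ge0 ?expR_ge0 ?(ltW (phi_gt0 z))//.
    rewrite /sig addrC subr_ge0 -[leRHS]mulr1 ler_pM2l// (le_trans _ (th_bd (k * z + y0)))//.
    exact: ler_norm.
rewrite mulNr expRN ler_pdivrMr ?expR_gt0//.
Qed.

Let th_y0 : th y0 = a.
Proof.
move/andP: a_bd => [a1 a0].
have q0 : 0 < (1 + a) / (1 - a) by rewrite divr_gt0//; lra.
have e2 : expR y0 ^+ 2 = (1 + a) / (1 - a).
  have -> : expR y0 ^+ 2 = expR (ln ((1 + a) / (1 - a))).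
    by rewrite expr2 -expRD [X in _ = expR X]splitr.
  by rewrite lnK// posrE.
rewrite /th expNV; have e0 := expR_gt0 y0.
have -> : (expR y0 - (expR y0)^-1) / (expR y0 + (expR y0)^-1) =
  (expR y0 ^+ 2 - 1) / (expR y0 ^+ 2 + 1).
  by field; rewrite !gt_eqF//= ?addr_gt0 ?mulr_gt0 ?exprn_gt0.
rewrite e2; field; apply/andP; split; apply/lt0r_neq0; lra.
Qed.

Let th_eq0 y : (th y == 0) = (y == 0).
Proof.
rewrite /th mulf_eq0 invr_eq0 [X in _ || X]gt_eqF// orbF subr_eq0.
apply/eqP/eqP => [/expR_inj h|->]; last by rewrite oppr0.
lra.
Qed.

Let y0_lt0 : y0 < 0.
Proof.
move/andP: a_bd => [a1 a0].
have d0 : 0 < 1 - a by lra.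
rewrite /y0 /artanh -/gam -/a pmulr_llt0 ?invr_gt0//.
rewrite -ln1 ltr_ln ?posrE// ?divr_gt0//; last by lra.
by rewrite ltr_pdivrMr//; lra.
Qed.

Lemma bump_profile_powR x : phi x `^ (p - 1) = Q x.
Proof.
rewrite {1}/powR gt_eqF// phiE expRK mulrA mulfV ?mul1r ?gt_eqF//.
by rewrite lnK// posrE.
Qed.

(** [sig] is [- gam tanh], whose value at the vertex is [alpha / N > 0]. The maximum of the bump is
    at [xm = - y0 / k], which is positive as [y0 < 0], and there [Q] takes the value
    [(p + 1) omega / 2], different from [omega]. *)
Lemma bump_profile_ground_state : exists sig Q c0 C0 Qb xm,
  ground_state phi sig Q omega p gam c0 C0 Qb xm /\
  forall x, Q x = phi x `^ (p - 1).
Proof.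
exists sig, Q, (phi 0), (expR ((p - 1)^-1 * (ln (4 * A) - 2 * y0))), A, (- y0 / k).
split; last by move=> x; rewrite bump_profile_powR.
split=> //.
- exact: expR_gt0.
- by move=> x; rewrite -[leRHS]mulr1 ler_pM2l// exprn_ile1// ltW.
- move=> x; rewrite normrN normrM gtr0_norm// -[leRHS]mulr1 ler_pM2l//.
- by rewrite divr_gt0// oppr_gt0.
- move=> x; rewrite /sig oppr_eq0 mulf_eq0 gt_eqF//= th_eq0 addr_eq0.
  rewrite -(inj_eq (mulfI (lt0r_neq0 k_gt0)) x) mulrC [in RHS](mulrC k (- y0 / k)) divfK//.
  by rewrite gt_eqF.
- have -> : Q (- y0 / k) = A.
    rewrite /Q mulrC [k * _]mulrC divfK ?gt_eqF// addNr /sech oppr0 expR0.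
    by rewrite divff ?expr1n ?mul1r// gt_eqF.
  by rewrite gt_eqF// /A; have := mulr_gt0 p1_gt0 omega_gt0; lra.
- rewrite /sig mulr0 add0r th_y0 /a mulNr mulrN opprK.
  by rewrite mulr_gt0// divr_gt0// mulr_gt0.
(* Beyond this point the argument exceeds 1, so its exponential is at least 2 and its hyperbolic
   tangent at least 1/2. *)
- exists ((1 - y0) / k) => x; rewrite ltr_pdivrMr// mulrC ltrBlDr => y1.
  rewrite /sig lerN2 ler_pM2l//; set y := k * x + y0 in y1 *.
  rewrite /th ler_pdivlMr// expNV -(ler_pM2r (expR_gt0 y)).
  have e0 : expR y != 0 by rewrite gt_eqF// expR_gt0.
  have ey : 2 <= expR y by apply: le_trans (expR_ge1Dx y); lra.
  have : 4 <= expR y * expR y.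
    by have := ler_pM _ _ ey ey; rewrite -natrM; apply.
  have -> : 2^-1 * (expR y + (expR y)^-1) * expR y = 2^-1 * (expR y * expR y + 1) by field.
  have -> : (expR y - (expR y)^-1) * expR y = expR y * expR y - 1 by field.
  lra.
Qed.

End profile_ground_state.

(** * A smooth step function *)

Section smooth_step.
Context {R : realType}.
Implicit Types (x y a b t : R) (f : R -> R).

(** The flat function [e^(-1/x)] together with its multiples by powers of [1/x]: a family whose
    linear span is stable under differentiation. *)
Definition rho (k : nat) x := if 0 < x then x ^- k * expR (- x^-1) else 0.

Lemma rho_ge0 k x : 0 <= rho k x.
Proof. by rewrite /rho; case: ifPn => // x0; rewrite mulr_ge0 ?expR_ge0// invr_ge0 exprn_ge0// ltW. Qed.

Lemma rho_gt0 k x : 0 < x -> 0 < rho k x.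
Proof. by move=> x0; rewrite /rho x0 mulr_gt0 ?expR_gt0// invr_gt0 exprn_gt0. Qed.

Lemma rho_le0 k x : x <= 0 -> rho k x = 0.
Proof. by move=> x0; rewrite /rho ltNge x0. Qed.

Lemma expRN_pow_le (n : nat) y : 0 < y -> y ^+ n.+1 * expR (- y) <= n.+1%:R ^+ n.+1.
Proof.
move=> y0; have n0 : 0 < n.+1%:R :> R by rewrite ltr0n.
have h : y / n.+1%:R <= expR (y / n.+1%:R).
  by apply: le_trans (expR_ge1Dx _); rewrite lerDr.
have e : expR (y / n.+1%:R) ^+ n.+1 = expR y.
  by rewrite -expRM_natl mulrC divfK// gt_eqF.
have : (y / n.+1%:R) ^+ n.+1 <= expR y.
  by rewrite -e lerXn2r ?nnegrE ?expR_ge0// divr_ge0// ltW.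
rewrite expr_div_n ler_pdivrMr ?exprn_gt0// => h2.
by rewrite expRN ler_pdivrMr ?expR_gt0// mulrC.
Qed.

(** The exponential beats every power of [1/x]; the two orders gained make [rho k] differentiable at
    0 with derivative 0. *)
Lemma rho_sq k x : 0 < x -> rho k x <= k.+2%:R ^+ k.+2 * x ^+ 2.
Proof.
move=> x0; rewrite /rho x0.
have := expRN_pow_le k.+1 (y := x^-1); rewrite invr_gt0 => /(_ x0).
rewrite -(ler_pM2r (exprn_gt0 2 x0)); apply: le_trans; rewrite le_eqVlt; apply/orP; left; apply/eqP.
by rewrite -exprVn [in RHS]exprS exprS; field; rewrite gt_eqF.
Qed.

Lemma rho_derive k x : is_derive x 1 (rho k) (rho k.+2 x - k%:R * rho k.+1 x).
Proof.
have [x0|x0|->] := ltgtP x 0.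
- rewrite !rho_le0 ?(ltW x0)// mulr0 subrr.
  apply: is_derive_eps => e e0; exists (- x); first by rewrite oppr_gt0.
  move=> s sx; have s0 : s < 0 by move: sx; rewrite ltr_norml; lra.
  by rewrite (rho_le0 k (ltW s0)) (rho_le0 k (ltW x0)) mulr0 !subr0 normr0 mulr_ge0// ltW.
- pose f (z : R) := z ^- k * expR (- z^-1).
  have x1 : x != 0 by rewrite gt_eqF.
  have hV := derV (f := id) x1 (is_derive_id x 1).
  have hk : is_derive x 1 (fun z : R => z ^- k) (- k%:R * x ^- k.+1).
    case: k @f => [|k] _.
      rewrite oppr0 mul0r (_ : (fun z : R => z ^- 0) = fun=> 1); first exact: is_derive_cst.
      by apply/funext => z; rewrite expr0 invr1.
    have h := derV (f := fun z : R => z ^+ k.+1) (expf_neq0 k.+1 x1) (derX k (is_derive_id x 1)).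
    by apply: der_eq h _; rewrite !exprS; field; rewrite expf_neq0//= x1.
  have he := is_derive1_comp (g := fun z : R => - z^-1) (is_derive_expR (- x^-1)) (derN hV).
  have hf : is_derive x 1 f (rho k.+2 x - k%:R * rho k.+1 x).
    apply: der_eq (derM hk he) _; rewrite /rho x0 /=.
    by rewrite ![x ^+ _.+1]exprS; field; rewrite expf_neq0//= x1.
  apply: is_derive_eps => e e0; have [d d0 hd] := is_derive_eps_inv hf e0.
  exists (Num.min d x); first by rewrite lt_min d0.
  move=> s; rewrite lt_min => /andP[sd sx].
  have s0 : 0 < s by move: sx; rewrite ltr_norml; lra.
  have rE z : 0 < z -> rho k z = f z by move=> z0; rewrite /rho z0.
  by have := hd s sd; rewrite !rE.
- rewrite !rho_le0// mulr0 subrr.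
  set C : R := k.+2%:R ^+ k.+2; have C0 : 0 < C by rewrite exprn_gt0.
  apply: is_derive_eps => e e0; exists (e / C); first by rewrite divr_gt0.
  move=> s; rewrite !subr0 mulr0 subr0 (rho_le0 k (lexx 0)) subr0 => se.
  rewrite ger0_norm ?rho_ge0//; have [s0|s0] := leP s 0.
    by rewrite rho_le0// mulr_ge0// ltW.
  move: se; rewrite gtr0_norm// => se; apply: le_trans (rho_sq k s0) _.
  rewrite expr2 mulrA ler_pM2r// -/C mulrC -ler_pdivlMr//; exact: ltW.
Qed.

(** A class of expressions stable under differentiation, so that smoothness to all orders follows by
    induction without computing any higher derivative. *)
Inductive sm : (R -> R) -> Prop :=
| sm_cst a : sm (fun=> a)
| sm_rho k a b : sm (fun x => rho k (a * x + b))
| sm_add f g : sm f -> sm g -> sm (fun x => f x + g x)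
| sm_mul f g : sm f -> sm g -> sm (fun x => f x * g x)
| sm_inv f : (forall x, f x != 0) -> sm f -> sm (fun x => (f x)^-1).

Lemma sm_derive f : sm f -> exists2 f', sm f' & forall x, is_derive x 1 f (f' x).
Proof.
elim=> [a|k a b|{}f g _ [f' sf' df] _ [g' sg' dg]|{}f g sf [f' sf' df] sg [g' sg' dg]
       |{}f f0 sf [f' sf' df]].
- by exists (fun=> 0); [exact: sm_cst|move=> x; exact: (is_derive_cst a x 1)].
- exists (fun x => (rho k.+2 (a * x + b) + (- k%:R) * rho k.+1 (a * x + b)) * a).
    do ! first [exact: sm_cst | exact: sm_rho | apply: sm_mul | apply: sm_add].
  move=> x.
  have h : is_derive x 1 (fun z : R => a * z + b) a.
    by apply: der_eq (derD (der_lin a x) (is_derive_cst b x 1)) _; rewrite addr0.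
  have h2 := is_derive1_comp (g := fun z : R => a * z + b) (rho_derive k (a * x + b)) h.
  by apply: der_eq h2 _; rewrite mulNr.
- by exists (fun x => f' x + g' x); [exact: sm_add|move=> x; exact: derD].
- exists (fun x => f' x * g x + f x * g' x); last by move=> x; exact: derM.
  by apply: sm_add; apply: sm_mul.
- exists (fun x => (- 1) * ((f x)^-1 * (f x)^-1) * f' x).
    by have si := sm_inv f0 sf; exact: (sm_mul (sm_mul (sm_cst (- 1)) (sm_mul si si)) sf').
  move=> x; apply: der_eq (derV (f0 x) (df x)) _.
  by rewrite mulN1r -invfM expr2.
Qed.

Lemma sm_smooth f : sm f -> forall n x, derivable (derive1n n f) x 1.
Proof.
move=> sf n.
suff [g sg ->] : exists2 g, sm g & derive1n n f = g.
  by have [g' _ dg] := sm_derive sg; move=> x; case: (dg x).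
elim: n => [|n [g sg e]]; first by exists f.
have [g' sg' dg] := sm_derive sg; exists g' => //.
rewrite derive1nS e; apply/funext => x; rewrite derive1E.
by case: (dg x).
Qed.

Let den_gt0 t : 0 < rho 0 t + rho 0 (1 - t).
Proof.
have [t0|t0] := lerP t 0; last by rewrite ltr_pwDl ?rho_gt0 ?rho_ge0.
by rewrite ltr_wpDl ?rho_ge0// rho_gt0//; lra.
Qed.

Definition step t := rho 0 t / (rho 0 t + rho 0 (1 - t)).
Definition step' t := (rho 2 t * rho 0 (1 - t) + rho 0 t * rho 2 (1 - t)) /
  (rho 0 t + rho 0 (1 - t)) ^+ 2.

Lemma step_derive t : is_derive t 1 step (step' t).
Proof.
have h1 : is_derive t 1 (rho 0) (rho 2 t).
  by apply: der_eq (rho_derive 0 t) _; rewrite mul0r subr0.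
have h2 : is_derive t 1 (fun z : R => rho 0 (1 - z)) (- rho 2 (1 - t)).
  have h : is_derive (1 - t) 1 (rho 0) (rho 2 (1 - t)).
    by apply: der_eq (rho_derive 0 (1 - t)) _; rewrite mul0r subr0.
  have h3 : is_derive t 1 (fun z : R => 1 - z) (- 1).
    by apply: der_eq (derB (is_derive_cst (1 : R) t 1) (is_derive_id t 1)) _; rewrite sub0r.
  by apply: der_eq (is_derive1_comp (g := fun z : R => 1 - z) h h3) _; rewrite mulrN1.
have nz : rho 0 t + rho 0 (1 - t) != 0 by rewrite gt_eqF.
apply: der_eq (derM h1 (derV (f := fun z : R => rho 0 z + rho 0 (1 - z)) nz (derD h1 h2))) _.
by rewrite /step'; field.
Qed.

Lemma step'_ge0 t : 0 <= step' t.
Proof. by rewrite divr_ge0 ?sqr_ge0// addr_ge0// mulr_ge0// rho_ge0. Qed.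

Lemma step_0 t : t <= 0 -> step t = 0.
Proof. by move=> t0; rewrite /step rho_le0// mul0r. Qed.

Lemma step_1 t : 1 <= t -> step t = 1.
Proof.
move=> t1; have h : 1 - t <= 0 by rewrite subr_le0.
by rewrite /step (rho_le0 0 h) addr0 divff// gt_eqF// rho_gt0// (lt_le_trans ltr01).
Qed.

Lemma step_ge0 t : 0 <= step t.
Proof. by rewrite divr_ge0 ?rho_ge0// ltW. Qed.

Lemma step_le1 t : step t <= 1.
Proof. by rewrite ler_pdivrMr// mul1r lerDl rho_ge0. Qed.

Lemma sm_step a b : sm (fun x => step (a * x + b)).
Proof.
have e : (fun x => rho 0 (1 - (a * x + b))) = (fun x => rho 0 (- a * x + (1 - b))).
  by apply/funext => x; congr rho; ring.
apply: (@sm_mul _ (fun x => (rho 0 (a * x + b) + rho 0 (1 - (a * x + b)))^-1)); first exact: sm_rho.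
apply: (@sm_inv (fun x => rho 0 (a * x + b) + rho 0 (1 - (a * x + b)))).
  by move=> x; rewrite gt_eqF.
apply: (@sm_add _ (fun x => rho 0 (1 - (a * x + b)))); first exact: sm_rho.
by rewrite e; exact: sm_rho.
Qed.

End smooth_step.

(** * Weak derivatives, their uniqueness and the Sobolev bound *)

Section weak_derivatives.
Context {R : realType}.
Local Notation mu := (@lebesgue_measure R).
Local Notation D := (@half_line R).
Implicit Types (f g h phi : R -> R) (x y r : R).

Definition weakR f g := forall phi, test_function phi ->
  I (fun x => f x * derive1 phi x) = - I (fun x => g x * phi x).

Lemma test_derive phi x : test_function phi -> is_derive x 1 phi (derive1 phi x).
Proof. by move=> [d _]; split; [exact: (d 0%N x)|rewrite derive1E]. Qed.

Lemma test_continuous phi : test_function phi -> continuous phi.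
Proof. by move=> tp; apply: is_derive_cnt => x; exact: test_derive. Qed.

Lemma test_deriv_test phi : test_function phi -> test_function (derive1 phi).
Proof.
move=> tp; have [d [a [b [a0 ab]]]] := tp; split.
  by move=> n x; have := d n.+1 x; rewrite derive1Sn.
exists (a / 2), (b + 1); split=> [|x xab]; first by rewrite divr_gt0.
have [_ <-] := test_derive x tp.
suff : is_derive x 1 phi 0 by case.
apply: is_derive_eps => e e0.
have out (s : R) : s \notin `[a, b] -> phi s = 0 by exact: ab.
have xout : x < a \/ b < x.
  move: xab; rewrite in_itv/= negb_and -!ltNge => /orP[h|h]; [left|right]; lra.
have z s : (s < a) \/ (b < s) -> phi s = 0.
  move=> h; apply: out; rewrite in_itv/= negb_and -!ltNge.
  by case: h => ->; rewrite ?orbT.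
case: xout => h.
- exists (a - x); first by rewrite subr_gt0.
  move=> s; rewrite ltr_norml => /andP[_ sx].
  by rewrite !z ?mulr0 ?subrr ?normr0 ?mulr_ge0 ?(ltW e0)//; left; lra.
- exists (x - b); first by rewrite subr_gt0.
  move=> s; rewrite ltr_norml => /andP[sx _].
  by rewrite !z ?mulr0 ?subrr ?normr0 ?mulr_ge0 ?(ltW e0)//; right; lra.
Qed.

Lemma test_bound phi : test_function phi -> exists2 B, 0 <= B & forall x, 0 < x -> `|phi x| <= B.
Proof.
move=> tp; have [_ [a [b [a0 ab]]]] := tp.
have cp := test_continuous tp.
have [ab'|ba] := lerP a b; last first.
  exists 0 => // x _; rewrite ab ?normr0// in_itv/= negb_and -!ltNge.
  by have [//|/=] := ltP x a => ax; exact: lt_le_trans ax.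
have cn : {within `[a, b], continuous (fun x => `|phi x|)}.
  by apply: continuous_subspaceT => x; apply: cvg_norm; exact: cp.
have [c _ hc] := EVT_max ab' cn.
exists `|phi c| => // x _; have [xab|xab] := boolP (x \in `[a, b]); first exact: hc.
by rewrite ab// normr0.
Qed.

Lemma intD_L2_test f phi : measurable_fun D f -> intD (fun x => f x ^+ 2) -> test_function phi ->
  intD (fun x => f x * phi x).
Proof.
move=> mf fi tp; have cp := test_continuous tp.
apply: intD_mul => //; first exact: continuous_mD.
have [_ [a [b [a0 ab]]]] := tp.
apply: (@intD_supp _ _ b) => [|x bx]; first exact: cntX.
by rewrite ab ?expr0n// in_itv/= negb_and -!ltNge bx orbT.
Qed.

Lemma weakR_classical f f1 : continuous f -> continuous f1 ->
  (forall x, 0 < x -> is_derive x 1 f (f1 x)) -> weakR f f1.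
Proof.
move=> cf cf1 df phi tp; have cp := test_continuous tp.
have cp' := test_continuous (test_deriv_test tp).
have vanish psi : test_function psi -> exists b, forall x, b < x -> psi x = 0.
  move=> [_ [a [b [a0 ab]]]]; exists b => x bx.
  by rewrite ab// in_itv/= negb_and -!ltNge bx orbT.
have [b phi0] := vanish _ tp; have [b' phi'0] := vanish _ (test_deriv_test tp).
have i1 : intD (fun x => f1 x * phi x).
  by apply: (@intD_supp _ _ b) => [|x /phi0 ->]; [exact: cntM|rewrite mulr0].
have i2 : intD (fun x => f x * derive1 phi x).
  by apply: (@intD_supp _ _ b') => [|x /phi'0 ->]; [exact: cntM|rewrite mulr0].
have i3 : intD (fun x => f x * phi x).
  by apply: (@intD_supp _ _ b) => [|x /phi0 ->]; [exact: cntM|rewrite mulr0].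
have dF x (x0 : 0 < x) := derM (df x x0) (test_derive x tp).
have e := I_FTC (F := fun x => f x * phi x) (f := fun x => f1 x * phi x + f x * derive1 phi x)
  (cntM cf cp) (cntD (cntM cf1 cp) (cntM cf cp'))
  dF i3 (intDD i1 i2).
have phi00 : phi 0 = 0.
  by have [_ [a [c [a0 ->]]]] := tp; rewrite // in_itv/= negb_and -ltNge a0.
rewrite ID// phi00 mulr0 oppr0 in e; lra.
Qed.

(** For [x < y] a smooth approximation of the indicator of []x, y]], with transition layers of width
    [1 / n] to the right of [x] and of [y]. *)
Definition hat (n : R) x y z := step (n * z - n * x) - step (n * z - n * y).

Lemma hat_test n x y : 0 < n -> 0 < x -> 0 < y -> test_function (hat n x y).
Proof.
move=> n0 x0 y0; split.
  apply: sm_smooth.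
  apply: (@sm_add _ _ (fun z => - step (n * z - n * y))); first exact: sm_step.
  rewrite (_ : (fun z => _) = (fun z => (-1) * step (n * z + - (n * y)))).
    by apply: sm_mul; [exact: sm_cst|exact: sm_step].
  by apply/funext => z; rewrite mulN1r.
exists (Num.min x y), (Num.max x y + n^-1); split=> [|z]; first by rewrite lt_min x0.
rewrite in_itv/= negb_and -!ltNge => /orP[|].
  rewrite lt_min => /andP[zx zy]; rewrite /hat !step_0 ?subrr// -mulrBr.
    by rewrite pmulr_rle0// subr_le0 ltW.
  by rewrite pmulr_rle0// subr_le0 ltW.
have e : n * n^-1 = 1 by rewrite mulfV// gt_eqF.
rewrite -ltrBrDr gt_max => /andP[h1 h2]; rewrite /hat !step_1 ?subrr// -mulrBr -e ler_pM2l//; lra.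
Qed.

Lemma hat_derive (n x y z : R) : is_derive z 1 (hat n x y)
  (n * step' (n * z - n * x) - n * step' (n * z - n * y)).
Proof.
have h (c : R) : is_derive z 1 (fun z : R => step (n * z - n * c)) (n * step' (n * z - n * c)).
  have h1 : is_derive z 1 (fun z : R => n * z - n * c) n.
    by apply: der_eq (derB (der_lin n z) (is_derive_cst (n * c) z 1)) _; rewrite subr0.
  by apply: der_eq (is_derive1_comp (g := fun z : R => n * z - n * c) (step_derive _) h1) _; rewrite mulrC.
exact: derB.
Qed.


Lemma step'_out t : t <= 0 \/ 1 <= t -> step' t = 0 :> R.
Proof.
rewrite /step'; case=> h; first by rewrite !(rho_le0 _ h) !mul0r add0r mul0r.
have h' : 1 - t <= 0 by rewrite subr_le0.
by rewrite !(rho_le0 _ h') !mulr0 add0r mul0r.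
Qed.

Lemma step'_cnt : continuous (@step' R).
Proof.
have cr k : continuous (@rho R k) by apply: is_derive_cnt => x; exact: rho_derive.
have cr' k : continuous (fun t : R => rho k (1 - t)).
  move=> t; apply: (@continuous_comp R R R (fun t : R => 1 - t) (rho k)); last exact: cr.
  by apply: cvgB; [exact: cvg_cst|exact: cvg_id].
apply: cntM; first by apply: cntD; apply: cntM.
apply: cntV; last by apply: cntX; exact: cntD.
move=> t; rewrite expf_neq0// gt_eqF//.
have [t0|t0] := lerP t 0; last by rewrite ltr_pwDl ?rho_gt0 ?rho_ge0.
by rewrite ltr_wpDl ?rho_ge0// rho_gt0//; lra.
Qed.

(** Approximate identity at [c]: nonnegative, supported in [[c, c + 1 / n]], and of mass 1 when
    [c > 0]. The derivative of [hat n x y] is [k n x - k n y]. *)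
Let k (n c z : R) := n * step' (n * z - n * c).

Let k_cnt n c : continuous (k n c).
Proof.
apply: cntM; first exact: cnt_cst.
move=> z; apply: (@continuous_comp R R R (fun z : R => n * z - n * c) step'); last exact: step'_cnt.
by apply: is_derive_cnt => z'; exact: (derB (der_lin n z') (is_derive_cst (n * c) z' 1)).
Qed.

Let k_out n c z : 0 < n -> z <= c \/ c + n^-1 <= z -> k n c z = 0.
Proof.
move=> n0 h; rewrite /k step'_out ?mulr0//; rewrite -mulrBr; case: h => h; [left|right].
  by rewrite pmulr_rle0// subr_le0.
have e : n * n^-1 = 1 by rewrite mulfV// gt_eqF.
by rewrite -e ler_pM2l//; lra.
Qed.

Let k_ge0 n c z : 0 < n -> 0 <= k n c z.
Proof. by move=> n0; rewrite mulr_ge0 ?step'_ge0// ltW. Qed.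

Let k_supp h n c : 0 < n -> continuous h -> intD (fun z => h z * k n c z).
Proof.
move=> n0 ch; apply: (@intD_supp _ _ (c + n^-1)); first exact: cntM.
by move=> z h'; rewrite k_out ?mulr0//; right; exact: ltW.
Qed.

Let k_int1 n c : 0 < n -> intD (k n c).
Proof.
move=> n0; have := k_supp c n0 (@cnt_cst R 1); apply: intD_eq => z _; exact: mul1r.
Qed.

Let k_I n c : 0 < n -> 0 < c -> I (k n c) = 1.
Proof.
move=> n0 c0; have kc := @k_cnt n c.
have h := J_cvg kc (k_int1 c n0).
apply: (cvg_unique _ h) => //.
apply: cvg_near_cst; near=> r.
have r0 : 0 < r by near: r; apply: nbhs_pinfty_gt; rewrite num_real.
have rc : c + n^-1 <= r by near: r; apply: nbhs_pinfty_ge; rewrite num_real.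
have dF (z : R) : 0 < z -> is_derive z 1 (fun z : R => step (n * z - n * c)) (k n c z).
  move=> _; have h1 : is_derive z 1 (fun z : R => n * z - n * c) n.
    by apply: der_eq (derB (der_lin n z) (is_derive_cst (n * c) z 1)) _; rewrite subr0.
  by apply: der_eq (is_derive1_comp (g := fun z : R => n * z - n * c) (step_derive _) h1) _; rewrite /k mulrC.
have cF : continuous (fun z : R => step (n * z - n * c)).
  move=> z; apply: (@continuous_comp R R R (fun z : R => n * z - n * c) step).
    by apply: is_derive_cnt => z'; exact: (derB (der_lin n z') (is_derive_cst (n * c) z' 1)).
  by apply: is_derive_cnt => z'; exact: step_derive.
rewrite (FTC_J r0 kc cF dF) mulr0 sub0r (@step_0 _ (- (n * c))) ?oppr_le0 ?mulr_ge0 ?(ltW n0) ?(ltW c0)//.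
rewrite step_1 ?subr0//.
have e : n * n^-1 = 1 by rewrite mulfV// gt_eqF.
by rewrite -mulrBr -e ler_pM2l//; lra.
Unshelve. all: by end_near. Qed.

Let k_cvg f c : continuous f -> 0 < c ->
  I (fun z => f z * k m.+1%:R c z) @[m --> \oo] --> f c.
Proof.
move=> cf c0; apply/cvgrPdist_le => e e0.
have /cvgrPdist_le /(_ e e0) [d /= d0 hd] := cf c.
near=> m.
have nd : (m.+1%:R : R)^-1 < d by near: m; exact: near_infty_natSinv_lt (PosNum d0).
move: nd; set n : R := m.+1%:R => nd.
have n0 : 0 < n by rewrite ltr0n.
have -> : f c = I (fun z => f c * k n c z) by rewrite IZ ?k_I ?mulr1//; exact: k_int1.
rewrite -IB; [|exact: (k_supp c n0 (@cnt_cst R (f c)))|exact: k_supp].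
have ik := k_int1 c n0.
have hb : intD (fun z => f c * k n c z - f z * k n c z).
  by apply: intDB; [exact: (k_supp c n0 (@cnt_cst R (f c)))|exact: k_supp].
have pw z : 0 < z -> `|f c * k n c z - f z * k n c z| <= e * k n c z.
  move=> z0; rewrite -mulrBl normrM (ger0_norm (k_ge0 c z n0)).
  have [h|h] := boolP ((z <= c) || (c + n^-1 <= z)).
    by rewrite (k_out n0) ?mulr0//; exact/orP.
  rewrite ler_wpM2r ?k_ge0//; apply: hd; rewrite /ball_ /=.
  move: h; rewrite negb_or -!ltNge => /andP[h1 h2].
  by rewrite distrC gtr0_norm ?subr_gt0// (lt_trans _ nd)// ltrBlDl.
apply: le_trans (le_normr_Rintegral _ hb) _ => //.
apply: (@le_trans _ _ (I (fun z => e * k n c z))); last by rewrite IZ// k_I// mulr1.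
apply: I_le => //; [exact: integrable_abse hb|exact: intDZ].
Unshelve. all: by end_near. Qed.

Let cst_itv x y (c : R) : 0 <= x -> mu.-integrable `]x, y] (EFin \o (fun=> c)).
Proof.
move=> x0; apply: integrableS (J_int y (@cnt_cst R c)) => // z /=.
by rewrite !in_itv/= => /andP[xz ->]; rewrite andbT (le_trans x0 (ltW xz)).
Qed.

Lemma L2_itv g x y : 0 <= x -> measurable_fun D g -> intD (fun z => g z ^+ 2) ->
  mu.-integrable `]x, y] (EFin \o g).
Proof.
move=> x0 mg ig.
have sub : [set` `]x, y]] `<=` D.
  by move=> z /=; rewrite in_itv/= => /andP[xz _]; rewrite inD; exact: le_lt_trans xz.
have i1 : mu.-integrable `]x, y] (EFin \o (fun z => g z ^+ 2)) by exact: integrableS ig.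
have i2 := cst_itv y 1 x0.
have mI : measurable (`]x, y]%classic : set (measurableTypeR R)) by exact: measurable_itv.
have i3 := integrableD mI i1 i2.
apply: (le_integrable _ _ _ i3) => //.
  apply/measurable_EFinP.
  by apply: (@measurable_funS _ _ _ _ D); [exact: measurable_itv|exact: sub|exact: mg].
move=> z _ /=; rewrite lee_fin [leRHS]ger0_norm ?addr_ge0 ?sqr_ge0//.
have := sqr_ge0 (`|g z| - 1); rewrite sqrrB real_normK ?num_real//.
have := normr_ge0 (g z); lra.
Qed.

Let RI x y g := \int[mu]_(z in `]x, y]) g z.
Let cut x y g z := if (x < z) && (z <= y) then g z else 0.

Let cut_mD x y g : measurable_fun D g -> measurable_fun D (cut x y g).
Proof.
move=> mg; apply: measurable_fun_if => //.
- exact: measurable_itv.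
- apply: measurable_and; first by apply: measurable_fun_ltr => //; exact: measurable_cst.
  by apply: measurable_fun_ler => //; exact: measurable_cst.
- by apply: (@measurable_funS _ _ _ _ D); [exact: measurable_itv|move=> z []|exact: mg].
Qed.

Let RI_cut x y g : 0 <= x -> RI x y g = I (cut x y g).
Proof.
move=> x0; rewrite /RI (_ : [set` `]x, y]] = D `&` [set z | (x < z) && (z <= y)]); last first.
  apply/seteqP; split => z /=; rewrite in_itv/= inD; last by case.
  by move=> h; split => //; case/andP: h => xz _; exact: le_lt_trans xz.
rewrite Rintegral_mkcondr; apply: eq_Rintegral => z _.
rewrite /cut patchE; case: ifPn => [|/negP h]; first by rewrite inE /= => ->.
by case: ifPn => // h2; exfalso; apply: h; rewrite inE.
Qed.


Lemma weakR_FTC f g x y : continuous f -> measurable_fun D g ->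
  intD (fun z => g z ^+ 2) -> weakR f g -> 0 < x -> x < y -> f y - f x = RI x y g.
Proof.
move=> cf mg ig wfg x0 xy; have y0 := lt_trans x0 xy.
have l1 : I (fun z => f z * k m.+1%:R x z) - I (fun z => f z * k m.+1%:R y z)
    @[m --> \oo] --> f x - f y by apply: cvgB; exact: k_cvg.
pose hm m z := hat (m.+1%:R : R) x y z.
have n0 m : 0 < m.+1%:R :> R by rewrite ltr0n.
have e m : I (fun z => f z * k m.+1%:R x z) - I (fun z => f z * k m.+1%:R y z) =
    - I (fun z => g z * hm m z).
  rewrite -(wfg _ (hat_test (n0 m) x0 y0)) -IB; [|exact: k_supp|exact: k_supp].
  by apply: I_eq => z _; rewrite derive1E; have [_ ->] := hat_derive m.+1%:R x y z;
    rewrite /k; ring.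
have hm_bd m z : `|hm m z| <= 1.
  have := step_ge0 (m.+1%:R * z - m.+1%:R * x); have := step_le1 (m.+1%:R * z - m.+1%:R * x).
  have := step_ge0 (m.+1%:R * z - m.+1%:R * y); have := step_le1 (m.+1%:R * z - m.+1%:R * y).
  by rewrite /hm /hat ler_norml; lra.
have hm_out m z : y + 1 < z -> hm m z = 0.
  move=> yz; have h c : c <= y -> 1 <= m.+1%:R * z - m.+1%:R * c.
    move=> cy; rewrite -mulrBr; have m1 : 1 <= m.+1%:R :> R by rewrite ler1n.
    by have := ler_pM ler01 ler01 m1 (_ : 1 <= z - c); rewrite mulr1; apply; lra.
  by rewrite /hm /hat !step_1 ?subrr// h// ltW.
(* Dominating function: since the parameter [m.+1] is at least 1, all the test functions vanish
   beyond [y + 1]. *)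
pose G z := if z <= y + 1 then `|g z| else 0.
have iG : mu.-integrable D (EFin \o G).
  have := @L2_itv g 0 (y + 1) (lexx 0) mg ig.
  move=> /integrable_abse; rewrite integrable_mkcond// => h.
  have := integrableS measurableT (measurable_D) (@subsetT _ _) h.
  apply: eq_integrable => // z; rewrite inE inD => z0; rewrite patchE /G.
  have -> : (z \in `]0, y + 1]%classic) = (z <= y + 1).
    by apply/idP/idP; rewrite inE /= in_itv/= z0.
  by rewrite /=; case: ifP.
pose lim := cut x y g.
have mh m : measurable_fun D (fun z => g z * hm m z).
  apply: measurable_funM => //; apply: continuous_mD.
  by apply: is_derive_cnt => z; exact: hat_derive.
have := @dominated_convergence _ _ R mu D (measurable_D) (fun m z => (g z * hm m z)%:E)
  (fun z => (lim z)%:E) (EFin \o G).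
move=> H; have {}H : (\int[mu]_(z in D) (g z * hm m z)%:E)%E @[m --> \oo] -->
    (\int[mu]_(z in D) (lim z)%:E)%E.
  case: H => //.
  - by move=> m; apply/measurable_EFinP; exact: mh.
  - by apply/measurable_EFinP; exact: cut_mD.
  - apply/aeW => z Dz; apply: cvg_EFin; first exact: nearW.
    apply: cvg_near_cst; rewrite /lim /cut /= /hm /hat.
    have [xz|zx] /= := ltP x z; last first.
      apply: nearW => m; have h c : x <= c -> m.+1%:R * z - m.+1%:R * c <= 0.
        by move=> xc; rewrite -mulrBr pmulr_rle0// subr_le0 (le_trans zx).
      by rewrite !step_0 ?subrr ?mulr0// h// ltW.
    have big (m : nat) c : c < z -> m.+1%:R^-1 < z - c -> 1 <= m.+1%:R * z - m.+1%:R * c.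
      move=> cz hc; rewrite -mulrBr.
      have e' : (m.+1%:R : R) * m.+1%:R^-1 = 1 by rewrite mulfV// gt_eqF.
      by rewrite -[leLHS]e' ler_pM2l// ltW.
    have zx0 : 0 < z - x by rewrite subr_gt0.
    have [zy|yz] := leP z y.
      near=> m; have mx : m.+1%:R^-1 < z - x by near: m; exact: near_infty_natSinv_lt (PosNum zx0).
      rewrite (step_1 (big m x xz mx)) step_0 ?subr0 ?mulr1// -mulrBr.
      by rewrite pmulr_rle0// subr_le0.
    have zy0 : 0 < z - y by rewrite subr_gt0.
    near=> m; have mx : m.+1%:R^-1 < z - x by near: m; exact: near_infty_natSinv_lt (PosNum zx0).
    have my : m.+1%:R^-1 < z - y by near: m; exact: near_infty_natSinv_lt (PosNum zy0).
    by rewrite (step_1 (big m x xz mx)) (step_1 (big m y yz my)) subrr mulr0.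
  - apply/aeW => z m _ /=; rewrite lee_fin /G.
    case: ifPn => [_|]; first by rewrite normrM ler_piMr.
    by rewrite -ltNge => /hm_out ->; rewrite mulr0 normr0.
have ilim : intD lim.
  apply: (intD_le _ _ iG); first exact: cut_mD.
  move=> z z0; rewrite /lim /cut /G; case: ifPn => [/andP[_ zy]|_].
    by rewrite ifT//; lra.
  by rewrite normr0; case: ifP.
have l2 : - I (fun z => g z * hm m z) @[m --> \oo] --> - I lim.
  apply: cvgN; rewrite /I /Rintegral.
  by apply: fine_cvg; rewrite fineK//; exact: integrable_fin_num.
have l1' : - I (fun z => g z * hm m z) @[m --> \oo] --> f x - f y.
  by apply: cvg_trans l1; apply: near_eq_cvg; near=> m; rewrite e.
have := cvg_unique _ l1' l2; rewrite RI_cut ?(ltW x0)// -/lim => h.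
have {}h : f x - f y = - I lim by exact: h.
by lra.
Unshelve. all: by end_near. Qed.

(** Somewhere in []x, x + 1]] the modulus of [f] is at most [2 nu], otherwise its [L^2] mass would
    be too large, and the increment from [x] to that point is at most [nu]; hence the factor 3. *)
Lemma sobolev_bound f g nu : continuous f -> intD (fun z => f z ^+ 2) -> measurable_fun D g ->
  intD (fun z => g z ^+ 2) -> weakR f g -> 0 < nu ->
  I (fun z => f z ^+ 2) + I (fun z => g z ^+ 2) <= nu ^+ 2 ->
  forall x, 0 <= x -> `|f x| <= 3 * nu.
Proof.
move=> cf fi mg ig wfg nu0 hnu.
have f20 := I_ge0 (fun z _ => sqr_ge0 (f z)) ; have g20 := I_ge0 (fun z _ => sqr_ge0 (g z)).
suff main x : 0 < x -> `|f x| <= 3 * nu.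
  move=> x; rewrite le_eqVlt => /orP[/eqP <-|]; last exact: main.
  have c : `|f z| @[z --> 0^'+] --> `|f 0|.
    by apply: cvg_norm; apply: cvg_at_right_filter; exact: cf.
  apply: (cvgr_to_le c); near=> z; apply: main; near: z; exact: nbhs_right_gt.
move=> x0.
have [z [xz zx fz]] : exists z, [/\ x < z, z <= x + 1 & `|f z| <= 2 * nu].
  apply: contrapT => /forallNP h.
  have big z : x < z <= x + 1 -> (2 * nu) ^+ 2 <= f z ^+ 2.
    move=> /andP[xz zx]; rewrite -[leRHS]real_normK ?num_real// lerXn2r ?nnegrE//.
      by rewrite mulr_ge0// ltW.
    by rewrite leNgt; apply/negP => lt; apply: (h z); split => //; exact: ltW.
  have c2 : continuous (fun z => f z ^+ 2) by exact: cntX.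
  have bigc z : x <= z <= x + 1 -> (2 * nu) ^+ 2 <= f z ^+ 2.
    move=> /andP[]; rewrite le_eqVlt => /orP[/eqP <- _|xz zx]; last by apply: big; rewrite xz.
    have c : f z ^+ 2 @[z --> x^'+] --> f x ^+ 2 by apply: cvg_at_right_filter; exact: c2.
    apply: (cvgr_to_ge c); near=> z'; apply: big; apply/andP; split; near: z'.
      exact: nbhs_right_gt.
    by apply: nbhs_right_le; rewrite ltrDl.
  have := @increment_le R (fun z => (2 * nu) ^+ 2 * z) (fun r => J r (fun z => f z ^+ 2))
    (fun=> (2 * nu) ^+ 2) (fun z => f z ^+ 2) x (x + 1) (ltW (ltr_pwDr ltr01 (lexx x))).
  have pos z : x <= z <= x + 1 -> 0 < z by case/andP => xz _; exact: lt_le_trans xz.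
  move=> H; have := H (fun z _ => der_lin _ z) (fun z hz => J_derive c2 (pos z hz)) bigc.
  have h1 := J_le_I (x + 1) c2 (fun z _ => sqr_ge0 _) fi.
  have h2 : 0 <= J x (fun z => f z ^+ 2) by apply: Rintegral_ge0 => z _; exact: sqr_ge0.
  have n2 : 0 < nu ^+ 2 by rewrite exprn_gt0.
  by rewrite exprMn; lra.
have e := weakR_FTC cf mg ig wfg x0 xz.
have i1 := L2_itv z (ltW x0) mg ig.
have : `|RI x z g| <= nu.
  apply: le_trans (le_normr_Rintegral _ i1) _ => //.
  have sub : [set` `]x, z]] `<=` D.
    by move=> t /=; rewrite in_itv/= => /andP[xt _]; rewrite inD; exact: lt_trans xt.
  have i2 : mu.-integrable `]x, z] (EFin \o (fun t => (2 * nu)^-1 * g t ^+ 2)).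
    by apply: integrableS (intDZ _ ig).
  have i3 := cst_itv z (nu / 2) (ltW x0).
  apply: (@le_trans _ _ (\int[mu]_(t in `]x, z]) ((2 * nu)^-1 * g t ^+ 2 + nu / 2))).
    apply: le_Rintegral => //; [exact: integrable_abse i1|exact: (integrableD _ i2 i3)|].
    move=> t _; have := sqr_ge0 (`|g t| - nu).
    rewrite -(pmulr_rge0 _ (x := (2 * nu)^-1)) ?invr_gt0 ?mulr_gt0//.
    have -> : (2 * nu)^-1 * (`|g t| - nu) ^+ 2 = (2 * nu)^-1 * `|g t| ^+ 2 + nu / 2 - `|g t|.
      by field; rewrite gt_eqF.
    by rewrite real_normK ?num_real// subr_ge0.
  rewrite RintegralD//.
  have -> : \int[mu]_(t in `]x, z]) (nu / 2) = nu / 2 * (z - x).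
    by rewrite Rintegral_cst//= lebesgue_measure_itv/= lte_fin xz.
  have : \int[mu]_(t in `]x, z]) ((2 * nu)^-1 * g t ^+ 2) <= nu / 2.
    apply: (@le_trans _ _ (I (fun t => (2 * nu)^-1 * g t ^+ 2))).
      rewrite -/(RI x z (fun t => (2 * nu)^-1 * g t ^+ 2)) RI_cut ?(ltW x0)//.
      have pw t : 0 < t -> cut x z (fun t => (2 * nu)^-1 * g t ^+ 2) t <= (2 * nu)^-1 * g t ^+ 2.
        move=> t0; rewrite /cut; case: ifP => // _.
        by rewrite mulr_ge0 ?sqr_ge0// invr_ge0 mulr_ge0// ltW.
      apply: I_le => //; last exact: intDZ.
      apply: (intD_le _ _ (intDZ (2 * nu)^-1 ig)).
        by apply: cut_mD; apply: measurable_funM; [exact: measurable_cst|exact: measurable_funX].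
      move=> t t0; rewrite ger0_norm ?pw// /cut; case: ifP => // _.
      by rewrite mulr_ge0 ?sqr_ge0// invr_ge0 mulr_ge0// ltW.
    rewrite IZ//; have : I (fun t => g t ^+ 2) <= nu ^+ 2 by lra.
    rewrite -(ler_pM2l (x := (2 * nu)^-1)) ?invr_gt0 ?mulr_gt0//.
    by have -> : (2 * nu)^-1 * nu ^+ 2 = nu / 2 by field; rewrite gt_eqF.
  have : nu / 2 * (z - x) <= nu / 2 by rewrite ler_piMr ?divr_ge0 ?(ltW nu0)//; lra.
  by lra.
rewrite -e => h; have -> : f x = f z - (f z - f x) by ring.
by rewrite (le_trans (ler_normB _ _))//; lra.
Unshelve. all: by end_near. Qed.

(** Lebesgue differentiation: the primitive of [g] based at [a] vanishes identically on []a, +oo[],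
    and [a] runs through a sequence tending to 0. *)
Lemma RI_eq0_ae g : measurable_fun D g -> intD (fun z => g z ^+ 2) ->
  (forall x y, 0 < x -> x < y -> RI x y g = 0) -> \forall x \ae mu, D x -> g x = 0.
Proof.
move=> mg ig h.
suff : forall n : nat, \forall x \ae mu, n.+1%:R^-1 < x -> g x = 0.
  move/ae_foralln; apply: filterS => x hx; rewrite inD => x0.
  have [n hn] : exists n : nat, n.+1%:R^-1 < x.
    have := near_infty_natSinv_lt (PosNum x0); move=> [n _ /(_ n (leqnn n))] /= ?.
    by exists n.
  exact: hx hn.
move=> n; set a : R := n.+1%:R^-1; have a0 : 0 < a by rewrite invr_gt0.
pose g0 := g \_ D.
have ii y : mu.-integrable [set` `]a, y]] (EFin \o g0).
  apply: eq_integrable (L2_itv y (ltW a0) mg ig) => // z; rewrite inE /= in_itv/= => /andP[az _].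
  by rewrite /g0 patchE ifT// inE inD; exact: lt_trans az.
have mg0 : measurable_fun setT g0.
  by apply: (measurable_restrictT g _).1 => //; exact: measurable_itv.
have ig2 : mu.-integrable setT (EFin \o (fun z => g0 z ^+ 2)).
  have := ig; rewrite /intD integrable_mkcond// => h2.
  apply: eq_integrable h2 => // z _; rewrite /= patchE /g0 [in RHS]patchE.
  by case: ifP => //= _; rewrite (_ : (point : R) = 0)// expr0n.
have loc : locally_integrable [set: R] g0.
  split => //; first exact: openT.
  move=> K _ cK; have mK : measurable (K : set (measurableTypeR R)) by exact: compact_measurable.
  have i1 : mu.-integrable K (EFin \o (fun z => g0 z ^+ 2)) by exact: integrableS ig2.
  have i2 : mu.-integrable K (EFin \o (fun _ : R => 1 : R)).
    apply: continuous_compact_integrable => //.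
    by apply: continuous_subspaceT; exact: cnt_cst.
  have i3 := integrableD mK i1 i2.
  have : mu.-integrable K (EFin \o g0).
    apply: (le_integrable _ _ _ i3) => //.
      by apply/measurable_EFinP; exact: measurable_funS mg0.
    move=> z _ /=; rewrite lee_fin [leRHS]ger0_norm ?addr_ge0 ?sqr_ge0//.
    have := sqr_ge0 (`|g0 z| - 1); rewrite sqrrB real_normK ?num_real//.
    have := normr_ge0 (g0 z); lra.
  by move=> /integrableP[].
have := FTC1 (a := BRight a) ii loc.
apply: filterS; first exact: (ae_filter_ringOfSetsType mu).
move=> x hx ax; have h' : (BRight a < BRight x)%O by rewrite bnd_simp.
have [_] := hx h'.
have -> : g0 x = g x by rewrite /g0 patchE ifT// inE inD (lt_trans a0).
move=> <-; set F := (X in derive1 X).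
suff : is_derive x 1 F 0 by rewrite derive1E; case.
have F0 s : a < s -> F s = 0.
  move=> as'; rewrite /F -(h a s a0 as'); apply: eq_Rintegral => z.
  rewrite inE /= in_itv/= => /andP[az _].
  by rewrite /g0 patchE ifT// inE inD; exact: lt_trans az.
apply: is_derive_eps => e e0; exists (x - a); first by rewrite subr_gt0.
move=> s; rewrite ltr_norml => /andP[sx _].
by rewrite !F0 ?mulr0 ?subrr ?normr0 ?mulr_ge0 ?(ltW e0)//; lra.
Qed.

(** Since [weak_deriv] is an arbitrary choice in its class, norms and pairings are computed by
    replacing it almost everywhere with the classical derivative. *)
Lemma weakR_unique f g1 g2 : continuous f ->
  measurable_fun D g1 -> intD (fun z => g1 z ^+ 2) ->
  measurable_fun D g2 -> intD (fun z => g2 z ^+ 2) ->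
  weakR f g1 -> weakR f g2 -> \forall x \ae mu, D x -> g1 x = g2 x.
Proof.
move=> cf m1 i1 m2 i2 w1 w2.
have i12 : intD (fun z => (g1 z - g2 z) ^+ 2).
  have i3 := intD_mul m1 m2 i1 i2.
  by apply: intD_eq (intDD (intDB i1 (intDZ 2 i3)) i2) => z _; ring.
have : \forall x \ae mu, D x -> g1 x - g2 x = 0.
  apply: RI_eq0_ae => //; first exact: measurable_funB.
  move=> x y x0 xy.
  have e1 := weakR_FTC cf m1 i1 w1 x0 xy; have e2 := weakR_FTC cf m2 i2 w2 x0 xy.
  rewrite /RI RintegralB//; [|exact: (L2_itv y (ltW x0) m1 i1)|exact: (L2_itv y (ltW x0) m2 i2)].
  by rewrite -/(RI x y g1) -/(RI x y g2) -e1 -e2 subrr.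
apply: filterS; first exact: (ae_filter_ringOfSetsType mu).
by move=> x h Dx; apply/eqP; rewrite -subr_eq0; apply/eqP; exact: h.
Qed.

Lemma I_ae f g : measurable_fun D f -> measurable_fun D g ->
  (\forall x \ae mu, D x -> f x = g x) -> I f = I g.
Proof.
move=> mf mg h; rewrite /I /Rintegral; congr fine.
apply: ae_eq_integral => //; [exact/measurable_EFinP|exact/measurable_EFinP|].
move: h; apply: filterS; first exact: (ae_filter_ringOfSetsType mu).
by move=> x h Dx; rewrite h.
Qed.

End weak_derivatives.

Local Open Scope complex_scope.
Local Open Scope ring_scope.

(** * Complex functions on an edge *)

Section complex_functions.
Context {R : realType}.
Local Notation mu := (@lebesgue_measure R).
Local Notation D := (@half_line R).
Local Notation Re := complex.Re.
Local Notation Im := complex.Im.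
Implicit Types (v w : R -> R[i]) (z : R[i]) (f g phi : R -> R) (x y : R).

Lemma modulus_sq z : modulus z ^+ 2 = Re z ^+ 2 + Im z ^+ 2.
Proof. by case: z => a b; rewrite /modulus /= sqr_sqrtr// addr_ge0// sqr_ge0. Qed.

Lemma modulus_ge0 z : 0 <= modulus z.
Proof. by case: z => a b; exact: sqrtr_ge0. Qed.

Lemma modulus_le z (c : R) : 0 <= c -> Re z ^+ 2 + Im z ^+ 2 <= c ^+ 2 -> modulus z <= c.
Proof.
by move=> c0 h; rewrite -(@ler_pXn2r _ 2)// ?nnegrE ?modulus_ge0// modulus_sq.
Qed.

Lemma Re_le_modulus z : `|Re z| <= modulus z.
Proof.
rewrite -(@ler_pXn2r _ 2)// ?nnegrE ?modulus_ge0// modulus_sq real_normK ?num_real//.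
by rewrite lerDl sqr_ge0.
Qed.

Lemma Im_le_modulus z : `|Im z| <= modulus z.
Proof.
rewrite -(@ler_pXn2r _ 2)// ?nnegrE ?modulus_ge0// modulus_sq real_normK ?num_real//.
by rewrite lerDr sqr_ge0.
Qed.

Lemma modulus_le_add z : modulus z <= `|Re z| + `|Im z|.
Proof.
apply: modulus_le; first exact: addr_ge0.
rewrite sqrrD !real_normK ?num_real//.
have := mulr_ge0 (normr_ge0 (Re z)) (normr_ge0 (Im z)); lra.
Qed.

Lemma ReM z1 z2 : Re (z1 * z2) = Re z1 * Re z2 - Im z1 * Im z2.
Proof. by case: z1 z2 => a b [c d]. Qed.

Lemma ImM z1 z2 : Im (z1 * z2) = Re z1 * Im z2 + Im z1 * Re z2.
Proof. by case: z1 z2 => a b [c d]. Qed.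

Lemma ReB z1 z2 : Re (z1 - z2) = Re z1 - Re z2.
Proof. by case: z1 z2 => a b [c d]. Qed.

Lemma ImB z1 z2 : Im (z1 - z2) = Im z1 - Im z2.
Proof. by case: z1 z2 => a b [c d]. Qed.

Lemma ReD z1 z2 : Re (z1 + z2) = Re z1 + Re z2.
Proof. by case: z1 z2 => a b [c d]. Qed.

Lemma ImD z1 z2 : Im (z1 + z2) = Im z1 + Im z2.
Proof. by case: z1 z2 => a b [c d]. Qed.

Lemma ReC (a : R) : Re a%:C = a. Proof. by []. Qed.
Lemma ImC (a : R) : Im a%:C = 0. Proof. by []. Qed.

Lemma complex_eq z1 z2 : Re z1 = Re z2 -> Im z1 = Im z2 -> z1 = z2.
Proof. by case: z1 z2 => a b [c d] /= -> ->. Qed.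

Lemma in_L2P v : in_L2 v <-> [/\ measurable_fun D (fun x => Re (v x)),
  measurable_fun D (fun x => Im (v x)), intD (fun x => Re (v x) ^+ 2) &
  intD (fun x => Im (v x) ^+ 2)].
Proof.
split=> [[mr mi h]|[mr mi ir ii]].
  have msq : measurable_fun D (fun x => modulus (v x) ^+ 2).
    under eq_fun do rewrite modulus_sq.
    by apply: measurable_funD; apply: measurable_funX.
  have i : intD (fun x => modulus (v x) ^+ 2).
    apply/integrableP; split; first exact/measurable_EFinP.
    apply: le_lt_trans h; rewrite le_eqVlt; apply/orP; left; apply/eqP.
    by apply: eq_integral => x _ /=; rewrite ger0_norm// sqr_ge0.
  split=> //; apply: (intD_le _ _ i); try exact: measurable_funX;
    by move=> x _; rewrite ger0_norm ?sqr_ge0// modulus_sq ?lerDl ?lerDr sqr_ge0.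
split=> //.
have /integrableP[_] := intDD ir ii.
apply: le_lt_trans; rewrite le_eqVlt; apply/orP; left; apply/eqP.
by apply: eq_integral => x _ /=; rewrite modulus_sq ger0_norm// addr_ge0// sqr_ge0.
Qed.

Lemma L2normsqE v : in_L2 v ->
  L2normsq v = I (fun x => Re (v x) ^+ 2) + I (fun x => Im (v x) ^+ 2).
Proof.
move=> /in_L2P[_ _ ir ii]; rewrite -ID//.
by apply: I_eq => x _; rewrite modulus_sq.
Qed.

Lemma L2normsq_ge0 v : 0 <= L2normsq v.
Proof. by apply: I_ge0 => x _; exact: sqr_ge0. Qed.

Lemma cintegral_mulC v phi : cintegral (fun x => v x * (phi x)%:C) =
  I (fun x => Re (v x) * phi x) +i* I (fun x => Im (v x) * phi x).
Proof.
rewrite /cintegral; congr (_ +i* _); apply: I_eq => x _.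
  by rewrite ReM ReC ImC mulr0 subr0.
by rewrite ImM ReC ImC mulr0 add0r.
Qed.

Lemma is_weak_derivP v w : is_weak_deriv v w <->
  weakR (fun x => Re (v x)) (fun x => Re (w x)) /\
  weakR (fun x => Im (v x)) (fun x => Im (w x)).
Proof.
split=> [h|[hr hi] phi tp].
  by split=> phi tp; have := h phi tp; rewrite !cintegral_mulC => -[].
by rewrite !cintegral_mulC hr// hi.
Qed.

(** Reflection turns continuity up to the vertex into continuity on the whole line, the form
    required by the function space. *)
Lemma continuous_evn f : {within `[0, +oo[, continuous f} -> continuous (fun x : R => f `|x|).
Proof.
move=> cf x.
have c : f z @[z --> within `[0, +oo[ (nbhs `|x|)] --> f `|x|.
  have /subspace_continuousP h := cf.
  by apply: h; rewrite /= in_itv /= andbT.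
apply/cvgrPdist_le => e e0; move/cvgrPdist_le : c => /(_ e e0) [d /= d0 hd].
exists d => //= y; rewrite /ball_ /= => xy; apply: hd; last by rewrite /= in_itv/= andbT.
by rewrite /ball_ /= (le_lt_trans _ xy)// ler_dist_dist.
Qed.

Lemma weakR_evn f g : weakR f g -> weakR (fun x : R => f `|x|) g.
Proof.
move=> h phi tp; rewrite -(h phi tp); apply: I_eq => x x0.
by rewrite gtr0_norm.
Qed.

Lemma intD_evn f : intD f -> intD (fun x : R => f `|x|).
Proof. by apply: intD_eq => x x0; rewrite gtr0_norm. Qed.

Lemma weak_deriv_spec v : in_H1 v -> in_L2 (weak_deriv v) /\ is_weak_deriv v (weak_deriv v).
Proof.
move=> [_ [w hw] _ _].
by have : [set w | in_L2 w /\ is_weak_deriv v w] (weak_deriv v) by apply: xgetPex; exists w.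
Qed.

Lemma H1_sup_bound v nu : in_H1 v -> 0 < nu ->
  L2normsq v + L2normsq (weak_deriv v) <= nu ^+ 2 ->
  forall x, 0 <= x -> `|Re (v x)| <= 3 * nu /\ `|Im (v x)| <= 3 * nu.
Proof.
move=> hv nu0; have [l2w /is_weak_derivP[wr wi]] := weak_deriv_spec hv.
have [l2v _ cr ci] := hv; rewrite !L2normsqE//.
have /in_L2P[_ _ ir ii] := l2v; have /in_L2P[mr mi jr ji] := l2w.
have a1 := I_ge0 (fun x _ => sqr_ge0 (Re (v x))).
have a2 := I_ge0 (fun x _ => sqr_ge0 (Im (v x))).
have a3 := I_ge0 (fun x _ => sqr_ge0 (Re (weak_deriv v x))).
have a4 := I_ge0 (fun x _ => sqr_ge0 (Im (weak_deriv v x))).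
move=> hnu x x0; split.
- have := @sobolev_bound R (fun x => Re (v `|x|)) (fun x => Re (weak_deriv v x)) nu
    (continuous_evn cr) (intD_evn (f := fun x => Re (v x) ^+ 2) ir) mr jr (weakR_evn wr) nu0.
  rewrite (I_eq (f := fun x => Re (v `|x|) ^+ 2) (g := fun x => Re (v x) ^+ 2)).
    by move=> H; rewrite -{1}(ger0_norm x0); apply: H => //; lra.
  by move=> y y0; rewrite gtr0_norm.
- have := @sobolev_bound R (fun x => Im (v `|x|)) (fun x => Im (weak_deriv v x)) nu
    (continuous_evn ci) (intD_evn (f := fun x => Im (v x) ^+ 2) ii) mi ji (weakR_evn wi) nu0.
  rewrite (I_eq (f := fun x => Im (v `|x|) ^+ 2) (g := fun x => Im (v x) ^+ 2)).
    by move=> H; rewrite -{1}(ger0_norm x0); apply: H => //; lra.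
  by move=> y y0; rewrite gtr0_norm.
Qed.

Lemma weakRB f1 g1 f2 g2 : measurable_fun D f1 -> intD (fun x => f1 x ^+ 2) ->
  measurable_fun D f2 -> intD (fun x => f2 x ^+ 2) ->
  measurable_fun D g1 -> intD (fun x => g1 x ^+ 2) ->
  measurable_fun D g2 -> intD (fun x => g2 x ^+ 2) ->
  weakR f1 g1 -> weakR f2 g2 -> weakR (fun x => f1 x - f2 x) (fun x => g1 x - g2 x).
Proof.
move=> mf1 if1 mf2 if2 mg1 ig1 mg2 ig2 h1 h2 phi tp; have tp' := test_deriv_test tp.
have := h1 _ tp; have := h2 _ tp.
rewrite (I_eq (f := fun x => (f1 x - f2 x) * derive1 phi x)
  (g := fun x => f1 x * derive1 phi x - f2 x * derive1 phi x)); last by move=> x _; ring.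
rewrite (I_eq (f := fun x => (g1 x - g2 x) * phi x) (g := fun x => g1 x * phi x - g2 x * phi x));
  last by move=> x _; ring.
rewrite IB; [|exact: intD_L2_test|exact: intD_L2_test].
rewrite IB; [|exact: intD_L2_test|exact: intD_L2_test].
by move=> -> ->; ring.
Qed.

Lemma intD_sqB f g : measurable_fun D f -> intD (fun x => f x ^+ 2) ->
  measurable_fun D g -> intD (fun x => g x ^+ 2) -> intD (fun x => (f x - g x) ^+ 2).
Proof.
move=> mf i1 mg i2; have i3 := intD_mul mf mg i1 i2.
by apply: intD_eq (intDD (intDB i1 (intDZ 2 i3)) i2) => z _; ring.
Qed.

Lemma in_L2B v w : in_L2 v -> in_L2 w -> in_L2 (fun x => v x - w x).
Proof.
move=> /in_L2P[m1 m2 i1 i2] /in_L2P[m3 m4 i3 i4]; apply/in_L2P.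
have eR : (fun x => Re (v x - w x)) = (fun x => Re (v x) - Re (w x)) by apply/funext => x; rewrite ReB.
have eI : (fun x => Im (v x - w x)) = (fun x => Im (v x) - Im (w x)) by apply/funext => x; rewrite ImB.
rewrite eR eI; split; [exact: measurable_funB|exact: measurable_funB| |].
  by under eq_fun do rewrite ReB; exact: intD_sqB.
by under eq_fun do rewrite ImB; exact: intD_sqB.
Qed.

Lemma within_continuousB f g (A : set R) : {within A, continuous f} -> {within A, continuous g} ->
  {within A, continuous (fun x => f x - g x)}.
Proof. by move=> cf cg x; apply: cvgB; [exact: cf|exact: cg]. Qed.

Lemma in_H1B v w : in_H1 v -> in_H1 w -> in_H1 (fun x => v x - w x).
Proof.
move=> [l1 [v' [lv' /is_weak_derivP[r1 s1]]] cr1 ci1] [l2 [w' [lw' /is_weak_derivP[r2 s2]]] cr2 ci2].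
have eR : (fun x => Re (v x - w x)) = (fun x => Re (v x) - Re (w x)) by apply/funext => x; rewrite ReB.
have eI : (fun x => Im (v x - w x)) = (fun x => Im (v x) - Im (w x)) by apply/funext => x; rewrite ImB.
split; first exact: in_L2B.
- exists (fun x => v' x - w' x); split; first exact: in_L2B.
  have /in_L2P[m1 m2 i1 i2] := l1; have /in_L2P[m3 m4 i3 i4] := l2.
  have /in_L2P[m5 m6 i5 i6] := lv'; have /in_L2P[m7 m8 i7 i8] := lw'.
  have eR' : (fun x => Re (v' x - w' x)) = (fun x => Re (v' x) - Re (w' x)) by apply/funext => x; rewrite ReB.
  have eI' : (fun x => Im (v' x - w' x)) = (fun x => Im (v' x) - Im (w' x)) by apply/funext => x; rewrite ImB.
  by apply/is_weak_derivP; rewrite eR eI eR' eI'; split; apply: weakRB.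
- by rewrite eR; exact: within_continuousB.
- by rewrite eI; exact: within_continuousB.
Qed.

(* C^1 up to the vertex, with [f'] square integrable. *)
Record classicalH1 f f' : Prop := ClassicalH1 {
  cl_c : continuous f;
  cl_c' : continuous f';
  cl_d : forall x : R, 0 < x -> is_derive x 1 f (f' x);
  cl_i : intD (fun x => f x ^+ 2);
  cl_i' : intD (fun x => f' x ^+ 2)
}.

Lemma classical_weak f f' : classicalH1 f f' -> weakR f f'.
Proof. by case=> cf cf' df _ _; exact: weakR_classical. Qed.

Lemma classical_in_H1 f f' g g' : classicalH1 f f' -> classicalH1 g g' ->
  in_H1 (fun x => f x +i* g x) /\ is_weak_deriv (fun x => f x +i* g x) (fun x => f' x +i* g' x).
Proof.
move=> hf hg; have wd : is_weak_deriv (fun x => f x +i* g x) (fun x => f' x +i* g' x).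
  by apply/is_weak_derivP; split; exact: classical_weak.
split=> //; split.
- apply/in_L2P; split; [apply: continuous_mD; exact: cl_c hf|apply: continuous_mD; exact: cl_c hg|exact: cl_i hf|exact: cl_i hg].
- exists (fun x => f' x +i* g' x); split => //.
  by apply/in_L2P; split; [apply: continuous_mD; exact: cl_c' hf|apply: continuous_mD; exact: cl_c' hg|exact: cl_i' hf|exact: cl_i' hg].
- by apply: continuous_subspaceT; exact: cl_c hf.
- by apply: continuous_subspaceT; exact: cl_c hg.
Qed.

Lemma weak_deriv_ae f f' g g' w : classicalH1 f f' -> classicalH1 g g' -> in_L2 w ->
  is_weak_deriv (fun x => f x +i* g x) w ->
  (\forall x \ae mu, D x -> Re (w x) = f' x) /\ (\forall x \ae mu, D x -> Im (w x) = g' x).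
Proof.
move=> hf hg /in_L2P[m1 m2 i1 i2] /is_weak_derivP[h1 h2]; split.
- apply: (weakR_unique (cl_c hf)) => //; [|exact: cl_i' hf|exact: classical_weak].
  by apply: continuous_mD; exact: cl_c' hf.
- apply: (weakR_unique (cl_c hg)) => //; [|exact: cl_i' hg|exact: classical_weak].
  by apply: continuous_mD; exact: cl_c' hg.
Qed.

Lemma L2normsq_weak_deriv f f' g g' : classicalH1 f f' -> classicalH1 g g' ->
  L2normsq (weak_deriv (fun x => f x +i* g x)) = I (fun x => f' x ^+ 2) + I (fun x => g' x ^+ 2).
Proof.
move=> hf hg; have [h1 _] := classical_in_H1 hf hg.
have [l2 wd] := weak_deriv_spec h1; rewrite L2normsqE//.
have [ar ai] := weak_deriv_ae hf hg l2 wd.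
have /in_L2P[m1 m2 _ _] := l2.
congr (_ + _); apply: I_ae.
- exact: measurable_funX.
- by apply: measurable_funX; apply: continuous_mD; exact: cl_c' hf.
- by move: ar; apply: filterS; [exact: (ae_filter_ringOfSetsType mu)|move=> x h Dx; rewrite h].
- exact: measurable_funX.
- by apply: measurable_funX; apply: continuous_mD; exact: cl_c' hg.
- by move: ai; apply: filterS; [exact: (ae_filter_ringOfSetsType mu)|move=> x h Dx; rewrite h].
Qed.

End complex_functions.

(** * The modulus and the energy norm on the graph *)

Section modulus_norm.
Context {R : realType}.
Local Notation Re := complex.Re.
Local Notation Im := complex.Im.
Implicit Types z w : R[i].

Lemma modulusM z w : modulus (z * w) = modulus z * modulus w.
Proof.
apply/eqP; rewrite -(@eqrXn2 _ 2)// ?mulr_ge0 ?modulus_ge0// exprMn !modulus_sq ReM ImM.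
by apply/eqP; ring.
Qed.

Lemma modulusN z : modulus (- z) = modulus z.
Proof.
apply/eqP; rewrite -(@eqrXn2 _ 2)// ?modulus_ge0// !modulus_sq.
by case: z => a b /=; rewrite !sqrrN.
Qed.

Lemma modulusD z w : modulus (z + w) <= modulus z + modulus w.
Proof.
apply: modulus_le; first by rewrite addr_ge0// modulus_ge0.
rewrite ReD ImD [leRHS]sqrrD !modulus_sq.
have h : Re z * Re w + Im z * Im w <= modulus z * modulus w.
  apply: le_trans (ler_norm _) _.
  rewrite -(@ler_pXn2r _ 2)// ?nnegrE ?mulr_ge0 ?modulus_ge0// real_normK ?num_real//.
  rewrite exprMn !modulus_sq.
  have := sqr_ge0 (Re z * Im w - Im z * Re w); nra.
by rewrite mulr2n; lra.
Qed.

Lemma modulusB z w : modulus (z - w) <= modulus z + modulus w.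
Proof. by rewrite -(modulusN w) modulusD. Qed.

Lemma modulusC (a : R) : modulus a%:C = `|a|.
Proof.
apply/eqP; rewrite -(@eqrXn2 _ 2)// ?modulus_ge0// modulus_sq /= expr0n addr0.
by rewrite real_normK ?num_real.
Qed.

Lemma modulus_dist z w : `|modulus z - modulus w| <= modulus (z - w).
Proof.
have h1 := modulusD (z - w) w; have h2 := modulusD (- (z - w)) z.
rewrite subrK in h1; rewrite modulusN opprB subrK in h2.
by rewrite ler_norml; lra.
Qed.

End modulus_norm.

Section graph_norms.
Context {R : realType} {N : nat}.
Implicit Types (V W : graph_fun R N).

Lemma normE_ge0 V : 0 <= normE V. Proof. exact: sqrtr_ge0. Qed.

Lemma normE_sq V : normE V ^+ 2 = \sum_(j < N) (L2normsq (V j) + L2normsq (weak_deriv (V j))).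
Proof.
by rewrite sqr_sqrtr// sumr_ge0// => j _; rewrite addr_ge0// L2normsq_ge0.
Qed.

Lemma normE_edge V j (nu : R) : normE V <= nu ->
  L2normsq (V j) + L2normsq (weak_deriv (V j)) <= nu ^+ 2.
Proof.
move=> h; apply: (@le_trans _ _ (normE V ^+ 2)); last first.
  by rewrite lerXn2r ?nnegrE ?normE_ge0// (le_trans (normE_ge0 V)).
rewrite normE_sq (bigD1 j)//= lerDl sumr_ge0// => i _.
by rewrite addr_ge0// L2normsq_ge0.
Qed.

Lemma normE_le V (nu : R) : 0 <= nu ->
  \sum_(j < N) (L2normsq (V j) + L2normsq (weak_deriv (V j))) <= nu ^+ 2 -> normE V <= nu.
Proof. by move=> nu0 h; rewrite -(@ler_pXn2r _ 2)// ?nnegrE ?normE_ge0// normE_sq. Qed.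

End graph_norms.

(** * Estimates for real powers *)

Section power_estimates.
Context {R : realType}.
Implicit Types (p q x y r : R).

Lemma powR_pred p x : 0 < p -> 0 <= x -> x `^ p = x `^ (p - 1) * x.
Proof.
move=> p0; rewrite le_eqVlt => /orP[/eqP <-|x0].
  by rewrite powR0 ?mulr0// gt_eqF.
have h : (p - 1 + 1 == 0) ==> (x != 0) by apply/implyP => _; rewrite gt_eqF.
by rewrite -[in LHS](subrK 1 p) (@powRD _ x (p - 1) 1)// powRr1// ltW.
Qed.

Lemma powR_mono p x y : 0 <= p -> 0 <= x -> x <= y -> x `^ p <= y `^ p.
Proof. by move=> p0 x0 xy; apply: ge0_ler_powR => //; rewrite nnegrE// (le_trans x0). Qed.

Lemma powR_diff p x y : 1 < p -> 0 <= y -> y <= x ->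
  p * y `^ (p - 1) * (x - y) <= x `^ p - y `^ p <= p * x `^ (p - 1) * (x - y).
Proof.
move=> p1 y0 yx; have p0 : 0 < p by lra.
have x0 := le_trans y0 yx.
have m0 : p - 1 != 0 by rewrite subr_eq0 gt_eqF.
move: y0; rewrite le_eqVlt => /orP[/eqP <-|y0].
  rewrite (powR0 m0) (powR0 (lt0r_neq0 p0)) mulr0 mul0r !subr0 powR_ge0/= powR_pred//.
  by rewrite ler_wpM2r// ler_peMl ?powR_ge0// ltW.
have pos t : y <= t <= x -> 0 < t by case/andP => yt _; exact: lt_le_trans yt.
have dp t (ht : y <= t <= x) := is_derive1_powR p (pos t ht).
have pm t s : 0 < t -> t <= s -> p * t `^ (p - 1) <= p * s `^ (p - 1).
  by move=> t0 ts; rewrite ler_pM2l// powR_mono// ?(ltW t0)//; lra.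
have h1 := @increment_le R (fun t => p * y `^ (p - 1) * t) (fun t => t `^ p)
  (fun=> p * y `^ (p - 1)) (fun t => p * t `^ (p - 1)) y x yx (fun t _ => der_lin _ t) dp.
have h2 := @increment_le R (fun t => t `^ p) (fun t => p * x `^ (p - 1) * t)
  (fun t => p * t `^ (p - 1)) (fun=> p * x `^ (p - 1)) y x yx dp (fun t _ => der_lin _ t).
have {}h1 : p * y `^ (p - 1) * x - p * y `^ (p - 1) * y <= x `^ p - y `^ p.
  by apply: h1 => t /andP[yt _]; exact: pm.
have {}h2 : x `^ p - y `^ p <= p * x `^ (p - 1) * x - p * x `^ (p - 1) * y.
  by apply: h2 => t ht; apply: pm; [exact: pos ht|case/andP: ht].
by rewrite !mulrBr; apply/andP.
Qed.

(** Convexity squeezes the slope of the chord between the slopes at its two ends, both of which are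
    within [p * e] of [p * c]. *)
Lemma powR_diff_close p x y (c e : R) : 1 < p -> 0 <= x -> 0 <= y ->
  `|x `^ (p - 1) - c| <= e -> `|y `^ (p - 1) - c| <= e ->
  `|x `^ p - y `^ p - p * c * (x - y)| <= p * e * `|x - y|.
Proof.
move=> p1; have p0 : 0 < p by lra.
wlog yx : x y / y <= x => [hw x0 y0 hx hy|x0 y0].
  have [yx|/ltW xy] := leP y x; first exact: hw.
  have := hw y x xy y0 x0 hy hx; rewrite -normrN distrC.
  by congr (`|_| <= _); ring.
rewrite !ler_norml => /andP[x1 x2] /andP[y1 y2].
have /andP[h1 h2] := powR_diff p1 y0 yx.
rewrite (ger0_norm (x := x - y)) ?subr_ge0//.
have d0 : 0 <= p * (x - y) by rewrite mulr_ge0 ?subr_ge0// ltW.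
have := ler_wpM2l d0 x2; have := ler_wpM2l d0 y1.
move: h1 h2; rewrite mulrAC [p * x `^ (p - 1) * (x - y)]mulrAC [p * c * _]mulrAC [p * e * _]mulrAC.
by rewrite !mulrBr mulrN; lra.
Qed.

Lemma powR_superadd q x y : 1 <= q -> 0 <= x -> 0 <= y -> x `^ q + y `^ q <= (x + y) `^ q.
Proof.
move=> q1 x0 y0; have q0 : 0 < q by lra.
rewrite !(@powR_pred q)// ?addr_ge0// mulrDr lerD// ler_wpM2r// powR_mono ?lerDl ?lerDr//; lra.
Qed.

(** For [m <= 1], superadditivity of the power [1 / m] gives Hölder continuity with constant 1; for
    [m > 1] the power is Lipschitz on [[0, K]]. *)
Lemma powR_unif m K e : 0 < m -> 0 < K -> 0 < e -> exists2 d, 0 < d &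
  forall x y, 0 <= x <= K -> 0 <= y <= K -> `|x - y| <= d -> `|x `^ m - y `^ m| <= e.
Proof.
move=> m0 K0 e0.
suff [d d0 hd] : exists2 d, 0 < d & forall x y : R, 0 <= y -> y <= x -> x <= K ->
    x - y <= d -> x `^ m - y `^ m <= e.
  exists d => // x y /andP[x0 xK] /andP[y0 yK].
  wlog yx : x y x0 xK y0 yK / y <= x => [hw|].
    have [yx|/ltW xy] := leP y x; first exact: hw.
    by rewrite distrC => h; rewrite distrC; apply: hw.
  rewrite !ger0_norm ?subr_ge0//; first exact: hd.
  by apply: powR_mono => //; exact: ltW.
have [m1|m1] := leP m 1.
  exists (e `^ m^-1); first exact: powR_gt0.
  move=> x y y0 yx xK xyd.
  have x0 := le_trans y0 yx; have mxy : y `^ m <= x `^ m by apply: powR_mono => //; exact: ltW.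
  have d0 : 0 <= x `^ m - y `^ m by rewrite subr_ge0.
  have i1 : 1 <= m^-1 by rewrite invf_ge1.
  have := powR_superadd i1 d0 (powR_ge0 y m).
  rewrite subrK -!powRrM !mulfV ?gt_eqF// !powRr1// => h.
  have {}h : (x `^ m - y `^ m) `^ m^-1 <= e `^ m^-1 by lra.
  rewrite leNgt; apply/negP => lt.
  have : e `^ m^-1 < (x `^ m - y `^ m) `^ m^-1.
    by apply: gt0_ltr_powR => //; rewrite ?invr_gt0// nnegrE// ltW.
  by rewrite ltNge h.
have Km : 0 < m * K `^ (m - 1) by rewrite mulr_gt0// powR_gt0.
exists (e / (m * K `^ (m - 1))); first exact: divr_gt0.
move=> x y y0 yx xK; rewrite ler_pdivlMr// => xyd.
have /andP[_ h] := powR_diff m1 y0 yx.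
apply: le_trans h _; apply: le_trans xyd.
rewrite mulrC ler_wpM2l ?subr_ge0// ler_pM2l// powR_mono//; first lra.
exact: le_trans yx.
Qed.

End power_estimates.

(** * The nonlinearity and its uniform linearization *)

Section nonlinearity.
Context {R : realType}.
Variable p : R.
Hypothesis p1 : 1 < p.
Local Notation Re := complex.Re.
Local Notation Im := complex.Im.
Local Notation m := (p - 1).
Implicit Types (z : R[i]) (x y K d e f : R).
Let p0 : 0 < p. Proof. exact: lt_trans ltr01 p1. Qed.
Let m0 : 0 < m. Proof. by rewrite subr_gt0. Qed.

Definition nl z := (modulus z `^ (p - 1))%:C * z.

(** The power [m] may fail to be Lipschitz at 0; the factor [y] trades its increments for those of
    the power [p > 1], which is Lipschitz on bounded sets. *)
Lemma powR_diff_mul x y : 0 <= x -> 0 <= y -> `|x `^ m - y `^ m| * y <= `|x `^ p - y `^ p|.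
Proof.
move=> x0 y0.
have [xy|/ltW yx] := leP x y.
  have h := powR_mono (ltW m0) x0 xy; have h' := powR_mono (ltW p0) x0 xy.
  rewrite !ler0_norm ?subr_le0// !(@powR_pred _ p)//.
  have := ler_wpM2l (powR_ge0 x m) xy; lra.
have h := powR_mono (ltW m0) y0 yx; have h' := powR_mono (ltW p0) y0 yx.
rewrite !ger0_norm ?subr_ge0// !(@powR_pred _ p)//.
have := ler_wpM2l (powR_ge0 x m) yx; lra.
Qed.

Lemma powR_lip x y K : 0 <= x <= K -> 0 <= y <= K ->
  `|x `^ p - y `^ p| <= p * K `^ m * `|x - y|.
Proof.
move=> /andP[x0 xK] /andP[y0 yK].
wlog yx : x y x0 xK y0 yK / y <= x => [hw|].
  have [yx|/ltW xy] := leP y x; first exact: hw.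
  by rewrite distrC [X in _ <= _ * X]distrC; exact: hw.
rewrite !ger0_norm ?subr_ge0//; last by apply: powR_mono => //; exact: ltW.
have /andP[_ h] := powR_diff p1 y0 yx; apply: le_trans h _.
by rewrite ler_wpM2r ?subr_ge0// ler_pM2l// powR_mono// ltW.
Qed.

Lemma nl_split z1 z2 : nl z1 - nl z2 = (modulus z1 `^ m)%:C * (z1 - z2)
  + (modulus z1 `^ m - modulus z2 `^ m)%:C * z2.
Proof. by rewrite /nl rmorphB/=; ring. Qed.

Lemma nl_lip z1 z2 K : modulus z1 <= K -> modulus z2 <= K ->
  modulus (nl z1 - nl z2) <= (p + 1) * K `^ m * modulus (z1 - z2).
Proof.
move=> k1 k2; have n1 := modulus_ge0 z1; have n2 := modulus_ge0 z2.
rewrite nl_split (le_trans (modulusD _ _))// !modulusM !modulusC.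
rewrite (ger0_norm (powR_ge0 _ _)).
have h1 : modulus z1 `^ m * modulus (z1 - z2) <= K `^ m * modulus (z1 - z2).
  by rewrite ler_wpM2r ?modulus_ge0// powR_mono// ltW.
have h2 := powR_diff_mul n1 n2.
have h3 : `|modulus z1 `^ p - modulus z2 `^ p| <= p * K `^ m * `|modulus z1 - modulus z2|.
  by apply: powR_lip; apply/andP.
have h4 : p * K `^ m * `|modulus z1 - modulus z2| <= p * K `^ m * modulus (z1 - z2).
  by rewrite ler_wpM2l ?modulus_dist// mulr_ge0 ?powR_ge0// ltW.
by rewrite mulrDl mul1r mulrDl; lra.
Qed.

Lemma nl_rotate z w : modulus w = 1 -> nl (w * z) = w * nl z.
Proof. by move=> w1; rewrite /nl modulusM w1 mul1r mulrCA. Qed.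

End nonlinearity.

Section nonlinearity_differential.
Context {R : realType}.
Variable p : R.
Hypothesis p1 : 1 < p.
Local Notation Re := complex.Re.
Local Notation Im := complex.Im.
Local Notation m := (p - 1).
Local Notation nl := (nl p).
Let p0 : 0 < p. Proof. exact: lt_trans ltr01 p1. Qed.
Let m0 : 0 < m. Proof. by rewrite subr_gt0. Qed.

(* [f^m (zeta + m Re zeta)] is the differential of [nl] at the real point [f];
   it is approximated uniformly even as [f] tends to 0. *)
Lemma nl_linearize K d : 0 < K -> 0 < d -> exists2 e, 0 < e &
  forall f z1 z2, 0 < f <= K -> modulus (z1 - f%:C) <= e -> modulus (z2 - f%:C) <= e ->
  modulus (nl z1 - nl z2 - (f `^ m)%:C * ((z1 - z2) + (m * Re (z1 - z2))%:C))
    <= d * modulus (z1 - z2).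
Proof.
(* The four error terms below cost at most [v], [4 p v] together, and [(p + 1) v], and the sum is at
   most [8 p v] since [p > 1]. *)
move=> K0 d0; pose v := d / (8 * p).
have v0 : 0 < v by rewrite divr_gt0// mulr_gt0.
have vd : 8 * p * v = d by rewrite /v; field; rewrite gt_eqF.
clearbody v.
have K10 : 0 < K + 1 by lra.
have [e1 e10 he1] := powR_unif m0 K10 v0.
pose r := Num.min (e1 / 2) ((K + 1) / 2).
have r0 : 0 < r by rewrite lt_min !divr_gt0.
have r1 : 2 * r <= e1.
  by have : r <= e1 / 2; [rewrite ge_min lexx|lra].
have r2 : 2 * r <= K + 1.
  by have : r <= (K + 1) / 2; [rewrite ge_min lexx orbT|lra].
pose A := (K + 1) `^ m; have A0 : 0 < A by exact: powR_gt0.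
pose e := Num.min (Num.min 1 (e1 / 2)) (Num.min (r / 2) (v * r / (10 * p * A))).
have e0 : 0 < e.
  rewrite !lt_min ltr01 (divr_gt0 e10)// (divr_gt0 r0)//= divr_gt0 ?(mulr_gt0 v0 r0)//.
  by rewrite mulr_gt0// mulr_gt0.
have ea : e <= 1 by rewrite !ge_min lexx.
have eb : e <= e1 / 2 by rewrite !ge_min lexx !orbT.
have ec : e <= r / 2 by rewrite !ge_min lexx !orbT.
have ed : 10 * p * A * e <= v * r.
  have : e <= v * r / (10 * p * A) by rewrite !ge_min lexx !orbT.
  by rewrite ler_pdivlMr ?mulr_gt0// mulrC.
exists e => // f z1 z2 /andP[f0 fK] h1 h2.
set r1' := modulus z1; set r2' := modulus z2; set Z := modulus (z1 - z2).
have Z0 : 0 <= Z by exact: modulus_ge0.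
have n1 : 0 <= r1' by exact: modulus_ge0.
have n2 : 0 <= r2' by exact: modulus_ge0.
have d1 : `|r1' - f| <= e.
  by have := modulus_dist z1 f%:C; rewrite modulusC (gtr0_norm f0); move/le_trans; apply.
have d2 : `|r2' - f| <= e.
  by have := modulus_dist z2 f%:C; rewrite modulusC (gtr0_norm f0); move/le_trans; apply.
move: (d1) (d2); rewrite !ler_norml => /andP[d1a d1b] /andP[d2a d2b].
have k1 : 0 <= r1' <= K + 1 by rewrite n1/=; lra.
have k2 : 0 <= r2' <= K + 1 by rewrite n2/=; lra.
have kf : 0 <= f <= K + 1 by rewrite (ltW f0)/=; lra.
have p1f : `|r1' `^ m - f `^ m| <= v by apply: he1 => //; lra.
have p2f : `|r2' `^ m - f `^ m| <= v by apply: he1 => //; lra.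
have rr : `|r1' - r2'| <= Z by exact: modulus_dist.
have ReZ : `|Re (z1 - z2)| <= Z by exact: Re_le_modulus.
have ImZ : `|Im (z1 - z2)| <= Z by exact: Im_le_modulus.
have fA : f `^ m <= A by apply: powR_mono; [exact: ltW|exact: ltW|lra].
have fm0 : 0 <= f `^ m by exact: powR_ge0.
pose T3 := (r1' `^ m - r2' `^ m) * r2' - m * f `^ m * (r1' - r2').
pose T4 := m * f `^ m * ((r1' - r2') - Re (z1 - z2)).
have -> : nl z1 - nl z2 - (f `^ m)%:C * ((z1 - z2) + (m * Re (z1 - z2))%:C) =
  (r1' `^ m - f `^ m)%:C * (z1 - z2) + (r1' `^ m - r2' `^ m)%:C * (z2 - r2'%:C)
   + T3%:C + T4%:C.
  rewrite nl_split -/r1' -/r2' /T3 /T4; move: (Re (z1 - z2)) => q.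
  by rewrite !(rmorphB, rmorphM, rmorph1)/=; ring.
have b1 : modulus ((r1' `^ m - f `^ m)%:C * (z1 - z2)) <= v * Z.
  by rewrite modulusM modulusC ler_wpM2r.
have b3 : `|T3| <= (p + 1) * v * Z.
  have -> : T3 = (r1' `^ p - r2' `^ p - p * f `^ m * (r1' - r2'))
      - (r1' `^ m - f `^ m) * (r1' - r2').
    by rewrite /T3 !(@powR_pred _ p)//; ring.
  rewrite (le_trans (ler_normB _ _))// normrM.
  have q1 := powR_diff_close p1 n1 n2 p1f p2f.
  have q2 : p * v * `|r1' - r2'| <= p * v * Z by rewrite ler_wpM2l// mulr_ge0 ?ltW.
  have q3 : `|r1' `^ m - f `^ m| * `|r1' - r2'| <= v * Z by rewrite ler_pM.
  by rewrite mulrDl mul1r mulrDl; lra.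
have q0 := powR_diff_mul p1 n1 n2.
have mp : m * f `^ m <= p * f `^ m by rewrite ler_wpM2r//; lra.
have mf0 : 0 <= m * f `^ m by rewrite mulr_ge0// ltW.
have b24 : modulus ((r1' `^ m - r2' `^ m)%:C * (z2 - r2'%:C)) + `|T4| <= 4 * p * v * Z.
  rewrite modulusM modulusC /T4 normrM (ger0_norm mf0).
  have zr2 : modulus (z2 - r2'%:C) <= 2 * e.
    have -> : z2 - r2'%:C = (z2 - f%:C) - (r2' - f)%:C by rewrite rmorphB/=; ring.
    by rewrite (le_trans (modulusB _ _))// modulusC; lra.
  (* Below [r] all the powers of order [m] are at most [v] and crude bounds suffice. Above it both
     moduli are at least [r / 2], so one may divide by them, and the factor [e] outweighs the
     loss. *)
  have [fr|rf] := ltP f r.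
    have s1 : r1' <= e1 by lra.
    have s2 : r2' <= e1 by lra.
    pose s := Num.max r1' r2'.
    have sv : s `^ m <= v.
      have s0 : 0 <= s <= K + 1.
        by rewrite le_max n1 ge_max/=; case/andP: k1 => _ ->; case/andP: k2.
      have := he1 s 0 s0; rewrite lexx (ltW K10) powR0 ?gt_eqF// !subr0 => /(_ isT).
      rewrite !ger0_norm ?powR_ge0//; last by case/andP: s0.
      by apply; rewrite ge_max s1.
    have t1 : modulus (z2 - r2'%:C) <= 2 * r2'.
      by rewrite (le_trans (modulusB _ _))// modulusC ger0_norm//; rewrite -/r2'; lra.
    have t2 : `|r1' `^ p - r2' `^ p| <= p * s `^ m * `|r1' - r2'|.
      by apply: (powR_lip p1); rewrite ?n1 ?n2 le_max lexx ?orbT.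
    have t3 : p * s `^ m * `|r1' - r2'| <= p * v * Z.
      by rewrite ler_pM ?mulr_ge0 ?powR_ge0 ?(ltW p0)// ler_pM2l.
    have t4 : `|r1' `^ m - r2' `^ m| * modulus (z2 - r2'%:C) <=
        `|r1' `^ m - r2' `^ m| * (2 * r2') by rewrite ler_wpM2l.
    have fv : f `^ m <= v.
      have := he1 f 0 kf; rewrite lexx (ltW K10) powR0 ?gt_eqF// !subr0 => /(_ isT).
      by rewrite !ger0_norm ?(ltW f0)//; apply; lra.
    have t5 : `|r1' - r2' - Re (z1 - z2)| <= 2 * Z by rewrite (le_trans (ler_normB _ _))//; lra.
    have t6 : m * f `^ m * `|r1' - r2' - Re (z1 - z2)| <= p * v * (2 * Z).
      apply: ler_pM => //; apply: le_trans mp _; by rewrite ler_pM2l.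
    by lra.
  have r2lo : r / 2 <= r2' by lra.
  have r1lo : r / 2 <= r1' by lra.
  have t1 : `|r1' `^ m - r2' `^ m| * (r / 2) <= p * A * Z.
    apply: (@le_trans _ _ (`|r1' `^ m - r2' `^ m| * r2')); first by rewrite ler_wpM2l.
    apply: le_trans q0 _; apply: le_trans (powR_lip p1 k1 k2) _.
    by rewrite ler_wpM2l// mulr_ge0 ?(ltW p0) ?(ltW A0).
  have t2 : `|r1' `^ m - r2' `^ m| * modulus (z2 - r2'%:C) * r <= 4 * e * (p * A * Z).
    have : `|r1' `^ m - r2' `^ m| * modulus (z2 - r2'%:C) <= `|r1' `^ m - r2' `^ m| * (2 * e).
      by rewrite ler_wpM2l.
    move/(ler_wpM2r (ltW r0)); move/le_trans; apply.
    have := ler_wpM2l (ltW (mulr_gt0 (ltr0n R 4) e0)) t1.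
    by congr (_ <= _); field.
  have im1 : `|Im z1| <= e.
    by have := Im_le_modulus (z1 - f%:C); rewrite ImB ImC subr0; move/le_trans; apply.
  have im2 : `|Im z2| <= e.
    by have := Im_le_modulus (z2 - f%:C); rewrite ImB ImC subr0; move/le_trans; apply.
  have re1 : `|Re z1 - r1'| <= 2 * e.
    have := Re_le_modulus (z1 - f%:C); rewrite ReB ReC => h; have {}h := le_trans h h1.
    by move: h; rewrite !ler_norml; lra.
  have re2 : `|Re z2 - r2'| <= 2 * e.
    have := Re_le_modulus (z2 - f%:C); rewrite ReB ReC => h; have {}h := le_trans h h2.
    by move: h; rewrite !ler_norml; lra.
  have id : (r1' - r2' - Re (z1 - z2)) * (r1' + r2') =
    Re (z1 - z2) * ((Re z1 - r1') + (Re z2 - r2')) + Im (z1 - z2) * (Im z1 + Im z2).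
    have := modulus_sq z1; have := modulus_sq z2; rewrite -/r1' -/r2' ReB ImB => e2 e1'.
    have -> : (r1' - r2' - (Re z1 - Re z2)) * (r1' + r2') =
      r1' ^+ 2 - r2' ^+ 2 - (Re z1 - Re z2) * (r1' + r2') by ring.
    by rewrite e1' e2; ring.
  have t3 : `|r1' - r2' - Re (z1 - z2)| * r <= 6 * e * Z.
    apply: (@le_trans _ _ (`|(r1' - r2' - Re (z1 - z2)) * (r1' + r2')|)).
      by rewrite normrM ler_wpM2l// ger0_norm; lra.
    rewrite id (le_trans (ler_normD _ _))// !normrM.
    have u1 : `|Re (z1 - z2)| * `|Re z1 - r1' + (Re z2 - r2')| <= Z * (4 * e).
      by rewrite ler_pM// (le_trans (ler_normD _ _))//; lra.
    have u2 : `|Im (z1 - z2)| * `|Im z1 + Im z2| <= Z * (2 * e).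
      by rewrite ler_pM// (le_trans (ler_normD _ _))//; lra.
    by lra.
  have t4 : m * f `^ m * `|r1' - r2' - Re (z1 - z2)| * r <= p * A * (6 * e * Z).
    have rc0 : 0 <= `|r1' - r2' - Re (z1 - z2)| * r by rewrite mulr_ge0// ltW.
    rewrite -mulrA; apply: (ler_pM mf0 rc0 _ t3).
    by apply: le_trans mp _; rewrite ler_pM2l.
  have t5 : 10 * p * A * e * Z <= v * r * Z by rewrite ler_wpM2r.
  have t6 : (`|r1' `^ m - r2' `^ m| * modulus (z2 - r2'%:C) +
     m * f `^ m * `|r1' - r2' - Re (z1 - z2)|) * r <= v * Z * r.
    by rewrite mulrDl; lra.
  rewrite ler_pM2r// in t6; apply: le_trans t6 _.
  have vZ := mulr_ge0 (ltW v0) Z0; have pvZ := ler_peMl vZ (ltW p1).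
  have X4 : p * (v * Z) <= 4 * (p * (v * Z)) by rewrite ler_peMl ?(le_trans vZ pvZ)// ler1n.
  have -> : 4 * p * v * Z = 4 * (p * (v * Z)) by ring.
  exact: le_trans pvZ X4.
have := modulusD ((r1' `^ m - f `^ m)%:C * (z1 - z2) + (r1' `^ m - r2' `^ m)%:C * (z2 - r2'%:C)
   + T3%:C) T4%:C.
have := modulusD ((r1' `^ m - f `^ m)%:C * (z1 - z2) + (r1' `^ m - r2' `^ m)%:C * (z2 - r2'%:C)) T3%:C.
have := modulusD ((r1' `^ m - f `^ m)%:C * (z1 - z2)) ((r1' `^ m - r2' `^ m)%:C * (z2 - r2'%:C)).
rewrite !modulusC.
have vZ : 0 <= v * Z by rewrite mulr_ge0// ltW.
have pvZ : 1 * (v * Z) <= p * (v * Z) by rewrite ler_wpM2r// ltW.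
rewrite -vd; move: b3 b24 b1; rewrite -!mulrA ![(p + 1) * _]mulrDl !mul1r.
by rewrite -/Z; lra.
Qed.

End nonlinearity_differential.

(** * The equation tested on two edges *)

Section test_pairing.
Context {R : realType} {N : nat}.
Local Notation mu := (@lebesgue_measure R).
Local Notation D := (@half_line R).
Local Notation Re := complex.Re.
Local Notation Im := complex.Im.
Variables (j0 j1 : 'I_N).
Hypothesis j01 : j0 != j1.
Implicit Types (f g w : R -> R) (e s x : R) (V : graph_fun R N).

(** [e = -1] extracts the difference along the two edges, [e = 1] their sum, from which the phase is
    measured. *)
Definition sgn2 e (j : 'I_N) : R := if j == j0 then 1 else if j == j1 then e else 0.

Lemma sum_sgn2 (T : nmodType) e (F : R -> 'I_N -> T) : (forall j, F 0 j = 0) ->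
  \sum_(j < N) F (sgn2 e j) j = F 1 j0 + F e j1.
Proof.
move=> F0; rewrite (bigD1 j0)//= (bigD1 j1) 1?eq_sym//= /sgn2 eqxx eq_sym (negbTE j01) eqxx.
rewrite big1 ?addr0// => j /andP[/negbTE -> /negbTE ->]; exact: F0.
Qed.

Definition edge_test e w : graph_fun R N := fun j x => (sgn2 e j * w x) +i* 0.

Lemma classicalZ s f f' : classicalH1 f f' -> classicalH1 (fun x => s * f x) (fun x => s * f' x).
Proof.
case=> cf cf' df i1 i2; split.
- by apply: cntM => //; exact: cnt_cst.
- by apply: cntM => //; exact: cnt_cst.
- by move=> x x0; apply: derZ; exact: df.
- by apply: intD_eq (intDZ (s ^+ 2) i1) => x _; ring.
- by apply: intD_eq (intDZ (s ^+ 2) i2) => x _; ring.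
Qed.

Lemma classical0 : classicalH1 (fun _ : R => 0) (fun _ : R => 0).
Proof.
split; [exact: cnt_cst|exact: cnt_cst|by move=> x _; exact: (is_derive_cst (0 : R) x 1)| |];
  by apply: intD_eq intD0 => x _; rewrite expr0n.
Qed.

(** Derivatives of test functions are test functions, so all weak derivatives of [f] have the same
    weak derivatives. This makes the nested arbitrary choices in [Hdelta] harmless. *)
Lemma weakR_trans f g1 g2 h : weakR f g1 -> weakR f g2 -> weakR g2 h -> @weakR R g1 h.
Proof.
move=> h1 h2 h3 phi tp; have tp' := test_deriv_test tp.
by rewrite -(h3 _ tp); apply: oppr_inj; rewrite -(h1 _ tp') -(h2 _ tp').
Qed.

Variables (w w1 w2 : R -> R).
Hypothesis cw : classicalH1 w w1.
Hypothesis cw1 : classicalH1 w1 w2.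
Hypothesis w0 : w 0 = 0.

Lemma edge_test_H1 e j : in_H1 (edge_test e w j).
Proof. exact: (classical_in_H1 (classicalZ (sgn2 e j) cw) classical0).1. Qed.

Lemma edge_test_vertex e : continuous_at_vertex (edge_test e w).
Proof. by move=> i j; rewrite /edge_test w0 !mulr0. Qed.

Lemma edge_test_in_E e : in_E (edge_test e w).
Proof. by split; [exact: edge_test_H1|exact: edge_test_vertex]. Qed.

(** With [w 0 = 0] the vertex condition reduces to the vanishing of the sum of derivatives,
    [(1 + e) * w1 0]. It is automatic for [e = -1], where only the Dirichlet condition is left, and
    for [e = 1] it asks for [w1 0 = 0]. *)
Lemma edge_test_dom alpha e : (1 + e) * w1 0 = 0 -> dom_Hdelta alpha (edge_test e w).
Proof.
move=> ew; split.
- move=> j; split; first exact: edge_test_H1.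
  exists (fun x => (sgn2 e j * w1 x) +i* 0); split.
    exact: (classical_in_H1 (classicalZ (sgn2 e j) cw1) classical0).1.
  exact: (classical_in_H1 (classicalZ (sgn2 e j) cw) classical0).2.
- exact: edge_test_vertex.
- exists (fun j x => (sgn2 e j * w1 x) +i* 0); split.
    move=> j; split; first exact: (classical_in_H1 (classicalZ (sgn2 e j) cw1) classical0).1.
    exact: (classical_in_H1 (classicalZ (sgn2 e j) cw) classical0).2.
  move=> k; rewrite (sum_sgn2 e (F := fun s (_ : 'I_N) => (s * w1 0) +i* 0)); last first.
    by move=> _; rewrite mul0r.
  apply: complex_eq; rewrite ?ReD ?ImD ?ReM ?ImM /= w0 !mulr0 ?mul0r ?subr0 ?addr0//.
  by rewrite -mulrDl ew.
Qed.

Lemma edge_test_normE e : `|e| <= 1 -> 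
  normE (edge_test e w) <= Num.sqrt (2 * (I (fun x => w x ^+ 2) + I (fun x => w1 x ^+ 2))).
Proof.
move=> e1; have i1 := cl_i cw; have i2 := cl_i' cw.
have a1 : 0 <= I (fun x => w x ^+ 2) by apply: I_ge0 => x _; exact: sqr_ge0.
have a2 : 0 <= I (fun x => w1 x ^+ 2) by apply: I_ge0 => x _; exact: sqr_ge0.
have e2 : e ^+ 2 <= 1 by rewrite -[e ^+ 2]real_normK ?num_real// exprn_ile1.
apply: normE_le; first exact: sqrtr_ge0.
rewrite sqr_sqrtr; last by rewrite mulr_ge0// addr_ge0.
have F j : L2normsq (edge_test e w j) + L2normsq (weak_deriv (edge_test e w j)) =
    sgn2 e j ^+ 2 * (I (fun x => w x ^+ 2) + I (fun x => w1 x ^+ 2)).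
  have cz := classicalZ (sgn2 e j) cw.
  have [[l2 _ _ _] _] := classical_in_H1 cz classical0.
  have I0 : I (fun _ : R => 0 ^+ 2) = 0.
    rewrite (I_eq (g := fun _ => 0 * 0)) ?IZ ?mul0r//; first exact: intD0.
    by move=> x _; rewrite expr0n.
  rewrite (L2normsq_weak_deriv cz classical0) L2normsqE// I0 addr0 /=.
  rewrite (I_eq (f := fun x => (sgn2 e j * w x) ^+ 2) (g := fun x => sgn2 e j ^+ 2 * w x ^+ 2));
    last by move=> x _; rewrite exprMn.
  rewrite (I_eq (f := fun x => (sgn2 e j * w1 x) ^+ 2) (g := fun x => sgn2 e j ^+ 2 * w1 x ^+ 2));
    last by move=> x _; rewrite exprMn.
  by rewrite !IZ// addr0 -mulrDr.
rewrite (eq_bigr _ (fun j _ => F j)).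
rewrite (sum_sgn2 e (F := fun s _ => s ^+ 2 * (I (fun x => w x ^+ 2) + I (fun x => w1 x ^+ 2)))).
  rewrite expr1n mul1r; have := ler_wpM2r (addr_ge0 a1 a2) e2; lra.
by move=> j; rewrite expr0n mul0r.
Qed.

Definition rcomb e V x := Re (V j0 x) + e * Re (V j1 x).
Definition icomb e V x := Im (V j0 x) + e * Im (V j1 x).

Lemma conj_ri (a b : R) : (a +i* b)^* = a +i* (- b).
Proof. by []. Qed.

Lemma inner_edge_test e V : (forall j, in_L2 (V j)) ->
  inner_L2 V (edge_test e w) =
  I (fun x => rcomb e V x * w x) +i* I (fun x => icomb e V x * w x).
Proof.
move=> l2; have mw : measurable_fun D w by apply: continuous_mD; exact: cl_c cw.
have iR j : intD (fun x => Re (V j x) * w x).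
  by have /in_L2P[m1 m2 i1 i2] := l2 j; apply: intD_mul => //; exact: cl_i cw.
have iI j : intD (fun x => Im (V j x) * w x).
  by have /in_L2P[m1 m2 i1 i2] := l2 j; apply: intD_mul => //; exact: cl_i cw.
have F j : cintegral (fun x => V j x * (edge_test e w j x)^*) =
    (sgn2 e j * I (fun x => Re (V j x) * w x)) +i* (sgn2 e j * I (fun x => Im (V j x) * w x)).
  rewrite (_ : (fun x => V j x * _) = (fun x => V j x * (sgn2 e j * w x)%:C)); last first.
    by apply/funext => x; rewrite /edge_test conj_ri oppr0.
  rewrite cintegral_mulC -!IZ//; congr (_ +i* _); apply: I_eq => x _; ring.
rewrite /inner_L2 (eq_bigr _ (fun j _ => F j)).
rewrite (sum_sgn2 e (F := fun s j => (s * I (fun x => Re (V j x) * w x)) +i* (s * I (fun x => Im (V j x) * w x)))); last by move=> j; rewrite !mul0r.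
have rE : I (fun x => rcomb e V x * w x) = I (fun x => Re (V j0 x) * w x) + e * I (fun x => Re (V j1 x) * w x).
  rewrite -IZ// -ID//; last exact: intDZ.
  by apply: I_eq => x _; rewrite /rcomb; ring.
have iE : I (fun x => icomb e V x * w x) = I (fun x => Im (V j0 x) * w x) + e * I (fun x => Im (V j1 x) * w x).
  rewrite -IZ// -ID//; last exact: intDZ.
  by apply: I_eq => x _; rewrite /icomb; ring.
by apply: complex_eq; rewrite ?ReD ?ImD /= ?rE ?iE !mul1r.
Qed.

Lemma Hdelta_edge e j : let g := Hdelta (edge_test e w) j in
  in_L2 g /\ ((\forall x \ae mu, D x -> Re (g x) = - (sgn2 e j * w2 x)) /\
  (\forall x \ae mu, D x -> Im (g x) = 0)).
Proof.
set W := edge_test e w j.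
have [lw /is_weak_derivP[h1 h2]] := weak_deriv_spec (edge_test_H1 e j).
have cz := classicalZ (sgn2 e j) cw; have cz1 := classicalZ (sgn2 e j) cw1.
have k1 := classical_weak cz; have k2 := classical_weak cz1; have k0 := classical_weak classical0.
have ex : exists g : R -> R[i], in_L2 g /\ is_weak_deriv (weak_deriv W) g.
  exists (fun x => (sgn2 e j * w2 x) +i* 0); split.
    have [_ [_ _]] := (classical_in_H1 cz1 classical0).1; move=> _ _.
    apply/in_L2P; split; [apply: continuous_mD; exact: cl_c' cz1|apply: continuous_mD; exact: cnt_cst|exact: cl_i' cz1|exact: cl_i' classical0].
  by apply/is_weak_derivP; split; [exact: (weakR_trans h1 k1 k2)|exact: (weakR_trans h2 k0 k0)].
have [lg wg] : [set g : R -> R[i] | in_L2 g /\ is_weak_deriv (weak_deriv W) g] (weak_deriv (weak_deriv W)).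
  exact: xgetPex ex.
have /is_weak_derivP[q1 q2] := wg.
have wg1 : is_weak_deriv (fun x => (sgn2 e j * w1 x) +i* 0) (weak_deriv (weak_deriv W)).
  by apply/is_weak_derivP; split; [exact: (weakR_trans k1 h1 q1)|exact: (weakR_trans k0 h2 q2)].
have [ar ai] := weak_deriv_ae cz1 classical0 lg wg1.
have l0 : in_L2 (fun _ : R => 0 : R[i]).
  by apply/in_L2P; split; [exact: continuous_mD (@cnt_cst R 0)|exact: continuous_mD (@cnt_cst R 0)|exact: cl_i classical0|exact: cl_i classical0].
split.
  have := in_L2B l0 lg; congr in_L2; apply/funext => x; exact: sub0r.
split; [move: ar|move: ai]; apply: filterS; try exact: (ae_filter_ringOfSetsType mu).
- move=> x h Dx; rewrite -(h Dx) /Hdelta -/W; by case: (weak_deriv (weak_deriv W) x).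
- move=> x h Dx; rewrite -[RHS]oppr0 -(h Dx) /Hdelta -/W; by case: (weak_deriv (weak_deriv W) x).
Qed.

Lemma inner_Hdelta e V : (forall j, in_L2 (V j)) ->
  inner_L2 V (Hdelta (edge_test e w)) =
  (- I (fun x => rcomb e V x * w2 x)) +i* (- I (fun x => icomb e V x * w2 x)).
Proof.
move=> l2; have mw : measurable_fun D w2 by apply: continuous_mD; exact: cl_c' cw1.
have iR j : intD (fun x => Re (V j x) * w2 x).
  by have /in_L2P[m1 m2 i1 i2] := l2 j; apply: intD_mul => //; exact: cl_i' cw1.
have iI j : intD (fun x => Im (V j x) * w2 x).
  by have /in_L2P[m1 m2 i1 i2] := l2 j; apply: intD_mul => //; exact: cl_i' cw1.
have F j : cintegral (fun x => V j x * (Hdelta (edge_test e w) j x)^*) =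
    (- (sgn2 e j * I (fun x => Re (V j x) * w2 x))) +i* (- (sgn2 e j * I (fun x => Im (V j x) * w2 x))).
  have [/in_L2P[m3 m4 _ _] [ar ai]] := Hdelta_edge e j.
  have /in_L2P[m1 m2 i1 i2] := l2 j.
  set g := Hdelta (edge_test e w) j in m3 m4 ar ai *.
  have ReE (z z' : R[i]) : Re (z * z'^*) = Re z * Re z' + Im z * Im z'.
    by case: z z' => a b [c d]; rewrite conj_ri ReM /=; ring.
  have ImE (z z' : R[i]) : Im (z * z'^*) = Im z * Re z' - Re z * Im z'.
    by case: z z' => a b [c d]; rewrite conj_ri ImM /=; ring.
  have both : \forall x \ae mu, D x -> Re (g x) = - (sgn2 e j * w2 x) /\ Im (g x) = 0.
    move: ar ai; apply: filterS2; first exact: (ae_filter_ringOfSetsType mu).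
    by move=> x h1 h2 Dx; split; [exact: h1|exact: h2].
  rewrite /cintegral -!IZ// -!IN; [|exact: intDZ|exact: intDZ].
  congr (_ +i* _); apply: I_ae.
  - under eq_fun do rewrite ReE; by apply: measurable_funD; apply: measurable_funM.
  - apply: measurableT_comp => //; apply: measurable_funM; first exact: measurable_cst.
    exact: measurable_funM.
  - move: both; apply: filterS; first exact: (ae_filter_ringOfSetsType mu).
    by move=> x h Dx; have [h1 h2] := h Dx; rewrite ReE h1 h2; ring.
  - under eq_fun do rewrite ImE; by apply: measurable_funB; apply: measurable_funM.
  - apply: measurableT_comp => //; apply: measurable_funM; first exact: measurable_cst.
    exact: measurable_funM.
  - move: both; apply: filterS; first exact: (ae_filter_ringOfSetsType mu).
    by move=> x h Dx; have [h1 h2] := h Dx; rewrite ImE h1 h2; ring.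
rewrite /inner_L2 (eq_bigr _ (fun j _ => F j)).
rewrite (sum_sgn2 e (F := fun s j => (- (s * I (fun x => Re (V j x) * w2 x))) +i* (- (s * I (fun x => Im (V j x) * w2 x))))); last by move=> j; rewrite !mul0r oppr0.
have rE : I (fun x => rcomb e V x * w2 x) = I (fun x => Re (V j0 x) * w2 x) + e * I (fun x => Re (V j1 x) * w2 x).
  rewrite -IZ// -ID//; last exact: intDZ.
  by apply: I_eq => x _; rewrite /rcomb; ring.
have iE : I (fun x => icomb e V x * w2 x) = I (fun x => Im (V j0 x) * w2 x) + e * I (fun x => Im (V j1 x) * w2 x).
  rewrite -IZ// -ID//; last exact: intDZ.
  by apply: I_eq => x _; rewrite /icomb; ring.
by apply: complex_eq; rewrite ?ReD ?ImD /= ?rE ?iE !mul1r opprD.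
Qed.

Section tested_equation.
Variables (alpha p : R) (U : R -> graph_fun R N).
Hypothesis hU : forall T, 0 < T -> NLS_solution alpha p T U.
Hypothesis nl_L2 : forall t j, in_L2 (nonlinearity p (U t) j).
Variable e : R.
Hypothesis e_le1 : `|e| <= 1.
Hypothesis ew : (1 + e) * w1 0 = 0.
Hypothesis w_small : normE (edge_test e w) <= 1.

Lemma solution_in_E t : in_E (U t).
Proof.
have T0 : 0 < `|t| + 1 by rewrite ltr_wpDl.
by have [h _ _] := hU T0; apply: h; rewrite in_itv/= -ler_norml lerDl.
Qed.

Let U_L2 t j : in_L2 (U t j). Proof. by have [h _] := solution_in_E t; case: (h j). Qed.

(** On a test function in the domain, the extended operator is the pairing of the solution with
    [Hdelta], so the equation becomes scalar. The minus sign of the second derivative and the factor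
    [i] exchange the real and imaginary parts. *)
Lemma tested_derivative (t : R) :
  is_derive t 1 (fun s => I (fun x => rcomb e (U s) x * w x))
    (- I (fun x => icomb e (U t) x * w2 x)
     - I (fun x => icomb e (nonlinearity p (U t)) x * w x)) /\
  is_derive t 1 (fun s => I (fun x => icomb e (U s) x * w x))
    (I (fun x => rcomb e (U t) x * w2 x)
     + I (fun x => rcomb e (nonlinearity p (U t)) x * w x)).
Proof.
(* The margin 1 puts [t] in the interior of the time interval, so that derivatives within the
   interval are two-sided. *)
have T0 : 0 < `|t| + 1 by rewrite ltr_wpDl.
have tT : t \in `[- (`|t| + 1), `|t| + 1] by rewrite in_itv/= -ler_norml lerDl.
have [_ _ [Dt [_ _ hD hE]]] := hU T0.
have [HU [[_ hHU] heq]] := hE t tT.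
set W := edge_test e w.
have EW : in_E W := edge_test_in_E e.
have := heq W EW; rewrite (hHU W (edge_test_dom alpha ew)) inner_Hdelta// inner_edge_test//.
set d := Dt t W => eqd.
have [dr di] : Re d = - I (fun x => icomb e (U t) x * w2 x) - I (fun x => icomb e (nonlinearity p (U t)) x * w x)
  /\ Im d = I (fun x => rcomb e (U t) x * w2 x) + I (fun x => rcomb e (nonlinearity p (U t)) x * w x).
  move: eqd; case: d => a b; rewrite /=.
  move/eqP; rewrite eq_complex /= => /andP[/eqP h1 /eqP h2].
  by split; move: h1 h2; rewrite ?(mul0r, mul1r, add0r, sub0r); lra.
have key (ep : R) : 0 < ep -> exists2 dd, 0 < dd & forall s, `|s - t| < dd ->
    modulus (inner_L2 (U s) W - inner_L2 (U t) W - (s - t)%:C * d) <= ep * `|s - t|.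
  move=> ep0; have := hD t tT.
  have nb : nbhs (0%E : \bar R) [set x | (x < ep%:E)%E].
    exists ep => //= r /=; rewrite sub0r normrN lte_fin => h; exact: le_lt_trans (ler_norm _) h.
  move=> /(_ _ nb) [d0 /= d00 hd0].
  exists (Num.min d0 1); first by rewrite lt_min d00 ltr01.
  move=> s; rewrite lt_min => /andP[s1 s2].
  have [->|st] := eqVneq s t.
    by rewrite !subrr mul0r subr0 normr0 mulr0 modulusC normr0.
  have sT : s \in `[- (`|t| + 1), `|t| + 1].
    rewrite in_itv/= -ler_norml -[s](subrK t) (le_trans (ler_normD _ _))//.
    by rewrite addrC lerD2l ltW.
  have := hd0 s _ st sT; rewrite /= /ball_ /= distrC => /(_ s1) /=.
  set F := (X in normE' X) => hF.
  (* The dual norm is a supremum over the unit ball of the energy space, to which [W] belongs by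
     [w_small]. *)
  have : ((modulus (F W))%:E < ep%:E)%E.
    apply: le_lt_trans hF; apply: ereal_sup_ubound; exists W => //.
  rewrite lte_fin /F -/d => h.
  have st0 : s - t != 0 by rewrite subr_eq0.
  have -> : inner_L2 (U s) W - inner_L2 (U t) W - (s - t)%:C * d =
    (s - t)%:C * (((s - t)^-1)%:C * (inner_L2 (U s) W - inner_L2 (U t) W) - d).
    rewrite mulrBr mulrA -rmorphM/= mulfV//.
    by rewrite mul1r.
  by rewrite modulusM modulusC mulrC ler_wpM2r// ltW.
rewrite -dr -di; split; apply: is_derive_eps => ep ep0; have [dd dd0 h] := key ep ep0;
  exists dd => // s /h; rewrite !inner_edge_test//; apply: le_trans.
- apply: le_trans (Re_le_modulus _); rewrite le_eqVlt; apply/orP; left; apply/eqP; congr (`|_|).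
  by rewrite !ReB ReM ReC ImC mul0r subr0.
- apply: le_trans (Im_le_modulus _); rewrite le_eqVlt; apply/orP; left; apply/eqP; congr (`|_|).
  by rewrite !ImB ImM ReC ImC mul0r addr0.
Qed.

End tested_equation.

End test_pairing.

(** * Curves that are bounded and continuous both uniformly and in [L^2] *)

Section good_families.
Context {R : realType}.
Local Notation D := (@half_line R).
Local Notation ip := (@ip R).
Local Notation nm := (psd_norm ip).
Local Notation V := (@L2fun R).
Let hb : psd_form ip := ip_psd.
Implicit Types (h k : R -> V) (c : R -> R) (t s x e M : R).

(* Bounded and continuous in time, both in L2 and uniformly in space. *)
Definition goodV h : Prop :=
  (exists2 M, 0 <= M & forall t, (forall x, `|L2val (h t) x| <= M) /\ nm (h t) <= M) /\
  (forall t e, 0 < e -> exists2 d, 0 < d & forall s, `|s - t| < d ->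
    (forall x, `|L2val (h s) x - L2val (h t) x| <= e) /\ nm (h s - h t) <= e).

Definition goodS c : Prop :=
  (exists2 M, 0 <= M & forall t, `|c t| <= M) /\
  (forall t e, 0 < e -> exists2 d, 0 < d & forall s, `|s - t| < d -> `|c s - c t| <= e).

Lemma goodV_vcont h t : goodV h -> @vcont R V ip h t.
Proof.
by move=> [_ hc] e e0; have [d d0 hd] := hc t e e0; exists d => // s /hd[].
Qed.

Lemma goodV_prim h : goodV h -> exists k, k 0 = 0 /\ forall t, @vder R V ip k t (h t).
Proof.
move=> gh; have [[M M0 hM] hc] := gh; apply: (@time_primitive _ h M).
- by move=> t; exact: goodV_vcont.
- by move=> t e e0; have [d d0 hd] := hc t e e0; exists d => // s /hd[].
- by move=> t x; case: (hM t).
- by move=> t; case: (hM t).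
Qed.

Lemma goodVD h k : goodV h -> goodV k -> goodV (fun t => h t + k t).
Proof.
move=> [[M M0 hM] hc] [[M' M'0 kM] kc]; split.
  exists (M + M'); first exact: addr_ge0.
  move=> t; have [a1 a2] := hM t; have [b1 b2] := kM t; split=> [x|].
    by rewrite L2valD (le_trans (ler_normD _ _))// lerD.
  by rewrite (le_trans (nmD hb _ _))// lerD.
move=> t e e0; have e2 : 0 < e / 2 by rewrite divr_gt0.
have [d d0 hd] := hc t _ e2; have [d' d'0 kd] := kc t _ e2.
exists (Num.min d d'); first by rewrite lt_min d0.
move=> s; rewrite lt_min => /andP[/hd[a1 a2] /kd[b1 b2]]; split=> [x|].
  rewrite !L2valD opprD addrACA (le_trans (ler_normD _ _))// [e]splitr lerD//.
by rewrite opprD addrACA (le_trans (nmD hb _ _))// [e]splitr lerD.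
Qed.

Lemma goodV_map (T : {linear V -> V}) (w : R) h : 0 <= w ->
  (forall v x, `|L2val (T v) x| <= w * `|L2val v x|) -> (forall v, nm (T v) <= w * nm v) ->
  goodV h -> goodV (fun t => T (h t)).
Proof.
move=> w0 Tx Tn [[M M0 hM] hc]; split.
  exists (w * M); first exact: mulr_ge0.
  move=> t; have [a1 a2] := hM t; split=> [x|].
    by rewrite (le_trans (Tx _ _))// ler_wpM2l.
  by rewrite (le_trans (Tn _))// ler_wpM2l.
move=> t e e0; have w1 : 0 < w + 1 by lra.
have e2 : 0 < e / (w + 1) by rewrite divr_gt0.
have we : w * (e / (w + 1)) <= e.
  by rewrite mulrA ler_pdivrMr// mulrC ler_pM2l//; lra.
have [d d0 hd] := hc t _ e2; exists d => // s /hd[a1 a2]; split=> [x|].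
  rewrite -L2valB -(linearB T) (le_trans (Tx _ _))// (le_trans _ we)// ler_wpM2l//.
  by rewrite L2valB.
by rewrite -(linearB T) (le_trans (Tn _))// (le_trans _ we)// ler_wpM2l.
Qed.

Lemma goodVZ c h : goodS c -> goodV h -> goodV (fun t => c t *: h t).
Proof.
move=> [[M M0 cM] cc] [[M' M'0 hM] hc]; split.
  exists (M * M'); first exact: mulr_ge0.
  move=> t; have [a1 a2] := hM t; split=> [x|].
    by rewrite L2valZ normrM ler_pM.
  by rewrite (nmZ hb) ler_pM// nm_ge0.
move=> t e e0; pose K := M + M' + 1; have K0 : 0 < K by rewrite /K; lra.
have e2 : 0 < e / (2 * K) by rewrite divr_gt0// mulr_gt0.
have [d d0 cd] := cc t _ e2; have [d' d'0 hd] := hc t _ e2.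
exists (Num.min d d'); first by rewrite lt_min d0.
move=> s; rewrite lt_min => /andP[/cd b1 /hd[a1 a2]].
have ke : K * (e / (2 * K)) = e / 2 by field; rewrite gt_eqF.
have [m1 m2] := hM t.
have q1 : M * (e / (2 * K)) <= e / 2 by rewrite -ke ler_wpM2r ?(ltW e2)// /K; lra.
have q2 : e / (2 * K) * M' <= e / 2 by rewrite -ke mulrC ler_wpM2r ?(ltW e2)// /K; lra.
split=> [x|].
  have -> : L2val (c s *: h s) x - L2val (c t *: h t) x =
    c s * (L2val (h s) x - L2val (h t) x) + (c s - c t) * L2val (h t) x.
    by rewrite !L2valZ; ring.
  rewrite (le_trans (ler_normD _ _))// [e]splitr lerD// normrM.
    by apply: le_trans q1; rewrite ler_pM.
  by apply: le_trans q2; rewrite ler_pM.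
have -> : c s *: h s - c t *: h t = c s *: (h s - h t) + (c s - c t) *: h t.
  by rewrite scalerBr scalerBl addrA subrK.
rewrite (le_trans (nmD hb _ _))// [e]splitr lerD// (nmZ hb).
  by apply: le_trans q1; rewrite ler_pM// nm_ge0.
by apply: le_trans q2; rewrite ler_pM// nm_ge0.
Qed.

Lemma goodS_cst (a : R) : goodS (fun=> a).
Proof.
split; first by exists `|a|.
by move=> t e e0; exists 1 => // s _; rewrite subrr normr0 ltW.
Qed.

Lemma goodVN h : goodV h -> goodV (fun t => - h t).
Proof.
move=> /(goodVZ (goodS_cst (-1))); congr goodV; apply/funext => t.
by rewrite scaleN1r.
Qed.

Lemma goodS_ip h z : goodV h -> goodS (fun t => ip (h t) z).
Proof.
move=> [[M M0 hM] hc]; split.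
  exists (M * nm z); first by rewrite mulr_ge0 ?nm_ge0.
  by move=> t; rewrite (le_trans (psd_CS_nm hb _ _))// ler_wpM2r ?nm_ge0//; case: (hM t).
move=> t e e0; have z1 : 0 < nm z + 1 by have := nm_ge0 ip z; lra.
have [d d0 hd] := hc t _ (divr_gt0 e0 z1); exists d => // s /hd[_ a2].
rewrite -(psdBl hb) (le_trans (psd_CS_nm hb _ _))//.
apply: (@le_trans _ _ (e / (nm z + 1) * nm z)); first by rewrite ler_wpM2r ?nm_ge0.
by rewrite mulrAC ler_pdivrMr// ler_pM2l//; lra.
Qed.

Lemma goodSD c c' : goodS c -> goodS c' -> goodS (fun t => c t + c' t).
Proof.
move=> [[M M0 hM] hc] [[M' M'0 kM] kc]; split.
  exists (M + M'); first exact: addr_ge0.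
  by move=> t; rewrite (le_trans (ler_normD _ _))// lerD.
move=> t e e0; have e2 : 0 < e / 2 by rewrite divr_gt0.
have [d d0 hd] := hc t _ e2; have [d' d'0 kd] := kc t _ e2.
exists (Num.min d d'); first by rewrite lt_min d0.
move=> s; rewrite lt_min => /andP[/hd a1 /kd b1].
by rewrite opprD addrACA (le_trans (ler_normD _ _))// [e]splitr lerD.
Qed.

Lemma goodSZ (a : R) c : goodS c -> goodS (fun t => a * c t).
Proof.
move=> [[M M0 hM] hc]; split.
  exists (`|a| * M); first exact: mulr_ge0.
  by move=> t; rewrite normrM ler_wpM2l.
move=> t e e0; have a1 : 0 < `|a| + 1 by rewrite ltr_wpDl.
have [d d0 hd] := hc t _ (divr_gt0 e0 a1); exists d => // s /hd h.
rewrite -mulrBr normrM (@le_trans _ _ (`|a| * (e / (`|a| + 1))))// ?ler_wpM2l//.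
by rewrite mulrA ler_pdivrMr// mulrC ler_pM2l//; lra.
Qed.

Lemma goodSN c : goodS c -> goodS (fun t => - c t).
Proof. by move=> /(goodSZ (-1)); congr goodS; apply/funext => t; rewrite mulN1r. Qed.

Implicit Types (F G H : R -> R -> R) (f : R -> R).

Definition edge_fun f : Prop := continuous (fun x : R => f `|x|) /\ intD (fun x => f x ^+ 2).

(** Total version of the even extension; the default 0 is excluded as soon as [edge_fun f] holds. *)
Definition L2of f : V := insubd 0 (fun x : R => f `|x|).

Lemma L2ofE f x : edge_fun f -> L2val (L2of f) x = f `|x|.
Proof.
move=> [cf fi]; rewrite /L2of (_ : L2val _ = val (insubd 0 (fun x : R => f `|x|) : V))//.
rewrite insubdK//; apply: evenL2P => //; first by move=> y; rewrite normrN.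
exact: (intD_evn (f := fun x => f x ^+ 2) fi).
Qed.

Definition goodF F : Prop := [/\ forall t, edge_fun (F t),
  exists2 M, 0 <= M & forall t, (forall x, 0 <= x -> `|F t x| <= M) /\
    I (fun x => F t x ^+ 2) <= M ^+ 2 &
  forall t e, 0 < e -> exists2 d, 0 < d & forall s, `|s - t| < d ->
    (forall x, 0 <= x -> `|F s x - F t x| <= e) /\
    I (fun x => (F s x - F t x) ^+ 2) <= e ^+ 2].

Lemma goodF_V F : goodF F -> goodV (fun t => L2of (F t)).
Proof.
move=> [Fe [M M0 FM] Fc]; split.
  exists M => // t; have [a1 a2] := FM t; split=> [x|].
    by rewrite L2ofE//; exact: a1.
  apply: (nm_le hb) => //; apply: le_trans a2; rewrite le_eqVlt; apply/orP; left; apply/eqP.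
  by apply: I_eq => x x0; rewrite !L2ofE// gtr0_norm// expr2.
move=> t e e0; have [d d0 hd] := Fc t e e0; exists d => // s /hd[a1 a2]; split=> [x|].
  by rewrite !L2ofE//; exact: a1.
apply: (nm_le hb); first exact: ltW.
apply: le_trans a2; rewrite le_eqVlt; apply/orP; left; apply/eqP.
by apply: I_eq => x x0; rewrite L2valB !L2ofE// gtr0_norm// expr2.
Qed.

Lemma edge_fun_mD f : edge_fun f -> measurable_fun D f.
Proof.
move=> [cf _]; apply: (eq_measurable_fun (fun x : R => f `|x|)); last exact: continuous_mD.
by move=> x; rewrite inE inD => x0; rewrite gtr0_norm.
Qed.

(** The Lipschitz bound compares different times and different points at once, so it gives
    continuity in space, and continuity in time in both norms. It applies to the nonlinearity and to
    linear combinations of edges. *)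
Lemma goodF_lip F G H (L : R) : 0 <= L -> goodF F -> goodF G ->
  (forall s t x y, 0 <= x -> 0 <= y ->
     `|H s x - H t y| <= L * (`|F s x - F t y| + `|G s x - G t y|)) ->
  (forall t x, 0 <= x -> `|H t x| <= L * (`|F t x| + `|G t x|)) -> goodF H.
Proof.
move=> L0 [Fe [M M0 FM] Fc] [Ge [M' M'0 GM] Gc] Hl Hb.
have Hc t : continuous (fun x : R => H t `|x|).
  move=> x; apply/cvgrPdist_le => e e0.
  have L1 : 0 < 2 * L + 1 by lra.
  have e1 : 0 < e / (2 * L + 1) by rewrite divr_gt0.
  have /cvgrPdist_le /(_ _ e1) hF := (Fe t).1 x.
  have /cvgrPdist_le /(_ _ e1) hG := (Ge t).1 x.
  near=> y; have a1 : `|F t `|x| - F t `|y| | <= e / (2 * L + 1) by near: y.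
  have a2 : `|G t `|x| - G t `|y| | <= e / (2 * L + 1) by near: y.
  apply: le_trans (Hl t t _ _ (normr_ge0 x) (normr_ge0 y)) _.
  apply: (@le_trans _ _ (L * (e / (2 * L + 1) + e / (2 * L + 1)))).
    by rewrite ler_wpM2l// lerD.
  have -> : L * (e / (2 * L + 1) + e / (2 * L + 1)) = 2 * L * e / (2 * L + 1) by ring.
  by rewrite ler_pdivrMr//; lra.
have sq (a b c : R) : `|a| <= L * (`|b| + `|c|) -> a ^+ 2 <= 2 * L ^+ 2 * (b ^+ 2 + c ^+ 2).
  move=> h; have : `|a| ^+ 2 <= (L * (`|b| + `|c|)) ^+ 2.
    by rewrite lerXn2r ?nnegrE// mulr_ge0// addr_ge0.
  rewrite real_normK ?num_real// => /le_trans; apply.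
  rewrite -(real_normK (num_real b)) -(real_normK (num_real c)).
  have := mulr_ge0 (sqr_ge0 L) (sqr_ge0 (`|b| - `|c|)).
  by rewrite exprMn; set l2 := L ^+ 2; rewrite sqrrB sqrrD; nra.
have int2 (f g h' : R -> R) : measurable_fun D f -> intD (fun x => g x ^+ 2) ->
    intD (fun x => h' x ^+ 2) -> (forall x, 0 < x -> `|f x| <= L * (`|g x| + `|h' x|)) ->
    intD (fun x => f x ^+ 2) /\
    I (fun x => f x ^+ 2) <= 2 * L ^+ 2 * (I (fun x => g x ^+ 2) + I (fun x => h' x ^+ 2)).
  move=> mf gi hi le; have i := intDZ (2 * L ^+ 2) (intDD gi hi).
  have fi : intD (fun x => f x ^+ 2).
    apply: (intD_le _ _ i); first exact: measurable_funX.
    by move=> x x0; rewrite ger0_norm ?sqr_ge0// sq ?le.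
  split=> //; rewrite -ID// -IZ; last exact: intDD.
  by apply: I_le => // x x0; rewrite sq ?le.
have Hm t : measurable_fun D (H t).
  apply: (eq_measurable_fun (fun x : R => H t `|x|)); last exact: continuous_mD.
  by move=> x; rewrite inE inD => x0; rewrite gtr0_norm.
have four : (2 * L * Num.max M M') ^+ 2 = 2 * L ^+ 2 * (2 * Num.max M M' ^+ 2) by ring.
have mx (a b : R) : 0 <= a -> 0 <= b -> a ^+ 2 + b ^+ 2 <= 2 * Num.max a b ^+ 2.
  move=> a0 b0; have : a ^+ 2 <= Num.max a b ^+ 2 by rewrite lerXn2r ?nnegrE ?le_max ?lexx ?a0.
  have : b ^+ 2 <= Num.max a b ^+ 2 by rewrite lerXn2r ?nnegrE ?le_max ?lexx ?a0 ?orbT.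
  by lra.
have Hb' t x (x0 : 0 < x) := Hb t x (ltW x0).
have Hi t := int2 (H t) (F t) (G t) (Hm t) (Fe t).2 (Ge t).2 (Hb' t).
split.
- by move=> t; split; [exact: Hc|exact: (Hi t).1].
- exists (2 * L * Num.max M M'); first by rewrite !mulr_ge0// le_max M0.
  move=> t; have [a1 a2] := FM t; have [b1 b2] := GM t; split=> [x x0|].
    apply: le_trans (Hb t x x0) _; rewrite (mulrC 2) -mulrA ler_wpM2l//.
    have h1 : `|F t x| <= Num.max M M' by rewrite le_max a1.
    have h2 : `|G t x| <= Num.max M M' by rewrite le_max b1 ?orbT.
    by lra.
  apply: le_trans (Hi t).2 _; rewrite four ler_wpM2l ?mulr_ge0 ?sqr_ge0//.
  by apply: le_trans (mx M M' M0 M'0); rewrite lerD.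
- move=> t e e0; have L1 : 0 < 2 * L + 1 by lra.
  pose e1 := e / (2 * L + 1); have e10 : 0 < e1 by rewrite divr_gt0.
  have le : 2 * L * e1 <= e by rewrite /e1 mulrA ler_pdivrMr// mulrC ler_pM2l//; lra.
  have [d d0 hd] := Fc t e1 e10; have [d' d'0 hd'] := Gc t e1 e10.
  exists (Num.min d d'); first by rewrite lt_min d0.
  move=> s; rewrite lt_min => /andP[/hd[a1 a2] /hd'[b1 b2]]; split=> [x x0|].
    apply: le_trans (Hl s t x x x0 x0) _; apply: le_trans le.
    by rewrite (mulrC 2) -mulrA ler_wpM2l//; have := a1 x x0; have := b1 x x0; lra.
  have iF := intD_sqB (edge_fun_mD (Fe s)) (Fe s).2 (edge_fun_mD (Fe t)) (Fe t).2.
  have iG := intD_sqB (edge_fun_mD (Ge s)) (Ge s).2 (edge_fun_mD (Ge t)) (Ge t).2.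
  have Hl' x (x0 : 0 < x) := Hl s t x x (ltW x0) (ltW x0).
  have [_ h] := int2 (fun x => H s x - H t x) (fun x => F s x - F t x) (fun x => G s x - G t x)
    (measurable_funB (Hm s) (Hm t)) iF iG Hl'.
  apply: le_trans h _; apply: (@le_trans _ _ ((2 * L * e1) ^+ 2)).
    have -> : (2 * L * e1) ^+ 2 = 2 * L ^+ 2 * (e1 ^+ 2 + e1 ^+ 2) by ring.
    by rewrite ler_wpM2l ?mulr_ge0 ?sqr_ge0// lerD.
  have le0 : 0 <= 2 * L * e1 by rewrite mulr_ge0 ?(ltW e10)// mulr_ge0.
  by rewrite lerXn2r ?nnegrE// ltW.
Unshelve. all: by end_near. Qed.

End good_families.

(** * Regularity of a bounded solution as a family of edge functions *)

Section solution_families.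
Context {R : realType} {N : nat}.
Local Notation Re := complex.Re.
Local Notation Im := complex.Im.
Variables (alpha p : R) (U : R -> graph_fun R N).
Hypothesis p1 : 1 < p.
Hypothesis hU : forall T, 0 < T -> NLS_solution alpha p T U.
Variable K : R.
Hypothesis U_bd : forall t j x, 0 <= x -> modulus (U t j x) <= K.
Hypothesis U_l2 : forall t j, L2normsq (U t j) <= K ^+ 2.

Let inE t : in_E (U t).
Proof. exact: (solution_in_E hU t). Qed.

Let K0 (j : 'I_N) : 0 <= K.
Proof. exact: le_trans (modulus_ge0 _) (U_bd 0 j (lexx 0)). Qed.

Lemma solution_continuous (t e : R) : 0 < e -> exists2 d, 0 < d &
  forall s, `|s - t| < d -> normE (gsub (U s) (U t)) <= e.
Proof.
move=> e0; have T0 : 0 < `|t| + 1 by rewrite ltr_wpDl.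
have tT : t \in `[- (`|t| + 1), `|t| + 1] by rewrite in_itv/= -ler_norml lerDl.
have [_ hc _] := hU T0; have /cvgrPdist_le /(_ e e0) [d0 /= d00 hd] := hc t tT.
exists (Num.min d0 1); first by rewrite lt_min d00 ltr01.
move=> s; rewrite lt_min => /andP[s1 s2].
have sT : s \in `[- (`|t| + 1), `|t| + 1].
  rewrite in_itv/= -ler_norml -[s](subrK t) (le_trans (ler_normD _ _))//.
  by rewrite addrC lerD2l ltW.
have := hd s _ sT; rewrite /ball_ /= distrC => /(_ s1).
by rewrite sub0r normrN ger0_norm// normE_ge0.
Qed.

(** The energy norm controls the uniform norm with the Sobolev factor 3 and the [L^2] norm with
    factor 1; the larger factor is kept for both. *)
Lemma solution_close t s j e : 0 < e -> normE (gsub (U s) (U t)) <= e ->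
  [/\ forall x, 0 <= x -> `|Re (U s j x) - Re (U t j x)| <= 3 * e,
      forall x, 0 <= x -> `|Im (U s j x) - Im (U t j x)| <= 3 * e,
      I (fun x => (Re (U s j x) - Re (U t j x)) ^+ 2) <= (3 * e) ^+ 2 &
      I (fun x => (Im (U s j x) - Im (U t j x)) ^+ 2) <= (3 * e) ^+ 2].
Proof.
move=> e0 h; have hd := normE_edge j h.
have H1 : in_H1 (fun x => U s j x - U t j x) by apply: in_H1B; [case: (inE s)|case: (inE t)].
have sup := H1_sup_bound H1 e0 hd.
have l2 : in_L2 (fun x => U s j x - U t j x) by case: H1.
have w0 := L2normsq_ge0 (weak_deriv (gsub (U s) (U t) j)).
have n2 : L2normsq (fun x => U s j x - U t j x) <= e ^+ 2.
  by apply: le_trans hd; rewrite lerDl.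
rewrite L2normsqE// in n2.
have i1 : 0 <= I (fun x => Re (U s j x - U t j x) ^+ 2) by apply: I_ge0 => x _; exact: sqr_ge0.
have i2 : 0 <= I (fun x => Im (U s j x - U t j x) ^+ 2) by apply: I_ge0 => x _; exact: sqr_ge0.
have e2 : 0 <= e ^+ 2 by exact: sqr_ge0.
have eR : (fun x => (Re (U s j x) - Re (U t j x)) ^+ 2) = (fun x => Re (U s j x - U t j x) ^+ 2).
  by apply/funext => x; rewrite ReB.
have eI : (fun x => (Im (U s j x) - Im (U t j x)) ^+ 2) = (fun x => Im (U s j x - U t j x) ^+ 2).
  by apply/funext => x; rewrite ImB.
split; rewrite ?eR ?eI ?exprMn; try lra.
- by move=> x x0; rewrite -ReB; case: (sup x x0).
- by move=> x x0; rewrite -ImB; case: (sup x x0).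
Qed.

Lemma edge_fun_H1 (v : R -> R[i]) : in_H1 v ->
  edge_fun (fun x => Re (v x)) /\ edge_fun (fun x => Im (v x)).
Proof.
move=> [/in_L2P[_ _ ir ii] _ cr ci]; split.
  by split; [exact: (continuous_evn cr)|exact: ir].
by split; [exact: (continuous_evn ci)|exact: ii].
Qed.

Lemma goodF_Re j : goodF (fun t x => Re (U t j x)).
Proof.
split=> [t||t e e0].
- by apply: (edge_fun_H1 _).1; case: (inE t).
- exists K; first exact: K0.
  move=> t; split=> [x x0|]; first by rewrite (le_trans (Re_le_modulus _))// U_bd.
  apply: le_trans (U_l2 t j); rewrite L2normsqE; last by case: (inE t) => h _; case: (h j).
  by rewrite lerDl I_ge0// => x _; exact: sqr_ge0.
- have e3 : 0 < e / 3 by rewrite divr_gt0.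
  have [d d0 hd] := solution_continuous t e3; exists d => // s /hd/(solution_close j e3).
  by rewrite mulrC divfK// => -[].
Qed.

Lemma goodF_Im j : goodF (fun t x => Im (U t j x)).
Proof.
split=> [t||t e e0].
- by apply: (edge_fun_H1 _).2; case: (inE t).
- exists K; first exact: K0.
  move=> t; split=> [x x0|]; first by rewrite (le_trans (Im_le_modulus _))// U_bd.
  apply: le_trans (U_l2 t j); rewrite L2normsqE; last by case: (inE t) => h _; case: (h j).
  by rewrite lerDr I_ge0// => x _; exact: sqr_ge0.
- have e3 : 0 < e / 3 by rewrite divr_gt0.
  have [d d0 hd] := solution_continuous t e3; exists d => // s /hd/(solution_close j e3).
  by rewrite mulrC divfK// => -[].
Qed.

Let L := (p + 1) * K `^ (p - 1).
Let L0 : 0 <= L. Proof. by have h := p1; rewrite mulr_ge0 ?powR_ge0//; lra. Qed.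

Let nl_close s t j x y : 0 <= x -> 0 <= y ->
  modulus (nonlinearity p (U s) j x - nonlinearity p (U t) j y) <=
  L * (`|Re (U s j x) - Re (U t j y)| + `|Im (U s j x) - Im (U t j y)|).
Proof.
move=> x0 y0; apply: le_trans (nl_lip p1 (U_bd s j x0) (U_bd t j y0)) _.
by apply: ler_wpM2l; [exact: L0|rewrite -ReB -ImB modulus_le_add].
Qed.

Let nl_bd t j x : 0 <= x ->
  modulus (nonlinearity p (U t) j x) <= L * (`|Re (U t j x)| + `|Im (U t j x)|).
Proof.
move=> x0; have z0 : modulus (0 : R[i]) <= K.
  by rewrite (_ : 0 = (0 : R)%:C)// modulusC normr0 (K0 j).
have := nl_lip p1 (U_bd t j x0) z0; rewrite /nl mulr0 !subr0 => /le_trans; apply.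
by apply: ler_wpM2l; [exact: L0|exact: modulus_le_add].
Qed.

Lemma goodF_nlRe j : goodF (fun t x => Re (nonlinearity p (U t) j x)).
Proof.
apply: (goodF_lip L0 (goodF_Re j) (goodF_Im j)) => [s t x y x0 y0|t x x0].
  by apply: le_trans (nl_close s t j x0 y0); rewrite -ReB Re_le_modulus.
by apply: le_trans (nl_bd t j x0); rewrite Re_le_modulus.
Qed.

Lemma goodF_nlIm j : goodF (fun t x => Im (nonlinearity p (U t) j x)).
Proof.
apply: (goodF_lip L0 (goodF_Re j) (goodF_Im j)) => [s t x y x0 y0|t x x0].
  by apply: le_trans (nl_close s t j x0 y0); rewrite -ImB Im_le_modulus.
by apply: le_trans (nl_bd t j x0); rewrite Im_le_modulus.
Qed.

Lemma nonlinearity_L2 t j : in_L2 (nonlinearity p (U t) j).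
Proof.
have [h1 _ _] := goodF_nlRe j; have [h2 _ _] := goodF_nlIm j.
by apply/in_L2P; split; [exact: edge_fun_mD|exact: edge_fun_mD|case: (h1 t)|case: (h2 t)].
Qed.

Lemma goodF_pair (F G : R -> R -> R) e : `|e| <= 1 -> goodF F -> goodF G ->
  goodF (fun t x => F t x + e * G t x).
Proof.
move=> e1 gF gG; apply: (goodF_lip ler01 gF gG) => [s t x y _ _|t x _].
  rewrite mul1r opprD addrACA -mulrBr (le_trans (ler_normD _ _))// lerD2l normrM.
  by rewrite ler_piMl.
by rewrite mul1r (le_trans (ler_normD _ _))// lerD2l normrM ler_piMl.
Qed.

End solution_families.

(** * The weight that measures the phase *)

Section near_orbit.
Context {R : realType} {N : nat}.
Local Notation D := (@half_line R).
Local Notation Re := complex.Re.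
Local Notation Im := complex.Im.
Variables (phi sig Q : R -> R) (omega p gam c0 C0 Qb xm : R).
Hypothesis gs : ground_state phi sig Q omega p gam c0 C0 Qb xm.
Hypothesis omega_ge0 : 0 <= omega.
Hypothesis QE : forall x, Q x = phi x `^ (p - 1).
Variables (j0 j1 : 'I_N).
Let p_gt1 := gs_p gs.
Let phi_gt0 := gs_phi gs.
Let Q_gt0 := gs_Q0 gs.
Let dphi := gs_dphi gs.
Let dsig := gs_dsig gs.
Let dQ := gs_dQ gs.
Let phi_cnt : continuous phi. Proof. exact: is_derive_cnt dphi. Qed.
Let sig_cnt : continuous sig. Proof. exact: is_derive_cnt dsig. Qed.
Let Q_cnt : continuous Q. Proof. exact: is_derive_cnt dQ. Qed.
Let p_gt0 : 0 < p. Proof. exact: lt_trans ltr01 p_gt1. Qed.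
Implicit Types (f g : R -> R) (x y e : R).

Definition bc f := continuous f /\ exists B, forall x, 0 < x -> `|f x| <= B.

Lemma bc_cst (a : R) : bc (fun=> a).
Proof. by split; [exact: cnt_cst|exists `|a|]. Qed.

Lemma bcD f g : bc f -> bc g -> bc (fun x => f x + g x).
Proof.
move=> [cf [B hB]] [cg [B' hB']]; split; first exact: cntD.
by exists (B + B') => x x0; rewrite (le_trans (ler_normD _ _))// lerD ?hB ?hB'.
Qed.

Lemma bcM f g : bc f -> bc g -> bc (fun x => f x * g x).
Proof.
move=> [cf [B hB]] [cg [B' hB']]; split; first exact: cntM.
by exists (B * B') => x x0; rewrite normrM ler_pM ?hB ?hB'.
Qed.

Lemma bcB f g : bc f -> bc g -> bc (fun x => f x - g x).
Proof.
move=> bf [cg [B hB]]; apply: bcD => //; split; first exact: cntN.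
by exists B => x x0; rewrite normrN hB.
Qed.

Lemma phi_le x : 0 < x -> phi x <= C0.
Proof.
move=> x0; apply: le_trans (gs_hi gs x0) _; rewrite ler_piMr ?(ltW (gs_C0 gs))//.
by rewrite -expR0 ler_expR mulNr oppr_le0 mulr_ge0 ?(ltW (gs_gam gs)) ?(ltW x0).
Qed.

Lemma bc_phi : bc phi.
Proof. by split => //; exists C0 => x x0; rewrite gtr0_norm ?phi_le. Qed.

Lemma bc_sig : bc sig.
Proof. by split => //; exists gam => x _; exact: (gs_sigb gs). Qed.

Lemma bc_Q : bc Q.
Proof. by split => //; exists Qb => x _; rewrite gtr0_norm ?(gs_Qb gs). Qed.

Lemma bc_intD f g : bc f -> measurable_fun D g -> intD g -> intD (fun x => f x * g x).
Proof. by move=> [cf [B hB]] mg gi; exact: (intD_bounded cf mg hB gi). Qed.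

Lemma bc_L2 f : bc f -> intD (fun x => (f x * phi x) ^+ 2).
Proof.
by move=> [cf [B hB]]; apply: (intD_bounded2 cf _ hB (intD_phi2 gs)); exact: continuous_mD.
Qed.

Lemma bc_L1 f : bc f -> intD (fun x => f x * phi x ^+ 2).
Proof.
by move=> bf; apply: (bc_intD bf _ (intD_phi2 gs)); apply: continuous_mD; exact: cntX.
Qed.

Ltac bc := repeat first [exact: bc_cst | exact: bc_phi | exact: bc_sig | exact: bc_Q
  | apply: bcB | apply: bcD | apply: bcM].

Let s0 := sig 0.
Let u0 x := sig x - s0.
Let u1 x := omega - Q x - s0 * sig x.
Let u2 x := (omega - Q x) * u0 x - (p - 1) * (Q x * sig x).
(** [(phi' - sig 0 phi)^2]: a nonnegative function vanishing to second order at the vertex, hence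
    admissible as a test with equal signs on both edges whatever [alpha] is. [wt1] and [wt2] are its
    derivatives, each written as a bounded factor times [phi]. *)
Definition wt x := (u0 x * u0 x * phi x) * phi x.
Definition wt1 x := (2 * (u0 x * u1 x) * phi x) * phi x.
Definition wt2 x := (2 * (u1 x * u1 x + u0 x * u2 x) * phi x) * phi x.

Let bu0 : bc u0. Proof. by rewrite /u0; bc. Qed.
Let bu1 : bc u1. Proof. by rewrite /u1; bc. Qed.
Let bu2 : bc u2. Proof. by rewrite /u2; apply: bcB; [apply: bcM; [bc|exact: bu0]|bc]. Qed.
Let bw : bc (fun x => u0 x * u0 x * phi x).
Proof. by apply: bcM; [exact: bcM|exact: bc_phi]. Qed.
Let bw1 : bc (fun x => 2 * (u0 x * u1 x) * phi x).
Proof. by apply: bcM; [apply: bcM; [exact: bc_cst|exact: bcM]|exact: bc_phi]. Qed.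
Let bw2 : bc (fun x => 2 * (u1 x * u1 x + u0 x * u2 x) * phi x).
Proof.
by apply: bcM; [apply: bcM; [exact: bc_cst|apply: bcD; exact: bcM]|exact: bc_phi].
Qed.

Let cst_der (a x : R) : is_derive x 1 (fun _ : R => a) 0.
Proof. exact: (is_derive_cst a x 1). Qed.

Let du0 x : is_derive x 1 u0 (omega - Q x - sig x ^+ 2).
Proof. by apply: der_eq (derB (dsig x) (cst_der s0 x)) _; rewrite subr0. Qed.

Let du1 x : is_derive x 1 u1 (- ((p - 1) * (sig x * Q x)) - s0 * (omega - Q x - sig x ^+ 2)).
Proof.
by apply: der_eq (derB (derB (cst_der omega x) (dQ x)) (derZ s0 (dsig x))) _; rewrite sub0r.
Qed.

Lemma wt_classical : classicalH1 wt wt1.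
Proof.
split.
- by apply: cntM => //; case: bw.
- by apply: cntM => //; case: bw1.
- move=> x _; apply: der_eq (derM (derM (derM (du0 x) (du0 x)) (dphi x)) (dphi x)) _.
  by rewrite /wt1 /u1 /u0; ring.
- exact: bc_L2 bw.
- exact: bc_L2 bw1.
Qed.

Lemma wt1_classical : classicalH1 wt1 wt2.
Proof.
split.
- by apply: cntM => //; case: bw1.
- by apply: cntM => //; case: bw2.
- move=> x _; apply: der_eq (derM (derM (derZ 2 (derM (du0 x) (du1 x))) (dphi x)) (dphi x)) _.
  by rewrite /wt2 /u2 /u1 /u0; ring.
- exact: bc_L2 bw1.
- exact: bc_L2 bw2.
Qed.

Lemma phi_classical : classicalH1 phi (fun x => sig x * phi x).
Proof.
split=> //; first exact: cntM.
- exact: (intD_phi2 gs).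
- exact: (bc_L2 bc_sig).
Qed.

Lemma wt_0 : wt 0 = 0. Proof. by rewrite /wt /u0 subrr !mul0r. Qed.
Lemma wt1_0 : wt1 0 = 0. Proof. by rewrite /wt1 /u0 subrr mul0r mulr0 !mul0r. Qed.
Lemma wt_ge0 x : 0 <= wt x.
Proof.
apply: mulr_ge0; last exact: ltW.
by apply: mulr_ge0; [rewrite -expr2 sqr_ge0|exact: ltW].
Qed.
Lemma wt_cnt : continuous wt. Proof. exact: cl_c wt_classical. Qed.
Lemma wt2_cnt : continuous wt2. Proof. exact: cl_c' wt1_classical. Qed.

Lemma wt_L1 : intD wt.
Proof. by apply: intD_eq (bc_L1 (bcM bu0 bu0)) => x _; rewrite /wt; ring. Qed.

Lemma wt2_L1 : intD wt2.
Proof.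
have b : bc (fun x => 2 * (u1 x * u1 x + u0 x * u2 x)).
  by apply: bcM; [exact: bc_cst|apply: bcD; exact: bcM].
by apply: intD_eq (bc_L1 b) => x _; rewrite /wt2; ring.
Qed.

(** Amplitude of the phase functional on the orbit; the factor 2 counts the two edges. *)
Definition cc := 2 * I (fun x => phi x * wt x).

Let phiwt_int : intD (fun x => phi x * wt x).
Proof. by apply: bc_intD bc_phi _ wt_L1; exact: continuous_mD wt_cnt. Qed.

Lemma cc_gt0 : 0 < cc.
Proof.
rewrite mulr_gt0// lt_neqAle; apply/andP; split; last first.
  by apply: I_ge0 => x _; rewrite mulr_ge0 ?wt_ge0// ltW.
rewrite eq_sym; apply/eqP => h.
have xm0 := gs_xm gs.
(* At [xm], where [sig] vanishes, the weight is the square of [sig 0 * phi xm], which is not 0. *)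
have := I_eq0 (f := fun x => phi x * wt x) (cntM phi_cnt wt_cnt)
  (fun x _ => mulr_ge0 (ltW (phi_gt0 x)) (wt_ge0 x)) phiwt_int h xm0.
move/eqP; rewrite /wt !mulf_eq0 (gt_eqF (phi_gt0 xm)) !orbF orFb orbb /u0 subr_eq0.
have /eqP -> : sig xm == 0 by rewrite (gs_sig_eq0 gs).
by rewrite eq_sym (gt_eqF (gs_sig0 gs)).
Qed.

(* [phi] solves [- phi'' + omega phi = phi^p] and [wt] vanishes to second order at the vertex. *)
Lemma phi_wt_identity :
  I (fun x => phi x * wt2 x) + I (fun x => Q x * phi x * wt x) = omega * I (fun x => phi x * wt x).
Proof.
have i1 : intD (fun x => phi x * wt2 x).
  by apply: bc_intD bc_phi _ wt2_L1; exact: continuous_mD wt2_cnt.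
have i2 : intD (fun x => Q x * phi x * wt x).
  by apply: bc_intD (bcM bc_Q bc_phi) _ wt_L1; exact: continuous_mD wt_cnt.
pose F x := phi x * wt1 x - sig x * phi x * wt x.
pose f x := phi x * wt2 x + Q x * phi x * wt x - omega * (phi x * wt x).
have wt1c : continuous wt1 by exact: cl_c wt1_classical.
have dF x : 0 < x -> is_derive x 1 F (f x).
  move=> x0; have h1 := derM (dphi x) (cl_d wt1_classical x0).
  have h2 := derM (derM (dsig x) (dphi x)) (cl_d wt_classical x0).
  by apply: der_eq (derB h1 h2) _; rewrite /f; ring.
have cF : continuous F.
  apply: cntB; [exact: cntM|apply: cntM; [exact: cntM|exact: wt_cnt]].
have cf : continuous f.
  apply: cntB; first (apply: cntD; apply: cntM => //; [exact: wt2_cnt|exact: cntM|exact: wt_cnt]).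
  by apply: cntM; [exact: cnt_cst|apply: cntM => //; exact: wt_cnt].
have iF : intD F.
  have b : bc (fun x => 2 * (u0 x * u1 x) * phi x - sig x * (u0 x * u0 x * phi x)).
    by apply: bcB => //; apply: bcM => //; exact: bc_sig.
  by apply: intD_eq (bc_L1 b) => x _; rewrite /F /wt1 /wt; ring.
have if_ : intD f by apply: intDB; [exact: intDD|exact: intDZ].
have := I_FTC cF cf dF iF if_.
rewrite /F wt_0 wt1_0 !mulr0 subrr oppr0 IB//; [|exact: intDD|exact: intDZ].
by rewrite ID// IZ// => /eqP; rewrite subr_eq0 => /eqP.
Qed.

Definition Phi : graph_fun R N := fun _ x => (phi x)%:C.

Lemma rot_Phi (theta : R) j : gscale (expi theta) Phi j =
  (fun x => (cos theta * phi x) +i* (sin theta * phi x)).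
Proof.
apply/funext => x; rewrite /gscale /Phi /expi; apply: complex_eq.
  by rewrite ReM /= mulr0 subr0.
by rewrite ImM /= mulr0 add0r.
Qed.

Lemma orbit_close (V : graph_fun R N) theta e : in_E V -> 0 < e ->
  normE (gsub V (gscale (expi theta) Phi)) <= e ->
  forall j, [/\ forall x, 0 <= x -> `|Re (V j x) - cos theta * phi x| <= 3 * e,
    forall x, 0 <= x -> `|Im (V j x) - sin theta * phi x| <= 3 * e &
    L2normsq (V j) <= 2 * e ^+ 2 + 2 * I (fun x => phi x ^+ 2)].
Proof.
move=> [hV _] e0 h j; have hd := normE_edge j h.
have c1 := classicalZ (cos theta) phi_classical; have c2 := classicalZ (sin theta) phi_classical.
have [hP _] := classical_in_H1 c1 c2.
have eD : gsub V (gscale (expi theta) Phi) j =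
    (fun x => V j x - ((cos theta * phi x) +i* (sin theta * phi x))).
  by apply/funext => x; rewrite /gsub rot_Phi.
rewrite eD in hd.
have H1 := in_H1B (hV j) hP; have sup := H1_sup_bound H1 e0 hd.
split.
- by move=> x x0; have [] := sup x x0; rewrite ReB.
- by move=> x x0; have [_] := sup x x0; rewrite ImB.
have [l2V _ _ _] := hV j; have [l2 _ _ _] := H1.
have w0 := L2normsq_ge0 (weak_deriv (fun x => V j x - ((cos theta * phi x) +i* (sin theta * phi x)))).
have : L2normsq (fun x => V j x - ((cos theta * phi x) +i* (sin theta * phi x))) <= e ^+ 2.
  by apply: le_trans hd; rewrite lerDl.
rewrite !L2normsqE//; have /in_L2P[_ _ a1 a2] := l2; have /in_L2P[_ _ b1 b2] := l2V.
have ip2 := intD_phi2 gs.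
rewrite -!ID// => hle.
apply: (@le_trans _ _ (I (fun x => 2 * (Re (V j x - ((cos theta * phi x) +i* (sin theta * phi x))) ^+ 2
   + Im (V j x - ((cos theta * phi x) +i* (sin theta * phi x))) ^+ 2) + 2 * phi x ^+ 2))).
  apply: I_le; [exact: intDD|by apply: intDD; apply: intDZ => //; exact: intDD|].
  move=> x _; rewrite ReB ImB /=.
  have e1 : phi x ^+ 2 = (cos theta * phi x) ^+ 2 + (sin theta * phi x) ^+ 2.
    by rewrite !exprMn -mulrDl cos2Dsin2 mul1r.
  rewrite e1; move: (Re _) (Im _) (cos theta * phi x) (sin theta * phi x) => a b c d.
  have := sqr_ge0 (a - 2 * c); have := sqr_ge0 (b - 2 * d); nra.
rewrite ID; [|by apply: intDZ; exact: intDD|exact: intDZ].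
have i12 := intDD a1 a2.
have q1 := IZ 2 i12; have q2 := IZ 2 ip2.
by rewrite q2 lerD2r q1 ler_pM2l.
Qed.

Definition B1 := I wt.
Definition B2 := I (fun x => `|wt2 x|) + omega * B1.
Lemma B2E : B2 = I (fun x => `|wt2 x|) + omega * B1. Proof. by []. Qed.

Lemma B1_ge0 : 0 <= B1. Proof. by apply: I_ge0 => x _; exact: wt_ge0. Qed.
Lemma B2_ge0 : 0 <= B2.
Proof. by rewrite addr_ge0 ?mulr_ge0 ?B1_ge0// I_ge0. Qed.

Lemma I_close (f g k : R -> R) e : measurable_fun D f -> intD (fun x => f x * k x) ->
  intD (fun x => g x * k x) -> intD (fun x => `|k x|) ->
  (forall x, 0 < x -> `|f x - g x| <= e) ->
  `|I (fun x => f x * k x) - I (fun x => g x * k x)| <= e * I (fun x => `|k x|).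
Proof.
move=> mf i1 i2 ik h; rewrite -IB//.
have i3 := intDB i1 i2.
apply: le_trans (le_normr_Rintegral _ i3) _ => //.
rewrite -IZ//; apply: I_le; [exact: (integrable_abse i3)|exact: intDZ|].
by move=> x x0; rewrite -mulrBl normrM ler_wpM2r// h.
Qed.

End near_orbit.

Lemma double_estimate (R : realType) (u v : R) : 0 <= u -> 0 <= v -> 6 * v + 12 * u <= 12 * v + 24 * u.
Proof. by move=> u0 v0; lra. Qed.

(** * Removal of the normalisation of test functions *)

Section scaled_test.
Context {R : realType} {N : nat}.
Local Notation Re := complex.Re.
Local Notation Im := complex.Im.
Variables (j0 j1 : 'I_N).
Hypothesis j01 : j0 != j1.
Variables (alpha p : R) (U : R -> graph_fun R N).
Hypothesis hU : forall T, 0 < T -> NLS_solution alpha p T U.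
Hypothesis nl_L2 : forall t j, in_L2 (nonlinearity p (U t) j).

Lemma rcomb_int e (V : graph_fun R N) (w : R -> R) : (forall j, in_L2 (V j)) ->
  continuous w -> intD (fun x => w x ^+ 2) -> intD (fun x => rcomb j0 j1 e V x * w x).
Proof.
move=> l2 cw iw; have mw := continuous_mD cw.
have h j : intD (fun x => Re (V j x) * w x).
  by have /in_L2P[m1 _ i1 _] := l2 j; exact: intD_mul.
by apply: intD_eq (intDD (h j0) (intDZ e (h j1))) => x _; rewrite /rcomb; ring.
Qed.

Lemma icomb_int e (V : graph_fun R N) (w : R -> R) : (forall j, in_L2 (V j)) ->
  continuous w -> intD (fun x => w x ^+ 2) -> intD (fun x => icomb j0 j1 e V x * w x).
Proof.
move=> l2 cw iw; have mw := continuous_mD cw.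
have h j : intD (fun x => Im (V j x) * w x).
  by have /in_L2P[_ m1 _ i1] := l2 j; exact: intD_mul.
by apply: intD_eq (intDD (h j0) (intDZ e (h j1))) => x _; rewrite /icomb; ring.
Qed.

(** All terms are linear in the test function, so it may be scaled by [l] into the unit ball and the
    factor removed afterwards. *)
Lemma tested_derivative_any (w w1 w2 : R -> R) (e : R) : classicalH1 w w1 -> classicalH1 w1 w2 ->
  w 0 = 0 -> `|e| <= 1 -> (1 + e) * w1 0 = 0 -> forall t : R,
  is_derive t 1 (fun s => I (fun x => rcomb j0 j1 e (U s) x * w x))
    (- I (fun x => icomb j0 j1 e (U t) x * w2 x)
     - I (fun x => icomb j0 j1 e (nonlinearity p (U t)) x * w x)) /\
  is_derive t 1 (fun s => I (fun x => icomb j0 j1 e (U s) x * w x))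
    (I (fun x => rcomb j0 j1 e (U t) x * w2 x)
     + I (fun x => rcomb j0 j1 e (nonlinearity p (U t)) x * w x)).
Proof.
move=> cw cw1 w0 e1 ew t.
pose B := Num.sqrt (2 * (I (fun x => w x ^+ 2) + I (fun x => w1 x ^+ 2))).
have B0 : 0 <= B by exact: sqrtr_ge0.
have B1 : 0 < B + 1 by lra.
pose l := (B + 1)^-1; have l0 : 0 < l by rewrite invr_gt0.
have lw0 : l * w 0 = 0 by rewrite w0 mulr0.
have lew : (1 + e) * (l * w1 0) = 0 by rewrite mulrCA ew mulr0.
have cz := classicalZ l cw; have cz1 := classicalZ l cw1.
have small : normE (edge_test j0 j1 e (fun x => l * w x)) <= 1.
  apply: le_trans (edge_test_normE j01 cz e1) _.
  have i1 := cl_i cw; have i2 := cl_i' cw.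
  have -> : 2 * (I (fun x => (l * w x) ^+ 2) + I (fun x => (l * w1 x) ^+ 2)) =
      l ^+ 2 * (2 * (I (fun x => w x ^+ 2) + I (fun x => w1 x ^+ 2))).
    rewrite (I_eq (f := fun x => (l * w x) ^+ 2) (g := fun x => l ^+ 2 * w x ^+ 2)); last by move=> x _; ring.
    rewrite (I_eq (f := fun x => (l * w1 x) ^+ 2) (g := fun x => l ^+ 2 * w1 x ^+ 2)); last by move=> x _; ring.
    by rewrite !IZ//; ring.
  rewrite sqrtrM ?sqr_ge0// sqrtr_sqr (gtr0_norm l0) -/B /l mulrC ler_pdivrMr// mul1r; lra.
have [d1 d2] := tested_derivative j01 cz cz1 lw0 hU nl_L2 lew small t.
have U2 s j : in_L2 (U s j) by have [h _] := solution_in_E hU s; case: (h j).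
have c0 := cl_c cw; have c2 := cl_c' cw1; have i0 := cl_i cw; have i2 := cl_i' cw1.
have scal (f k : R -> R) : intD (fun x => f x * k x) ->
    I (fun x => f x * (l * k x)) = l * I (fun x => f x * k x).
  by move=> h; rewrite -IZ//; apply: I_eq => x _; ring.
have e2 (a : R) : l^-1 * (l * a) = a by rewrite mulKf// gt_eqF.
split.
- have eF : (fun s => l^-1 * I (fun x => rcomb j0 j1 e (U s) x * (l * w x))) =
      (fun s => I (fun x => rcomb j0 j1 e (U s) x * w x)).
    by apply/funext => s; rewrite (scal (rcomb j0 j1 e (U s)) w) ?e2//; exact: rcomb_int.
  rewrite -eF; apply: der_eq (derZ l^-1 d1) _.
  rewrite (scal (icomb j0 j1 _ (U t)) w2); last exact: icomb_int.
  rewrite (scal (icomb j0 j1 _ (nonlinearity p (U t))) w); last exact: icomb_int.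
  by rewrite mulrBr mulrN !e2.
- have eF : (fun s => l^-1 * I (fun x => icomb j0 j1 e (U s) x * (l * w x))) =
      (fun s => I (fun x => icomb j0 j1 e (U s) x * w x)).
    by apply/funext => s; rewrite (scal (icomb j0 j1 e (U s)) w) ?e2//; exact: icomb_int.
  rewrite -eF; apply: der_eq (derZ l^-1 d2) _.
  rewrite (scal (rcomb j0 j1 _ (U t)) w2); last exact: rcomb_int.
  rewrite (scal (rcomb j0 j1 _ (nonlinearity p (U t))) w); last exact: rcomb_int.
  by rewrite mulrDr !e2.
Qed.

End scaled_test.

(** * The phase of a solution that stays near the orbit *)

Section solution_near_orbit.
Context {R : realType} {N : nat}.
Local Notation D := (@half_line R).
Local Notation Re := complex.Re.
Local Notation Im := complex.Im.
Local Notation V := (@L2fun R).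
Local Notation ip := (@ip R).
Variables (phi sig Q : R -> R) (omega p gam c0 C0 Qb xm : R).
Hypothesis gs : ground_state phi sig Q omega p gam c0 C0 Qb xm.
Hypothesis omega_ge0 : 0 <= omega.
Hypothesis QE : forall x, Q x = phi x `^ (p - 1).
Variables (j0 j1 : 'I_N).
Hypothesis j01 : j0 != j1.
Variables (alpha : R) (U : R -> graph_fun R N) (eps : R).
Hypothesis hU : forall T, 0 < T -> NLS_solution alpha p T U.
Hypothesis eps_gt0 : 0 < eps.
Hypothesis eps_le1 : eps <= 1.
Hypothesis orbit : forall t, exists theta, normE (gsub (U t) (gscale (expi theta) (@Phi R N phi))) <= eps.
Let p_gt1 := gs_p gs.
Let phi_gt0 := gs_phi gs.
Let Q_gt0 := gs_Q0 gs.
Let phi_cnt : continuous phi. Proof. exact: is_derive_cnt (gs_dphi gs). Qed.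
Let Q_cnt : continuous Q. Proof. exact: is_derive_cnt (gs_dQ gs). Qed.
Implicit Types (t x e theta : R).
Local Notation wt := (wt phi sig).
Local Notation wt1 := (wt1 phi sig Q omega).
Local Notation wt2 := (wt2 phi sig Q omega p).
Local Notation cc := (cc phi sig).
Local Notation B1 := (B1 phi sig).
Local Notation B2 := (B2 phi sig Q omega p).

(** One bound for two purposes when [eps <= 1]: it exceeds the uniform bound [6 eps + phi] and the
    squared [L^2] bound [2 eps^2] plus twice that of [phi]. *)
Definition Kb := 8 + C0 + phi 0 + 2 * I (fun x => phi x ^+ 2).

Let inE t : in_E (U t). Proof. exact: (solution_in_E hU t). Qed.

Let phi2_ge0 : 0 <= I (fun x => phi x ^+ 2).
Proof. by apply: I_ge0 => x _; exact: sqr_ge0. Qed.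

Lemma phi_le_max x : 0 <= x -> phi x <= C0 + phi 0.
Proof.
have C00 := gs_C0 gs; have p00 := phi_gt0 0.
rewrite le_eqVlt => /orP[/eqP <-|x0]; first by lra.
by have := phi_le gs x0; lra.
Qed.

Let near t theta j x : normE (gsub (U t) (gscale (expi theta) (@Phi R N phi))) <= eps -> 0 <= x ->
  modulus (U t j x - expi theta * (phi x)%:C) <= 6 * eps.
Proof.
move=> h x0; have [a1 a2 _] := orbit_close gs (inE t) eps_gt0 h j.
apply: le_trans (modulus_le_add _) _; rewrite ReB ImB ReM ImM /= !mulr0 subr0 add0r.
by have := a1 x x0; have := a2 x x0; lra.
Qed.

Lemma modulus_expi theta : modulus (expi theta : R[i]) = 1.
Proof. by rewrite /modulus /expi /= cos2Dsin2 sqrtr1. Qed.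

Lemma solution_bound t j x : 0 <= x -> modulus (U t j x) <= Kb.
Proof.
move=> x0; have [th h] := orbit t; have := near j h x0.
have := modulusD (U t j x - expi th * (phi x)%:C) (expi th * (phi x)%:C).
rewrite subrK modulusM modulus_expi modulusC mul1r (gtr0_norm (phi_gt0 x)) => h1 h2.
have := phi_le_max x0; have e1 := eps_le1; have := phi2_ge0; rewrite /Kb; lra.
Qed.

Let Kb_ge1 : 1 <= Kb.
Proof. by have := gs_C0 gs; have := phi_gt0 0; have := phi2_ge0; rewrite /Kb; lra. Qed.

Lemma solution_L2_bound t j : L2normsq (U t j) <= Kb ^+ 2.
Proof.
have [th h] := orbit t; have [_ _ h2] := orbit_close gs (inE t) eps_gt0 h j.
apply: le_trans h2 _; apply: (@le_trans _ _ Kb); last by rewrite expr2 ler_peMl// (le_trans ler01).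
have e2 : eps ^+ 2 <= 1 by rewrite exprn_ile1// ltW.
by have := gs_C0 gs; have := phi_gt0 0; rewrite /Kb; lra.
Qed.

Let ubd := solution_bound.
Let ul2 := solution_L2_bound.

Let nl2 t j : in_L2 (nonlinearity p (U t) j).
Proof. exact: (nonlinearity_L2 p_gt1 hU ubd ul2). Qed.
Let U2 t j : in_L2 (U t j).
Proof. by have [h _] := inE t; case: (h j). Qed.

Definition rU e t : V := L2of (rcomb j0 j1 e (U t)).
Definition iU e t : V := L2of (icomb j0 j1 e (U t)).
Definition rNl e t : V := L2of (rcomb j0 j1 e (nonlinearity p (U t))).
Definition iNl e t : V := L2of (icomb j0 j1 e (nonlinearity p (U t))).

Let goodF_rU e : `|e| <= 1 -> goodF (fun t => rcomb j0 j1 e (U t)).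
Proof.
by move=> e1; apply: (goodF_pair e1); [exact: (goodF_Re hU ubd ul2 j0)|exact: (goodF_Re hU ubd ul2 j1)].
Qed.
Let goodF_iU e : `|e| <= 1 -> goodF (fun t => icomb j0 j1 e (U t)).
Proof.
by move=> e1; apply: (goodF_pair e1); [exact: (goodF_Im hU ubd ul2 j0)|exact: (goodF_Im hU ubd ul2 j1)].
Qed.
Let goodF_rN e : `|e| <= 1 -> goodF (fun t => rcomb j0 j1 e (nonlinearity p (U t))).
Proof.
by move=> e1; apply: (goodF_pair e1); [exact: (goodF_nlRe p_gt1 hU ubd ul2 j0)|exact: (goodF_nlRe p_gt1 hU ubd ul2 j1)].
Qed.
Let goodF_iN e : `|e| <= 1 -> goodF (fun t => icomb j0 j1 e (nonlinearity p (U t))).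
Proof.
by move=> e1; apply: (goodF_pair e1); [exact: (goodF_nlIm p_gt1 hU ubd ul2 j0)|exact: (goodF_nlIm p_gt1 hU ubd ul2 j1)].
Qed.

Lemma good_rU e : `|e| <= 1 -> goodV (rU e). Proof. by move=> e1; exact: goodF_V (goodF_rU e1). Qed.
Lemma good_iU e : `|e| <= 1 -> goodV (iU e). Proof. by move=> e1; exact: goodF_V (goodF_iU e1). Qed.
Lemma good_rN e : `|e| <= 1 -> goodV (rNl e). Proof. by move=> e1; exact: goodF_V (goodF_rN e1). Qed.
Lemma good_iN e : `|e| <= 1 -> goodV (iNl e). Proof. by move=> e1; exact: goodF_V (goodF_iN e1). Qed.

Lemma rUE e t x : `|e| <= 1 -> 0 <= x -> L2val (rU e t) x = rcomb j0 j1 e (U t) x.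
Proof. by move=> e1 x0; have [h _ _] := goodF_rU e1; rewrite L2ofE// ger0_norm. Qed.
Lemma iUE e t x : `|e| <= 1 -> 0 <= x -> L2val (iU e t) x = icomb j0 j1 e (U t) x.
Proof. by move=> e1 x0; have [h _ _] := goodF_iU e1; rewrite L2ofE// ger0_norm. Qed.
Lemma rNE e t x : `|e| <= 1 -> 0 <= x -> L2val (rNl e t) x = rcomb j0 j1 e (nonlinearity p (U t)) x.
Proof. by move=> e1 x0; have [h _ _] := goodF_rN e1; rewrite L2ofE// ger0_norm. Qed.
Lemma iNE e t x : `|e| <= 1 -> 0 <= x -> L2val (iNl e t) x = icomb j0 j1 e (nonlinearity p (U t)) x.
Proof. by move=> e1 x0; have [h _ _] := goodF_iN e1; rewrite L2ofE// ger0_norm. Qed.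

Lemma pairing_derivative (w w1 w2 : R -> R) (z z2 : V) e : classicalH1 w w1 -> classicalH1 w1 w2 ->
  w 0 = 0 -> `|e| <= 1 -> (1 + e) * w1 0 = 0 ->
  (forall x, 0 < x -> L2val z x = w x) -> (forall x, 0 < x -> L2val z2 x = w2 x) ->
  forall t : R,
  is_derive t 1 (fun s => ip (rU e s) z) (- ip (iU e t) z2 - ip (iNl e t) z) /\
  is_derive t 1 (fun s => ip (iU e s) z) (ip (rU e t) z2 + ip (rNl e t) z).
Proof.
move=> cw cw1 w0 e1 ew zE z2E t.
have [d1 d2] := tested_derivative_any j01 hU nl2 cw cw1 w0 e1 ew t.
have conv (f : R -> V) (g : R -> R -> R) (y : V) k :
    (forall s x, 0 < x -> L2val (f s) x = g s x) -> (forall x, 0 < x -> L2val y x = k x) ->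
    (fun s => ip (f s) y) = (fun s => I (fun x => g s x * k x)).
  move=> fE yE; apply/funext => s; apply: I_eq => x x0; by rewrite fE ?yE.
have k1 (s x : R) (x0 : 0 < x) := @rUE e s x e1 (ltW x0).
have c1 := conv (rU e) (fun s => rcomb j0 j1 e (U s)) _ _ k1.
have k2 (s x : R) (x0 : 0 < x) := @iUE e s x e1 (ltW x0).
have c2 := conv (iU e) (fun s => icomb j0 j1 e (U s)) _ _ k2.
have k3 (s x : R) (x0 : 0 < x) := @rNE e s x e1 (ltW x0).
have c3 := conv (rNl e) (fun s => rcomb j0 j1 e (nonlinearity p (U s))) _ _ k3.
have k4 (s x : R) (x0 : 0 < x) := @iNE e s x e1 (ltW x0).
have c4 := conv (iNl e) (fun s => icomb j0 j1 e (nonlinearity p (U s))) _ _ k4.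
rewrite (c1 _ _ zE) (c2 _ _ zE); split.
- apply: der_eq d1 _.
  by rewrite -(congr1 (@^~ t) (c2 _ _ z2E)) -(congr1 (@^~ t) (c4 _ _ zE)).
- apply: der_eq d2 _.
  by rewrite -(congr1 (@^~ t) (c1 _ _ z2E)) -(congr1 (@^~ t) (c3 _ _ zE)).
Qed.

Definition wtV : V := L2of wt.
Definition wt2V : V := L2of wt2.

Lemma wtVE x : 0 < x -> L2val wtV x = wt x.
Proof.
move=> x0; rewrite L2ofE ?gtr0_norm//; split; last exact: cl_i (wt_classical gs).
exact: cnt_norm (wt_cnt gs).
Qed.
Lemma wt2VE x : 0 < x -> L2val wt2V x = wt2 x.
Proof.
move=> x0; rewrite L2ofE ?gtr0_norm//; split; last exact: cl_i' (wt1_classical gs).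
exact: cnt_norm (wt2_cnt gs).
Qed.

Let n1 : `|1 : R| <= 1. Proof. by rewrite normr1. Qed.

(* The phase [cr + i ci] follows [cc * expi theta] along the orbit. *)
Definition cr t := ip (rU 1 t) wtV.
Definition ci t := ip (iU 1 t) wtV.
(** With [E2], the deviation of the measured phase from uniform rotation at frequency [omega]; both
    vanish on the orbit. *)
Definition E1 t := - ip (iU 1 t) wt2V - ip (iNl 1 t) wtV + omega * ci t.
Definition E2 t := ip (rU 1 t) wt2V + ip (rNl 1 t) wtV - omega * cr t.

Lemma phase_derivative t :
  is_derive t 1 cr (- omega * ci t + E1 t) /\ is_derive t 1 ci (omega * cr t + E2 t).
Proof.
have w10 : (1 + 1) * wt1 0 = 0 by rewrite wt1_0 mulr0.
have [d1 d2] := pairing_derivative (wt_classical gs) (wt1_classical gs) (wt_0 phi sig) n1 w10 wtVE wt2VE t.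
by split; [apply: der_eq d1 _|apply: der_eq d2 _]; rewrite /E1 /E2; ring.
Qed.

Let L := (p + 1) * Kb `^ (p - 1).
Let L_ge0 : 0 <= L.
Proof. by have h := p_gt1; rewrite mulr_ge0 ?powR_ge0//; lra. Qed.

Definition B3 := 12 * B2 + 24 * L * B1.

(** Every pairing is compared with its value on the orbit at the same [theta]. By [phi_wt_identity]
    these values cancel in [E1] and [E2], so only deviations of order [eps] are left. *)
Lemma phase_estimates t theta : normE (gsub (U t) (gscale (expi theta) (@Phi R N phi))) <= eps ->
  [/\ `|cr t - cc * cos theta| <= 6 * eps * B1, `|ci t - cc * sin theta| <= 6 * eps * B1,
     `|E1 t| <= eps * B3 & `|E2 t| <= eps * B3].
Proof.
move=> h.
have zc x : 0 < x -> `|rcomb j0 j1 1 (U t) x - 2 * cos theta * phi x| <= 6 * eps.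
  move=> x0; have [a1 _ _] := orbit_close gs (inE t) eps_gt0 h j0.
  have [b1 _ _] := orbit_close gs (inE t) eps_gt0 h j1.
  have := a1 x (ltW x0); have := b1 x (ltW x0); rewrite /rcomb mul1r.
  have -> : Re (U t j0 x) + Re (U t j1 x) - 2 * cos theta * phi x =
    (Re (U t j0 x) - cos theta * phi x) + (Re (U t j1 x) - cos theta * phi x) by ring.
  by move=> g1 g2; rewrite (le_trans (ler_normD _ _))//; lra.
have zs x : 0 < x -> `|icomb j0 j1 1 (U t) x - 2 * sin theta * phi x| <= 6 * eps.
  move=> x0; have [_ a1 _] := orbit_close gs (inE t) eps_gt0 h j0.
  have [_ b1 _] := orbit_close gs (inE t) eps_gt0 h j1.
  have := a1 x (ltW x0); have := b1 x (ltW x0); rewrite /icomb mul1r.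
  have -> : Im (U t j0 x) + Im (U t j1 x) - 2 * sin theta * phi x =
    (Im (U t j0 x) - sin theta * phi x) + (Im (U t j1 x) - sin theta * phi x) by ring.
  by move=> g1 g2; rewrite (le_trans (ler_normD _ _))//; lra.
have nl_near j x : 0 < x -> modulus (nonlinearity p (U t) j x - expi theta * (Q x * phi x)%:C) <= L * (6 * eps).
  move=> x0; have -> : expi theta * (Q x * phi x)%:C = nl p (expi theta * (phi x)%:C).
    rewrite nl_rotate ?modulus_expi// /nl modulusC (gtr0_norm (phi_gt0 x)) -QE.
    by rewrite rmorphM.
  have kb : modulus (expi theta * (phi x)%:C) <= Kb.
    rewrite modulusM modulus_expi mul1r modulusC (gtr0_norm (phi_gt0 x)).
    by have := phi_le_max (ltW x0); have := phi2_ge0; rewrite /Kb; lra.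
  apply: le_trans (nl_lip p_gt1 (ubd t j (ltW x0)) kb) _.
  by apply: ler_wpM2l; [exact: L_ge0|exact: (near j h (ltW x0))].
have two (u v c m B : R) : `|u - c * m| <= B -> `|v - c * m| <= B -> `|u + v - 2 * c * m| <= 2 * B.
  have -> : u + v - 2 * c * m = (u - c * m) + (v - c * m) by ring.
  by move=> g1 g2; apply: le_trans (ler_normD _ _) _; lra.
have bE : 12 * L * eps = 2 * (L * (6 * eps)) by ring.
have nc x : 0 < x -> `|rcomb j0 j1 1 (nonlinearity p (U t)) x - 2 * cos theta * (Q x * phi x)| <= 12 * L * eps.
  move=> x0; rewrite bE /rcomb mul1r.
  have rl j : `|Re (nonlinearity p (U t) j x) - cos theta * (Q x * phi x)| <= L * (6 * eps).
    by have := le_trans (Re_le_modulus _) (nl_near j x x0); rewrite ReB [Re (expi theta * _)]ReM ReC ImC mulr0 subr0.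
  exact: two (rl j0) (rl j1).
have ns x : 0 < x -> `|icomb j0 j1 1 (nonlinearity p (U t)) x - 2 * sin theta * (Q x * phi x)| <= 12 * L * eps.
  move=> x0; rewrite bE /icomb mul1r.
  have il j : `|Im (nonlinearity p (U t) j x) - sin theta * (Q x * phi x)| <= L * (6 * eps).
    by have := le_trans (Im_le_modulus _) (nl_near j x x0); rewrite ImB [Im (expi theta * _)]ImM ReC ImC mulr0 add0r.
  exact: two (il j0) (il j1).
have rUwt : cr t = I (fun x => rcomb j0 j1 1 (U t) x * wt x).
  by apply: I_eq => x x0; rewrite rUE ?(ltW x0)// wtVE.
have iUwt : ci t = I (fun x => icomb j0 j1 1 (U t) x * wt x).
  by apply: I_eq => x x0; rewrite iUE ?(ltW x0)// wtVE.
have rUwt2 : ip (rU 1 t) wt2V = I (fun x => rcomb j0 j1 1 (U t) x * wt2 x).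
  by apply: I_eq => x x0; rewrite rUE ?(ltW x0)// wt2VE.
have iUwt2 : ip (iU 1 t) wt2V = I (fun x => icomb j0 j1 1 (U t) x * wt2 x).
  by apply: I_eq => x x0; rewrite iUE ?(ltW x0)// wt2VE.
have rNwt : ip (rNl 1 t) wtV = I (fun x => rcomb j0 j1 1 (nonlinearity p (U t)) x * wt x).
  by apply: I_eq => x x0; rewrite rNE ?(ltW x0)// wtVE.
have iNwt : ip (iNl 1 t) wtV = I (fun x => icomb j0 j1 1 (nonlinearity p (U t)) x * wt x).
  by apply: I_eq => x x0; rewrite iNE ?(ltW x0)// wtVE.
have wc := wt_cnt gs; have w2c := wt2_cnt gs.
have wi := cl_i (wt_classical gs); have w2i := cl_i' (wt1_classical gs).
have iphi : intD (fun x => phi x * wt x).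
  by apply: bc_intD (bc_phi gs) _ (wt_L1 gs); exact: continuous_mD.
have iphi2 : intD (fun x => phi x * wt2 x).
  by apply: bc_intD (bc_phi gs) _ (wt2_L1 gs); exact: continuous_mD.
have iQphi : intD (fun x => Q x * phi x * wt x).
  by apply: bc_intD (bcM (bc_Q gs) (bc_phi gs)) _ (wt_L1 gs); exact: continuous_mD.
have absw : I (fun x => `|wt x|) = B1.
  by apply: I_eq => x _; rewrite ger0_norm// (wt_ge0 gs).
have aw : intD (fun x => `|wt x|) := integrable_abse (wt_L1 gs).
have aw2 : intD (fun x => `|wt2 x|) := integrable_abse (wt2_L1 gs).
have est (f g k : R -> R) (a b : R) : intD (fun x => f x * k x) -> intD (fun x => g x * k x) ->
    intD (fun x => `|k x|) -> (forall x, 0 < x -> `|f x - a * g x| <= b) ->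
    `|I (fun x => f x * k x) - a * I (fun x => g x * k x)| <= b * I (fun x => `|k x|).
  move=> i1 i2 ik hfg.
  have e : a * I (fun x => g x * k x) = I (fun x => a * g x * k x).
    by rewrite -IZ//; apply: I_eq => x _; ring.
  have i3 : intD (fun x => a * g x * k x) by apply: intD_eq (intDZ a i2) => x _; ring.
  rewrite e -IB//; have i4 := intDB i1 i3.
  apply: le_trans (le_normr_Rintegral _ i4) _ => //.
  rewrite -IZ//; apply: I_le; [exact: (integrable_abse i4)|exact: intDZ|].
  by move=> x x0; rewrite -mulrBl normrM ler_wpM2r// hfg.
have r1 := est _ _ _ _ _ (rcomb_int j0 j1 1 (U2 t) wc wi) iphi aw zc.
have r2 := est _ _ _ _ _ (icomb_int j0 j1 1 (U2 t) wc wi) iphi aw zs.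
have r3 := est _ _ _ _ _ (rcomb_int j0 j1 1 (U2 t) w2c w2i) iphi2 aw2 zc.
have r4 := est _ _ _ _ _ (icomb_int j0 j1 1 (U2 t) w2c w2i) iphi2 aw2 zs.
have r5 := est _ (fun x => Q x * phi x) _ _ _ (rcomb_int j0 j1 1 (nl2 t) wc wi) iQphi aw nc.
have r6 := est _ (fun x => Q x * phi x) _ _ _ (icomb_int j0 j1 1 (nl2 t) wc wi) iQphi aw ns.
rewrite absw -?rUwt -?iUwt -?rUwt2 -?iUwt2 -?rNwt -?iNwt in r1 r2 r3 r4 r5 r6.
have ident := phi_wt_identity gs.
set P := I (fun x => phi x * wt x) in r1 r2 ident.
set P2 := I (fun x => phi x * wt2 x) in r3 r4 ident.
set P3 := I (fun x => Q x * phi x * wt x) in r5 r6 ident.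
have ccE : cc = 2 * P by [].
have P2E : P2 = omega * P - P3.
  by apply/eqP; rewrite eq_sym subr_eq eq_sym; apply/eqP; exact: ident.
have I2 : I (fun x => `|wt2 x|) = B2 - omega * B1 by rewrite B2E; ring.
rewrite I2 in r3 r4.
have eB : 0 <= 6 * eps * B1 by rewrite mulr_ge0 ?(B1_ge0 gs)// mulr_ge0// (ltW eps_gt0).
have oB := mulr_ge0 omega_ge0 eB.
have LB : 0 <= L * eps * B1 by rewrite mulr_ge0 ?(B1_ge0 gs)// mulr_ge0// (ltW eps_gt0).
have ow (a : R) : `|a| <= 6 * eps * B1 -> `|omega * a| <= omega * (6 * eps * B1).
  by move=> ha; rewrite normrM (ger0_norm omega_ge0) ler_wpM2l.
have B20 : 0 <= eps * B2 by rewrite mulr_ge0 ?(ltW eps_gt0) ?(B2_ge0 gs).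
split.
- by have -> : cr t - cc * cos theta = cr t - 2 * cos theta * P by rewrite ccE; ring.
- by have -> : ci t - cc * sin theta = ci t - 2 * sin theta * P by rewrite ccE; ring.
- have -> : E1 t = - (ip (iU 1 t) wt2V - 2 * sin theta * P2) - (ip (iNl 1 t) wtV - 2 * sin theta * P3)
      + omega * (ci t - 2 * sin theta * P).
    by rewrite /E1 P2E; ring.
  apply: le_trans (ler_normD _ _) _; apply: le_trans (lerD (ler_normD _ _) (ow _ r2)) _.
  rewrite !normrN; apply: le_trans (lerD (lerD r4 r6) (lexx _)) _.
  rewrite /B3; have -> : 6 * eps * (B2 - omega * B1) + 12 * L * eps * B1 + omega * (6 * eps * B1) =
    6 * (eps * B2) + 12 * (L * eps * B1) by ring.
  have -> : eps * (12 * B2 + 24 * L * B1) = 12 * (eps * B2) + 24 * (L * eps * B1) by ring.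
  exact: double_estimate.
- have -> : E2 t = (ip (rU 1 t) wt2V - 2 * cos theta * P2) + (ip (rNl 1 t) wtV - 2 * cos theta * P3)
      - omega * (cr t - 2 * cos theta * P).
    by rewrite /E2 P2E; ring.
  apply: le_trans (ler_normB _ _) _; apply: le_trans (lerD (ler_normD _ _) (ow _ r1)) _.
  apply: le_trans (lerD (lerD r3 r5) (lexx _)) _.
  rewrite /B3; have -> : 6 * eps * (B2 - omega * B1) + 12 * L * eps * B1 + omega * (6 * eps * B1) =
    6 * (eps * B2) + 12 * (L * eps * B1) by ring.
  have -> : eps * (12 * B2 + 24 * L * B1) = 12 * (eps * B2) + 24 * (L * eps * B1) by ring.
  exact: double_estimate.
Qed.

End solution_near_orbit.

(** * Pointwise bound of the error by the rotated difference *)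

Section error_estimate.
Context {R : realType}.
Local Notation Re := complex.Re.
Local Notation Im := complex.Im.
Variables (p q cc theta k1 L d' E1 E2 cr ci mu delta eb3 Qb : R).
Variables (z0 z1 : R[i]).
Hypothesis p1 : 1 < p.
Hypothesis q0 : 0 <= q.
Hypothesis qQ : q <= Qb.
Hypothesis cc0 : 0 < cc.
Hypothesis mu0 : 0 < mu.
Hypothesis delta0 : 0 < delta.
Hypothesis L0 : 0 <= L.
Let d := z0 - z1.
Let T := nl p z0 - nl p z1.
Let rot : R[i] := (cos theta) +i* (- sin theta).
Hypothesis hT : modulus T <= L * modulus d.
Hypothesis hlin : modulus (nl p (rot * z0) - nl p (rot * z1) -
  q%:C * ((rot * z0 - rot * z1) + ((p - 1) * Re (rot * z0 - rot * z1))%:C))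
  <= d' * modulus (rot * z0 - rot * z1).
Hypothesis hcr : `|cr - cc * cos theta| <= k1.
Hypothesis hci : `|ci - cc * sin theta| <= k1.
Hypothesis hE1 : `|E1| <= eb3.
Hypothesis hE2 : `|E2| <= eb3.
Hypothesis k1_small : 4 * k1 <= cc.
Hypothesis budget : (p * Qb + L) * (2 * k1) + cc * d' + 2 * eb3 <= delta * (cc / 2).
(** Conjugate of the measured phase, close to its ideal value [g0]. [dif] is the differential of the
    nonlinearity at the real point whose power [p - 1] is [q]. *)
Let gm : R[i] := cr +i* (- ci).
Let g0 : R[i] := cc%:C * rot.
Let dif (w : R[i]) : R[i] := q%:C * (w + ((p - 1) * Re w)%:C).

Let rot1 : modulus rot = 1.
Proof. by rewrite /modulus /rot /= sqrrN cos2Dsin2 sqrtr1. Qed.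

Let difE u v : dif (u + v) = dif u + dif v.
Proof. by rewrite /dif ReD [(p - 1) * _]mulrDr rmorphD/=; ring. Qed.

Let difZ (c : R) u : dif (c%:C * u) = c%:C * dif u.
Proof.
rewrite /dif ReM ReC ImC mul0r subr0 mulrCA rmorphM/=; ring.
Qed.

Let dif_le w : modulus (dif w) <= p * Qb * modulus w.
Proof.
rewrite /dif modulusM modulusC (ger0_norm q0).
have h1 := modulusD w ((p - 1) * Re w)%:C.
have m0 : 0 <= p - 1 by rewrite subr_ge0 ltW.
have h2 : modulus ((p - 1) * Re w)%:C <= (p - 1) * modulus w.
  by rewrite modulusC normrM (ger0_norm m0) ler_wpM2l// Re_le_modulus.
have h3 : modulus (w + ((p - 1) * Re w)%:C) <= p * modulus w.
  by apply: le_trans h1 _; move: h2; set mm := modulus w; set m2 := modulus _; lra.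
have h4 := ler_wpM2l q0 h3; apply: le_trans h4 _.
have p0 : 0 <= p by exact: le_trans ler01 (ltW p1).
by rewrite mulrA [q * p]mulrC ler_wpM2r ?modulus_ge0// ler_wpM2l.
Qed.

Let gm_near : modulus (gm - g0) <= 2 * k1.
Proof.
apply: le_trans (modulus_le_add _) _.
have -> : Re (gm - g0) = cr - cc * cos theta by rewrite ReB ReM /= mul0r subr0.
have -> : Im (gm - g0) = - (ci - cc * sin theta) by rewrite ImB ImM /= mul0r addr0; ring.
by rewrite normrN; move: hcr hci; lra.
Qed.

Let gm_low : cc / 2 <= modulus gm.
Proof.
have := modulusD (gm - g0) (- gm); have -> : gm - g0 - gm = - g0 by ring.
rewrite !modulusN {1}/g0 modulusM modulusC rot1 mulr1 (gtr0_norm cc0).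
by move: gm_near k1_small; lra.
Qed.

(** Linearized minus actual increment of the nonlinearity, both rotated by the measured phase. *)
Let Z := dif (d * gm) - T * gm.

Let Z_le : modulus Z <= ((p * Qb + L) * (2 * k1) + cc * d') * modulus d.
Proof.
have d0 := modulus_ge0 d.
have e1 : d * g0 = cc%:C * (rot * d) by rewrite /g0; ring.
have e2 : rot * z0 - rot * z1 = rot * d by rewrite /d; ring.
have e3 : nl p (rot * z0) - nl p (rot * z1) = rot * T by rewrite !nl_rotate// /T; ring.
(* The hypothesis [hlin] concerns the exact rotation; replacing [gm] by [g0] costs a Lipschitz
   factor times the phase error. *)
have -> : Z = dif (d * (gm - g0)) - T * (gm - g0) - cc%:C * (rot * T - dif (rot * d)).
  have -> : cc%:C * (rot * T - dif (rot * d)) = cc%:C * rot * T - dif (d * g0).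
    by rewrite e1 difZ; ring.
  have -> : dif (d * (gm - g0)) = dif (d * gm) - dif (d * g0).
    by apply/eqP; rewrite eq_sym subr_eq -difE; apply/eqP; congr dif; ring.
  by rewrite /Z /g0; ring.
apply: le_trans (modulusB _ _) _.
have b1 : modulus (dif (d * (gm - g0)) - T * (gm - g0)) <= (p * Qb + L) * (2 * k1) * modulus d.
  apply: le_trans (modulusB _ _) _; have h1 := dif_le (d * (gm - g0)).
  rewrite !modulusM in h1 *.
  have Qb0 : 0 <= Qb := le_trans q0 qQ.
  have pQ0 : 0 <= p * Qb by rewrite mulr_ge0// (le_trans ler01 (ltW p1)).
  have h2 : p * Qb * (modulus d * modulus (gm - g0)) <= p * Qb * (modulus d * (2 * k1)).
    by do 2 rewrite ler_wpM2l//.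
  have h3 : modulus T * modulus (gm - g0) <= L * modulus d * (2 * k1).
    by rewrite ler_pM ?modulus_ge0.
  have := lerD (le_trans h1 h2) h3; congr (_ <= _); ring.
have b2 : modulus (cc%:C * (rot * T - dif (rot * d))) <= cc * d' * modulus d.
  rewrite modulusM modulusC (gtr0_norm cc0) -mulrA ler_wpM2l ?(ltW cc0)//.
  by move: hlin; rewrite e3 e2 [modulus (rot * d)]modulusM rot1 mul1r.
rewrite [leRHS]mulrDl; exact: lerD b1 b2.
Qed.

Let a := mu * (cr * Re d + ci * Im d).
Let b := mu * (cr * Im d - ci * Re d).
Let ea := mu * (E1 * Re d + E2 * Im d) + (q * b - mu * (cr * Im T - ci * Re T)).
Let eb := mu * (E1 * Im d - E2 * Re d) + ((mu * (cr * Re T + ci * Im T) - q * a) - (p - 1) * q * a).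

(** In complex form [a + i b = mu d gm] and [ea + i eb = mu (X + d w)] with [X = - i Z], so both
    sides are squared moduli. The lower bound [cc / 2] on the modulus of [gm] converts the bound by
    [d] into a bound by [a + i b]. *)
Lemma error_estimate : ea ^+ 2 + eb ^+ 2 <= delta ^+ 2 * (a ^+ 2 + b ^+ 2).
Proof.
pose w : R[i] := E1 +i* (- E2).
pose X : R[i] := (Im Z) +i* (- Re Z).
have X1 : modulus X = modulus Z.
  by apply/eqP; rewrite -(@eqrXn2 _ 2)// ?modulus_ge0// !modulus_sq /= sqrrN addrC.
have eaE : ea = Re (mu%:C * (X + d * w)).
  rewrite ReM ReC ImC mul0r subr0 ReD /= ReM /= /Z ImB /dif !ImM !ReC !ImC ImD ImC ReD ReC !ReM !ImM /=.
  by rewrite /ea /b; ring.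
have ebE : eb = Im (mu%:C * (X + d * w)).
  have XE : Im X = - Re Z by [].
  rewrite ImM ReC ImC mul0r addr0 ImD XE ImM /Z ReB /dif ReM ReC ImC mul0r subr0 ReD ReC !ReM.
  have [g1 g2 w1 w2] : [/\ Re gm = cr, Im gm = - ci, Re w = E1 & Im w = - E2] by [].
  by rewrite g1 g2 w1 w2 /eb /a; ring.
have abE : a ^+ 2 + b ^+ 2 = (mu * (modulus d * modulus gm)) ^+ 2.
  by rewrite !exprMn !modulus_sq /= /a /b; ring.
rewrite eaE ebE -modulus_sq abE -exprMn lerXn2r ?nnegrE ?modulus_ge0 ?mulr_ge0 ?modulus_ge0 ?(ltW delta0) ?(ltW mu0)//.
rewrite modulusM modulusC (gtr0_norm mu0) mulrCA ler_pM2l//.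
have d0 := modulus_ge0 d.
have w1 : modulus w <= 2 * eb3.
  by apply: le_trans (modulus_le_add _) _; rewrite /= normrN; move: hE1 hE2; lra.
have h1 : modulus (X + d * w) <= delta * (cc / 2) * modulus d.
  apply: le_trans (modulusD _ _) _; rewrite X1 modulusM.
  have h2 : modulus d * modulus w <= modulus d * (2 * eb3) by rewrite ler_wpM2l.
  have h3 := ler_wpM2r d0 budget.
  apply: le_trans (lerD Z_le h2) _; apply: le_trans h3.
  by rewrite [X in _ <= X]mulrDl [modulus d * _]mulrC.
apply: le_trans h1 _; rewrite -mulrA ler_wpM2l ?(ltW delta0)// mulrC ler_wpM2l//.
Qed.

End error_estimate.

(** * The rotated difference of the two edges solves the perturbed flow *)

Section instability.
Context {R : realType} {N : nat}.
Local Notation D := (@half_line R).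
Local Notation Re := complex.Re.
Local Notation Im := complex.Im.
Local Notation V := (@L2fun R).
Local Notation ip := (@ip R).
Local Notation nm := (psd_norm ip).
Variables (phi sig Q : R -> R) (omega p gam c0 C0 Qb xm alpha : R).
Hypothesis gs : ground_state phi sig Q omega p gam c0 C0 Qb xm.
Hypothesis omega_ge0 : 0 <= omega.
Hypothesis QE : forall x, Q x = phi x `^ (p - 1).
Variables (j0 j1 : 'I_N).
Hypothesis j01 : j0 != j1.
Let hb : psd_form ip := ip_psd.
Let p_gt1 := gs_p gs.
Let phi_gt0 := gs_phi gs.
Let Q_gt0 := gs_Q0 gs.
Let sig_cnt : continuous sig. Proof. exact: is_derive_cnt (gs_dsig gs). Qed.
Let Q_cnt : continuous Q. Proof. exact: is_derive_cnt (gs_dQ gs). Qed.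
Implicit Types (t x e theta : R).
Local Notation sol := (green_sol phi).
Local Notation sol' := (green_dsol phi sig).
Local Notation G := (Gop gs).
Local Notation W := (Wop gs).
Local Notation cc := (cc phi sig).
Local Notation Kb := (Kb phi C0).

Let sol2 (y : V) x := (omega - Q x) * sol y x - L2val y x.

Lemma sol_classical y : classicalH1 (sol y) (sol' y).
Proof.
split; [exact: (sol_cnt gs)|exact: (sol'_cnt gs)|by move=> x; exact: (dsol gs)| |].
- exact: (sol_int gs y).1.
- exact: (sol'_int gs y).1.
Qed.

Lemma sol'_classical y : classicalH1 (sol' y) (sol2 y).
Proof.
have cs2 : continuous (fun x => (omega - Q x) * sol y x).
  by apply: cntM; [apply: cntB => //; exact: cnt_cst|exact: (sol_cnt gs)].
split; [exact: (sol'_cnt gs)| |by move=> x; exact: (dsol' gs)| |].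
- by apply: cntB => //; exact: L2_cont.
- exact: (sol'_int gs y).1.
- apply: intD_sqB; [exact: continuous_mD| |exact: L2_mD|exact: L2_int].
  have [cb [B hB]] := bcB (bc_cst omega) (bc_Q gs).
  apply: (intD_bounded2 cb _ hB (sol_int gs y).1).
  by apply: continuous_mD; exact: (sol_cnt gs).
Qed.

Definition Qop (v : V) : V := (p - 1)^-1 *: W v.

Lemma QopE v x : 0 <= x -> L2val (Qop v) x = Q x * L2val v x.
Proof.
have m0 : p - 1 != 0 by rewrite subr_eq0 gt_eqF.
by move=> x0; rewrite L2valZ WopE// mulrA mulKf.
Qed.

Section against_a_solution.
Variables (U : R -> graph_fun R N) (eps mu delta d' : R).
Hypothesis hU : forall T, 0 < T -> NLS_solution alpha p T U.
Hypothesis eps_gt0 : 0 < eps.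
Hypothesis eps_le1 : eps <= 1.
Hypothesis orbit : forall t, exists theta,
  normE (gsub (U t) (gscale (expi theta) (@Phi R N phi))) <= eps.
Hypothesis mu_gt0 : 0 < mu.
Hypothesis delta_gt0 : 0 < delta.
Let L := (p + 1) * Kb `^ (p - 1).
Local Notation B1 := (B1 phi sig).
Local Notation B3 := (B3 phi sig Q omega p C0).
Hypothesis eps_small : 4 * (6 * eps * B1) <= cc.
Hypothesis budget : (p * Qb + L) * (2 * (6 * eps * B1)) + cc * d' + 2 * (eps * B3) <= delta * (cc / 2).
Hypothesis lin : forall f z1 z2, 0 < f <= C0 + phi 0 -> modulus (z1 - f%:C) <= 6 * eps ->
  modulus (z2 - f%:C) <= 6 * eps ->
  modulus (nl p z1 - nl p z2 - (f `^ (p - 1))%:C * ((z1 - z2) + ((p - 1) * Re (z1 - z2))%:C))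
    <= d' * modulus (z1 - z2).

Let rd t : V := rU j0 j1 U (- 1) t.
Let di t : V := iU j0 j1 U (- 1) t.
Let rn t : V := rNl p j0 j1 U (- 1) t.
Let iN t : V := iNl p j0 j1 U (- 1) t.
Let cr t := cr phi sig j0 j1 U t.
Let ci t := ci phi sig j0 j1 U t.
Let E1 t := E1 phi sig Q omega p j0 j1 U t.
Let E2 t := E2 phi sig Q omega p j0 j1 U t.
Let nN1 : `|-1 : R| <= 1. Proof. by rewrite normrN1. Qed.
Let n1 : `|1 : R| <= 1. Proof. by rewrite normr1. Qed.

(** [a + i b] is [mu (cr - i ci)] times the difference of the two edges. The rotation removes the
    frequency [omega] of the orbit; [ea] and [eb] collect the drift of the phase and the defect of
    linearization. *)
Let a t : V := mu *: (cr t *: rd t + ci t *: di t).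
Let b t : V := mu *: (cr t *: di t - ci t *: rd t).
Let ea t : V := mu *: (E1 t *: rd t + E2 t *: di t) + (Qop (b t) - mu *: (cr t *: iN t - ci t *: rn t)).
Let eb t : V := mu *: (E1 t *: di t - E2 t *: rd t)
  + ((mu *: (cr t *: rn t + ci t *: iN t) - Qop (a t)) - W (a t)).

Let grd : goodV rd. Proof. exact: (good_rU gs j0 j1 hU eps_gt0 eps_le1 orbit nN1). Qed.
Let gdi : goodV di. Proof. exact: (good_iU gs j0 j1 hU eps_gt0 eps_le1 orbit nN1). Qed.
Let grn : goodV rn. Proof. exact: (good_rN gs j0 j1 hU eps_gt0 eps_le1 orbit nN1). Qed.
Let giN : goodV iN. Proof. exact: (good_iN gs j0 j1 hU eps_gt0 eps_le1 orbit nN1). Qed.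
Let gcr : goodS cr. Proof. by apply: goodS_ip; exact: (good_rU gs j0 j1 hU eps_gt0 eps_le1 orbit n1). Qed.
Let gci : goodS ci. Proof. by apply: goodS_ip; exact: (good_iU gs j0 j1 hU eps_gt0 eps_le1 orbit n1). Qed.
Let gE1 : goodS E1.
Proof.
exact: (goodSD (goodSD (goodSN (goodS_ip _ (good_iU gs j0 j1 hU eps_gt0 eps_le1 orbit n1)))
  (goodSN (goodS_ip _ (good_iN gs j0 j1 hU eps_gt0 eps_le1 orbit n1)))) (goodSZ omega gci)).
Qed.
Let gE2 : goodS E2.
Proof.
exact: (goodSD (goodSD (goodS_ip _ (good_rU gs j0 j1 hU eps_gt0 eps_le1 orbit n1))
  (goodS_ip _ (good_rN gs j0 j1 hU eps_gt0 eps_le1 orbit n1))) (goodSN (goodSZ omega gcr))).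
Qed.

Let gmu h : goodV h -> goodV (fun t => mu *: h t). Proof. exact: goodVZ (goodS_cst mu). Qed.
Let gsubV h k : goodV h -> goodV k -> goodV (fun t => h t - k t).
Proof. by move=> gh gk; apply: goodVD => //; exact: goodVN. Qed.
Let ga : goodV a. Proof. exact: (gmu (goodVD (goodVZ gcr grd) (goodVZ gci gdi))). Qed.
Let gb : goodV b. Proof. exact: (gmu (gsubV (goodVZ gcr gdi) (goodVZ gci grd))). Qed.
Let gW h : goodV h -> goodV (fun t => W (h t)).
Proof.
have Qb0 : 0 <= Qb by exact: le_trans (ltW (Q_gt0 0)) (gs_Qb gs 0).
have m0 : 0 < p - 1 by rewrite subr_gt0.
apply: (goodV_map (T := W) (w := (p - 1) * Qb)); first by rewrite mulr_ge0// ltW.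
  move=> v x; rewrite /= normrM ler_wpM2r// normrM (gtr0_norm m0) (gtr0_norm (Q_gt0 _)).
  by rewrite ler_pM2l// (gs_Qb gs).
by move=> v; exact: (Wop_bd gs).
Qed.
Let gQ h : goodV h -> goodV (fun t => Qop (h t)).
Proof. by move=> gh; apply: (goodVZ (goodS_cst _)); exact: gW. Qed.
Let gea : goodV ea.
Proof.
exact: (goodVD (gmu (goodVD (goodVZ gE1 grd) (goodVZ gE2 gdi)))
  (gsubV (gQ gb) (gmu (gsubV (goodVZ gcr giN) (goodVZ gci grn))))).
Qed.
Let geb : goodV eb.
Proof.
exact: (goodVD (gmu (gsubV (goodVZ gE1 gdi) (goodVZ gE2 grd)))
  (gsubV (gsubV (gmu (goodVD (goodVZ gcr grn) (goodVZ gci giN))) (gQ ga)) (gW ga))).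
Qed.

Let aE t z : ip (a t) z = mu * (cr t * ip (rd t) z + ci t * ip (di t) z).
Proof. by rewrite /a (psdZl hb) (psdDl hb) !(psdZl hb). Qed.
Let bE t z : ip (b t) z = mu * (cr t * ip (di t) z - ci t * ip (rd t) z).
Proof. by rewrite /b (psdZl hb) (psdBl hb) !(psdZl hb). Qed.
Let QopS u z : ip (Qop u) z = (p - 1)^-1 * ip u (W z).
Proof. by rewrite /Qop (psdZl hb) (Wop_sym gs). Qed.

(** [G y] vanishes at the vertex, which is the whole domain condition for opposite signs on the two
    edges; [z2] is its second derivative, [omega (G y) - Q (G y) - y]. *)
Let tested y t :
  is_derive t 1 (fun s => ip (rd s) (G y))
    (- (omega * ip (di t) (G y) - (p - 1)^-1 * ip (di t) (W (G y)) - ip (di t) y) - ip (iN t) (G y)) /\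
  is_derive t 1 (fun s => ip (di s) (G y))
    (omega * ip (rd t) (G y) - (p - 1)^-1 * ip (rd t) (W (G y)) - ip (rd t) y + ip (rn t) (G y)).
Proof.
have e0 : (1 + -1) * sol' y 0 = 0 :> R by rewrite subrr mul0r.
pose z2 : V := omega *: G y - Qop (G y) - y.
have z2E x : 0 < x -> L2val z2 x = sol2 y x.
  move=> x0; rewrite !L2valB L2valZ QopE ?(ltW x0)// GopE ?(ltW x0)// /sol2; ring.
have zE x : 0 < x -> L2val (G y) x = sol y x by move=> x0; rewrite GopE ?ltW.
have [d1 d2] := pairing_derivative gs j01 hU eps_gt0 eps_le1 orbit (sol_classical y)
  (sol'_classical y) (sol0 _ _) nN1 e0 zE z2E t.
have z2ip u : ip u z2 = omega * ip u (G y) - (p - 1)^-1 * ip u (W (G y)) - ip u y.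
  by rewrite /z2 /Qop !(psdBr hb) !(psdZr hb).
by split; [apply: der_eq d1 _|apply: der_eq d2 _]; rewrite z2ip.
Qed.

Let phase t : is_derive t 1 cr (- omega * ci t + E1 t) /\ is_derive t 1 ci (omega * cr t + E2 t).
Proof. exact: (phase_derivative gs j01 hU eps_gt0 eps_le1 orbit t). Qed.

Let ip_ea (e1 e2 c1 c2 : R) (r d n i c z : V) :
  ip (mu *: (e1 *: r + e2 *: d) + (Qop c - mu *: (c1 *: i - c2 *: n))) z =
  mu * (e1 * ip r z + e2 * ip d z) + ((p - 1)^-1 * ip c (W z) - mu * (c1 * ip i z - c2 * ip n z)).
Proof. by rewrite (psdDl hb) (psdBl hb) QopS !(psdZl hb) (psdDl hb) (psdBl hb) !(psdZl hb). Qed.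

Let ip_eb (e1 e2 c1 c2 : R) (r d n i c z : V) :
  ip (mu *: (e1 *: d - e2 *: r) + ((mu *: (c1 *: n + c2 *: i) - Qop c) - W c)) z =
  mu * (e1 * ip d z - e2 * ip r z) + ((mu * (c1 * ip n z + c2 * ip i z) - (p - 1)^-1 * ip c (W z)) - ip c (W z)).
Proof.
by rewrite (psdDl hb) (psdBl hb) (psdBl hb) QopS (Wop_sym gs) !(psdZl hb) (psdBl hb) (psdDl hb) !(psdZl hb).
Qed.

Let weak_a t y : is_derive t 1 (fun s => ip (a s) (G y)) (ip (b t) y + ip (ea t) (G y)).
Proof.
have [d1 d2] := tested y t; have [q1 q2] := phase t.
rewrite (_ : (fun s => ip (a s) (G y)) = (fun s => mu * (cr s * ip (rd s) (G y) + ci s * ip (di s) (G y))));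
  last by apply/funext => s; exact: aE.
apply: der_eq (derZ mu (derD (derM q1 d1) (derM q2 d2))) _.
rewrite (ip_ea (E1 t) (E2 t) (cr t) (ci t) (rd t) (di t) (rn t) (iN t) (b t)) !bE; ring.
Qed.

Let weak_b t y : is_derive t 1 (fun s => ip (b s) (G y))
  (- ip (a t) y + ip (W (a t)) (G y) + ip (eb t) (G y)).
Proof.
have [d1 d2] := tested y t; have [q1 q2] := phase t.
rewrite (_ : (fun s => ip (b s) (G y)) = (fun s => mu * (cr s * ip (di s) (G y) - ci s * ip (rd s) (G y))));
  last by apply/funext => s; exact: bE.
apply: der_eq (derZ mu (derB (derM q1 d2) (derM q2 d1))) _.
rewrite (ip_eb (E1 t) (E2 t) (cr t) (ci t) (rd t) (di t) (rn t) (iN t) (a t)) (Wop_sym gs) !aE; ring.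
Qed.

Let val_ea (e1 e2 c1 c2 : R) (r d n i c : V) x : 0 <= x ->
  L2val (mu *: (e1 *: r + e2 *: d) + (Qop c - mu *: (c1 *: i - c2 *: n))) x =
  mu * (e1 * L2val r x + e2 * L2val d x) + (Q x * L2val c x - mu * (c1 * L2val i x - c2 * L2val n x)).
Proof. by move=> x0; rewrite L2valD L2valB QopE// !L2valZ L2valD L2valB !L2valZ. Qed.

Let val_eb (e1 e2 c1 c2 : R) (r d n i c : V) x : 0 <= x ->
  L2val (mu *: (e1 *: d - e2 *: r) + ((mu *: (c1 *: n + c2 *: i) - Qop c) - W c)) x =
  mu * (e1 * L2val d x - e2 * L2val r x)
    + ((mu * (c1 * L2val n x + c2 * L2val i x) - Q x * L2val c x) - (p - 1) * Q x * L2val c x).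
Proof.
by move=> x0; rewrite L2valD L2valB L2valB QopE// WopE// !L2valZ L2valB L2valD !L2valZ.
Qed.

(** At each time an angle close to the orbit is fixed. Rotating back by it puts both edge values
    within [6 * eps] of the positive number [phi x], where the uniform linearization applies. *)
Let pointwise t x : 0 < x -> L2val (ea t) x ^+ 2 + L2val (eb t) x ^+ 2 <=
  delta ^+ 2 * (L2val (a t) x ^+ 2 + L2val (b t) x ^+ 2).
Proof.
move=> x0; have x_ge0 := ltW x0.
have [th h] := orbit t.
have [h1 h2 h3 h4] := phase_estimates gs omega_ge0 QE j0 j1 hU eps_gt0 eps_le1 orbit h.
have inE := solution_in_E hU t.
pose z0 := U t j0 x; pose z1 := U t j1 x.
have rdE : L2val (rd t) x = Re (z0 - z1).
  by rewrite (rUE gs j0 j1 hU eps_gt0 eps_le1 orbit t nN1 x_ge0) /rcomb ReB mulN1r.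
have diE : L2val (di t) x = Im (z0 - z1).
  by rewrite (iUE gs j0 j1 hU eps_gt0 eps_le1 orbit t nN1 x_ge0) /icomb ImB mulN1r.
have rnE : L2val (rn t) x = Re (nl p z0 - nl p z1).
  by rewrite (rNE gs j0 j1 hU eps_gt0 eps_le1 orbit t nN1 x_ge0) /rcomb ReB mulN1r.
have iNE : L2val (iN t) x = Im (nl p z0 - nl p z1).
  by rewrite (iNE gs j0 j1 hU eps_gt0 eps_le1 orbit t nN1 x_ge0) /icomb ImB mulN1r.
have near j : modulus (U t j x - expi th * (phi x)%:C) <= 6 * eps.
  have [a1 a2 _] := orbit_close gs inE eps_gt0 h j.
  apply: le_trans (modulus_le_add _) _; rewrite ReB ImB ReM ImM /= !mulr0 subr0 add0r.
  by have := a1 x x_ge0; have := a2 x x_ge0; lra.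
pose rot : R[i] := (cos th) +i* (- sin th).
have rot1 : modulus rot = 1 by rewrite /modulus /rot /= sqrrN cos2Dsin2 sqrtr1.
have rote : rot * expi th = 1.
  have := cos2Dsin2 th; rewrite /rot /expi => cs.
  apply: complex_eq; rewrite ?ReM ?ImM /=; last by ring.
  by rewrite -cs; ring.
have near' j : modulus (rot * U t j x - (phi x)%:C) <= 6 * eps.
  have -> : rot * U t j x - (phi x)%:C = rot * (U t j x - expi th * (phi x)%:C).
    by rewrite mulrBr mulrA rote mul1r.
  by rewrite modulusM rot1 mul1r.
have pm : 0 < phi x <= C0 + phi 0 by rewrite phi_gt0 (phi_le_max gs).
have hl := lin pm (near' j0) (near' j1).
rewrite -QE in hl.
have ub := solution_bound gs hU eps_gt0 eps_le1 orbit.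
have hT := nl_lip p_gt1 (ub t j0 x x_ge0) (ub t j1 x x_ge0).
have := error_estimate p_gt1 (ltW (Q_gt0 x)) (gs_Qb gs x) (cc_gt0 gs) mu_gt0 delta_gt0
  hT hl h1 h2 h3 h4 eps_small budget.
have aV : L2val (a t) x = mu * (cr t * Re (z0 - z1) + ci t * Im (z0 - z1)).
  by rewrite !(L2valZ, L2valD) rdE diE.
have bV : L2val (b t) x = mu * (cr t * Im (z0 - z1) - ci t * Re (z0 - z1)).
  by rewrite !(L2valZ, L2valB) rdE diE.
have eaV : L2val (ea t) x = mu * (E1 t * Re (z0 - z1) + E2 t * Im (z0 - z1))
   + (Q x * L2val (b t) x - mu * (cr t * Im (nl p z0 - nl p z1) - ci t * Re (nl p z0 - nl p z1))).
  by rewrite -rdE -diE -rnE -iNE; exact: (val_ea (E1 t) (E2 t) (cr t) (ci t) (rd t) (di t) (rn t) (iN t) (b t) x_ge0).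
have ebV : L2val (eb t) x = mu * (E1 t * Im (z0 - z1) - E2 t * Re (z0 - z1))
   + ((mu * (cr t * Re (nl p z0 - nl p z1) + ci t * Im (nl p z0 - nl p z1)) - Q x * L2val (a t) x)
     - (p - 1) * Q x * L2val (a t) x).
  by rewrite -rdE -diE -rnE -iNE; exact: (val_eb (E1 t) (E2 t) (cr t) (ci t) (rd t) (di t) (rn t) (iN t) (a t) x_ge0).
by rewrite eaV ebV aV bV.
Qed.

Let sq_int u : ip u u = I (fun x => L2val u x ^+ 2).
Proof. by apply: I_eq => x _; rewrite expr2. Qed.

Lemma solution_flow : exists A B al be, perturbed_flow (ip := ip) G W delta a b ea eb A B al be.
Proof.
have [A [A0 hA]] := goodV_prim ga; have [B [B0 hB]] := goodV_prim gb.
have [al [al0 hal]] := goodV_prim gea; have [be [be0 hbe]] := goodV_prim geb.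
exists A, B, al, be; split; try by []; try exact: weak_a; try exact: weak_b.
- by move=> t; exact: goodV_vcont ga.
- by move=> t; exact: goodV_vcont gb.
- by move=> t; exact: goodV_vcont gea.
- by move=> t; exact: goodV_vcont geb.
- have [[M M0 hM] _] := ga; have [[M' M'0 hM'] _] := gb.
  exists (M ^+ 2 + M' ^+ 2) => t; rewrite -!(nm_sqr hb) lerD// lerXn2r ?nnegrE ?nm_ge0//.
    by case: (hM t).
  by case: (hM' t).
- move=> t; rewrite !sq_int -!ID; [|exact: L2_int|exact: L2_int|exact: L2_int|exact: L2_int].
  rewrite -IZ; last by apply: intDD; exact: L2_int.
  apply: I_le; [by apply: intDD; exact: L2_int|by apply: intDZ; apply: intDD; exact: L2_int|].
  by move=> x x0; exact: pointwise.
Qed.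

End against_a_solution.

End instability.

Section real_estimates.
Context {R : realType}.
Implicit Types x : R.

Lemma le_succ_sqr x : 0 <= x -> x <= (x + 1) ^+ 2.
Proof. by move=> x0; have := sqr_ge0 x; lra. Qed.

Lemma lt_double_succ x : 0 <= x -> x < 2 * (x + 1).
Proof. by move=> x0; lra. Qed.

Lemma budget_estimate (e s t k : R) : 0 < e -> e * s <= e * t -> e * (4 * (t + 1)) <= k ->
  e * s + k / 4 <= k / 2.
Proof. by move=> e0 h1 h2; lra. Qed.

End real_estimates.

(** * The unstable initial datum *)

Section unstable.
Context {R : realType} {N : nat}.
Local Notation D := (@half_line R).
Local Notation Re := complex.Re.
Local Notation Im := complex.Im.
Local Notation V := (@L2fun R).
Local Notation ip := (@ip R).
Variables (phi sig Q : R -> R) (omega p gam c0 C0 Qb xm alpha : R).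
Hypothesis gs : ground_state phi sig Q omega p gam c0 C0 Qb xm.
Hypothesis omega_ge0 : 0 <= omega.
Hypothesis QE : forall x, Q x = phi x `^ (p - 1).
Variables (j0 j1 : 'I_N).
Hypothesis j01 : j0 != j1.
Local Notation sol := (green_sol phi).
Local Notation sol' := (green_dsol phi sig).
Local Notation G := (Gop gs).
Local Notation W := (Wop gs).
Local Notation cc := (cc phi sig).
Local Notation Kb := (Kb phi C0).
Local Notation B1 := (B1 phi sig).
Local Notation B3 := (B3 phi sig Q omega p C0).

Lemma classicalD (f f' g g' : R -> R) : classicalH1 f f' -> classicalH1 g g' ->
  classicalH1 (fun x => f x + g x) (fun x => f' x + g' x).
Proof.
have sq (h k : R -> R) : continuous h -> continuous k -> intD (fun x => h x ^+ 2) ->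
    intD (fun x => k x ^+ 2) -> intD (fun x => (h x + k x) ^+ 2).
  move=> ch ck ih ik; have cNk : continuous (fun x => - k x) by move=> x; apply: cvgN; exact: ck.
  have iNk : intD (fun x => (- k x) ^+ 2) by apply: intD_eq ik => x _; rewrite sqrrN.
  have i := intD_sqB (continuous_mD ch) ih (continuous_mD cNk) iNk.
  by apply: intD_eq i => x _; rewrite opprK.
move=> [cf cf' df if1 if1'] [cg cg' dg ig1 ig1']; split.
- exact: cntD.
- exact: cntD.
- by move=> x x0; apply: derD; [exact: df|exact: dg].
- exact: sq.
- exact: sq.
Qed.

Lemma Qsol_classical y : classicalH1 (fun x => Q x * sol y x)
  (fun x => (p - 1) * (sig x * Q x) * sol y x + Q x * sol' y x).
Proof.
have cs : continuous (sol y) by exact: (sol_cnt gs).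
have cs' : continuous (sol' y) by exact: (sol'_cnt gs).
have bQ := bc_Q gs; have [cQ [BQ hQ]] := bQ.
have bsQ := bcM (bc_cst (p - 1)) (bcM (bc_sig gs) bQ); have [csQ [BsQ hsQ]] := bsQ.
have i1 := intD_bounded2 cQ (continuous_mD cs) hQ (sol_int gs y).1.
have i2 := intD_bounded2 cQ (continuous_mD cs') hQ (sol'_int gs y).1.
have i3 := intD_bounded2 csQ (continuous_mD cs) hsQ (sol_int gs y).1.
have c1 := cntM csQ cs; have c2 := cntM cQ cs'.
split=> //; first exact: cntM.
- exact: cntD.
- by move=> x x0; apply: der_eq (derM (gs_dQ gs x) (dsol gs y x0)) _; ring.
- have cN : continuous (fun x => - (Q x * sol' y x)) by move=> x; apply: cvgN; exact: c2.
  have iN : intD (fun x => (- (Q x * sol' y x)) ^+ 2) by apply: intD_eq i2 => x _; rewrite sqrrN.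
  have i := intD_sqB (continuous_mD c1) i3 (continuous_mD cN) iN.
  by apply: intD_eq i => x _; rewrite opprK.
Qed.

Let s (j : 'I_N) : R := if j == j0 then 1 else if j == j1 then -1 else 0.
Let s2 j : s j ^+ 2 <= 1.
Proof. by rewrite /s; case: ifP => _; [|case: ifP => _]; rewrite ?sqrrN ?expr1n// expr0n. Qed.
Let s_j0 : s j0 = 1. Proof. by rewrite /s eqxx. Qed.
Let s_j1 : s j1 = -1. Proof. by rewrite /s eq_sym (negbTE j01) eqxx. Qed.

(** Linear dependence on [k] allows the amplitude of the datum to be chosen after the radius [eta]
    supplied by stability. *)
Lemma antisymmetric_normE (f f' g g' : R -> R) : classicalH1 f f' -> classicalH1 g g' ->
  exists2 S, 0 <= S & forall k : R, 0 <= k ->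
    normE (fun (j : 'I_N) x => (k * s j * f x) +i* (k * s j * g x)) <= k * S.
Proof.
move=> cf cg.
pose T := I (fun x => f x ^+ 2) + I (fun x => g x ^+ 2) + (I (fun x => f' x ^+ 2) + I (fun x => g' x ^+ 2)).
have T0 : 0 <= T by rewrite !addr_ge0//; apply: I_ge0 => x _; exact: sqr_ge0.
have NT0 : 0 <= N%:R * T by rewrite mulr_ge0.
have NT1 : 0 <= N%:R * T + 1 by rewrite addr_ge0.
exists (N%:R * T + 1) => [//|k k0].
apply: normE_le; first exact: mulr_ge0.
apply: (@le_trans _ _ (\sum_(j < N) k ^+ 2 * T)).
  apply: ler_sum => j _; have cz := classicalZ (k * s j) cf; have dz := classicalZ (k * s j) cg.
  have [[l2 _ _ _] _] := classical_in_H1 cz dz.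
  have sc (h : R -> R) : intD (fun x => h x ^+ 2) ->
      I (fun x => (k * s j * h x) ^+ 2) = (k * s j) ^+ 2 * I (fun x => h x ^+ 2).
    by move=> ih; rewrite -IZ//; apply: I_eq => x _; rewrite exprMn.
  rewrite (L2normsq_weak_deriv cz dz) L2normsqE//=.
  rewrite !sc; [|exact: cl_i' cg|exact: cl_i' cf|exact: cl_i cg|exact: cl_i cf].
  rewrite -!mulrDr -/T ler_wpM2r// exprMn -[leRHS]mulr1.
  by apply: ler_wpM2l; [exact: sqr_ge0|exact: s2].
rewrite sumr_const card_ord -[leLHS]mulr_natl exprMn [leLHS]mulrCA ler_wpM2l ?sqr_ge0//.
exact: le_succ_sqr.
Qed.

(* The initial datum is [phi] perturbed by opposite amounts on the two edges [j0] and [j1]. *)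
Lemma ground_state_unstable : orbitally_unstable alpha p (@Phi R N phi).
Proof.
move=> stable; have p_gt1 := gs_p gs; have phi_gt0 := gs_phi gs.
have Qb0 : 0 < Qb := lt_le_trans (gs_Q0 gs 0) (gs_Qb gs 0).
have w0 : 0 < (p - 1) * Qb by rewrite mulr_gt0// subr_gt0.
have [y1 [y2 [y3 [delta delta0 core]]]] := @perturbed_flow_unbounded _ _ _ ip_psd ip_definite
  (Gop gs) (Wop gs) (Xop gs) (ell xm) _ _ _ (Gop_sym gs) (coer_gt0 gs) (Gop_coer gs) (Wop_sym gs) w0
  (Wop_bd gs) (fun v h => L1_ge0 h) (L1_negative gs) (CX_gt0 gs) (Xop_bd gs) (Mop_sym gs) (Mop_bd gs).
(* The linearization takes [delta * cc / 4], half of the admissible error; the other half is left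
   for the terms proportional to [eps]. *)
pose d' := delta / 4.
have d'0 : 0 < d' by rewrite divr_gt0.
have K0 : 0 < C0 + phi 0 by rewrite addr_gt0// (gs_C0 gs).
have [e e0 lin] := nl_linearize p_gt1 K0 d'0.
have c0' := cc_gt0 gs; have B10 := B1_ge0 gs.
pose L := (p + 1) * Kb `^ (p - 1).
pose S := (p * Qb + L) * (12 * B1) + 2 * B3.
have q2 : 0 < e / 6 by rewrite divr_gt0.
have b24 : 0 < 24 * (B1 + 1) by rewrite mulr_gt0// ltr_wpDl.
have q3 : 0 < cc / (24 * (B1 + 1)) by rewrite divr_gt0.
have b4 : 0 < 4 * (`|S| + 1) by rewrite mulr_gt0// ltr_wpDl.
have q4 : 0 < delta * cc / (4 * (`|S| + 1)) by rewrite divr_gt0// mulr_gt0.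
have [eps eps0 [i1 i2 i3 i4]] : exists2 eps : R, 0 < eps & [/\ eps <= 1, eps <= e / 6,
    eps <= cc / (24 * (B1 + 1)) & eps <= delta * cc / (4 * (`|S| + 1))].
  (* In order: a uniform bound on the solution, validity of the linearization within [6 * eps], a
     phase functional bounded away from 0, and the remaining half of the error. *)
  exists (Num.min (Num.min 1 (e / 6)) (Num.min (cc / (24 * (B1 + 1))) (delta * cc / (4 * (`|S| + 1))))).
    by rewrite !lt_min ltr01 q2 q3 q4.
  by split; rewrite !ge_min lexx ?orbT.
rewrite ler_pdivlMr// in i3; rewrite ler_pdivlMr// in i4.
have eB := mulr_ge0 (ltW eps0) B10.
have small : 4 * (6 * eps * B1) <= cc.
  apply: (le_trans _ i3); rewrite -subr_ge0 (_ : _ - _ = 24 * eps); first by rewrite mulr_ge0// ltW.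
  by ring.
have budget : (p * Qb + L) * (2 * (6 * eps * B1)) + cc * d' + 2 * (eps * B3) <= delta * (cc / 2).
  have -> : (p * Qb + L) * (2 * (6 * eps * B1)) + cc * d' + 2 * (eps * B3) = eps * S + delta * cc / 4.
    by rewrite /S /d'; field.
  rewrite mulrA; exact: budget_estimate eps0 (ler_wpM2l (ltW eps0) (ler_norm S)) i4.
have e6 : 6 * eps <= e by rewrite mulrC -ler_pdivlMr.
have lin' f z1 z2 : 0 < f <= C0 + phi 0 -> modulus (z1 - f%:C) <= 6 * eps ->
  modulus (z2 - f%:C) <= 6 * eps ->
  modulus (nl p z1 - nl p z2 - (f `^ (p - 1))%:C * ((z1 - z2) + ((p - 1) * Re (z1 - z2))%:C))
    <= d' * modulus (z1 - z2).
  by move=> hf h1 h2; exact: (lin f z1 z2 hf (le_trans h1 e6) (le_trans h2 e6)).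
have [eta [eta0 hst]] := stable _ eps0.
(* Real and imaginary parts of the perturbation, namely [G y1] and [W (G y2) + G y3] as functions on
   an edge. *)
pose chr x := sol y1 x; pose chi x := (p - 1) * (Q x * sol y2 x) + sol y3 x.
have cr' : classicalH1 chr (sol' y1) := sol_classical gs y1.
have ci' := classicalD (classicalZ (p - 1) (Qsol_classical y2)) (sol_classical gs y3).
have [T T0 hT] := antisymmetric_normE cr' ci'.
pose kap := eta / (2 * (T + 1)).
have T2 : 0 < 2 * (T + 1) by rewrite mulr_gt0// ltr_wpDl.
have kap0 : 0 < kap by rewrite divr_gt0.
pose U0 : graph_fun R N := fun j x => (phi x + kap * s j * chr x) +i* (kap * s j * chi x).
have U0E : in_E U0.
  split=> [j|i j].
    exact: (classical_in_H1 (classicalD (phi_classical gs) (classicalZ (kap * s j) cr'))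
      (classicalZ (kap * s j) ci')).1.
  by rewrite /U0 /chr /chi !sol0 !(mulr0, addr0).
have close : normE (gsub U0 (@Phi R N phi)) < eta.
  have -> : gsub U0 (@Phi R N phi) = (fun j x => (kap * s j * chr x) +i* (kap * s j * chi x)).
    apply/funext => j; apply/funext => x; rewrite /gsub /U0 /Phi.
    by apply: complex_eq; rewrite ?ReB ?ImB /=; ring.
  apply: le_lt_trans (hT _ (ltW kap0)) _.
  have kE : kap * (2 * (T + 1)) = eta by rewrite /kap mulfVK// gt_eqF.
  by rewrite -[ltRHS]kE ltr_pM2l// lt_double_succ.
have [U [u0 hU od]] := hst U0 U0E close.
have orbit t : exists theta, normE (gsub (U t) (gscale (expi theta) (@Phi R N phi))) <= eps.
  have lt : (ereal_inf (range (fun theta : R =>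
      (normE (gsub (U t) (gscale (expi theta) (@Phi R N phi))))%:E)) < eps%:E)%E.
    by apply: le_lt_trans od; apply: ereal_sup_ubound; exists t.
  by have [_ [th _ <-] h] := ereal_inf_lt lt; exists th; rewrite lte_fin in h; exact: ltW.
(* The flow is linear in [(a, b)], so a datum of amplitude [kap] can be normalised: [2 * kap] comes
   from the difference of opposite values and [cc] from the phase functional at time 0. *)
pose mu := (2 * kap * cc)^-1.
have kc : 0 < 2 * kap * cc by apply: mulr_gt0 => //; exact: mulr_gt0.
have mu0 : 0 < mu by rewrite invr_gt0.
have muE : mu * (2 * kap * cc) = 1 by rewrite mulVf// gt_eqF.
have n1 : `|1 : R| <= 1 by rewrite normr1.
have nN1 : `|-1 : R| <= 1 by rewrite normrN1.
have rV e1 (he : `|e1| <= 1) x : 0 < x -> L2val (rU j0 j1 U e1 0) x = (1 + e1) * phi x + (1 - e1) * (kap * chr x).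
  move=> x0; have x00 := ltW x0; rewrite (rUE gs j0 j1 hU eps0 i1 orbit 0 he x00) /rcomb !u0//= s_j0 s_j1.
  ring.
have iV e1 (he : `|e1| <= 1) x : 0 < x -> L2val (iU j0 j1 U e1 0) x = (1 - e1) * (kap * chi x).
  move=> x0; have x00 := ltW x0; rewrite (iUE gs j0 j1 hU eps0 i1 orbit 0 he x00) /icomb !u0//= s_j0 s_j1.
  ring.
have iphi : intD (fun x => phi x * wt phi sig x).
  apply: bc_intD (bc_phi gs) _ (wt_L1 gs); apply: continuous_mD; exact: (wt_cnt gs).
have cr0 : cr phi sig j0 j1 U 0 = cc.
  transitivity (I (fun x => 2 * (phi x * wt phi sig x))); last by rewrite IZ.
  by apply: I_eq => x x0; rewrite (rV _ n1)// (wtVE gs x0); ring.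
have ci0 : ci phi sig j0 j1 U 0 = 0.
  transitivity (I (fun x => 0 * (phi x * wt phi sig x))); last by rewrite IZ// mul0r.
  by apply: I_eq => x x0; rewrite (iV _ n1)// (wtVE gs x0); ring.
have a0 : mu *: (cr phi sig j0 j1 U 0 *: rU j0 j1 U (-1) 0 + ci phi sig j0 j1 U 0 *: iU j0 j1 U (-1) 0) = G y1.
  apply: L2_eq => x x0; rewrite L2valZ L2valD !L2valZ cr0 ci0 (rV _ nN1)// (iV _ nN1)// GopE ?(ltW x0)//.
  transitivity (mu * (2 * kap * cc) * chr x); first by ring.
  by rewrite muE mul1r.
have b0 : mu *: (cr phi sig j0 j1 U 0 *: iU j0 j1 U (-1) 0 - ci phi sig j0 j1 U 0 *: rU j0 j1 U (-1) 0)
    = W (G y2) + G y3.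
  apply: L2_eq => x x0; rewrite L2valZ L2valB !L2valZ cr0 ci0 (rV _ nN1)// (iV _ nN1)//.
  rewrite L2valD WopE ?(ltW x0)// !GopE ?(ltW x0)//.
  have -> : (p - 1) * Q x * sol y2 x + sol y3 x = chi x by rewrite /chi; ring.
  transitivity (mu * (2 * kap * cc) * chi x); first by ring.
  by rewrite muE mul1r.
have [A [B [al [be pf]]]] := solution_flow gs omega_ge0 QE j01 hU eps0 i1 orbit mu0 delta0 small budget lin'.
exact: (core _ _ _ _ _ _ _ _ pf a0 b0).
Qed.

End unstable.

Theorem theorem1p1 (R : realType) (N : nat) (alpha p : R) :
  (2 <= N)%N -> 0 < alpha -> 1 < p -> p < 5 ->
  (p <= 3 ->
     forall omega : R, alpha ^+ 2 / N%:R ^+ 2 < omega ->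
       orbitally_unstable alpha p (Phi_delta N alpha p omega)) /\
  (3 < p ->
     exists omega2 : R, alpha ^+ 2 / N%:R ^+ 2 < omega2 /\
       forall omega : R, omega2 < omega ->
         orbitally_unstable alpha p (Phi_delta N alpha p omega)).
Proof.
move=> N2 alpha0 p1 _.
have unstable omega : alpha ^+ 2 / N%:R ^+ 2 < omega ->
    orbitally_unstable alpha p (Phi_delta N alpha p omega).
  move=> h; have [sig [Q [c0 [C0 [Qb [xm [gs QE]]]]]]] := bump_profile_ground_state N2 alpha0 p1 h.
  have omega0 : 0 <= omega by apply/ltW/(le_lt_trans _ h); rewrite divr_ge0 ?sqr_ge0.
  (* The edges of index 0 and 1, both present since [N >= 2]. *)
  have j01 : Ordinal (ltnW N2) != Ordinal N2 by [].
  exact: (ground_state_unstable gs omega0 QE j01).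
split=> [_|_]; first exact: unstable.
(* A concrete value above [alpha^2 / N^2]; larger frequencies fall under [unstable]. *)
exists (alpha ^+ 2 / N%:R ^+ 2 + 1); split=> [|omega h]; first by rewrite ltrDl.
by apply: unstable; apply: lt_trans h; rewrite ltrDl.
Qed.
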